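(* Let $\Omega\subset\mathbb{R}^2$ be a bounded simply connected domain with Lipschitz boundary, let $x_0\in\Omega$ be any point, and let $(r,\theta)$ denote polar coordinates centered at $x_0$. For $j\in\mathbb{Z}$ define on $\mathbb{R}^2$ $$P_j(r,\theta)=r^{|j|}\exp(ij\theta),\qquad Q_j(r,\theta)=I_{|j|}(r)\exp(ij\theta),$$ where $I_{|j|}$ is the modified Bessel function of the first kind of order $|j|$. Then: (1) the family $\{P_j|_{\partial\Omega}\}_{j\in\mathbb{Z}}$ is linearly independent and its span is dense in $H^{1/2}(\partial\Omega)$; (2) the family $\{Q_j|_{\partial\Omega}\}_{j\in\mathbb{Z}}$ is linearly independent and its span is dense in $H^{1/2}(\partial\Omega)$.
   Context: Functions are complex-valued, and span means the set of finite complex linear combinations. $H^{1/2}(\partial\Omega)=H^{1/2}(\partial\Omega;\mathbb{C})$ is the usual trace space of $H^1(\Omega;\mathbb{C})$. *)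

(* Defs.v *)
From HB Require Import structures.
From mathcomp Require Import all_boot all_order all_algebra.
From mathcomp Require Import complex.
From mathcomp Require Import all_classical all_reals all_analysis.
Import Order.TTheory GRing.Theory Num.Theory.
Import numFieldNormedType.Exports.

Set Implicit Arguments.
Unset Strict Implicit.
Unset Printing Implicit Defensive.

Local Open Scope classical_set_scope.
Local Open Scope ring_scope.
Local Open Scope complex_scope.

(* The plane is R * R. Its library norm is the sup norm, so the Euclidean norm
   is spelled out wherever the geometry is Euclidean. *)
Notation plane R := (R * R)%type.

(* The same type carrying the product of the Borel sigma-algebras on which
   [lebesgue_measure] is declared as a measure. *)
Notation mplane R := (measurableTypeR R * measurableTypeR R)%type.

Section Geometry.
Context {R : realType}.
Implicit Types (Om A : set (plane R)) (x y p : plane R).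

Definition enorm p : R := Num.sqrt (p.1 ^+ 2 + p.2 ^+ 2).

Definition boundary A : set (plane R) := closure A `\` interior A.

(* Near every boundary point, after a rotation sending the axes to (a, b) and
   (- b, a), Om is the part of a rectangle above a Lipschitz graph. *)
Definition lipschitz_boundary Om : Prop :=
  forall x, boundary Om x ->
  exists (a b : R) (psi : R -> R) (L rho h : R),
    [/\ a ^+ 2 + b ^+ 2 = 1, 0 < rho, 0 < h,
        forall s t : R, `|psi s - psi t| <= L * `|s - t| &
        forall s t : R, `|s| < rho -> `|t| < h ->
          (Om (x.1 + s * a - t * b, x.2 + s * b + t * a) <-> psi s < t)].

Definition simply_connected Om : Prop :=
  connected Om /\
  forall gamma : R -> plane R,
    {within `[0, 1], continuous gamma} ->
    (forall t : R, 0 <= t <= 1 -> Om (gamma t)) ->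
    gamma 0 = gamma 1 ->
  exists H : R * R -> plane R,
    [/\ {within `[0, 1] `*` `[0, 1], continuous H},
        forall s t : R, 0 <= s <= 1 -> 0 <= t <= 1 -> Om (H (s, t)),
        forall t : R, 0 <= t <= 1 -> H (0, t) = gamma t /\ H (1, t) = gamma 0 &
        forall s : R, 0 <= s <= 1 -> H (s, 0) = gamma 0 /\ H (s, 1) = gamma 0].

(* One-dimensional Hausdorff measure. It is defined on all sets; on Borel sets,
   the only ones integration looks at, it is a measure, and on a Lipschitz
   boundary it is arc length. *)
Definition ediam A : \bar R :=
  ereal_sup ([set 0%E] `|` [set (enorm (z.1 - z.2))%:E | z in A `*` A]).

Definition hausdorff1_delta (delta : R) A : \bar R :=
  ereal_inf [set (\sum_(0 <= k <oo) ediam (F k))%E | F in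
    [set F : (set (plane R))^nat |
       A `<=` \bigcup_k F k /\ forall k, (ediam (F k) <= delta%:E)%E]].

Definition hausdorff1 : set (mplane R) -> \bar R := fun A =>
  ereal_sup [set hausdorff1_delta delta A | delta in [set delta | 0 < delta]].

Definition leb2 : set (mplane R) -> \bar R :=
  (@lebesgue_measure R \x @lebesgue_measure R)%E.

HB.instance Definition _ := Measure.on leb2.

End Geometry.

Section Sobolev.
Context {R : realType}.
Implicit Types (Om D : set (plane R)) (mu : set (mplane R) -> \bar R).
Implicit Types (u v g : plane R -> R[i]) (phi : plane R -> R).

Definition cmeasurable D u : Prop :=
  measurable_fun (D : set (mplane R)) (fun x => complex.Re (u x)) /\
  measurable_fun (D : set (mplane R)) (fun x => complex.Im (u x)).

Definition sqL2 mu D u : \bar R :=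
  (\int[mu]_(x in D) (ComplexField.Normc.normc (u x) ^+ 2)%:E)%E.

Definition inL2 mu D u : Prop := cmeasurable D u /\ (sqL2 mu D u < +oo)%E.

Fixpoint Ck (n : nat) phi : Prop :=
  continuous phi /\
  if n is m.+1 then
    forall e : plane R, e = (1, 0) \/ e = (0, 1) ->
      (forall x, derivable phi x e) /\ Ck m (fun x => 'D_e phi x)
  else True.

Definition smooth phi : Prop := forall n, Ck n phi.

Definition csmooth u : Prop :=
  smooth (fun x => complex.Re (u x)) /\ smooth (fun x => complex.Im (u x)).

Definition test_function Om phi : Prop :=
  smooth phi /\ exists K : set (plane R),
    [/\ compact K, K `<=` Om & forall x, ~ K x -> phi x = 0].

(* By linearity real-valued test functions suffice. *)
Definition weak_derivative Om (e : plane R) u g : Prop :=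
  forall phi, test_function Om phi ->
    \int[leb2]_(x in Om) (complex.Re (u x) * 'D_e phi x) =
      - (\int[leb2]_(x in Om) (complex.Re (g x) * phi x)) /\
    \int[leb2]_(x in Om) (complex.Im (u x) * 'D_e phi x) =
      - (\int[leb2]_(x in Om) (complex.Im (g x) * phi x)).

(* H^1(Om; C): functions on the plane, relevant on Om only, bundled with
   representatives of their weak partial derivatives, which are determined
   almost everywhere on Om. *)
Record H1 Om := MkH1 {
  H1val :> plane R -> R[i];
  H1dx : plane R -> R[i];
  H1dy : plane R -> R[i];
  H1val_L2 : inL2 leb2 Om H1val;
  H1dx_L2 : inL2 leb2 Om H1dx;
  H1dy_L2 : inL2 leb2 Om H1dy;
  H1dxP : weak_derivative Om (1, 0) H1val H1dx;
  H1dyP : weak_derivative Om (0, 1) H1val H1dy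
}.

Definition H1norm Om (v : H1 Om) : \bar R :=
  sqrte (sqL2 leb2 Om v + sqL2 leb2 Om (H1dx v) + sqL2 leb2 Om (H1dy v))%E.

Definition H1dist Om (v w : H1 Om) : \bar R :=
  sqrte (sqL2 leb2 Om (v \- w)%R + sqL2 leb2 Om (H1dx v \- H1dx w)%R
         + sqL2 leb2 Om (H1dy v \- H1dy w)%R)%E.

(* Graph of the trace operator H^1(Om) -> L^2(boundary Om): the continuous
   extension of the restriction map on functions smooth up to the boundary. *)
Definition is_trace Om (v : H1 Om) g : Prop :=
  inL2 hausdorff1 (boundary Om) g /\
  exists phi : nat -> H1 Om,
    [/\ forall n, csmooth (phi n),
        H1dist (phi n) v @[n --> \oo] --> 0%E &
        sqL2 hausdorff1 (boundary Om) (phi n \- g) @[n --> \oo] --> 0%E].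

(* H^{1/2}(boundary Om), the range of the trace operator with the quotient
   norm. Functions are considered up to equality [trace_eq]. *)
Definition inH12 Om g : Prop := exists v : H1 Om, is_trace v g.

Definition H12norm Om g : \bar R :=
  ereal_inf [set H1norm v | v in [set v : H1 Om | is_trace v g]].

Definition trace_eq Om g1 g2 : Prop :=
  hausdorff1.-negligible (boundary Om `&` [set x | g1 x <> g2 x]).

Definition lincomb (f : int -> plane R -> R[i]) (s : seq int) (c : int -> R[i]) :
  plane R -> R[i] := fun x => \sum_(j <- s) c j * f j x.

Definition H12_independent Om (f : int -> plane R -> R[i]) : Prop :=
  forall (s : seq int) (c : int -> R[i]), uniq s ->
    trace_eq Om (lincomb f s c) (fun=> 0) -> forall j, j \in s -> c j = 0.

Definition H12_span_dense Om (f : int -> plane R -> R[i]) : Prop :=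
  (forall j, inH12 Om (f j)) /\
  forall g, inH12 Om g -> forall eps : R, 0 < eps ->
    exists (s : seq int) (c : int -> R[i]),
      (H12norm Om (g \- lincomb f s c)%R < eps%:E)%E.

End Sobolev.

Section Families.
Context {R : realType}.

Definition besselI (n : nat) (r : R) : R :=
  limn (series (fun k : nat => (r / 2) ^+ (2 * k + n) / (k`! * (k + n)`!)%:R)).

Definition expi (t : R) : R[i] := cos t +i* sin t.

(* Polar angle in (- pi, pi]; its value at the pole plays no role. *)
Definition angle (p : plane R) : R :=
  if 0 <= p.2 then acos (p.1 / enorm p) else - acos (p.1 / enorm p).

(* The function given by F(r, theta) in polar coordinates centered at x0. *)
Definition in_polar (x0 : plane R) (F : R -> R -> R[i]) : plane R -> R[i] :=
  fun x => F (enorm (x - x0)) (angle (x - x0)).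

Definition P_ (j : int) (r theta : R) : R[i] :=
  (r ^+ `|j|%N)%:C * expi (j%:~R * theta).

Definition Q_ (j : int) (r theta : R) : R[i] :=
  (besselI `|j|%N r)%:C * expi (j%:~R * theta).

End Families.

(* Main.v *)
(** A combination of the modes solves [lap u = c u] on the whole plane, with
    [c = 0] for [P_] and [c = 1] for [Q_]. If its trace vanishes almost everywhere
    then, arcs of a Lipschitz boundary having positive length, it vanishes on the
    boundary, hence on [Om] by the maximum principle, and on a small circle around
    the center it is a trigonometric polynomial, so its coefficients are zero.

    For density, it is enough that a functional [l], bounded for the H^1 norm of
    [Om] and killing the modes and the test functions of [Om], kills all smooth
    functions. Let [B] be a disc containing the closure of [Om], centered at the
    pole. By Riesz, [l] is the limit of the energy products on [B] with test
    functions [psi_n] of [B]. Since the modes span the trigonometric polynomials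
    on the circle bounding [B], this representation is valid for all smooth
    functions and not only for those vanishing on the circle, so the
    limit [U] of the [psi_n], extended by zero outside of [B], still solves
    [lap U = c U] outside of the closure of [Om]. As [Om] is simply connected its
    exterior has no bounded component, and unique continuation (by a Carleman
    estimate) gives [U = 0] there. Pushing [U] inward in the Lipschitz charts
    exhibits it as a limit of test functions of [Om], on which [l] vanishes; hence
    the energy of [U], which is [l U], is zero, and [l = 0]. *)

Require Import Defs.
From HB Require Import structures.
From mathcomp Require Import all_boot all_order all_algebra.
From mathcomp Require Import complex ring lra.
From mathcomp Require Import all_classical all_reals all_analysis.
From mathcomp Require Import measurable_realfun.
Import Order.TTheory GRing.Theory Num.Theory.
Import numFieldNormedType.Exports.

Set Implicit Arguments.
Unset Strict Implicit.
Unset Printing Implicit Defensive.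

Local Open Scope classical_set_scope.
Local Open Scope ring_scope.

(** * Smooth functions of two variables *)

Section SmoothCalculus.
Context {R : realType}.
Implicit Types (f g u v phi : plane R -> R) (x y : plane R) (i : bool).

(** Until Sobolev spaces return at the end, only smooth functions and integrals of continuous
    functions occur, and no completion is formed. The Riesz and Hahn-Banach steps therefore yield
    minimising sequences with the explicit rate [tn j], and the limit of the [psi j] exists only as
    a functional [U f], the limit of the integrals of [f psi j] over [B]. Its regularity is
    recovered by convolution with small bumps, which turns the weak equation into a pointwise one to
    which the Carleman estimate applies. Unique continuation says that the part of the support of
    [U] outside the closure of [Om] is open; its complement in the exterior is open too, and it is
    bounded because [U] sees only [B]. What remains is to exclude such a bounded piece, and this is
    where simple connectedness enters, through the argument of [x - y] for a point [y] of the piece.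
    One value [c] in [0, 1] serves both families. For [c = 0] the form [en c] does not contain the
    L^2 norm, and on functions vanishing off [B] the Poincare inequality restores it. The upper
    bound 1 lets the Carleman estimate absorb the term [c u] on small discs. *)

Definition ax i : plane R := if i then (0, 1) else (1, 0).

(** Locked, so that unification and simplification treat [pd i f] as a symbol and never open the
    limit behind ['D_]; [pdE] is the way in. *)
Definition pd_def i f : plane R -> R := fun x => 'D_(ax i) f x.
Fact pd_key : unit. Proof. exact: tt. Qed.
Definition pd := locked_with pd_key pd_def.

Lemma pdE i f : pd i f = fun x => 'D_(ax i) f x.
Proof. by rewrite /pd unlock. Qed.

Lemma CkS n f : Ck n.+1 f <->
  continuous f /\ forall i, (forall x, derivable f x (ax i)) /\ Ck n (pd i f).
Proof.
split=> [[cf H]|[cf H]]; split=> //.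
  by move=> [|]; rewrite pdE; apply: H; [right|left].
by move=> e [->|->]; [have := H false|have := H true]; rewrite pdE.
Qed.

(** A class closed under both partial derivatives is handled as a whole: the induction on the order
    of differentiation runs over all its members at once. Constants, translates, reflections and
    convolutions are treated as such classes. *)
Lemma smooth_coind (P : (plane R -> R) -> Prop) :
  (forall f, P f -> continuous f /\
     forall i, (forall x, derivable f x (ax i)) /\ P (pd i f)) ->
  forall f, P f -> smooth f.
Proof.
move=> HP f Pf n; elim: n f Pf => [|n IH] f Pf; first by split=> //; case: (HP _ Pf).
apply/CkS; have [cf H] := HP _ Pf; split=> // i; have [df Pd] := H i.
by split=> //; exact: IH.
Qed.

Lemma smooth_cont f : smooth f -> continuous f.
Proof. by move=> /(_ 0%N) []. Qed.

Lemma smooth_der f i x : smooth f -> derivable f x (ax i).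
Proof. by move=> /(_ 1%N) /CkS[_ /(_ i)[]]. Qed.

Lemma smooth_pd f i : smooth f -> smooth (pd i f).
Proof. by move=> sf n; have /CkS[_ /(_ i)[]] := sf n.+1. Qed.

Lemma Ck_cont n f : Ck n f -> continuous f.
Proof. by case: n => [|n] []. Qed.

Lemma CkW n f : Ck n.+1 f -> Ck n f.
Proof.
elim: n f => [|n IH] f /CkS [cf H]; first by split.
apply/CkS; split=> // i; have [df /IH] := H i; by [].
Qed.

Lemma pdD f g i : (forall x, derivable f x (ax i)) -> (forall x, derivable g x (ax i)) ->
  pd i (fun x => f x + g x) = (fun x => pd i f x + pd i g x).
Proof. by move=> df dg; apply/funext => x; rewrite !pdE -deriveD. Qed.

Lemma pdM f g i : (forall x, derivable f x (ax i)) -> (forall x, derivable g x (ax i)) ->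
  pd i (fun x => f x * g x) = (fun x => f x * pd i g x + g x * pd i f x).
Proof. by move=> df dg; apply/funext => x; rewrite !pdE deriveM. Qed.

Lemma pdV f i : (forall x, f x != 0) -> (forall x, derivable f x (ax i)) ->
  pd i (fun x => (f x)^-1) = (fun x => - ((f x)^-1 * (f x)^-1) * pd i f x).
Proof.
move=> f0 df; apply/funext => x; rewrite !pdE deriveV //.
by rewrite /GRing.scale /= -exprVn expr2.
Qed.

Lemma pd_cst (c : R) i : pd i (fun=> c) = (fun=> 0).
Proof. by apply/funext => x; rewrite !pdE derive_cst. Qed.

Lemma CkD n f g : Ck n f -> Ck n g -> Ck n (fun x => f x + g x).
Proof.
elim: n f g => [|n IH] f g.
  by move=> [cf _] [cg _]; split=> // x; apply: cvgD; [exact: cf|exact: cg].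
move=> /CkS [cf Hf] /CkS [cg Hg]; apply/CkS; split.
  by move=> x; apply: cvgD; [exact: cf|exact: cg].
move=> i; have [df Pf] := Hf i; have [dg Pg] := Hg i; split.
  by move=> x; apply: derivableD.
by rewrite pdD //; exact: IH.
Qed.

Lemma CkM n f g : Ck n f -> Ck n g -> Ck n (fun x => f x * g x).
Proof.
elim: n f g => [|n IH] f g.
  by move=> [cf _] [cg _]; split=> // x; apply: cvgM; [exact: cf|exact: cg].
move=> Cf Cg; move: (Cf) (Cg) => /CkS [cf Hf] /CkS [cg Hg]; apply/CkS; split.
  by move=> x; apply: cvgM; [exact: cf|exact: cg].
move=> i; have [df Pf] := Hf i; have [dg Pg] := Hg i; split.
  by move=> x; apply: derivableM.
by rewrite pdM //; apply: CkD; apply: IH => //; exact: CkW.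
Qed.

Lemma smooth_cst (c : R) : smooth (fun _ : plane R => c).
Proof.
apply: (@smooth_coind (fun f => exists c, f = fun=> c)); last by exists c.
move=> _ [a ->]; split; first by move=> x; exact: cvg_cst.
by move=> i; split=> [x|]; [exact: derivable_cst|exists 0; rewrite pd_cst].
Qed.

Lemma smoothD f g : smooth f -> smooth g -> smooth (fun x => f x + g x).
Proof. by move=> sf sg n; exact: CkD. Qed.

Lemma smoothM f g : smooth f -> smooth g -> smooth (fun x => f x * g x).
Proof. by move=> sf sg n; exact: CkM. Qed.

Lemma smoothZ (a : R) f : smooth f -> smooth (fun x => a * f x).
Proof. by move=> sf; apply: smoothM => //; exact: smooth_cst. Qed.

Lemma smoothN f : smooth f -> smooth (fun x => - f x).
Proof.
move=> /(smoothZ (-1)); congr smooth; apply/funext => x; by rewrite mulN1r.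
Qed.

Lemma smoothB f g : smooth f -> smooth g -> smooth (fun x => f x - g x).
Proof. by move=> sf sg; apply: smoothD => //; exact: smoothN. Qed.

Lemma smoothX f n : smooth f -> smooth (fun x => f x ^+ n).
Proof.
move=> sf; elim: n => [|n IH].
  by rewrite (_ : (fun x => _) = fun=> 1) //; exact: smooth_cst.
rewrite (_ : (fun x => _) = fun x => f x * f x ^+ n); first exact: smoothM.
by apply/funext => x; rewrite exprS.
Qed.

Lemma smooth_sum (I : Type) (s : seq I) (F : I -> plane R -> R) :
  (forall j, smooth (F j)) -> smooth (fun x => \sum_(j <- s) F j x).
Proof.
move=> sF; elim: s => [|a s IH].
  rewrite (_ : (fun x => _) = fun=> 0); first exact: smooth_cst.
  by apply/funext => x; rewrite big_nil.
rewrite (_ : (fun x => _) = fun x => F a x + \sum_(j <- s) F j x).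
  exact: smoothD.
by apply/funext => x; rewrite big_cons.
Qed.

Lemma smoothV f : smooth f -> (forall x, f x != 0) -> smooth (fun x => (f x)^-1).
Proof.
move=> sf f0 n; elim: n => [|n IH].
  by split=> // x; apply: cvgV => //; exact: smooth_cont.
apply/CkS; split; first by move=> x; apply: cvgV => //; exact: smooth_cont.
move=> i; split; first by move=> x; apply: derivableV => //; exact: smooth_der.
rewrite pdV //; last by move=> x; exact: smooth_der.
apply: CkM; last exact: (smooth_pd i sf).
rewrite (_ : (fun x => _) = fun x => (-1) * ((f x)^-1 * (f x)^-1)).
  by apply: CkM; [exact: smooth_cst|exact: CkM].
by apply/funext => x; rewrite mulN1r.
Qed.

Definition pr i (x : plane R) : R := if i then x.2 else x.1.

Lemma is_derive_pr i j x : is_derive x (ax j) (pr i) (pr i (ax j)).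
Proof.
have E : (fun h : R => h^-1 *: (((pr i) \o shift x) (h *: ax j) - pr i x)) @ 0^' --> pr i (ax j).
  apply: (@cvg_trans _ ((fun=> pr i (ax j)) @ (0 : R)^')); last exact: cvg_cst.
  apply: near_eq_cvg; near=> h; rewrite /=.
  have h0 : h != 0 by near: h; exact: nbhs_dnbhs_neq.
  have -> : pr i (h *: ax j + x) - pr i x = h * pr i (ax j).
    by case: i; rewrite /= /GRing.scale /= addrK.
  by rewrite /GRing.scale /= mulrA mulVf // mul1r.
split; first by apply/cvg_ex; exists (pr i (ax j)).
by apply/cvg_lim.
Unshelve. all: by end_near. Qed.

Lemma pd_pr i j : pd j (pr i) = fun=> (i == j)%:R.
Proof.
apply/funext => x; rewrite !pdE (@derive_val _ _ _ _ _ _ _ (is_derive_pr i j x)).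
by case: i j => [] [].
Qed.

Lemma cont_pr i : continuous (pr i).
Proof. by case: i => x; [exact: cvg_snd|exact: cvg_fst]. Qed.

Lemma smooth_pr i : smooth (pr i).
Proof.
move=> [|n]; first by split=> //; exact: cont_pr.
apply/CkS; split; first exact: cont_pr.
move=> j; split; last by rewrite pd_pr; exact: smooth_cst.
by move=> x; have := is_derive_pr i j x => /(@ex_derive _ _ _).
Qed.

Lemma smooth_fst : smooth (fun x : plane R => x.1).
Proof. exact: (smooth_pr false). Qed.

Lemma smooth_snd : smooth (fun x : plane R => x.2).
Proof. exact: (smooth_pr true). Qed.

(** Restricting to the line through [x] in direction [e] turns a directional derivative into a
    derivative at 0 of a function of one variable, for which [is_derive_comp] can use the
    one-variable chain rule. *)
Lemma derivable_line f x (e : plane R) :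
  derivable f x e <-> derivable (fun t : R => f (t *: e + x)) 0 1.
Proof.
rewrite /derivable (_ : (fun h : R => h^-1 *: (((fun t : R => f (t *: e + x)) \o shift 0) (h *: 1) - f (0 *: e + x)))
   = (fun h : R => h^-1 *: ((f \o shift x) (h *: e) - f x))) //.
by apply/funext => h /=; rewrite addr0 scale0r add0r [h *: 1]mulr1.
Qed.

Lemma is_derive_line f x (e : plane R) : derivable f x e ->
  is_derive (0 : R) (1 : R) (fun t : R => f (t *: e + x)) ('D_e f x).
Proof.
move=> df; split; first exact/derivable_line.
rewrite /derive (_ : (fun h : R => h^-1 *: (((fun t : R => f (t *: e + x)) \o shift 0) (h *: 1) - f (0 *: e + x)))
   = (fun h : R => h^-1 *: ((f \o shift x) (h *: e) - f x))) //.
by apply/funext => h /=; rewrite addr0 scale0r add0r [h *: 1]mulr1.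
Qed.

Lemma is_derive_comp (F : R -> R) (dF : R) f x (e : plane R) :
  derivable f x e -> is_derive (f x) (1 : R) F dF ->
  is_derive x e (F \o f) (dF * 'D_e f x).
Proof.
move=> df HF.
have H0 := is_derive_line df.
have HF' : is_derive ((fun t : R => f (t *: e + x)) 0) (1 : R) F dF by rewrite /= scale0r add0r.
have HC := is_derive1_comp HF' H0.
have dc : derivable (F \o f) x e.
  by apply/derivable_line; exact: (@ex_derive _ _ _ _ _ _ _ HC).
split=> //.
have H1 := is_derive_line dc.
rewrite -(@derive_val _ _ _ _ _ _ _ H1).
exact: (@derive_val _ _ _ _ _ _ _ HC).
Qed.

(** The tower of derivatives is carried as a witness: in [smooth_comp] the induction on the order
    moves the outer function up this tower. *)
Definition smooth1 (F : R -> R) := exists G : nat -> R -> R,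
  G 0%N = F /\ forall n t, is_derive t (1 : R) (G n) (G n.+1 t).

Lemma smooth_comp (F : R -> R) f : smooth1 F -> smooth f -> smooth (F \o f).
Proof.
move=> [G [<- HG]] sf n; elim: n 0%N => [|n IH] m.
  split=> // x; apply: continuous_comp; first exact: smooth_cont.
  apply: differentiable_continuous; apply/derivable1_diffP.
  exact: (@ex_derive _ _ _ _ _ _ _ (HG m _)).
have D i x : is_derive x (ax i) (G m \o f) (G m.+1 (f x) * pd i f x).
  by rewrite pdE; apply: is_derive_comp (HG m (f x)); apply: smooth_der.
apply/CkS; split; first exact: Ck_cont (IH m).
move=> i; split; first by move=> x; exact: (@ex_derive _ _ _ _ _ _ _ (D i x)).
rewrite (_ : pd i _ = fun x => (G m.+1 \o f) x * pd i f x).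
  by apply: CkM; [exact: IH|exact: smooth_pd].
by apply/funext => x; rewrite [LHS](congr1 (@^~ x) (pdE _ _)) (@derive_val _ _ _ _ _ _ _ (D i x)).
Qed.

End SmoothCalculus.

#[global] Opaque smooth.

(** * Smooth cutoffs, Euclidean discs and test functions *)

Section Cutoffs.
Context {R : realType}.
Implicit Types (f g u v phi : plane R -> R) (x y : plane R) (i : bool) (p : {poly R}).

(** The function [p(1/t) exp(-1/t)] extended by 0. With [s = 1/t] its derivative is
    [s^2 (p(s) - p'(s)) exp(-s)], again of this kind, so letting [p] vary closes the family under
    differentiation. *)
Definition flat p (t : R) : R := if 0 < t then p.[t^-1] * expR (- t^-1) else 0.

(** With [N = size p] and [s = 1/t >= 1], [p(s)] is at most a constant times [s^N], while the
    exponential series gives [exp s >= s^(N+2) / (N+2)!]. The surplus of two powers makes the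
    difference quotient at 0 tend to 0. *)
Lemma flat_bound p : exists K : R, 0 <= K /\
  forall t, 0 < t -> t <= 1 -> `|flat p t| <= K * t ^+ 2.
Proof.
exists ((\sum_(i < size p) `|p`_i|) * ((size p).+2)`!%:R); split.
  by apply: mulr_ge0 => //; exact: sumr_ge0.
move=> t t0 t1; rewrite /flat t0; set s := t^-1.
have s1 : 1 <= s by rewrite invf_ge1.
have s0 : 0 < s by exact: lt_le_trans s1.
have H1 : `|p.[s]| <= (\sum_(i < size p) `|p`_i|) * s ^+ size p.
  rewrite horner_coef mulr_suml; apply: (le_trans (ler_norm_sum _ _ _)).
  apply: ler_sum => i _; rewrite normrM [X in _ * X]ger0_norm ?exprn_ge0 ?(ltW s0)//.
  by apply: ler_wpM2l => //; apply: ler_weXn2l => //; exact: ltnW.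
have H2 : expR (- s) <= ((size p).+2)`!%:R / s ^+ (size p).+2.
  rewrite expRN -[leRHS]invrK invf_div lef_pV2 ?posrE ?expR_gt0//; last first.
    by apply: divr_gt0; rewrite ?exprn_gt0 // ltr0n fact_gt0.
  by apply: le_trans (expR_ge1Dxn (size p).+1 (ltW s0)); rewrite lerDr.
rewrite normrM (gtr0_norm (expR_gt0 _)).
apply: (le_trans (ler_pM _ _ H1 H2)) => //.
rewrite -!mulrA ler_wpM2l ?sumr_ge0 //.
rewrite mulrCA ler_wpM2l // -[(size p).+2]addn2 exprD invfM mulrA mulfV ?mul1r.
  by rewrite exprVn invrK.
by rewrite expf_neq0 // gt_eqF.
Qed.

Lemma is_derive_flat p (t : R) : is_derive t (1 : R) (flat p) (flat ('X^2 * (p - p^`())) t).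
Proof.
have [t0|t0|->] := ltgtP t 0.
- rewrite {2}/flat ltNge (ltW t0) /=.
  apply: (@near_eq_is_derive _ _ _ (cst (0 : R))).
  near=> s; rewrite /flat ltNge ltW //=.
  by near: s; exact: lt_nbhsl.
- have tn0 : t != 0 by rewrite gt_eqF.
  rewrite {2}/flat t0.
  apply: (@near_eq_is_derive _ _ _ ((horner p \o GRing.inv) * (expR \o (fun s : R => - s^-1)))).
    near=> s; rewrite /flat ifT //.
    by near: s; exact: lt_nbhsr.
  have D1 : is_derive t (1 : R) GRing.inv (- t ^- 2).
    have H := @is_deriveV _ id t 1 1 tn0 (is_derive_id _ _).
    by apply: is_derive_eq; rewrite /GRing.scale /= mulr1.
  have D2 : is_derive t (1 : R) (fun s : R => - s^-1) (t ^- 2).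
    by apply: is_derive_eq; rewrite opprK.
  have D3 : is_derive t (1 : R) (horner p \o GRing.inv) (p^`().[t^-1] * - t ^- 2).
    exact: is_derive1_comp.
  have D4 : is_derive t (1 : R) (expR \o (fun s : R => - s^-1)) (expR (- t^-1) * t ^- 2).
    exact: is_derive1_comp.
  apply: is_derive_eq; rewrite /GRing.scale /= !hornerE /= -exprVn.
  by ring.
- rewrite {2}/flat ltxx.
  have [K [K0 HK]] := flat_bound p.
  have E : (fun h : R => h^-1 *: ((flat p \o shift 0) (h *: 1) - flat p 0)) @ 0^' --> (0 : R).
    apply/cvgr0Pnorm_le => e e0; near=> h.
    have h0 : h != 0 by near: h; exact: nbhs_dnbhs_neq.
    rewrite /= /GRing.scale /= mulr1 addr0 {2}/flat ltxx subr0.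
    have [hp|hn] := ltP 0 h; last by rewrite /flat ltNge hn /= mulr0 normr0 ltW.
    rewrite normrM normfV (gtr0_norm hp) ler_pdivrMl //.
    have h1 : h <= 1.
      apply: le_trans (ler_norm _) _; near: h.
      by apply: nbhs_dnbhs; apply: (@nbhs0_le R R^o) .
    apply: (le_trans (HK _ hp h1)); rewrite expr2 mulrCA ler_pM2l //.
    have : (K + 1) * h <= e.
      rewrite -ler_pdivlMl; last by rewrite ltr_wpDl.
      apply: le_trans (ler_norm _) _; near: h.
      apply: nbhs_dnbhs; apply: (@nbhs0_le R R^o).
      by rewrite mulr_gt0 // invr_gt0 ltr_wpDl.
    by apply: le_trans; rewrite ler_wpM2r ?(ltW hp) // lerDl.
  split; first by apply/cvg_ex; exists 0.
  exact/cvg_lim.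
Unshelve. all: by end_near. Qed.

Lemma smooth1_flat p : smooth1 (flat p).
Proof.
exists (fun n => flat (iter n (fun q => 'X^2 * (q - q^`())) p)); split=> // n t.
exact: is_derive_flat.
Qed.

Definition step (t : R) : R := flat 1 t / (flat 1 t + flat 1 (1 - t)).

Lemma flat1_ge0 t : 0 <= flat 1 t.
Proof. by rewrite /flat; case: ifP => // _; rewrite hornerE mul1r expR_ge0. Qed.

Lemma flat1_gt0 t : 0 < t -> 0 < flat 1 t.
Proof. by move=> t0; rewrite /flat t0 hornerE mul1r expR_gt0. Qed.

Lemma flat_eq0 p t : t <= 0 -> flat p t = 0.
Proof. by move=> t0; rewrite /flat ltNge t0. Qed.

Lemma step_den t : 0 < flat 1 t + flat 1 (1 - t).
Proof.
have [t0|t0] := ltP 0 t; first by rewrite ltr_pwDl ?flat1_gt0 ?flat1_ge0.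
by rewrite ltr_wpDl ?flat1_ge0 // flat1_gt0 // subr_gt0 (le_lt_trans t0).
Qed.

Lemma step_le0 t : t <= 0 -> step t = 0.
Proof. by move=> t0; rewrite /step flat_eq0 // mul0r. Qed.

Lemma step_ge1 t : 1 <= t -> step t = 1.
Proof.
move=> t1; rewrite /step [flat 1 (1 - t)]flat_eq0 ?subr_le0 // addr0 divff //.
by rewrite gt_eqF // flat1_gt0 // (lt_le_trans ltr01).
Qed.

Lemma step_ge0 t : 0 <= step t.
Proof. by rewrite divr_ge0 ?flat1_ge0 // ltW // step_den. Qed.

Lemma step_le1 t : step t <= 1.
Proof. by rewrite ler_pdivrMr ?step_den // mul1r lerDl flat1_ge0. Qed.

Lemma smooth_step phi : smooth phi -> smooth (fun x => step (phi x)).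
Proof.
move=> sp; rewrite /step.
have s1 : smooth (fun x => flat 1 (phi x)) by exact: (smooth_comp (smooth1_flat 1) sp).
have s2 : smooth (fun x => flat 1 (1 - phi x)).
  apply: (smooth_comp (smooth1_flat 1) (f := fun x => 1 - phi x)).
  by apply: smoothB => //; exact: smooth_cst.
apply: smoothM => //; apply: smoothV; first exact: smoothD.
by move=> x; rewrite gt_eqF // step_den.
Qed.

(** The squared Euclidean distance: a polynomial, hence smooth at [y] as well, and independent of
    the sup norm that the plane carries. *)
Definition sqd y x : R := (x.1 - y.1) ^+ 2 + (x.2 - y.2) ^+ 2.

Lemma smooth_sqd y : smooth (sqd y).
Proof.
by apply: smoothD; apply: smoothX; apply: smoothB;
   [exact: smooth_fst|exact: smooth_cst|exact: smooth_snd|exact: smooth_cst].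
Qed.

Lemma sqd_ge0 y x : 0 <= sqd y x.
Proof. by rewrite addr_ge0 // sqr_ge0. Qed.

Lemma sqdxx x : sqd x x = 0.
Proof. by rewrite /sqd !subrr expr0n addr0. Qed.

(** The argument of [step] is 1 at distance [a] from [y] and 0 at distance [b]. *)
Definition rcut y (a b : R) x := step ((b ^+ 2 - sqd y x) / (b ^+ 2 - a ^+ 2)).

Lemma smooth_rcut y a b : smooth (rcut y a b).
Proof.
apply: smooth_step; apply: smoothM; last exact: smooth_cst.
by apply: smoothB; [exact: smooth_cst|exact: smooth_sqd].
Qed.

Lemma rcut_ge0 y a b x : 0 <= rcut y a b x. Proof. exact: step_ge0. Qed.
Lemma rcut_le1 y a b x : rcut y a b x <= 1. Proof. exact: step_le1. Qed.

Lemma rcut1 y a b x : 0 <= a -> a < b -> sqd y x <= a ^+ 2 -> rcut y a b x = 1.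
Proof.
move=> a0 ab xa; apply: step_ge1.
have ab2 : a ^+ 2 < b ^+ 2 by rewrite ltr_pXn2r // nnegrE ltW // (le_lt_trans a0).
by rewrite ler_pdivlMr ?subr_gt0 // mul1r lerD2l lerN2.
Qed.

Lemma rcut0 y a b x : 0 <= a -> a < b -> b ^+ 2 <= sqd y x -> rcut y a b x = 0.
Proof.
move=> a0 ab xa; apply: step_le0.
have ab2 : a ^+ 2 < b ^+ 2 by rewrite ltr_pXn2r // nnegrE ltW // (le_lt_trans a0).
by rewrite mulr_le0_ge0 // ?subr_le0 // invr_ge0 subr_ge0 ltW.
Qed.

Definition eball y (a : R) : set (plane R) := [set x | sqd y x < a ^+ 2].

Lemma open_sqd_lt y (a : R) : open [set x | sqd y x < a].
Proof.
have := @open_lt R a; move=> /(@open_comp _ _ (sqd y)); apply => x _.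
exact: smooth_cont (smooth_sqd y) x.
Qed.

Lemma open_eball y a : open (eball y a). Proof. exact: open_sqd_lt. Qed.

Lemma closed_sqd_le y (a : R) : closed [set x | sqd y x <= a].
Proof.
have := @closed_le R a; move=> /(@closed_comp _ _ (sqd y)); apply => x _.
exact: smooth_cont (smooth_sqd y) x.
Qed.

Lemma sqd_coord y x (a : R) : 0 <= a -> sqd y x <= a ^+ 2 ->
  `|x.1 - y.1| <= a /\ `|x.2 - y.2| <= a.
Proof.
move=> a0 H; split; rewrite -(@ler_pXn2r _ 2) ?nnegrE // real_normK ?num_real //;
  apply: le_trans H; rewrite /sqd ?lerDl ?lerDr sqr_ge0 //.
Qed.

Lemma compact_box y (a : R) : compact [set x | `|x.1 - y.1| <= a /\ `|x.2 - y.2| <= a].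
Proof.
have -> : [set x : plane R | `|x.1 - y.1| <= a /\ `|x.2 - y.2| <= a] =
   `[y.1 - a, y.1 + a]%classic `*` `[y.2 - a, y.2 + a]%classic.
  by apply/seteqP; split=> x /=; rewrite !in_itv /= !ler_distl.
by apply: compact_setX; exact: segment_compact.
Qed.

Lemma compact_sqd_le y (a : R) : compact [set x | sqd y x <= a].
Proof.
have [a0|a0] := leP 0 a; last first.
  rewrite (_ : [set x | _] = set0); first exact: compact0.
  by apply/seteqP; split=> // x /=; rewrite leNgt (lt_le_trans a0) ?sqd_ge0.
apply: (subclosed_compact (closed_sqd_le (y:=y) (a:=a)) (@compact_box y (Num.sqrt a))).
by move=> x /= xa; apply: sqd_coord; rewrite ?sqrtr_ge0 ?sqr_sqrtr.
Qed.

Lemma nbhs_eball (A : set (plane R)) y : nbhs y A <-> exists2 a : R, 0 < a & eball y a `<=` A.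
Proof.
split; last first.
  move=> [a a0 aA]; apply: filterS aA _; apply: open_nbhs_nbhs; split.
    exact: open_eball.
  by rewrite /eball /= sqdxx exprn_gt0.
move=> /nbhs_ballP[e /= e0 eA]; exists e => // x xe; apply: eA.
have [n1 n2] : `|x.1 - y.1| < e /\ `|x.2 - y.2| < e.
  split; rewrite -(@ltr_pXn2r _ 2) ?nnegrE ?(ltW e0) // real_normK ?num_real //;
    by apply: le_lt_trans xe; rewrite /sqd ?lerDl ?lerDr sqr_ge0.
by split; rewrite /ball /= distrC.
Qed.

Lemma open_eballP (O : set (plane R)) y : open O -> O y -> exists2 a : R, 0 < a & eball y a `<=` O.
Proof. by move=> oO Oy; apply/nbhs_eball; exact: open_nbhs_nbhs. Qed.

Lemma plane_compact_cover (K : set (plane R)) : compact K -> cover_compact K.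
Proof.
pose p := @isPointed.Build (R * R)%type (0, 0).
pose T : ptopologicalType := HB.pack (R * R)%type p.
by rewrite (@compact_cover T).
Qed.

(* Stands in for partitions of unity. *)
Lemma cutoff_principle (A : (plane R -> R) -> Prop) (K : set (plane R)) :
  A (fun=> 0) ->
  (forall f g, A f -> A g -> A (fun x => f x + g x)) ->
  (forall f g, A f -> smooth g -> A (fun x => g x * f x)) ->
  compact K ->
  (forall y, K y -> exists2 a : R, 0 < a & A (rcut y a (2 * a))) ->
  exists chi, [/\ A chi, smooth chi, forall x, 0 <= chi x <= 1 &
    exists V, [/\ open V, K `<=` V & forall x, V x -> chi x = 1]].
Proof.
move=> A0 AD AM cK HK.
have [a Ha] : {a : plane R -> R & forall y, K y -> 0 < a y /\ A (rcut y (a y) (2 * a y))}.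
  apply: (@choice _ _ (fun y (b : R) => K y -> 0 < b /\ A (rcut y b (2 * b)))) => y.
  have [/HK[b b0 Ab]|nK] := pselect (K y); first by exists b.
  by exists 0 => /nK.
have [D DK Dc] : finite_subset_cover K (fun y => eball y (a y)) K.
  have : cover_compact K by exact: plane_compact_cover.
  apply; first by move=> y _; exact: open_eball.
  by move=> y Ky; exists y => //; rewrite /eball /= sqdxx exprn_gt0 //; case: (Ha y Ky).
pose E : seq (plane R) := finmap.enum_fset D.
have EK y : y \in E -> K y by move=> yD; move: (DK y yD); rewrite inE.
(* This equals 1 wherever one of the cutoffs does and stays in [0, 1]; by [WS] it arises from the
   single cutoffs by sums and by products with smooth functions, the operations under which [A] is
   closed. *)
pose W (s : seq (plane R)) x := 1 - \prod_(y <- s) (1 - rcut y (a y) (2 * a y) x).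
have WS y s : W (y :: s) = fun x => W s x + (\prod_(y <- s) (1 - rcut y (a y) (2 * a y) x)) * rcut y (a y) (2 * a y) x.
  by apply/funext => x; rewrite /W big_cons; ring.
have sP s : smooth (fun x => \prod_(y <- s) (1 - rcut y (a y) (2 * a y) x)).
  elim: s => [|y s IH].
    rewrite (_ : (fun x => _) = fun=> 1); first exact: smooth_cst.
    by apply/funext => x; rewrite big_nil.
  rewrite (_ : (fun x => _) = fun x => (1 - rcut y (a y) (2 * a y) x) * \prod_(y <- s) (1 - rcut y (a y) (2 * a y) x)).
    apply: smoothM => //; apply: smoothB; [exact: smooth_cst|exact: smooth_rcut].
  by apply/funext => x; rewrite big_cons.
have WA (s : seq (plane R)) : (forall y, y \in s -> K y) -> A (W s).
  elim: s => [|y s IH] Hs.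
    by rewrite (_ : W _ = fun=> 0) //; apply/funext => x; rewrite /W big_nil subrr.
  rewrite WS; apply: AD; first by apply: IH => z zs; apply: Hs; rewrite inE zs orbT.
  by apply: AM => //; have [] := Ha y (Hs y (mem_head _ _)).
exists (W E); split.
- exact: WA.
- by apply: smoothB => //; exact: smooth_cst.
- move=> x; have : 0 <= \prod_(y <- E) (1 - rcut y (a y) (2 * a y) x) <= 1.
    elim/big_ind: _ => //; first by rewrite lexx ler01.
      move=> b c /andP[b0 b1] /andP[c0 c1]; rewrite mulr_ge0 //=.
      by rewrite -[leRHS]mulr1; apply: ler_pM.
    by move=> y _; rewrite subr_ge0 rcut_le1 /= gerBl rcut_ge0.
  by rewrite /W => /andP[h1 h2]; rewrite subr_ge0 h2 /= gerBl.
- exists (\bigcup_(y in [set` E]) eball y (a y)); split.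
  + by apply: bigcup_open => y _; exact: open_eball.
  + exact: Dc.
  + move=> x [y /= yD yx].
    have Ky : K y by exact: EK.
    have [ay0 _] := Ha y Ky.
    rewrite /W (big_rem y) //= (rcut1 (ltW ay0)) ?subrr ?mul0r ?subr0 //.
      by rewrite ltr_pMl // ltr1n.
    exact: ltW.
Qed.

Lemma test0 (O : set (plane R)) : test_function O (fun=> 0).
Proof. by split; [exact: smooth_cst|exists set0; split=> //; exact: compact0]. Qed.

Lemma testD (O : set (plane R)) f g : test_function O f -> test_function O g ->
  test_function O (fun x => f x + g x).
Proof.
move=> [sf [K [cK KO fK]]] [sg [L [cL LO gL]]]; split; first exact: smoothD.
exists (K `|` L); split; first exact: compactU.
  by move=> x [/KO|/LO].
by move=> x nx; rewrite fK ?gL ?addr0 // => ?; apply: nx; [right|left].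
Qed.

Lemma testM (O : set (plane R)) f g : test_function O f -> smooth g ->
  test_function O (fun x => g x * f x).
Proof.
move=> [sf [K [cK KO fK]]] sg; split; first exact: smoothM.
by exists K; split=> // x nx; rewrite fK ?mulr0.
Qed.

Lemma testMr (O : set (plane R)) f g : test_function O f -> smooth g ->
  test_function O (fun x => f x * g x).
Proof.
move=> tf sg; rewrite (_ : (fun x => _) = fun x => g x * f x); first exact: testM.
by apply/funext => x; rewrite mulrC.
Qed.

Lemma testZ (O : set (plane R)) (a : R) f : test_function O f -> test_function O (fun x => a * f x).
Proof. by move=> tf; apply: testM => //; exact: smooth_cst. Qed.

Lemma testN (O : set (plane R)) f : test_function O f -> test_function O (fun x => - f x).
Proof. move=> /(testZ (-1)); congr test_function; apply/funext => x; by rewrite mulN1r. Qed.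

Lemma testB (O : set (plane R)) f g : test_function O f -> test_function O g ->
  test_function O (fun x => f x - g x).
Proof. by move=> tf tg; apply: testD => //; exact: testN. Qed.

Lemma test_sub (O O' : set (plane R)) f : O `<=` O' -> test_function O f -> test_function O' f.
Proof.
by move=> OO' [sf [K [cK KO fK]]]; split=> //; exists K; split=> //; exact: subset_trans OO'.
Qed.

Lemma test_notin (O : set (plane R)) f x : test_function O f -> ~ O x -> f x = 0.
Proof. by move=> [_ [K [_ KO fK]]] nO; apply: fK => /KO. Qed.

Lemma eball_sub (y : plane R) (a b : R) : 0 <= a -> a <= b -> eball y a `<=` eball y b.
Proof.
move=> a0 ab x; rewrite /eball /= => /lt_le_trans; apply.
by rewrite ler_pXn2r // nnegrE // (le_trans a0).
Qed.

Lemma test_rcut (O : set (plane R)) y (a b c : R) : 0 <= a -> a < b -> b < c ->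
  eball y c `<=` O -> test_function O (rcut y a b).
Proof.
move=> a0 ab bc cO; split; first exact: smooth_rcut.
exists [set x | sqd y x <= b ^+ 2]; split; first exact: compact_sqd_le.
  move=> x /= xb; apply: cO; apply: le_lt_trans xb _.
  by rewrite ltr_pXn2r // nnegrE ltW // ?(lt_trans _ bc) // (le_lt_trans a0).
by move=> x /negP; rewrite -ltNge => /ltW xb; exact: rcut0.
Qed.

Lemma cutoff (K O : set (plane R)) : compact K -> open O -> K `<=` O ->
  exists chi, [/\ test_function O chi, forall x, 0 <= chi x <= 1 &
    exists V, [/\ open V, K `<=` V & forall x, V x -> chi x = 1]].
Proof.
move=> cK oO KO.
have [|f g|f g tf sg||y Ky|chi [tchi _ c01 HV]] := @cutoff_principle (test_function O) K.
- exact: test0.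
- exact: testD.
- exact: testM.
- exact: cK.
- have [a a0 aO] := open_eballP oO (KO _ Ky).
  exists (a / 3); first by rewrite divr_gt0.
  by apply: (@test_rcut O y _ _ a) => //; lra.
by exists chi.
Qed.

End Cutoffs.

(** * Integration over the plane *)

Section PlaneIntegral.
Context {R : realType}.
Implicit Types (f g u v phi : plane R -> R) (x y : plane R) (i : bool) (D O K : set (plane R)).

Local Notation leb2m := (leb2 : measure (mplane R) R).

Definition box y (a : R) : set (plane R) := [set x | `|x.1 - y.1| <= a /\ `|x.2 - y.2| <= a].

(** The sigma-algebra of the plane is a product, so an open set has to be exhibited as a countable
    union of boxes, here the open ones with rational center and half-side that it contains. *)
Lemma measurable_open_plane O : open O -> measurable (O : set (mplane R)).
Proof.
move=> oO.
pose J (a r : rat) : set R := `]ratr a - ratr r, ratr a + ratr r[%classic.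
pose B (a b r : rat) : set (mplane R) := J a r `*` J b r.
pose F a b r : set (mplane R) := if `[< B a b r `<=` O >] then B a b r else set0.
have -> : (O : set (mplane R)) = \bigcup_a \bigcup_b \bigcup_r F a b r.
  apply/seteqP; split=> x; last first.
    by move=> [a _ [b _ [r _]]]; rewrite /F; case: asboolP => // BO /BO.
  move=> Ox; have /nbhs_ballP[e /= e0 eO] : nbhs x O by exact: open_nbhs_nbhs.
  have e2 : (0 : R) < e / 2 by rewrite divr_gt0.
  have [r /[!in_itv]/= /andP[r0 re]] := rat_in_itvoo e2.
  have xr (z : R) : z - ratr r < z + ratr r by rewrite ltrD2l gtrN.
  have [a /[!in_itv]/= /andP[a1 a2]] := rat_in_itvoo (xr x.1).
  have [b /[!in_itv]/= /andP[b1 b2]] := rat_in_itvoo (xr x.2).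
  exists a => //; exists b => //; exists r => //; rewrite /F.
  rewrite asboolT; first by split; rewrite /J /= in_itv /=; lra.
  case=> z1 z2 [/=]; rewrite /J /= !in_itv /= => h1 h2; apply: eO.
  by split; rewrite /ball /= ltr_distl; lra.
apply: bigcupT_measurable_rat => a; apply: bigcupT_measurable_rat => b.
apply: bigcupT_measurable_rat => r; rewrite /F; case: asboolP => _ //.
by apply: measurableX; exact: measurable_itv.
Qed.

Lemma measurable_closed_plane O : closed O -> measurable (O : set (mplane R)).
Proof.
by move=> cO; rewrite -(setCK O); apply: measurableC; apply: measurable_open_plane; exact: closed_openC.
Qed.

Lemma measurable_cont_plane f : continuous f -> measurable_fun setT (f : mplane R -> R).
Proof.
move=> cf; apply: (@measurability _ _ _ _ _ _ (@RGenOInfty.G R)).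
  exact: RGenOInfty.measurableE.
move=> _ [_ [a ->] <-]; rewrite setTI; apply: measurable_open_plane.
by apply: open_comp; [move=> x _; exact: cf|exact: interval_open].
Qed.

Lemma measurable_cont_plane_on D f : measurable (D : set (mplane R)) -> continuous f ->
  measurable_fun (D : set (mplane R)) (f : mplane R -> R).
Proof. by move=> mD cf; apply: measurable_funTS; exact: measurable_cont_plane. Qed.

Lemma boxE y a : box y a = `[y.1 - a, y.1 + a]%classic `*` `[y.2 - a, y.2 + a]%classic.
Proof. by apply/seteqP; split=> x /=; rewrite /box /= !in_itv /= !ler_distl. Qed.

Lemma measurable_box y a : measurable (box y a : set (mplane R)).
Proof. by rewrite boxE; apply: measurableX; exact: measurable_itv. Qed.

Lemma leb2_box y a : 0 <= a -> leb2m (box y a) = ((2 * a) ^+ 2)%:E.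
Proof.
move=> a0; rewrite boxE /= /leb2 product_measure1E; [|exact: measurable_itv|exact: measurable_itv].
have E (z : R) : (lebesgue_measure `[(z - a)%R, (z + a)%R]%classic = (2 * a)%:E)%E.
  rewrite lebesgue_measure_itv /= lte_fin; case: ltP => [_|H]; first by rewrite -EFinB; congr EFin; ring.
  by congr EFin; lra.
transitivity ((2 * a)%:E * (2 * a)%:E)%E; last by rewrite -EFinM expr2.
by congr (_ * _)%E; exact: E.
Qed.

Definition integ D f := leb2m.-integrable (D : set (mplane R)) (EFin \o f).
Definition II_def D f : R := \int[leb2m]_(x in (D : set (mplane R))) f x.
Fact II_key : unit. Proof. exact: tt. Qed.
Definition II := locked_with II_key II_def.

Lemma IIE D f : II D f = \int[leb2m]_(x in (D : set (mplane R))) f x.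
Proof. by rewrite /II unlock. Qed.

Lemma cont_bounded_box f y a : continuous f -> exists M, forall x, box y a x -> `|f x| <= M.
Proof.
move=> cf.
have : compact (f @` box y a).
  by apply: continuous_compact; [exact: continuous_subspaceT|exact: compact_box].
move=> /compact_bounded[M [_ HM]]; exists (M + 1) => x bx.
by apply: (HM (M + 1)); [rewrite ltrDl|exists x].
Qed.

Lemma integ_cont D y a f : measurable (D : set (mplane R)) -> D `<=` box y a -> continuous f -> integ D f.
Proof.
move=> mD Da cf; apply: measurable_bounded_integrable => //.
- apply: (@le_lt_trans _ _ (leb2m (box y (`|a|)))).
    apply: le_measure; rewrite ?inE //; first exact: measurable_box.
    by move=> x /Da [h1 h2]; split; [apply: le_trans h1 _|apply: le_trans h2 _]; exact: ler_norm.
  by rewrite leb2_box // ltry.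
- exact: measurable_cont_plane_on.
- have [M HM] := cont_bounded_box y a cf.
  exists M; split; first exact: num_real.
  by move=> r Mr x /Da bx; apply: le_trans (HM _ bx) (ltW Mr).
Qed.

Lemma compact_sub_box K : compact K -> exists2 a : R, 0 < a & K `<=` box 0 a.
Proof.
move=> /compact_bounded[M [_ HM]]; exists (`|M| + 1); first by rewrite ltr_wpDl.
move=> x Kx; have := HM (`|M| + 1); rewrite (le_lt_trans (ler_norm M)) ?ltrDl // => /(_ erefl x Kx).
rewrite /= prod_normE ge_max => /andP[h1 h2]; by rewrite /box /= !subr0.
Qed.

Lemma integ_test O D f : measurable (D : set (mplane R)) -> test_function O f -> integ D f.
Proof.
move=> mD [sf [K [cK _ fK]]]; have [a a0 Ka] := compact_sub_box cK.
apply: (integrableS _ mD (@subsetT _ D)) => //.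
have -> : (EFin \o f : mplane R -> \bar R) = (EFin \o f) \_ (box 0 a : set (mplane R)).
  apply/funext => x; rewrite patchE; case: ifPn => //.
  by rewrite notin_setE => nb; rewrite /= fK // => /Ka.
apply/(integrable_mkcond _ (measurable_box 0 a)).
exact: integ_cont (measurable_box 0 a) (@subset_refl _ _) (smooth_cont sf).
Qed.

Lemma integD D f g : measurable (D : set (mplane R)) ->
  integ D f -> integ D g -> integ D (fun x => f x + g x).
Proof.
by move=> mD If Ig; apply: eq_integrable (integrableD mD If Ig) => //.
Qed.

Lemma integZ D (a : R) f : measurable (D : set (mplane R)) ->
  integ D f -> integ D (fun x => a * f x).
Proof.
by move=> mD If; apply: eq_integrable (integrableZl mD a If) => //.
Qed.

Lemma integB D f g : measurable (D : set (mplane R)) ->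
  integ D f -> integ D g -> integ D (fun x => f x - g x).
Proof.
by move=> mD If Ig; apply: eq_integrable (integrableB mD If Ig) => //.
Qed.

Lemma IID D f g : measurable (D : set (mplane R)) -> integ D f -> integ D g ->
  II D (fun x => f x + g x) = II D f + II D g.
Proof. by rewrite !IIE; exact: RintegralD. Qed.

Lemma IIB D f g : measurable (D : set (mplane R)) -> integ D f -> integ D g ->
  II D (fun x => f x - g x) = II D f - II D g.
Proof. by rewrite !IIE; exact: RintegralB. Qed.

Lemma IIZ D (a : R) f : measurable (D : set (mplane R)) -> integ D f ->
  II D (fun x => a * f x) = a * II D f.
Proof. by move=> mD If; rewrite !IIE RintegralZl. Qed.

Lemma II_le D f g : measurable (D : set (mplane R)) -> integ D f -> integ D g ->
  (forall x, D x -> f x <= g x) -> II D f <= II D g.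
Proof. by rewrite !IIE; exact: le_Rintegral. Qed.

Lemma II_ge0 D f : (forall x, D x -> 0 <= f x) -> 0 <= II D f.
Proof. by move=> f0; rewrite IIE; apply: Rintegral_ge0. Qed.

Lemma II_eq D f g : (forall x, D x -> f x = g x) -> II D f = II D g.
Proof. by move=> fg; rewrite !IIE; apply: eq_Rintegral => x; rewrite inE => /fg. Qed.

Lemma II0 D : II D (fun=> 0) = 0.
Proof. by rewrite !IIE /Rintegral integral0. Qed.

Lemma II_abs D f g : measurable (D : set (mplane R)) -> integ D f -> integ D g ->
  (forall x, D x -> `|f x| <= g x) -> `|II D f| <= II D g.
Proof.
move=> mD If Ig fg; rewrite ler_norml; apply/andP; split.
  rewrite -mulN1r -IIZ //; apply: II_le => //; first exact: integZ.
  by move=> x /fg; rewrite ler_norml mulN1r => /andP[].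
by apply: II_le => // x /fg; rewrite ler_norml => /andP[].
Qed.

Lemma II_supp O D f : (forall x, ~ O x -> f x = 0) -> O `<=` D -> II O f = II D f.
Proof.
move=> f0 OD; rewrite !IIE Rintegral_mkcond [RHS]Rintegral_mkcond; congr (Rintegral _ _ _).
apply/funext => x; rewrite !patchE; case: ifPn => [/[!inE]/OD Dx|].
  by rewrite ifT // inE.
by rewrite notin_setE => nO; rewrite f0 //; case: ifP.
Qed.

Lemma II_test O D f : O `<=` D -> test_function O f -> II O f = II D f.
Proof. by move=> OD tf; apply: II_supp => // x nO; exact: test_notin tf nO. Qed.

Lemma II_mono O D f : measurable (O : set (mplane R)) -> measurable (D : set (mplane R)) ->
  O `<=` D -> integ D f -> (forall x, D x -> 0 <= f x) -> II O f <= II D f.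
Proof.
move=> mO mD OD If f0; rewrite !IIE Rintegral_mkcond [leRHS]Rintegral_mkcond.
apply: le_Rintegral => //.
- have := integrableS mD mO OD If; move/integrable_mkcond => /(_ mO).
  by congr (integrable _ _ _); apply/funext => x; rewrite /= !patchE; case: ifP.
- have := If; move/integrable_mkcond => /(_ mD).
  by congr (integrable _ _ _); apply/funext => x; rewrite /= !patchE; case: ifP.
- move=> x _; rewrite !patchE; case: ifPn => [/[!inE]/OD Dx|_]; first by rewrite ifT // inE.
  by case: ifPn => // /[!inE]/f0.
Qed.

(** The discriminant of a nonnegative quadratic. Both the Cauchy-Schwarz inequality and the
    variational step of the Riesz theorem go through it. *)
Lemma quad_disc (a b c : R) : 0 <= a ->
  (forall t, 0 <= a * t ^+ 2 + 2 * b * t + c) -> b ^+ 2 <= a * c.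
Proof.
move=> a0 H; have c0 : 0 <= c by have := H 0; rewrite expr0n /= !mulr0 !add0r.
have [az|an] := eqVneq a 0.
  have [->|b0] := eqVneq b 0; first by rewrite expr0n /= az mul0r.
  (* At this point the polynomial, affine since [a = 0], takes the value -1. *)
  have := H (- (c + 1) / (2 * b)); rewrite az mul0r add0r mulrCA mulfV ?mulr1; first lra.
  by rewrite mulf_neq0 // pnatr_eq0.
have ap : 0 < a by rewrite lt_neqAle eq_sym an.
have := H (- b / a); rewrite (_ : _ + c = (a * c - b ^+ 2) / a); last by field.
by rewrite pmulr_lge0 ?invr_gt0 // subr_ge0.
Qed.

Lemma II_CS D f g : measurable (D : set (mplane R)) -> integ D (fun x => f x * f x) ->
  integ D (fun x => f x * g x) -> integ D (fun x => g x * g x) ->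
  II D (fun x => f x * g x) ^+ 2 <= II D (fun x => f x * f x) * II D (fun x => g x * g x).
Proof.
move=> mD ff fg gg; apply: quad_disc => [|t].
  by apply: II_ge0 => x _; rewrite -expr2 sqr_ge0.
have E : II D (fun x => (t ^+ 2 * (f x * f x) + (2 * t) * (f x * g x)) + g x * g x) =
  II D (fun x => f x * f x) * t ^+ 2 + 2 * II D (fun x => f x * g x) * t + II D (fun x => g x * g x).
  rewrite IID ?IID ?IIZ //; first by ring.
  - exact: integZ.
  - exact: integZ.
  - by apply: integD => //; exact: integZ.
rewrite -E; apply: II_ge0 => x _.
by rewrite (_ : _ + _ = (t * f x + g x) ^+ 2) ?sqr_ge0 //; ring.
Qed.

Lemma leb2_pos_eq0 f : continuous f -> (forall x, 0 <= f x) -> integ setT f ->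
  II setT f = 0 -> forall x, f x = 0.
Proof.
move=> cf f0 If If0 x; apply/eqP; rewrite eq_le f0 andbT leNgt; apply/negP => fx.
have : \forall y \near x, f x / 2 < f y.
  by apply: (cf x (fun z => f x / 2 < z)); apply: lt_nbhsr; lra.
move=> /nbhs_ballP[e /= e0 He].
have bH y : box x (e / 2) y -> f x / 2 <= f y.
  move=> [h1 h2]; apply/ltW/He; split; rewrite /ball /= distrC.
    by apply: le_lt_trans h1 _; lra.
  by apply: le_lt_trans h2 _; lra.
have mb := measurable_box x (e / 2).
have H1 := II_mono mb (measurableT : measurable (setT : set (mplane R))) (@subsetT _ _) If (fun y _ => f0 y).
have Ib := integrableS (measurableT : measurable (setT : set (mplane R))) mb (@subsetT _ _) If.
have Ic : integ (box x (e / 2)) (fun=> f x / 2).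
  by apply: (integ_cont mb (@subset_refl _ _)) => y; exact: cvg_cst.
have H2 := II_le mb Ic Ib bH.
have : 0 < II (box x (e / 2)) (fun=> f x / 2).
  rewrite !IIE Rintegral_cst // leb2_box /=; last by rewrite ltW // divr_gt0.
  by rewrite mulr_gt0 // ?exprn_gt0 //; lra.
by rewrite ltNge (le_trans H2) // -If0.
Qed.

(** Uniqueness of measures is used twice: intervals determine the measure on the line, rectangles
    the one on the plane, and on each of them translation is visibly harmless. *)
Lemma leb2_shift (a : plane R) (A : set (mplane R)) : measurable A ->
  leb2m ((fun x : mplane R => (x + a : plane R)) @^-1` A) = leb2m A.
Proof.
pose T1 (b : R) : measurableTypeR R -> measurableTypeR R := fun t => t + b.
have mT b : measurable_fun setT (T1 b).
  by apply: measurable_funD => //; exact: measurable_cst.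
have L1 (b : R) (B : set (measurableTypeR R)) : measurable B ->
    lebesgue_measure (T1 b @^-1` B) = lebesgue_measure B.
  move=> mB; symmetry.
  unshelve refine (@lebesgue_measure_unique R (pushforward lebesgue_measure (T1 b) : measure _ _) _ B mB).
    exact: mT.
  move=> _ [[p q] _ <-] /=; rewrite /pushforward.
  have -> : T1 b @^-1` `]p, q]%classic = `]p - b, q - b]%classic.
    by apply/seteqP; split=> t /=; rewrite /T1 !in_itv /= ltrBlDr lerBrDr.
  rewrite !lebesgue_measure_itv /= !lte_fin ltrD2r; case: ifP => // _.
  by rewrite -!EFinB; congr EFin; ring.
have mT2 : measurable_fun setT (fun x : mplane R => ((x : plane R) + a : mplane R)).
  apply/measurable_fun_pairP; split.
    exact: (measurableT_comp (mT a.1) measurable_fst).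
  exact: (measurableT_comp (mT a.2) measurable_snd).
move=> mA; symmetry.
unshelve refine (@product_measure_unique _ _ _ _ R lebesgue_measure lebesgue_measure
  (pushforward leb2m (fun x : mplane R => ((x : plane R) + a : mplane R)) : measure _ _) _ A mA).
  exact: mT2.
move=> X Y mX mY; rewrite /= /pushforward.
have -> : (fun x : mplane R => ((x : plane R) + a : mplane R)) @^-1` (X `*` Y) =
   (T1 a.1 @^-1` X) `*` (T1 a.2 @^-1` Y) by [].
rewrite /leb2 product_measure1E.
- by congr (_ * _)%E; exact: L1.
- by rewrite -[X in measurable X]setTI; exact: mT.
- by rewrite -[X in measurable X]setTI; exact: mT.
Qed.

Definition shiftf (a : plane R) f : plane R -> R := fun x => f (x + a).

Lemma measurable_shift (a : plane R) :
  measurable_fun setT (fun x : mplane R => ((x : plane R) + a : mplane R)).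
Proof.
apply/measurable_fun_pairP; split.
  by apply: measurable_funD; [exact: measurable_fst|exact: measurable_cst].
by apply: measurable_funD; [exact: measurable_snd|exact: measurable_cst].
Qed.

Lemma pd_shift (a : plane R) f i : pd i (shiftf a f) = shiftf a (pd i f).
Proof.
apply/funext => x; rewrite !pdE /shiftf /derive /=.
rewrite (_ : (fun h : R => _) = (fun h : R => h^-1 *: (f (h *: ax i + (x + a)) - f (x + a)))) //.
by apply/funext => h /=; rewrite addrA.
Qed.

Lemma derivable_shift (a : plane R) f (e : plane R) x : derivable f (x + a) e -> derivable (shiftf a f) x e.
Proof.
rewrite /derivable /shiftf.
rewrite (_ : (fun h : R => h^-1 *: (_ - f (x + a))) = (fun h : R => h^-1 *: (((fun x => f (x + a)) \o shift x) (h *: e) - f (x + a)))) //.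
by apply/funext => h /=; rewrite addrA.
Qed.

Lemma smooth_shift (a : plane R) f : smooth f -> smooth (shiftf a f).
Proof.
move=> sf; apply: (@smooth_coind _ (fun g => exists2 f, smooth f & g = shiftf a f)); last by exists f.
move=> _ [g sg ->]; split.
  move=> x; apply: (@continuous_comp _ _ _ (fun x => x + a) g); last exact: smooth_cont.
  by apply: cvgD; [exact: cvg_id|exact: cvg_cst].
move=> i; split; first by move=> x; apply: derivable_shift; exact: smooth_der.
by exists (pd i g); [exact: smooth_pd|exact: pd_shift].
Qed.

Lemma test_shift (a : plane R) O O' f : (forall x, O (x + a) -> O' x) -> test_function O f ->
  test_function O' (shiftf a f).
Proof.
move=> OO' [sf [K [cK KO fK]]]; split; first exact: smooth_shift.
exists ((fun x => x - a) @` K); split.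
- apply: continuous_compact => //; apply: continuous_subspaceT => x.
  by apply: cvgB; [exact: cvg_id|exact: cvg_cst].
- by move=> _ [x Kx <-]; apply: OO'; rewrite subrK; exact: KO.
- by move=> x nx; apply: fK => Kx; apply: nx; exists (x + a) => //; rewrite addrK.
Qed.

Lemma II_shift (a : plane R) f : test_function setT f -> II setT (shiftf a f) = II setT f.
Proof.
move=> tf; have mT := measurableT : measurable (setT : set (mplane R)).
have Is := integ_test mT (test_shift (O' := setT) (a := a) (fun _ _ => I) tf).
rewrite !IIE /Rintegral; congr fine; symmetry.
have mf : measurable_fun setT (EFin \o f : mplane R -> \bar R).
  by apply/measurable_EFinP; apply: measurable_cont_plane; exact: smooth_cont tf.1.
have := @integral_pushforward _ _ _ _ R _ (measurable_shift a) leb2m setT _ mf Is mT.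
move=> H; apply: (eq_trans _ H); symmetry.
apply: (@eq_measure_integral _ _ R setT leb2m) => [|? A mA _]; first exact: measurable_shift.
exact: leb2_shift.
Qed.

Lemma compact_closed_plane K : compact K -> closed K.
Proof. by apply: compact_closed; exact: norm_hausdorff. Qed.

Lemma pd_supp K f i : closed K -> (forall x, ~ K x -> f x = 0) -> forall x, ~ K x -> pd i f x = 0.
Proof.
move=> cl fK x nx.
have : \forall y \near x, (fun=> 0) y = f y.
  near=> y; rewrite fK //; near: y; apply: open_nbhs_nbhs; split=> //; exact: closed_openC.
by move=> H; rewrite !pdE -(near_eq_derive _ H) derive_cst.
Unshelve. all: by end_near. Qed.

Lemma test_pd O f i : test_function O f -> test_function O (pd i f).
Proof.
move=> [sf [K [cK KO fK]]]; split; first exact: smooth_pd.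
by exists K; split=> //; apply: pd_supp => //; exact: compact_closed_plane.
Qed.

Lemma cont_test_bounded O f : continuous f -> (exists2 K, compact K & forall x, ~ K x -> f x = 0) ->
  exists2 M : R, 0 < M & forall x, `|f x| <= M.
Proof.
move=> cf [K cK fK]; have [a a0 Ka] := compact_sub_box cK.
have [M HM] := cont_bounded_box 0 a cf.
exists (`|M| + 1); first by rewrite ltr_wpDl.
move=> x; have [Kx|/fK ->] := pselect (K x); last by rewrite normr0 addr_ge0.
by apply: le_trans (HM _ (Ka _ Kx)) _; rewrite (le_trans (ler_norm M)) // lerDl.
Qed.

Lemma test_bounded O f : test_function O f -> exists2 M : R, 0 < M & forall x, `|f x| <= M.
Proof.
move=> [sf [K [cK _ fK]]]; apply: (@cont_test_bounded O); first exact: smooth_cont.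
by exists K.
Qed.

Lemma is_derive_axis f i x (t : R) : smooth f ->
  is_derive t (1 : R) (fun t : R => f (x + t *: ax i)) (pd i f (x + t *: ax i)).
Proof.
move=> sf.
have H := is_derive_line (@smooth_der _ f i (x + t *: ax i) sf).
have H2 : is_derive t (1 : R) ((fun s : R => s - t) : R -> R) (1 : R).
  have := is_deriveB (is_derive_id t (1 : R)) (is_derive_cst t t (1 : R)).
  by rewrite subr0.
have H3 : is_derive ((fun s : R => s - t) t) (1 : R)
   (fun s : R => f (s *: ax i + (x + t *: ax i))) (pd i f (x + t *: ax i)).
  by rewrite /= subrr pdE.
have := @is_derive1_comp _ _ (fun s : R => s - t) _ _ _ H3 H2; rewrite mulr1.
congr is_derive; apply/funext => s /=; congr f.
by rewrite scalerBl addrCA subrK.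
Qed.

Lemma MVT_ax f i x (h : R) : smooth f -> 0 <= h ->
  exists2 c, 0 <= c <= h & f (x + h *: ax i) - f x = pd i f (x + c *: ax i) * h.
Proof.
move=> sf h0.
have D t := is_derive_axis i x t sf.
have [|c cin E] := @MVT_segment R (fun t => f (x + t *: ax i)) _ 0 h h0 (fun t _ => D t).
  apply: derivable_within_continuous => t _; exact: (@ex_derive _ _ _ _ _ _ _ (D t)).
exists c; first by move: cin; rewrite in_itv.
by rewrite scale0r addr0 subr0 in E.
Qed.

Lemma scale_ax (h : R) i : h *: ax i = (if i then (0, h) else (h, 0)) :> plane R.
Proof. by case: i; congr pair; rewrite /GRing.scale /= ?mulr0 ?mulr1. Qed.

Lemma box_ax (a c : R) i x : 0 <= c <= 1 -> box 0 a (x + c *: ax i) -> box 0 (a + 1) x.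
Proof.
move=> /andP[c0 c1]; rewrite scale_ax /box /=.
case: i => /=; rewrite !subr0 ?addr0 !ler_norml => -[/andP[? ?] /andP[? ?]];
  by split; apply/andP; split; lra.
Qed.

(** Translation invariance makes the integral of every difference quotient vanish. By the mean value
    theorem, applied twice, the quotient of step [h] differs from [pd i f] by at most [h] times a
    bound on the second derivative, and only on a fixed box; now let [h] tend to 0. *)
Lemma II_pd f i : test_function setT f -> II setT (pd i f) = 0.
Proof.
move=> tf; have [sf [K [cK _ fK]]] := tf.
have mT : measurable (setT : set (mplane R)) by exact: measurableT.
have tg := test_pd i tf; have tgg := test_pd i tg.
have [M M0 HM] := test_bounded tgg.
have [a a0 Ka] := compact_sub_box cK.
have cl := compact_closed_plane cK.
(* The box is larger by 1 than one containing the support, to accommodate all steps [h <= 1]; [chi]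
   is an integrable majorant of its indicator. *)
have [chi [tchi c01 [V [_ KV V1]]]] := cutoff (compact_box (y := 0) (a := a + 1)) openT (@subsetT _ _).
have chi0 x : 0 <= chi x by case/andP: (c01 x).
have H (h : R) : 0 < h -> h <= 1 -> `|II setT (pd i f)| <= h * (M * II setT chi).
  move=> h0 h1.
  have ts : test_function setT (shiftf (h *: ax i) f) by exact: test_shift tf.
  have E : II setT (fun x => pd i f x - h^-1 * (f (x + h *: ax i) - f x)) = II setT (pd i f).
    rewrite IIB //; first last.
    - by apply: integZ => //; apply: integB => //; [exact: integ_test ts|exact: integ_test tf].
    - exact: integ_test tg.
    rewrite IIZ //; last by apply: integB => //; [exact: integ_test ts|exact: integ_test tf].
    rewrite IIB //; [|exact: integ_test ts|exact: integ_test tf].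
    by rewrite (II_shift (h *: ax i) tf) subrr mulr0 subr0.
  rewrite -E mulrA -IIZ //; last exact: integ_test tchi.
  apply: II_abs => //.
  - apply: integB => //; first exact: integ_test tg.
    by apply: integZ => //; apply: integB => //; [exact: integ_test ts|exact: integ_test tf].
  - by apply: integZ => //; exact: integ_test tchi.
  move=> x _; have [c /andP[c0 ch] Ec] := MVT_ax i x sf (ltW h0).
  have [c' /andP[c0' cc'] Ec'] := MVT_ax i x tg.1 c0.
  rewrite Ec mulrCA mulVf ?gt_eqF // mulr1 distrC Ec' normrM (ger0_norm c0).
  have [bx|nb] := pselect (box 0 (a + 1) x).
    rewrite V1; last exact: KV.
    by rewrite mulr1 mulrC; apply: ler_pM.
  have -> : pd i (pd i f) (x + c' *: ax i) = 0.
    apply: (@pd_supp K (pd i f) i cl); first exact: (@pd_supp K f i cl fK).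
    by move=> /Ka /box_ax H; apply: nb; apply: H; rewrite c0' /= (le_trans cc') // (le_trans ch).
  rewrite normr0 mul0r; apply: mulr_ge0 => //; first by rewrite mulr_ge0 ?ltW.
apply/eqP; rewrite -normr_le0; apply/ler_addgt0Pl => e e0; rewrite addr0.
set C := M * II setT chi in H *.
have C0 : 0 <= C by rewrite mulr_ge0 ?(ltW M0) //; apply: II_ge0.
pose h := Num.min 1 (e / (C + 1)).
have h0 : 0 < h by rewrite lt_min ltr01 divr_gt0 // ltr_wpDl.
apply: le_trans (H h h0 _) _; first by rewrite ge_min lexx.
apply: (@le_trans _ _ (e / (C + 1) * (C + 1))); last by rewrite divfK // gt_eqF // ltr_wpDl.
by apply: ler_pM => //; [exact: ltW|rewrite ge_min lexx orbT|rewrite lerDl].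
Qed.

Lemma II_parts i f g : test_function setT f -> smooth g ->
  II setT (fun x => f x * pd i g x) = - II setT (fun x => pd i f x * g x).
Proof.
move=> tf sg; have mT : measurable (setT : set (mplane R)) by exact: measurableT.
have t1 : test_function setT (fun x => f x * pd i g x) by apply: testMr => //; exact: smooth_pd.
have t2 : test_function setT (fun x => pd i f x * g x) by apply: testMr => //; exact: test_pd.
apply/eqP; rewrite -addr_eq0 -IID ?(integ_test mT t1) ?(integ_test mT t2) //; apply/eqP.
have := II_pd i (testMr tf sg); rewrite pdM => [<-||]; last 2 first.
- by move=> x; apply: smooth_der; exact: tf.1.
- by move=> x; apply: smooth_der.
by apply: II_eq => x _; rewrite [pd i f x * _]mulrC.
Qed.

End PlaneIntegral.

#[global] Opaque integ.

(** * Energy forms and unique continuation *)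

Section ApproximateRiesz.
Context {R : realType}.
Implicit Types (f g u v : plane R -> R).

Definition pform (P : (plane R -> R) -> Prop) (a : (plane R -> R) -> (plane R -> R) -> R) :=
  [/\ forall f g, P f -> P g -> a f g = a g f,
      forall f g h, P f -> P g -> P h -> a (fun x => f x + g x) h = a f h + a g h,
      forall t f g, P f -> P g -> a (fun x => t * f x) g = t * a f g &
      forall f, P f -> 0 <= a f f].

Definition plinear (P : (plane R -> R) -> Prop) (l : (plane R -> R) -> R) :=
  (forall f g, P f -> P g -> l (fun x => f x + g x) = l f + l g) /\
  (forall t f, P f -> l (fun x => t * f x) = t * l f).

Definition psubspace (P : (plane R -> R) -> Prop) :=
  [/\ P (fun=> 0), forall f g, P f -> P g -> P (fun x => f x + g x) &
      forall t f, P f -> P (fun x => t * f x)].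

(* The minimising-sequence half of the Riesz representation theorem: it needs no completeness. *)
Lemma riesz_approx P a l (C : R) : psubspace P -> pform P a -> plinear P l ->
  (forall u, P u -> l u ^+ 2 <= C * a u u) ->
  forall k : R, 0 < k -> exists2 psi, P psi &
    forall u, P u -> (a psi u - l u) ^+ 2 <= k * a u u.
Proof.
move=> [P0 PD PZ] [as_ aD aZ a0] [lD lZ] lC k k0.
pose J u := a u u - 2 * l u.
have C0 : 0 <= C \/ forall u, P u -> a u u = 0.
  have [C0|C0] := leP 0 C; [by left|right] => u Pu; apply/eqP; rewrite eq_le a0 // andbT.
  rewrite leNgt; apply/negP => au; have := lC u Pu.
  by rewrite leNgt => /negP; apply; apply: lt_le_trans (sqr_ge0 _); rewrite nmulr_rlt0.
(* Since [(2 l u)^2 <= 4 |C| a u u <= (a u u + |C|)^2], [J] is bounded below even if [a] is only a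
   seminorm. *)
have J_ge u : P u -> - `|C| <= J u.
  move=> Pu; rewrite /J; have H := lC u Pu; have A := a0 u Pu.
  have H' : l u ^+ 2 <= `|C| * a u u by apply: le_trans H _; rewrite ler_wpM2r // ler_norm.
  have n0 : 0 <= `|C| by [].
  rewrite leNgt; apply/negP => H2.
  have H3 : (a u u + `|C|) ^+ 2 < (2 * l u) ^+ 2.
    by rewrite ltr_pXn2r // ?nnegrE; lra.
  have := sqr_ge0 (a u u - `|C|); nra.
pose S := [set J u | u in [set u | P u]].
have hS : has_inf S.
  split; first by exists (J (fun=> 0)), (fun=> 0).
  by exists (- `|C|) => _ [u Pu <-]; exact: J_ge.
have [_ [psi Ppsi <-] Hpsi] := inf_adherent k0 hS.
(* As [psi] is [k]-almost minimal for [J], the quadratic [a u u t^2 + 2 (a psi u - l u) t + k] is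
   nonnegative in [t], and its discriminant is the claim. *)
exists psi => // u Pu; rewrite mulrC; apply: quad_disc; first exact: a0.
move=> t; have Ptu : P (fun x => t * u x) by exact: PZ.
have PU : P (fun x => psi x + t * u x) by exact: PD.
have : inf S <= J (fun x => psi x + t * u x).
  by apply: ge_inf; [case: hS|exists (fun x => psi x + t * u x)].
have E : J (fun x => psi x + t * u x) =
    J psi + (a u u * t ^+ 2 + 2 * (a psi u - l u) * t).
  rewrite /J aD // lD // lZ // aZ // (as_ psi) // (as_ u) // !aD // !aZ // (as_ u psi) //.
  by ring.
by rewrite E; lra.
Qed.

End ApproximateRiesz.

(** * Energy products, Poincare inequalities and the Carleman estimate *)

Section Energy.
Context {R : realType}.
Implicit Types (f g u v w : plane R -> R) (x y : plane R) (i : bool) (D : set (plane R)).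

Definition dom D := measurable (D : set (mplane R)) /\ exists a : R, D `<=` box 0 a.

(** For [c = 1] this is the real H^1 inner product on [D]; in general it is the form whose Euler
    equation is [lap u = c u]. *)
Definition en (c : R) D u v : R :=
  II D (fun x => pd false u x * pd false v x + pd true u x * pd true v x + c * (u x * v x)).

Lemma dom_integ D f : dom D -> continuous f -> integ D f.
Proof. by move=> [mD [a Da]] cf; exact: integ_cont Da cf. Qed.

Lemma smooth_density c u v : smooth u -> smooth v ->
  smooth (fun x => pd false u x * pd false v x + pd true u x * pd true v x + c * (u x * v x)).
Proof.
move=> su sv; apply: smoothD; last by apply: smoothZ; exact: smoothM.
by apply: smoothD; apply: smoothM; exact: smooth_pd.
Qed.

Lemma pdDs f g i : smooth f -> smooth g ->
  pd i (fun x => f x + g x) = (fun x => pd i f x + pd i g x).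
Proof. by move=> sf sg; apply: pdD => x; apply: smooth_der. Qed.

Lemma pdMs f g i : smooth f -> smooth g ->
  pd i (fun x => f x * g x) = (fun x => f x * pd i g x + g x * pd i f x).
Proof. by move=> sf sg; apply: pdM => x; apply: smooth_der. Qed.

Lemma pdZs (t : R) f i : smooth f -> pd i (fun x => t * f x) = (fun x => t * pd i f x).
Proof.
move=> sf; rewrite pdMs //; last exact: smooth_cst.
by apply/funext => x; rewrite pd_cst mulr0 addr0.
Qed.

Lemma pdNs f i : smooth f -> pd i (fun x => - f x) = (fun x => - pd i f x).
Proof.
move=> sf; rewrite (_ : (fun x => - f x) = fun x => -1 * f x).
  by rewrite pdZs //; apply/funext => x; rewrite mulN1r.
by apply/funext => x; rewrite mulN1r.
Qed.

Lemma pdBs f g i : smooth f -> smooth g ->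
  pd i (fun x => f x - g x) = (fun x => pd i f x - pd i g x).
Proof. by move=> sf sg; rewrite pdDs ?pdNs //; exact: smoothN. Qed.

Lemma en_form c D : dom D -> 0 <= c -> pform smooth (en c D).
Proof.
move=> dD c0; have iD f : smooth f -> integ D f by move=> sf; apply: dom_integ => //; exact: smooth_cont.
have mD := dD.1.
split.
- by move=> f g _ _; apply: II_eq => x _; ring.
- move=> f g h sf sg sh; rewrite /en -IID //; [|exact/iD/smooth_density|exact/iD/smooth_density].
  by apply: II_eq => x _; rewrite !pdDs //; ring.
- move=> t f g sf sg; rewrite /en -IIZ //; last exact/iD/smooth_density.
  by apply: II_eq => x _; rewrite !pdZs //; ring.
- move=> f sf; apply: II_ge0 => x _.
  by rewrite -!expr2 addr_ge0 // ?addr_ge0 ?sqr_ge0 // mulr_ge0 // sqr_ge0.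
Qed.

Lemma form_CS (P : (plane R -> R) -> Prop) a u v : psubspace P -> pform P a -> P u -> P v ->
  a u v ^+ 2 <= a u u * a v v.
Proof.
move=> [P0 PD PZ] [as_ aD aZ a0] Pu Pv; apply: quad_disc; first exact: a0.
move=> t; have Pt : P (fun x => t * u x) by exact: PZ.
have PU : P (fun x => t * u x + v x) by exact: PD.
have := a0 _ PU; rewrite aD // aZ // (as_ u) // (as_ v) // !aD // !aZ // (as_ v u) //; lra.
Qed.

Lemma smooth_sub : psubspace (@smooth R).
Proof. by split; [exact: smooth_cst|exact: smoothD|move=> t f; exact: smoothZ]. Qed.

Lemma test_subsp (O : set (plane R)) : psubspace (test_function O).
Proof. by split; [exact: test0|exact: testD|move=> t f; exact: testZ]. Qed.

Lemma cont_dist f (x : plane R) (e : R) : continuous f -> 0 < e -> exists2 d : R, 0 < d &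
  forall y, `|y.1 - x.1| < d -> `|y.2 - x.2| < d -> `|f y - f x| < e.
Proof.
move=> cf e0; have N : nbhs x (f @^-1` ball (f x) e) by apply: cf; exact: nbhsx_ballx.
have /nbhs_ballP[d /= d0 Hd] := N; exists d => // y y1 y2.
by rewrite distrC; apply: (Hd y); split; rewrite /ball /= distrC.
Qed.

(** The second difference of [f] over a small square is symmetric in the two axes, and two
    applications of the mean value theorem write its quotient by [h^2] as a value, near [x], of
    either mixed derivative. *)
Lemma schwarz f i j : smooth f -> pd i (pd j f) = pd j (pd i f).
Proof.
move=> sf; apply/funext => x.
have key k l (e : R) : 0 < e -> exists2 d : R, 0 < d & forall h : R, 0 < h -> h < d ->
   `|(f (x + h *: ax l + h *: ax k) - f (x + h *: ax l) - (f (x + h *: ax k) - f x)) / h ^+ 2 - pd k (pd l f) x| <= e.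
  move=> e0; have sg : smooth (fun y => f (y + 0)) by rewrite (_ : (fun y => _) = f) //; apply/funext => y; rewrite addr0.
  have [d d0 Hd] := cont_dist x (smooth_cont (smooth_pd k (smooth_pd l sf))) e0.
  exists (d / 2); [by rewrite divr_gt0|move=> h h0 hd].
  pose g := fun y => shiftf (h *: ax k) f y - f y.
  have sg' : smooth g by apply: smoothB => //; exact: smooth_shift.
  have [c /andP[c0 ch] E] := MVT_ax l x sg' (ltW h0).
  have [c' /andP[c'0 c'h] E'] := MVT_ax k (x + c *: ax l) (smooth_pd l sf) (ltW h0).
  have Eg : pd l g (x + c *: ax l) = pd k (pd l f) (x + c *: ax l + c' *: ax k) * h.
    by rewrite /g (pdBs _ (smooth_shift _ sf) sf) pd_shift -E'.
  have -> : f (x + h *: ax l + h *: ax k) - f (x + h *: ax l) - (f (x + h *: ax k) - f x) = g (x + h *: ax l) - g x by [].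
  rewrite E Eg (_ : _ * h * h / _ = pd k (pd l f) (x + c *: ax l + c' *: ax k)); last first.
    by field; rewrite gt_eqF.
  apply/ltW/Hd;
  rewrite !scale_ax; case: (k); case: (l);
    rewrite /= ltr_norml; apply/andP; clear -c0 ch c'0 c'h hd; split; lra.
apply/eqP; rewrite -subr_eq0 -normr_le0; apply/ler_addgt0Pl => e e0; rewrite addr0.
have e2 : 0 < e / 2 by rewrite divr_gt0.
have [d1 d10 H1] := key i j _ e2; have [d2 d20 H2] := key j i _ e2.
pose h := Num.min d1 d2 / 2.
have m0 : 0 < Num.min d1 d2 by rewrite lt_min d10.
have h0 : 0 < h by rewrite divr_gt0.
have hm : h < Num.min d1 d2 by rewrite ltr_pdivrMr // ltr_pMr // ltr1n.
have {}H1 := H1 h h0 (lt_le_trans hm _); have {}H2 := H2 h h0 (lt_le_trans hm _).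
have {H2} := H2 _; have {H1} := H1 _; rewrite !ge_min !lexx orbT /= => /(_ isT) H1 /(_ isT) H2; move: H2 H1.
rewrite (_ : f (x + h *: ax i + h *: ax j) - f (x + h *: ax i) - (f (x + h *: ax j) - f x) =
   f (x + h *: ax j + h *: ax i) - f (x + h *: ax j) - (f (x + h *: ax i) - f x)); last first.
  by rewrite [x + h *: ax j + _]addrAC; ring.
set q := (_ / _) => H2 H1; rewrite (_ : _ - _ = (q - pd j (pd i f) x) - (q - pd i (pd j f) x)); last by ring.
by apply: le_trans (ler_normB _ _) _; lra.
Qed.

Definition lap f : plane R -> R := fun x => pd false (pd false f) x + pd true (pd true f) x.

Lemma smooth_lap f : smooth f -> smooth (lap f).
Proof. by move=> sf; apply: smoothD; apply: smooth_pd; exact: smooth_pd. Qed.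

Lemma test_lap (O : set (plane R)) f : test_function O f -> test_function O (lap f).
Proof. by move=> tf; apply: testD; apply: test_pd; exact: test_pd. Qed.

Let mT : measurable (setT : set (mplane R)) := measurableT.

(** Since [x.1 - y.1] has derivative 1, integration by parts gives that the integral of [f^2] is
    that of [- 2 f (d_x f) (x.1 - y.1)], whose integrand is at most [f^2 / 2 + 2 r^2 (d_x f)^2] on
    the box; half of the left side is absorbed. *)
Lemma poincare y (r : R) f : test_function setT f -> (forall x, ~ box y r x -> f x = 0) ->
  II setT (fun x => f x ^+ 2) <= 4 * r ^+ 2 * II setT (fun x => pd false f x ^+ 2).
Proof.
move=> tf f0; have sf := tf.1.
have t2 : test_function setT (fun x => f x ^+ 2).
  by rewrite (_ : (fun x => _) = fun x => f x * f x); [exact: testM|apply/funext => x; rewrite expr2].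
have td2 : test_function setT (fun x => pd false f x ^+ 2).
  rewrite (_ : (fun x => _) = fun x => pd false f x * pd false f x); last by apply/funext => x; rewrite expr2.
  by apply: testM; [exact: test_pd|exact: smooth_pd].
have sg : smooth (fun x : plane R => x.1 - y.1) by apply: smoothB; [exact: smooth_fst|exact: smooth_cst].
have pg : pd false (fun x : plane R => x.1 - y.1) = fun=> 1.
  by rewrite pdBs ?(pd_pr false) ?pd_cst; [apply/funext => x; rewrite subr0|exact: smooth_fst|exact: smooth_cst].
have := II_parts false t2 sg; rewrite pg.
have -> : (fun x => f x ^+ 2 * 1) = (fun x => f x ^+ 2) by apply/funext => x; rewrite mulr1.
have -> : pd false (fun x => f x ^+ 2) = (fun x => 2 * (f x * pd false f x)).
  rewrite (_ : (fun x => f x ^+ 2) = fun x => f x * f x); last by apply/funext => x; rewrite expr2.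
  by rewrite pdMs //; apply/funext => x; ring.
move=> E.
have H : II setT (fun x => f x ^+ 2) <= 2^-1 * II setT (fun x => f x ^+ 2) + 2 * r ^+ 2 * II setT (fun x => pd false f x ^+ 2).
  have tm : test_function setT (fun x => 2 * (f x * pd false f x) * (x.1 - y.1)).
    by apply: testMr => //; apply: testZ; apply: testMr => //; exact: smooth_pd.
  have i1 := integ_test mT t2; have i2 := integ_test mT td2.
  have im := integ_test mT tm.
  rewrite -(IIZ _ mT i1) -(IIZ _ mT i2) -(IID mT (integZ _ mT i1) (integZ _ mT i2)).
  rewrite {1}E -mulN1r -(IIZ _ mT im).
  apply: (II_le mT (integZ _ mT im) (integD mT (integZ _ mT i1) (integZ _ mT i2))).
  move=> x _; have [bx|/f0 ->] := pselect (box y r x); last first.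
    rewrite mul0r mulr0 mul0r mulr0 expr0n /= mulr0 add0r.
    by rewrite mulr_ge0 ?sqr_ge0 // mulr_ge0 // sqr_ge0.
  have d2 : (x.1 - y.1) ^+ 2 <= r ^+ 2.
    have [h _] := bx; rewrite -(real_normK (num_real (x.1 - y.1))).
    by rewrite ler_pXn2r // nnegrE ?(le_trans _ h).
  have := sqr_ge0 (f x + 2 * (pd false f x * (x.1 - y.1))).
  have : pd false f x ^+ 2 * (x.1 - y.1) ^+ 2 <= pd false f x ^+ 2 * r ^+ 2.
    by rewrite ler_wpM2l ?sqr_ge0.
  lra.
by move: H; lra.
Qed.

(** With [w = w1 + i w2] this is the squared modulus of [(d_x + i d_y) w], twice the Cauchy-Riemann
    operator. Multiplying [w] by a holomorphic function multiplies it by the squared modulus of that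
    function, which is why weights [|z - y|^(-2n)] come for free. *)
Definition dsq w1 w2 : plane R -> R := fun x =>
  (pd false w1 x - pd true w2 x) ^+ 2 + (pd true w1 x + pd false w2 x) ^+ 2.

Lemma testX2 (O : set (plane R)) f : test_function O f -> test_function O (fun x => f x ^+ 2).
Proof.
move=> tf; rewrite (_ : (fun x => _) = fun x => f x * f x); first by apply: testM => //; exact: tf.1.
by apply/funext => x; rewrite expr2.
Qed.

(** Expanding the squares leaves both gradients and a cross term, the Jacobian of [(w1, w2)], whose
    integral vanishes by two integrations by parts. So the Cauchy-Riemann operator controls the full
    gradient, and [poincare] applies. *)
Lemma dbar_poincare y (r : R) w1 w2 : test_function setT w1 -> test_function setT w2 ->
  (forall x, ~ box y r x -> w1 x = 0) -> (forall x, ~ box y r x -> w2 x = 0) ->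
  II setT (fun x => w1 x ^+ 2 + w2 x ^+ 2) <= 4 * r ^+ 2 * II setT (dsq w1 w2).
Proof.
move=> t1 t2 z1 z2.
have P1 := poincare t1 z1; have P2 := poincare t2 z2.
have T i w : test_function setT w -> test_function setT (fun x => pd i w x ^+ 2).
  by move=> tw; apply: testX2; exact: test_pd.
have C i j : test_function setT (fun x => pd i w1 x * pd j w2 x).
  by apply: testMr; [exact: test_pd|apply: smooth_pd; exact: t2.1].
have Icross : II setT (fun x => pd false w1 x * pd true w2 x) = II setT (fun x => pd true w1 x * pd false w2 x).
  by rewrite (II_parts true (test_pd false t1) t2.1) (II_parts false (test_pd true t1) t2.1) (schwarz true false t1.1).
have E0 : II setT (fun x => w1 x ^+ 2 + w2 x ^+ 2) = II setT (fun x => w1 x ^+ 2) + II setT (fun x => w2 x ^+ 2).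
  exact: (IID mT (integ_test mT (testX2 t1)) (integ_test mT (testX2 t2))).
rewrite E0 {E0}.
apply: (le_trans (lerD P1 P2)); rewrite -mulrDr; apply: ler_wpM2l.
  by apply: mulr_ge0; [exact: ler0n|exact: sqr_ge0].
have i1 i := integ_test mT (T i _ t1); have i2 i := integ_test mT (T i _ t2).
have ic i j := integ_test mT (C i j).
have iA := integD mT (i1 false) (i2 false); have iB := integD mT (i1 true) (i2 true).
have iC := integB mT (ic true false) (ic false true).
pose F x := (pd false w1 x ^+ 2 + pd false w2 x ^+ 2) + (pd true w1 x ^+ 2 + pd true w2 x ^+ 2).
pose G x := pd true w1 x * pd false w2 x - pd false w1 x * pd true w2 x.
have E : dsq w1 w2 = fun x => F x + 2 * G x.
  by apply/funext => x; rewrite /dsq /F /G; ring.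
have E1 : II setT (dsq w1 w2) = II setT F + 2 * II setT G.
  by rewrite E (IID mT (integD mT iA iB) (integZ 2 mT iC)) (IIZ 2 mT iC).
have E2 : II setT G = 0.
  by apply: (eq_trans (IIB mT (ic true false) (ic false true))); rewrite Icross subrr.
have E3 : II setT F = (II setT (fun x => pd false w1 x ^+ 2) + II setT (fun x => pd false w2 x ^+ 2)) +
   II setT (fun x => pd true w1 x ^+ 2 + pd true w2 x ^+ 2).
  by apply: (eq_trans (IID mT iA iB)); congr (_ + _); exact: (IID mT (i1 false) (i2 false)).
rewrite E1 E2 E3 mulr0 addr0 lerDl.
by apply: II_ge0 => x _; rewrite addr_ge0 // sqr_ge0.
Qed.

(** The second clause keeps the support away from the pole of [1 / (z - y)], so that divisions by
    [z - y] stay among test functions. *)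
Definition vanish_off y (r d : R) f :=
  (forall x, ~ box y r x -> f x = 0) /\ (forall x, sqd y x < d ^+ 2 -> f x = 0).

Lemma pd_loc f g i (O : set (plane R)) x : open O -> O x -> (forall z, O z -> f z = g z) ->
  pd i f x = pd i g x.
Proof.
move=> oO Ox fg; rewrite !pdE; apply: near_eq_derive; near=> z; apply: fg.
by near: z; exact: open_nbhs_nbhs.
Unshelve. all: by end_near. Qed.

Lemma pd_sqd y i x : pd i (sqd y) x = 2 * (pr i x - pr i y).
Proof.
rewrite /sqd.
have s1 : smooth (fun x : plane R => x.1 - y.1) by apply: smoothB; [exact: smooth_fst|exact: smooth_cst].
have s2 : smooth (fun x : plane R => x.2 - y.2) by apply: smoothB; [exact: smooth_snd|exact: smooth_cst].
have E1 : (fun x : plane R => (x.1 - y.1) ^+ 2 + (x.2 - y.2) ^+ 2) =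
   fun x => (x.1 - y.1) * (x.1 - y.1) + (x.2 - y.2) * (x.2 - y.2) by apply/funext => z; rewrite !expr2.
rewrite E1 pdDs; [|exact: smoothM|exact: smoothM].
rewrite !pdMs // !pdBs; try exact: smooth_cst; try exact: smooth_fst; try exact: smooth_snd.
rewrite !(pd_pr false i) !(pd_pr true i) !pd_cst; case: i; rewrite /=; ring.
Qed.

(* A globally smooth function equal to [1 / |x - y|^2] off the ball of radius d. *)
Definition zweight y (d : R) x : R := (sqd y x + (1 - step (4 * sqd y x / d ^+ 2 - 1)))^-1.

Section Carleman.
Variables (y : plane R) (r d : R).
Hypothesis d0 : 0 < d.

Local Notation m := (zweight y d).

Let d20 : 0 < d ^+ 2. Proof. by rewrite exprn_gt0. Qed.

Lemma mden_gt0 x : 0 < sqd y x + (1 - step (4 * sqd y x / d ^+ 2 - 1)).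
Proof.
have [h|h] := ltP 0 (sqd y x); first by rewrite ltr_pwDl // subr_ge0 step_le1.
rewrite step_le0; first by rewrite subr0 ltr_wpDl // sqd_ge0.
have -> : sqd y x = 0 by apply/eqP; rewrite eq_le h sqd_ge0.
by rewrite mulr0 mul0r; lra.
Qed.

Lemma m_gt0 x : 0 < m x. Proof. by rewrite invr_gt0 mden_gt0. Qed.

Lemma m_out x : d ^+ 2 / 2 < sqd y x -> m x = (sqd y x)^-1.
Proof.
move=> h; rewrite /zweight step_ge1 ?subrr ?addr0 //.
by rewrite lerBrDr ler_pdivlMr //; lra.
Qed.

Lemma smooth_m : smooth m.
Proof.
apply: smoothV; last by move=> x; rewrite gt_eqF // mden_gt0.
apply: smoothD; first exact: smooth_sqd.
apply: smoothB; first exact: smooth_cst.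
apply: smooth_step; apply: smoothB; last exact: smooth_cst.
by apply: smoothM; [apply: smoothZ; exact: smooth_sqd|exact: smooth_cst].
Qed.

Lemma pd_m i x : d ^+ 2 / 2 < sqd y x ->
  pd i m x = - ((sqd y x)^-1 * (sqd y x)^-1) * (2 * (pr i x - pr i y)).
Proof.
move=> h; have q0 z : d ^+ 2 / 2 < sqd y z -> 0 < sqd y z by apply: lt_trans; rewrite divr_gt0.
have oO : open [set z | d ^+ 2 / 2 < sqd y z].
  rewrite (_ : [set z | _] = ~` [set z | sqd y z <= d ^+ 2 / 2]).
    by apply: closed_openC; exact: closed_sqd_le.
  by apply/seteqP; split=> z /=; [move=> h1; apply/negP; rewrite -ltNge|move=> /negP; rewrite -ltNge].
rewrite (pd_loc (g := fun z => (sqd y z)^-1) i oO h (fun z hz => m_out hz)) pdE deriveV.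
- by rewrite -[X in _ *: X](congr1 (@^~ x) (pdE i (sqd y))) pd_sqd /GRing.scale /= -exprVn expr2.
- by rewrite gt_eqF // q0.
- by apply: smooth_der; exact: smooth_sqd.
Qed.

Let A (x : plane R) : R := x.1 - y.1.
Let B (x : plane R) : R := x.2 - y.2.
Let sA : smooth A. Proof. by apply: smoothB; [exact: smooth_fst|exact: smooth_cst]. Qed.
Let sB : smooth B. Proof. by apply: smoothB; [exact: smooth_snd|exact: smooth_cst]. Qed.
Let pA i : pd i A = fun=> (~~ i)%:R.
Proof.
rewrite pdBs; [|exact: smooth_fst|exact: smooth_cst].
by rewrite (pd_pr false i) pd_cst; apply/funext => x; rewrite subr0; case: i.
Qed.
Let pB i : pd i B = fun=> i%:R.
Proof.
rewrite pdBs; [|exact: smooth_snd|exact: smooth_cst].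
by rewrite (pd_pr true i) pd_cst; apply/funext => x; rewrite subr0; case: i.
Qed.

(* Division of [w1 + i w2] by the holomorphic function [z - y]. *)
Lemma divide_by_z w1 w2 : test_function setT w1 -> test_function setT w2 ->
  vanish_off y r d w1 -> vanish_off y r d w2 ->
  exists v1 v2, [/\ test_function setT v1 /\ test_function setT v2,
    vanish_off y r d v1 /\ vanish_off y r d v2,
    forall x, v1 x ^+ 2 + v2 x ^+ 2 = m x * (w1 x ^+ 2 + w2 x ^+ 2) &
    forall x, dsq v1 v2 x = m x * dsq w1 w2 x].
Proof.
move=> t1 t2 [p1 n1] [p2 n2].
have sm := smooth_m; have [s1 s2] := (t1.1, t2.1).
pose a1 x := A x * w1 x + B x * w2 x; pose a2 x := A x * w2 x - B x * w1 x.
have sa1 : smooth a1 by apply: smoothD; exact: smoothM.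
have sa2 : smooth a2 by apply: smoothB; exact: smoothM.
exists (fun x => m x * a1 x), (fun x => m x * a2 x); split.
- split; apply: testM => //.
    by apply: testD; apply: testM.
  by apply: testB; apply: testM.
- split; split=> x hx; rewrite /a1 /a2 ?(p1 x hx) ?(p2 x hx) ?(n1 x hx) ?(n2 x hx);
    by rewrite ?mulr0 ?subr0 ?addr0 ?mulr0.
- move=> x; have [h|h] := ltP (sqd y x) (d ^+ 2).
    by rewrite /a1 /a2 (n1 x h) (n2 x h) !mulr0 subr0 !addr0 !mulr0 expr0n /= addr0 mulr0.
  have h2 : d ^+ 2 / 2 < sqd y x by apply: lt_le_trans h; rewrite ltr_pdivrMr // ltr_pMr // ltr1n.
  rewrite m_out // /a1 /a2 /A /B /sqd; field.
  by rewrite gt_eqF // -[_ + _]/(sqd y x) (lt_le_trans _ h).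
move=> x; have [h|h] := ltP (sqd y x) (d ^+ 2).
  have z i (w : plane R -> R) : (forall x, sqd y x < d ^+ 2 -> w x = 0) -> pd i w x = 0.
    move=> nw; rewrite (pd_loc (g := fun=> 0) i (open_sqd_lt (y:=y) (a:=d ^+ 2)) h nw).
    by rewrite pd_cst.
  have z1 i := z i _ n1; have z2 i := z i _ n2.
  have z3 i : pd i (fun x => m x * a1 x) x = 0.
    by apply: z => x' hx'; rewrite /a1 n1 // n2 // !mulr0 addr0 mulr0.
  have z4 i : pd i (fun x => m x * a2 x) x = 0.
    by apply: z => x' hx'; rewrite /a2 n1 // n2 // !mulr0 subr0 mulr0.
  by rewrite /dsq !z1 !z2 !z3 !z4 subr0 addr0 expr0n /= addr0 mulr0.
have h2 : d ^+ 2 / 2 < sqd y x by apply: lt_le_trans h; rewrite ltr_pdivrMr // ltr_pMr // ltr1n.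
have q0 : sqd y x != 0 by rewrite gt_eqF // (lt_le_trans _ h).
have sAw1 := smoothM sA s1; have sBw2 := smoothM sB s2; have sAw2 := smoothM sA s2; have sBw1 := smoothM sB s1.
rewrite /dsq !(pdMs _ sm sa1) !(pdMs _ sm sa2) /a1 /a2 !(pdDs _ sAw1 sBw2) !(pdBs _ sAw2 sBw1).
rewrite !(pdMs _ sA s1) !(pdMs _ sB s2) !(pdMs _ sA s2) !(pdMs _ sB s1) !pA !pB !pd_m // m_out //=.
rewrite /A /B; move: q0; rewrite /sqd.
set a := x.1 - y.1; set b := x.2 - y.2 => q0.
by field.
Qed.

Lemma divide_by_zn n w1 w2 : test_function setT w1 -> test_function setT w2 ->
  vanish_off y r d w1 -> vanish_off y r d w2 ->
  exists v1 v2, [/\ test_function setT v1 /\ test_function setT v2,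
    vanish_off y r d v1 /\ vanish_off y r d v2,
    forall x, v1 x ^+ 2 + v2 x ^+ 2 = m x ^+ n * (w1 x ^+ 2 + w2 x ^+ 2) &
    forall x, dsq v1 v2 x = m x ^+ n * dsq w1 w2 x].
Proof.
move=> t1 t2 o1 o2; elim: n => [|n [v1 [v2 [[tv1 tv2] [ov1 ov2] E1 E2]]]].
  by exists w1, w2; split=> // x; rewrite expr0 mul1r.
have [u1 [u2 [tu ou F1 F2]]] := divide_by_z tv1 tv2 ov1 ov2.
by exists u1, u2; split=> // x; rewrite ?F1 ?F2 ?E1 ?E2 mulrA -exprS.
Qed.

Lemma carleman_dbar n w1 w2 : test_function setT w1 -> test_function setT w2 ->
  vanish_off y r d w1 -> vanish_off y r d w2 ->
  II setT (fun x => m x ^+ n * (w1 x ^+ 2 + w2 x ^+ 2)) <=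
  4 * r ^+ 2 * II setT (fun x => m x ^+ n * dsq w1 w2 x).
Proof.
move=> t1 t2 o1 o2.
have [v1 [v2 [[tv1 tv2] [ov1 ov2] E1 E2]]] := divide_by_zn n t1 t2 o1 o2.
have := dbar_poincare tv1 tv2 ov1.1 ov2.1.
rewrite (_ : (fun x => v1 x ^+ 2 + v2 x ^+ 2) = fun x => m x ^+ n * (w1 x ^+ 2 + w2 x ^+ 2)); last exact/funext.
by rewrite (_ : dsq v1 v2 = fun x => m x ^+ n * dsq w1 w2 x) //; exact/funext.
Qed.

Lemma vanish_pd f i : vanish_off y r d f -> vanish_off y r d (pd i f).
Proof.
move=> [p n]; split=> x hx.
  apply: (@pd_supp _ (box y r)) => //; apply: compact_closed_plane; exact: compact_box.
by rewrite (pd_loc (g := fun=> 0) i (open_sqd_lt (y:=y) (a:=d ^+ 2)) hx n) pd_cst.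
Qed.

(* Divides [n] times by [z - y]; the constant does not depend on [n]. *)
Lemma carleman n u : test_function setT u -> vanish_off y r d u ->
  II setT (fun x => m x ^+ n * u x ^+ 2) <= 16 * r ^+ 4 * II setT (fun x => m x ^+ n * lap u x ^+ 2).
Proof.
move=> tu ou; have su := tu.1.
have v0 : vanish_off y r d (fun=> 0) by split.
(* The estimate is used twice: for [w = u], whose [dsq] is the squared gradient, then for
   [w = d_x u - i d_y u], whose [dsq] is the squared Laplacian. The two factors [4 r^2] multiply to
   [16 r^4]. *)
have H1 := carleman_dbar n tu (test0 _) ou v0.
have t2 : test_function setT (fun x => - pd true u x) by apply: testN; exact: test_pd.
have o2 : vanish_off y r d (fun x => - pd true u x).
  by have [a b] := vanish_pd true ou; split=> x hx; rewrite ?(a x hx) ?(b x hx) oppr0.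
have H2 := carleman_dbar n (test_pd false tu) t2 (vanish_pd false ou) o2.
have E1 : (fun x => m x ^+ n * (u x ^+ 2 + 0 ^+ 2)) = fun x => m x ^+ n * u x ^+ 2.
  by apply/funext => x; rewrite expr0n addr0.
have E2 : (fun x => m x ^+ n * dsq u (fun=> 0) x) = (fun x => m x ^+ n * (pd false u x ^+ 2 + (- pd true u x) ^+ 2)).
  by apply/funext => x; rewrite /dsq !pd_cst subr0 addr0 sqrrN.
have E3 : (fun x => m x ^+ n * dsq (pd false u) (fun x => - pd true u x) x) = fun x => m x ^+ n * lap u x ^+ 2.
  apply/funext => x; rewrite /dsq !(pdNs _ (smooth_pd true su)) (schwarz true false su) opprK subrr.
  by rewrite expr0n addr0.
rewrite E1 E2 in H1; rewrite E3 in H2.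
apply: (le_trans H1); apply: (le_trans (ler_wpM2l _ H2)).
  by rewrite mulr_ge0 // sqr_ge0.
by rewrite mulrA; apply: ler_wpM2r; [apply: II_ge0 => x _; rewrite mulr_ge0 ?sqr_ge0 // exprn_ge0 // ltW // m_gt0|lra].
Qed.

End Carleman.

Lemma test_of_supp f (K : set (plane R)) : smooth f -> compact K -> (forall x, ~ K x -> f x = 0) ->
  test_function setT f.
Proof. by move=> sf cK fK; split=> //; exists K; split. Qed.

Lemma sqd_box y x (r : R) : 0 <= r -> sqd y x <= r ^+ 2 -> box y r x.
Proof. exact: sqd_coord. Qed.

Theorem unique_continuation (c r : R) y (d : R) u : 0 <= c <= 1 -> 0 < d -> 0 < r -> r <= 4^-1 ->
  smooth u -> (forall x, sqd y x < r ^+ 2 -> lap u x = c * u x) ->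
  (forall x, sqd y x < d ^+ 2 -> u x = 0) ->
  forall x, sqd y x < (r / 2) ^+ 2 -> u x = 0.
Proof.
move=> /andP[c0 c1] d'0 r0 r4 su Hlap ud'.
(* Shrinking the disc of vanishing below [r2] ensures that [m] is exactly [|x - y|^(-2)] wherever
   the error [E] lives. *)
pose d0' := Num.min d (r / 2).
have d0 : 0 < d0' by rewrite lt_min d'0 divr_gt0.
have ud x : sqd y x < d0' ^+ 2 -> u x = 0.
  move=> h; apply: ud'; apply: lt_le_trans h _.
  by rewrite ler_pXn2r ?nnegrE ?(ltW d'0) ?(ltW d0) // ge_min lexx.
have dr : d0' <= r / 2 by rewrite ge_min lexx orbT.
clear d'0 ud'; move: d0' d0 ud dr => {}d d0 ud dr.
(* The order [r / 2 < r1 < r2 < r3 < r] is all that matters: [chi] descends between [r2] and [r3],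
   the final cutoff [kap] between [r / 2] and [r1]. *)
pose r2 := (3 * r) / 5; pose r3 := (4 * r) / 5; pose r1 := (11 * r) / 20.
pose chi := rcut y r2 r3.
have schi : smooth chi by exact: smooth_rcut.
have r20 : 0 <= r2 by rewrite /r2; lra.
have r23 : r2 < r3 by rewrite /r2 /r3; lra.
have sqlt (a b : R) : 0 <= a -> a <= b -> a ^+ 2 <= b ^+ 2.
  by move=> a0 ab; rewrite ler_pXn2r // nnegrE // (le_trans a0).
have tchi : test_function setT chi.
  by apply: (@test_rcut _ _ y _ _ (r3 + 1)) => //; rewrite ltrDl.
pose w x := chi x * u x.
have sw : smooth w by exact: smoothM.
have tw : test_function setT w by exact: testMr.
have w_off x : ~ box y r x -> w x = 0.
  move=> nb; rewrite /w /chi rcut0 ?mul0r //.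
  rewrite leNgt; apply/negP => h; apply: nb; apply: sqd_box; first exact: ltW.
  by apply: le_trans (ltW h) (sqlt _ _ _ _); rewrite /r3; lra.
have w_in x : sqd y x < d ^+ 2 -> w x = 0 by move=> h; rewrite /w ud ?mulr0.
have vw : vanish_off y r d w by split.
pose E x := lap w x - c * w x.
have tE : test_function setT E by apply: testB; [exact: test_lap|exact: testZ].
have E0 x : sqd y x < r2 ^+ 2 -> E x = 0.
  move=> h; rewrite /E.
  have wu z : sqd y z < r2 ^+ 2 -> w z = u z by move=> hz; rewrite /w /chi rcut1 ?mul1r // ltW.
  have pw i z : sqd y z < r2 ^+ 2 -> pd i w z = pd i u z.
    by move=> hz; apply: (pd_loc i (open_sqd_lt (y:=y) (a:=r2 ^+ 2)) hz wu).
  have ppw i : pd i (pd i w) x = pd i (pd i u) x.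
    by apply: (pd_loc i (open_sqd_lt (y:=y) (a:=r2 ^+ 2)) h) => z; exact: pw.
  have := Hlap x; rewrite /lap !ppw wu // => -> //; first by rewrite subrr.
  by apply: lt_le_trans h (sqlt _ _ _ _) => //; rewrite /r2; lra.
pose m := zweight y d.
have m0 x : 0 < m x by exact: m_gt0.
have sm : smooth m by exact: smooth_m.
have d20 : 0 < d ^+ 2 by rewrite exprn_gt0.
have mE x : d ^+ 2 <= sqd y x -> m x = (sqd y x)^-1.
  by move=> h; apply: (m_out d0); apply: lt_le_trans h; rewrite ltr_pdivrMr // ltr_pMr // ltr1n.
have tW n : test_function setT (fun x => m x ^+ n * w x ^+ 2) by apply: testM; [exact: testX2|exact: smoothX].
have tL n : test_function setT (fun x => m x ^+ n * lap w x ^+ 2).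
  by apply: testM; [apply: testX2; exact: test_lap|exact: smoothX].
have tEn n : test_function setT (fun x => m x ^+ n * E x ^+ 2) by apply: testM; [exact: testX2|exact: smoothX].
have tE2 : test_function setT (fun x => E x ^+ 2) by exact: testX2.
have iW n := integ_test mT (tW n); have iL n := integ_test mT (tL n).
have iE n := integ_test mT (tEn n); have iE2 := integ_test mT tE2.
have key n : II setT (fun x => m x ^+ n * w x ^+ 2) <= (r2 ^+ 2)^-1 ^+ n * II setT (fun x => E x ^+ 2).
  have H := carleman d0 n tw vw; rewrite -/m in H.
  have H2 : II setT (fun x => m x ^+ n * lap w x ^+ 2) <=
      2 * II setT (fun x => m x ^+ n * w x ^+ 2) + 2 * II setT (fun x => m x ^+ n * E x ^+ 2).
    rewrite -(IIZ 2 mT (iW n)) -(IIZ 2 mT (iE n)).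
    rewrite -(IID mT (integZ 2 mT (iW n)) (integZ 2 mT (iE n))).
    apply: (II_le mT (iL n) (integD mT (integZ 2 mT (iW n)) (integZ 2 mT (iE n)))) => x _.
    have mn : 0 <= m x ^+ n by rewrite exprn_ge0 // ltW.
    rewrite (_ : 2 * _ + 2 * _ = m x ^+ n * (2 * w x ^+ 2 + 2 * E x ^+ 2)); last by ring.
    apply: ler_wpM2l => //.
    have -> : lap w x = c * w x + E x by rewrite /E; ring.
    have h1 := sqr_ge0 (c * w x - E x).
    have h2 : (c * w x) ^+ 2 <= w x ^+ 2.
      by rewrite exprMn ler_piMl ?sqr_ge0 // exprn_ile1.
    have -> : (c * w x + E x) ^+ 2 = 2 * (c * w x) ^+ 2 + 2 * E x ^+ 2 - (c * w x - E x) ^+ 2 by ring.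
    move: (_ ^+ 2) h1 h2 => X; move: (_ ^+ 2) => Y; clear; lra.
  have H3 : II setT (fun x => m x ^+ n * E x ^+ 2) <= (r2 ^+ 2)^-1 ^+ n * II setT (fun x => E x ^+ 2).
    rewrite -(IIZ _ mT iE2); apply: (II_le mT (iE n) (integZ _ mT iE2)) => x _.
    have [h|h] := ltP (sqd y x) (r2 ^+ 2); first by rewrite E0 // expr0n !mulr0.
    apply: ler_wpM2r; first exact: sqr_ge0.
    have hd : d ^+ 2 <= sqd y x by apply: le_trans h; apply: sqlt; [exact: ltW|rewrite /r2; clear -r0 dr; lra].
    have r2p : 0 < r2 ^+ 2 by rewrite exprn_gt0 // /r2; clear -r0; lra.
    rewrite mE //; apply: lerXn2r; rewrite ?nnegrE ?invr_ge0 ?sqd_ge0 ?(ltW r2p) //.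
    by rewrite lef_pV2 ?posrE // (lt_le_trans r2p).
  (* The bound [r <= 1/4] enters here: with a Carleman constant at most 1/16 the weighted norm of
     [c w] is absorbed by the left side. *)
  have r4' : 16 * r ^+ 4 <= 16^-1.
    have : r ^+ 4 <= 4^-1 ^+ 4 by apply: lerXn2r; rewrite ?nnegrE ?(ltW r0).
    by rewrite !exprS expr0; clear; lra.
  have pW : 0 <= II setT (fun x => m x ^+ n * w x ^+ 2).
    by apply: II_ge0 => x _; rewrite mulr_ge0 ?sqr_ge0 // exprn_ge0 // ltW.
  have pL : 0 <= II setT (fun x => m x ^+ n * lap w x ^+ 2).
    by apply: II_ge0 => x _; rewrite mulr_ge0 ?sqr_ge0 // exprn_ge0 // ltW.
  have pE : 0 <= II setT (fun x => m x ^+ n * E x ^+ 2).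
    by apply: II_ge0 => x _; rewrite mulr_ge0 ?sqr_ge0 // exprn_ge0 // ltW.
  apply: le_trans H3.
  have := le_trans H (ler_wpM2r pL r4'); move: H2 pE pW; clear; lra.
pose kap := rcut y (r / 2) r1.
have skap : smooth kap by exact: smooth_rcut.
have kap0 x : 0 <= kap x by exact: rcut_ge0.
have tk : test_function setT (fun x => kap x * w x ^+ 2) by apply: testM => //; exact: testX2.
have ik := integ_test mT tk.
have r10 : 0 <= r1 by rewrite /r1; clear -r0; lra.
have key2 n : II setT (fun x => kap x * w x ^+ 2) <= ((r1 / r2) ^+ 2) ^+ n * II setT (fun x => E x ^+ 2).
  apply: (@le_trans _ _ ((r1 ^+ 2) ^+ n * II setT (fun x => m x ^+ n * w x ^+ 2))).
    rewrite -(IIZ _ mT (iW n)); apply: (II_le mT ik (integZ _ mT (iW n))) => x _.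
    have [h|h] := ltP (sqd y x) (d ^+ 2); first by rewrite w_in // expr0n !mulr0.
    have [h1|h1] := leP (r1 ^+ 2) (sqd y x).
      rewrite /kap rcut0 // ?mul0r; [|by clear -r0; lra|by rewrite /r1; clear -r0; lra].
      by rewrite mulr_ge0 ?exprn_ge0 ?sqr_ge0 // mulr_ge0 ?sqr_ge0 // exprn_ge0 // ltW.
    rewrite mulrA -exprMn; apply: ler_wpM2r; first exact: sqr_ge0.
    apply: le_trans (rcut_le1 _ _ _ _) _; apply: exprn_ege1.
    rewrite mE // ler_pdivlMr; last exact: lt_le_trans h.
    by rewrite mul1r ltW.
  apply: le_trans (ler_wpM2l _ (key n)) _; first by rewrite exprn_ge0 // sqr_ge0.
  have -> : ((r1 / r2) ^+ 2) ^+ n = (r1 ^+ 2) ^+ n * (r2 ^+ 2)^-1 ^+ n.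
    by rewrite -exprMn [in RHS]mulrC mulrC; congr (_ ^+ _); rewrite exprMn exprVn.
  by rewrite mulrA.
have k0 : II setT (fun x => kap x * w x ^+ 2) = 0.
  set I := II _ _ in key2 *; set J := II _ _ in key2.
  have I0 : 0 <= I by apply: II_ge0 => x _; rewrite mulr_ge0 ?sqr_ge0.
  have q1 : `|(r1 / r2) ^+ 2| < 1.
    have -> : r1 / r2 = 11 / 12 by rewrite /r1 /r2; field; rewrite gt_eqF.
    by rewrite ger0_norm ?sqr_ge0 // expr2; clear; lra.
  have cv : (fun n => ((r1 / r2) ^+ 2) ^+ n * J) @ \oo --> (0 : R).
    rewrite -[X in _ --> X](mul0r J); apply: cvgM; last exact: cvg_cst.
    exact: cvg_expr.
  apply/eqP; rewrite eq_le I0 andbT.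
  rewrite -(cvg_lim (@Rhausdorff R) cv); apply: limr_ge; first exact: cvgP cv.
  by near=> n; exact: key2.
move=> x hx.
have kw0 : kap x * w x ^+ 2 = 0.
  apply: (leb2_pos_eq0 (smooth_cont tk.1)) => // z; by rewrite mulr_ge0 ?sqr_ge0.
have := kw0; rewrite /kap rcut1 ?(ltW hx) //; [|by clear -r0; lra|by rewrite /r1; clear -r0; lra].
rewrite mul1r => /eqP; rewrite sqrf_eq0 /w /chi rcut1 ?mul1r; [by move/eqP|by []|by []|].
by apply: le_trans (ltW hx) (sqlt _ _ _ _); rewrite /r2; clear -r0; lra.
Unshelve. all: by end_near. Qed.

End Energy.

(** * Density in a disc *)

Section Bernstein.
Context {R : realType}.
Implicit Types (f g u v w : plane R -> R) (x y : plane R) (i : bool) (D : set (plane R)).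

Definition bern (n k : nat) : {poly R} := 'C(n, k)%:R *: ('X^k * (1 - 'X) ^+ (n - k)).

Lemma bernE n k (t : R) : (bern n k).[t] = t ^+ k * (1 - t) ^+ (n - k) * 'C(n, k)%:R.
Proof.
have E : (1 - 'X : {poly R}).[t] = 1 - t by rewrite !hornerE.
by rewrite /bern hornerZ hornerM hornerXn horner_exp E mulrC.
Qed.

Lemma bern_ge0 n k (t : R) : 0 <= t <= 1 -> 0 <= (bern n k).[t].
Proof.
by move=> /andP[t0 t1]; rewrite bernE mulr_ge0 // mulr_ge0 ?exprn_ge0 // subr_ge0.
Qed.

Lemma bern_sum n (t : R) : \sum_(k < n.+1) (bern n k).[t] = 1.
Proof.
transitivity ((1 - t + t) ^+ n); last by rewrite subrK expr1n.
by rewrite exprDn; apply: eq_bigr => k _; rewrite bernE mulr_natr [t ^+ _ * _]mulrC.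
Qed.

Lemma bernS0 n (t : R) : (bern n.+1 0).[t] = (1 - t) * (bern n 0).[t].
Proof. by rewrite !bernE !bin0 !expr0 !mulr1 !mul1r !subn0 exprS. Qed.

Lemma bernSS n k (t : R) : (bern n.+1 k.+1).[t] = (1 - t) * (bern n k.+1).[t] + t * (bern n k).[t].
Proof.
rewrite !bernE subSS binS.
have [kn|nk] := ltnP k n.
  rewrite -(subnSK kn) (exprS (1 - t) (n - k.+1)) (exprS t k) natrD.
  move: (t ^+ k) ((1 - t) ^+ (n - k.+1)) ('C(n, k.+1)%:R) ('C(n, k)%:R) => X Y c1 c2; ring.
have [->|kn] := eqVneq k n.
  by rewrite subnn bin_small // binn !mulr0 !add0r !expr0 !mulr1 exprS.
have nk' : (n < k)%N by rewrite ltn_neqAle eq_sym kn.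
by rewrite !bin_small ?mulr0 ?addr0 // ltnW.
Qed.

(** Pascal's rule in summed form: raising the degree averages the coefficients [a k] and [a k.+1].
    The first two moments follow from it by induction. *)
Lemma bern_rec n (a : nat -> R) (t : R) :
  \sum_(k < n.+2) a k * (bern n.+1 k).[t] =
  (1 - t) * (\sum_(k < n.+1) a k * (bern n k).[t]) + t * \sum_(k < n.+1) a k.+1 * (bern n k).[t].
Proof.
rewrite big_ord_recl /= bernS0.
under eq_bigr do rewrite /bump /= add1n bernSS mulrDr.
rewrite big_split /= addrA; congr (_ + _); last first.
  by rewrite mulr_sumr; apply: eq_bigr => k _; ring.
rewrite mulr_sumr [in RHS]big_ord_recl /= big_ord_recr /= [X in _ + (_ + X)](_ : _ = 0); last first.
  by rewrite bernE bin_small // !mulr0.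
by rewrite addr0; congr (_ + _); [ring|apply: eq_bigr => k _; rewrite /bump /= add1n; ring].
Qed.

Lemma bern_mean n (t : R) : \sum_(k < n.+1) k%:R * (bern n k).[t] = n%:R * t.
Proof.
elim: n => [|n IH]; first by rewrite big_ord1 !mul0r.
rewrite (bern_rec n (fun k => k%:R)).
under [X in _ + t * X]eq_bigr do rewrite -natr1 mulrDl mul1r.
by rewrite big_split /= bern_sum IH -natr1; ring.
Qed.

Lemma bern_sq n (t : R) : \sum_(k < n.+1) k%:R ^+ 2 * (bern n k).[t] = n%:R * t * (1 - t) + (n%:R * t) ^+ 2.
Proof.
elim: n => [|n IH]; first by rewrite big_ord1 expr0n /= !mul0r expr0n /= addr0.
rewrite (bern_rec n (fun k => k%:R ^+ 2)).
have -> : \sum_(k < n.+1) k.+1%:R ^+ 2 * (bern n k).[t] =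
  \sum_(k < n.+1) k%:R ^+ 2 * (bern n k).[t] + 2 * (\sum_(k < n.+1) k%:R * (bern n k).[t]) + 1.
  rewrite -[X in _ + X](bern_sum n t) mulr_sumr -!big_split /=; apply: eq_bigr => k _.
  by rewrite -natr1; ring.
by rewrite IH bern_mean -natr1; ring.
Qed.

Lemma bern_var n (t : R) : 0 <= t <= 1 ->
  \sum_(k < n.+2) (k%:R / n.+1%:R - t) ^+ 2 * (bern n.+1 k).[t] <= n.+1%:R^-1.
Proof.
move=> /andP[t0 t1]; set N : R := n.+1%:R.
have N0 : 0 < N by rewrite ltr0n.
have -> : \sum_(k < n.+2) (k%:R / N - t) ^+ 2 * (bern n.+1 k).[t] =
   N^-1 ^+ 2 * (\sum_(k < n.+2) k%:R ^+ 2 * (bern n.+1 k).[t])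
   - 2 * t * N^-1 * (\sum_(k < n.+2) k%:R * (bern n.+1 k).[t])
   + t ^+ 2 * \sum_(k < n.+2) (bern n.+1 k).[t].
  rewrite !mulr_sumr -sumrN -!big_split /=; apply: eq_bigr => k _; by ring.
rewrite bern_sq bern_mean bern_sum -/N.
have -> : N^-1 ^+ 2 * (N * t * (1 - t) + (N * t) ^+ 2) - 2 * t * N^-1 * (N * t) + t ^+ 2 * 1 =
   N^-1 * (t * (1 - t)) by field; rewrite gt_eqF.
rewrite ger_pMr ?invr_gt0 //; nra.
Qed.

(** From [|s| <= e + s^2 / e] and the variance bound. Keeping [e] free avoids square roots. *)
Lemma bern_dev n (t e : R) : 0 <= t <= 1 -> 0 < e ->
  \sum_(k < n.+2) `|k%:R / n.+1%:R - t| * (bern n.+1 k).[t] <= e + (e * n.+1%:R)^-1.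
Proof.
move=> t01 e0.
apply: (@le_trans _ _ (\sum_(k < n.+2) (e * (bern n.+1 k).[t] +
   e^-1 * ((k%:R / n.+1%:R - t) ^+ 2 * (bern n.+1 k).[t])))).
  apply: ler_sum => k _; rewrite mulrA -mulrDl; apply: ler_wpM2r; first exact: bern_ge0.
  rewrite -(real_normK (num_real (_ - t))); set a := `|_|.
  rewrite -subr_ge0 (_ : _ - _ = (e ^+ 2 + a ^+ 2 - a * e) / e); last by field; rewrite gt_eqF.
  rewrite divr_ge0 ?(ltW e0) //.
  have := sqr_ge0 (a - e); have : 0 <= a by exact: normr_ge0. move: e0. nra.
rewrite big_split /= -!mulr_sumr bern_sum mulr1 lerD2l invfM; apply: ler_wpM2l.
  by rewrite invr_ge0 ltW.
exact: bern_var.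
Qed.

Lemma deriv_bern0 n (t : R) : (bern n.+1 0)^`().[t] = - (n.+1%:R * (bern n 0).[t]).
Proof.
rewrite /bern derivZ expr0 mul1r deriv_exp derivB derivX -[1 : {poly R}]/(1%:P) derivC sub0r.
rewrite !bin0 !subn0 !hornerE /= hornerMn !hornerE /=.
rewrite -[_ *+ n.+1]mulr_natr; move: ((1 - t) ^+ n) => X; ring.
Qed.

Lemma deriv_bernS n k (t : R) :
  (bern n.+1 k.+1)^`().[t] = n.+1%:R * ((bern n k).[t] - (bern n k.+1).[t]).
Proof.
have -> : (bern n.+1 k.+1)^`().[t] = t ^+ k * (1 - t) ^+ (n - k) * ('C(n.+1, k.+1)%:R * k.+1%:R) -
     t ^+ k.+1 * (1 - t) ^+ (n - k).-1 * ('C(n.+1, k.+1)%:R * (n - k)%:R).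
  rewrite /bern derivZ derivM derivXn deriv_exp derivB derivX -[1 : {poly R}]/(1%:P) derivC sub0r subSS.
  rewrite hornerZ hornerD hornerM hornerM hornerMn hornerMn !hornerE /=.
  rewrite -[_ *+ k.+1]mulr_natr -[_ *+ (n - k)]mulr_natr.
  move: (t ^+ k) ((1 - t) ^+ (n - k)) ((1 - t) ^+ (n - k).-1) (t ^+ k.+1) => X Y Z W; ring.
have E1 : ('C(n.+1, k.+1)%:R * k.+1%:R : R) = n.+1%:R * 'C(n, k)%:R by rewrite -!natrM mulnC mul_bin_diag.
have E2 : ('C(n.+1, k.+1)%:R * (n - k)%:R : R) = n.+1%:R * 'C(n, k.+1)%:R.
  by rewrite -!natrM mulnC -(subSS k n) mul_bin_down.
rewrite E1 E2 !bernE -subnS.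
move: (t ^+ k) ((1 - t) ^+ (n - k)) ((1 - t) ^+ (n - k.+1)) (t ^+ k.+1) => X Y Z W; ring.
Qed.

(** Summation by parts: differentiation lowers the degree by one and replaces the coefficients by
    forward differences. Bernstein approximation is therefore also approximation of first
    derivatives. *)
Lemma deriv_bern n (a : nat -> R) (t : R) :
  \sum_(k < n.+2) a k * (bern n.+1 k)^`().[t] =
  n.+1%:R * \sum_(k < n.+1) (a k.+1 - a k) * (bern n k).[t].
Proof.
rewrite mulr_sumr big_ord_recl /= deriv_bern0.
under eq_bigr do rewrite /bump /= add1n deriv_bernS.
have -> : \sum_(j < n.+1) a j.+1 * (n.+1%:R * ((bern n j).[t] - (bern n j.+1).[t])) =
   \sum_(j < n.+1) n.+1%:R * (a j.+1 * (bern n j).[t]) - \sum_(j < n.+1) n.+1%:R * (a j.+1 * (bern n j.+1).[t]).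
  by rewrite -sumrB; apply: eq_bigr => j _; ring.
rewrite [X in _ - X]big_ord_recr /= [X in _ - (_ + X)](_ : _ = 0); last first.
  by rewrite bernE bin_small // !mulr0.
under [RHS]eq_bigr do rewrite mulrBl mulrBr.
rewrite sumrB [X in _ = _ - X]big_ord_recl /=.
under [X in _ = _ - (_ + X)]eq_bigr do rewrite /bump /= add1n.
ring.
Qed.

(** Says that [A] contains all polynomials in the two coordinates, in a form that can be checked
    directly for functions known only on a circle. *)
Definition polyclosed (A : (plane R -> R) -> Prop) :=
  [/\ A (fun=> 1), forall f g, A f -> A g -> A (fun x => f x + g x),
      forall t f, A f -> A (fun x => t * f x),
      forall f, A f -> A (fun x => x.1 * f x) &
      forall f, A f -> A (fun x => x.2 * f x)].

Lemma polyclosed_horner A (i : bool) (a b : R) (p : {poly R}) f : polyclosed A -> A f ->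
  A (fun x => p.[a * pr i x + b] * f x).
Proof.
move=> [A1 AD AZ Ax Ay] Af.
have A0 : A (fun=> 0).
  by have := AZ 0 _ A1; congr A; apply/funext => x; rewrite mul0r.
elim/poly_ind: p => [|p c IH].
  by move: A0; congr A; apply/funext => x; rewrite horner0 mul0r.
pose g x := p.[a * pr i x + b] * f x.
have Ai : A (fun x => pr i x * g x) by move: (IH : A g); clearbody g; case: (i) => H; [exact: Ay H|exact: Ax H].
have := AD _ _ (AD _ _ (AZ a _ Ai) (AZ b _ IH)) (AZ c _ Af).
by congr A; apply/funext => x; rewrite hornerD hornerM hornerX hornerC /g; move: (p.[_]) => P; ring.
Qed.

Lemma polyclosed_sum A (I : Type) (s : seq I) (F : I -> plane R -> R) : polyclosed A ->
  (forall j, A (F j)) -> A (fun x => \sum_(j <- s) F j x).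
Proof.
move=> [A1 AD AZ _ _] AF; elim: s => [|j s IH].
  by have := AZ 0 _ A1; congr A; apply/funext => x; rewrite big_nil mul0r.
by have := AD _ _ (AF j) IH; congr A; apply/funext => x; rewrite big_cons.
Qed.

Lemma pd_bound_lip f (M : R) : smooth f -> (forall i x, `|pd i f x| <= M) ->
  forall p q : plane R, `|f p - f q| <= M * (`|p.1 - q.1| + `|p.2 - q.2|).
Proof.
move=> sf HM p q.
have L i x (h : R) : `|f (x + h *: ax i) - f x| <= M * `|h|.
  have [h0|h0] := leP 0 h.
    have [c _ ->] := MVT_ax i x sf h0.
    by rewrite normrM; apply: ler_wpM2r.
  have h1 : 0 <= - h by rewrite oppr_ge0 ltW.
  have [c _] := MVT_ax i (x + h *: ax i) sf h1.
  rewrite -addrA -scalerDl subrr scale0r addr0 => E.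
  by rewrite distrC E normrM normrN; apply: ler_wpM2r.
have H1 := L false q (p.1 - q.1).
have H2 := L true (q + (p.1 - q.1) *: ax false) (p.2 - q.2).
have E : q + (p.1 - q.1) *: ax false + (p.2 - q.2) *: ax true = p.
  by rewrite !scale_ax; case: (p) (q) => p1 p2 [q1 q2]; congr pair => /=; ring.
rewrite E in H2.
rewrite (_ : f p - f q = (f p - f (q + (p.1 - q.1) *: ax false)) + (f (q + (p.1 - q.1) *: ax false) - f q)); last by ring.
by apply: le_trans (ler_normD _ _) _; rewrite mulrDr addrC lerD.
Qed.

Lemma test_pd_bound (O : set (plane R)) f : test_function O f ->
  exists2 M : R, 0 < M & [/\ forall x, `|f x| <= M, forall i x, `|pd i f x| <= M &
    forall i j x, `|pd i (pd j f) x| <= M].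
Proof.
move=> tf; have [M0 M00 H0] := test_bounded tf.
have [M1 M10 H1] := test_bounded (test_pd false tf); have [M2 M20 H2] := test_bounded (test_pd true tf).
have B i j : exists2 M : R, 0 < M & forall x, `|pd i (pd j f) x| <= M.
  by apply: test_bounded; apply: test_pd; exact: (test_pd j tf).
have [M3 M30 H3] := B false false; have [M4 M40 H4] := B false true.
have [M5 M50 H5] := B true false; have [M6 M60 H6] := B true true.
exists (M0 + M1 + M2 + M3 + M4 + M5 + M6); first by rewrite !addr_gt0.
split=> [x|i x|i j x].
- by apply: le_trans (H0 x) _; lra.
- by case: i; [apply: le_trans (H2 x) _|apply: le_trans (H1 x) _]; lra.
- by case: i j => [] []; [apply: le_trans (H6 x) _|apply: le_trans (H5 x) _|apply: le_trans (H4 x) _|apply: le_trans (H3 x) _]; lra.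
Qed.

Lemma smooth_horner (p : {poly R}) (i : bool) (a b : R) : smooth (fun x => p.[a * pr i x + b]).
Proof.
apply: (@smooth_comp _ (horner p) (fun x => a * pr i x + b)).
  exists (fun n => horner p^`(n)); split; first by rewrite derivn0.
  by move=> n t; rewrite derivnS; exact: is_derive_poly.
by apply: smoothD; [apply: smoothZ; exact: smooth_pr|exact: smooth_cst].
Qed.

Lemma pd_horner (p : {poly R}) (i j : bool) (a b : R) :
  pd j (fun x => p.[a * pr i x + b]) = fun x => (i == j)%:R * a * p^`().[a * pr i x + b].
Proof.
have sl : smooth (fun x => a * pr i x + b).
  by apply: smoothD; [apply: smoothZ; exact: smooth_pr|exact: smooth_cst].
apply/funext => x; rewrite [LHS](congr1 (@^~ x) (pdE _ _)).
have := @is_derive_comp _ (horner p) _ (fun x => a * pr i x + b) x (ax j) _ (is_derive_poly _ _).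
move=> /(_ (smooth_der sl)) D; rewrite (@derive_val _ _ _ _ _ _ _ D).
rewrite -[X in _ * X](congr1 (@^~ x) (pdE j _)) pdDs; [|apply: smoothZ; exact: smooth_pr|exact: smooth_cst].
rewrite pdZs; last exact: smooth_pr.
by rewrite (pd_pr i j) pd_cst; ring.
Qed.

Lemma pd_sum (I : Type) (s : seq I) (F : I -> plane R -> R) i x : (forall j, smooth (F j)) ->
  pd i (fun x => \sum_(j <- s) F j x) x = \sum_(j <- s) pd i (F j) x.
Proof.
move=> sF; elim: s => [|j s IH].
  rewrite big_nil (_ : (fun x => _) = fun=> 0) ?pd_cst //.
  by apply/funext => z; rewrite big_nil.
rewrite big_cons -IH (_ : (fun x => \sum_(j <- _) _) = fun x => F j x + \sum_(j <- s) F j x).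
  by rewrite pdDs //; exact: smooth_sum.
by apply/funext => z; rewrite big_cons.
Qed.

(** * Bernstein approximation in C^1 on a square *)

Section C1Approx.
Variables (y : plane R) (rho : R) (f : plane R -> R).
Hypothesis rho0 : 0 < rho.
Hypothesis tf : test_function setT f.

(** [sg i] maps the side of the square about [y] affinely onto [0, 1], and [node i n k] is the point
    sent to [k / n]. *)
Let a : R := (2 * rho)^-1.
Let b (i : bool) : R := (rho - pr i y) / (2 * rho).
Let sg (i : bool) x : R := a * pr i x + b i.
Let node (i : bool) (n k : nat) : R := pr i y - rho + 2 * rho * (k%:R / n%:R).
Let nodes n k l : plane R := (node false n k, node true n l).

Definition bernstein n x : R :=
  \sum_(k < n.+2) \sum_(l < n.+2)
     f (nodes n.+1 k l) * ((bern n.+1 k).[a * pr false x + b false] * (bern n.+1 l).[a * pr true x + b true]).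

Let sg01 i x : box y rho x -> 0 <= sg i x <= 1.
Proof.
move=> [h1 h2]; have h : `|pr i x - pr i y| <= rho by case: (i).
move: h; rewrite ler_norml => /andP[l1 l2].
have -> : sg i x = (pr i x - pr i y + rho) / (2 * rho) by rewrite /sg /a /b; field; rewrite gt_eqF.
have r2 : 0 < 2 * rho by rewrite mulr_gt0.
by apply/andP; split; [apply: divr_ge0; lra|rewrite ler_pdivrMr //; lra].
Qed.

Let node_sg i x n k : node i n.+1 k - pr i x = 2 * rho * (k%:R / n.+1%:R - sg i x).
Proof.
rewrite /node /sg /a /b; have : (n.+1%:R : R) != 0 by rewrite pnatr_eq0.
by move: (n.+1%:R) => N N0; field; rewrite N0 gt_eqF.
Qed.

Lemma bernstein_poly A n : polyclosed A -> A (bernstein n).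
Proof.
move=> pA; apply: polyclosed_sum => // k; apply: polyclosed_sum => // l.
have [A1 _ AZ _ _] := pA.
have := AZ (f (nodes n.+1 k l)) _ (polyclosed_horner false a (b false) (bern n.+1 k) pA
   (polyclosed_horner true a (b true) (bern n.+1 l) pA A1)).
by congr A; apply/funext => x; rewrite mulr1.
Qed.

(** The Bernstein weights form a partition of unity, so the error is an average of [c k l - g x].
    The coefficients only have to be near the values at the nodes, which admits the intermediate
    points of the mean value theorem, and the degrees [n] and [m] may differ, since differentiation
    lowers only one of them. In [5 * e], each deviation costs [2 * e] and the displacement [e]. *)
Lemma bern2_close (g : plane R -> R) (M e : R) (n m : nat) (c : nat -> nat -> R) x :
  0 <= M -> 0 < e -> (forall p q, `|g p - g q| <= M * (`|p.1 - q.1| + `|p.2 - q.2|)) ->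
  (forall k l, (k < n.+2)%N -> (l < m.+2)%N -> `|c k l - g x| <= M * (2 * rho) * (`|k%:R / n.+1%:R - sg false x| + `|l%:R / m.+1%:R - sg true x| + e)) ->
  e^-1 <= e * n.+1%:R -> e^-1 <= e * m.+1%:R ->
  box y rho x ->
  `|\sum_(k < n.+2) \sum_(l < m.+2) c k l * ((bern n.+1 k).[sg false x] * (bern m.+1 l).[sg true x]) - g x|
    <= M * (2 * rho) * (5 * e).
Proof.
move=> M0 e0 Hg Hc en em bx.
have s0 := sg01 false bx; have s1 := sg01 true bx.
pose B k := (bern n.+1 k).[sg false x]; pose B' l := (bern m.+1 l).[sg true x].
have B0 k : 0 <= B k by exact: bern_ge0.
have B'0 l : 0 <= B' l by exact: bern_ge0.
have S : \sum_(k < n.+2) B k = 1 by exact: bern_sum.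
have S' : \sum_(l < m.+2) B' l = 1 by exact: bern_sum.
have -> : \sum_(k < n.+2) \sum_(l < m.+2) c k l * (B k * B' l) - g x =
   \sum_(k < n.+2) \sum_(l < m.+2) (c k l - g x) * (B k * B' l).
  have -> : g x = \sum_(k < n.+2) \sum_(l < m.+2) g x * (B k * B' l).
    under eq_bigr do rewrite -mulr_sumr -mulr_sumr S' mulr1.
    by rewrite -mulr_sumr S mulr1.
  rewrite -sumrB; apply: eq_bigr => k _; rewrite -sumrB; apply: eq_bigr => l _.
  by rewrite -mulrBl; congr ((_ - _) * _); under eq_bigr do rewrite -mulr_sumr -mulr_sumr S' mulr1;
     rewrite -mulr_sumr S mulr1.
apply: le_trans (ler_norm_sum _ _ _) _.
pose P k := `|k%:R / n.+1%:R - sg false x|; pose P' l := `|l%:R / m.+1%:R - sg true x|.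
apply: (@le_trans _ _ (\sum_(k < n.+2) \sum_(l < m.+2) M * (2 * rho) * ((P k * B k) * B' l + B k * (P' l * B' l) + e * (B k * B' l)))).
  apply: ler_sum => k _; apply: le_trans (ler_norm_sum _ _ _) _; apply: ler_sum => l _.
  have bb : 0 <= B k * B' l by rewrite mulr_ge0.
  rewrite normrM (ger0_norm bb).
  apply: le_trans (ler_wpM2r bb (Hc k l (ltn_ord k) (ltn_ord l))) _.
  by rewrite le_eqVlt; apply/orP; left; apply/eqP; rewrite -/(P k) -/(P' l); ring.
under eq_bigr do rewrite -mulr_sumr.
rewrite -mulr_sumr; apply: ler_wpM2l; first by rewrite mulr_ge0 // mulr_ge0 // ltW.
have -> : \sum_(k < n.+2) \sum_(l < m.+2) (P k * B k * B' l + B k * (P' l * B' l) + e * (B k * B' l)) =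
   \sum_(k < n.+2) P k * B k + \sum_(l < m.+2) P' l * B' l + e.
  under eq_bigr do rewrite !big_split /= -!mulr_sumr S' !mulr1.
  by rewrite !big_split /= -!mulr_suml S mul1r -mulr_sumr S mulr1.
have D1 : \sum_(k < n.+2) P k * B k <= e + (e * n.+1%:R)^-1 by exact: bern_dev.
have D2 : \sum_(l < m.+2) P' l * B' l <= e + (e * m.+1%:R)^-1 by exact: bern_dev.
have F (N : nat) : e^-1 <= e * N.+1%:R -> (e * N.+1%:R)^-1 <= e.
  move=> h; rewrite -[leRHS]invrK lef_pV2 ?posrE ?invr_gt0 // mulr_gt0 // ltr0n.
move: (F _ en) (F _ em) D1 D2; move: ((e * _)^-1) ((e * m.+1%:R)^-1) (\sum_(k < _) _) (\sum_(l < _) _) => u1 u2 u3 u4.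
lra.
Qed.

Lemma smooth_bernstein n : smooth (bernstein n).
Proof.
apply: smooth_sum => k; apply: smooth_sum => l; apply: smoothZ.
by apply: smoothM; exact: smooth_horner.
Qed.

Let N_a n : n.+1%:R * (a * (2 * rho / n.+1%:R)) = 1.
Proof.
have n0 : (n.+1%:R : R) != 0 by rewrite pnatr_eq0.
by rewrite /a; move: (n.+1%:R) n0 => N N0; field; rewrite N0 gt_eqF.
Qed.

Let nodeS i n k : node i n.+1 k.+1 = node i n.+1 k + 2 * rho / n.+1%:R.
Proof.
rewrite /node -natr1; have : (n.+1%:R : R) != 0 by rewrite pnatr_eq0.
by move: (n.+1%:R) => N N0; field.
Qed.

Let pd_term n (j : bool) k l x :
  pd j (fun x => f (nodes n k l) * ((bern n k).[a * pr false x + b false] * (bern n l).[a * pr true x + b true])) x =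
  f (nodes n k l) * (a * (if j then (bern n k).[sg false x] * (bern n l)^`().[sg true x]
    else (bern n k)^`().[sg false x] * (bern n l).[sg true x])).
Proof.
have s1 := smooth_horner (bern n k) false a (b false).
have s2 := smooth_horner (bern n l) true a (b true).
rewrite pdZs; last exact: smoothM.
rewrite pdMs // !pd_horner -!/(sg _ _).
by case: j => /=; rewrite ?mulr0 ?mul0r ?mul1r ?mulr1 ?addr0 ?add0r; congr (_ * _); ring.
Qed.

Let pd_bern n (j : bool) x : pd j (bernstein n) x = \sum_(k < n.+2) \sum_(l < n.+2)
  f (nodes n.+1 k l) * (a * (if j then (bern n.+1 k).[sg false x] * (bern n.+1 l)^`().[sg true x]
    else (bern n.+1 k)^`().[sg false x] * (bern n.+1 l).[sg true x])).
Proof.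
have sm k l : smooth (fun x => f (nodes n.+1 k l) *
    ((bern n.+1 k).[a * pr false x + b false] * (bern n.+1 l).[a * pr true x + b true])).
  by apply: smoothZ; apply: smoothM; exact: smooth_horner.
rewrite /bernstein pd_sum => [|k]; last by apply: smooth_sum => l; exact: sm.
apply: eq_bigr => k _; rewrite pd_sum => [|l]; last exact: sm.
by apply: eq_bigr => l _; exact: pd_term.
Qed.

Let incr_node n (j : bool) k l : exists2 c, 0 <= c <= 2 * rho / n.+1%:R &
  f (nodes n.+1 (if j then k else k.+1) (if j then l.+1 else l)) - f (nodes n.+1 k l) =
  pd j f (nodes n.+1 k l + c *: ax j) * (2 * rho / n.+1%:R).
Proof.
have h0 : 0 <= 2 * rho / n.+1%:R by rewrite divr_ge0 // mulr_ge0 // ltW.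
have [sf _] := tf; have [c Hc E] := MVT_ax j (nodes n.+1 k l) sf h0.
exists c => //; rewrite -E; congr (f _ - _); rewrite scale_ax /nodes.
by case: (j); rewrite nodeS; congr pair => /=; rewrite addr0.
Qed.

Let incr_nodes n (j : bool) : exists xi : nat -> nat -> R, forall k l,
  0 <= xi k l <= 2 * rho / n.+1%:R /\
  n.+1%:R * a * (f (nodes n.+1 (if j then k else k.+1) (if j then l.+1 else l)) - f (nodes n.+1 k l)) =
  pd j f (nodes n.+1 k l + xi k l *: ax j).
Proof.
have /choice[xi Hxi] : forall kl : nat * nat, exists c, 0 <= c <= 2 * rho / n.+1%:R /\
    f (nodes n.+1 (if j then kl.1 else kl.1.+1) (if j then kl.2.+1 else kl.2)) - f (nodes n.+1 kl.1 kl.2) =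
    pd j f (nodes n.+1 kl.1 kl.2 + c *: ax j) * (2 * rho / n.+1%:R).
  by move=> kl; have [c h E] := incr_node n j kl.1 kl.2; exists c.
exists (fun k l => xi (k, l)) => k l; have /= [h ->] := Hxi (k, l); split => //.
transitivity (pd j f (nodes n.+1 k l + xi (k, l) *: ax j) * (n.+1%:R * (a * (2 * rho / n.+1%:R)))); last by rewrite N_a mulr1.
move: (pd _ _ _) (a) (2 * rho / n.+1%:R) => P A B; ring.
Qed.

Let pd_bern_false n x : exists xi : nat -> nat -> R,
  (forall k l, 0 <= xi k l <= 2 * rho / n.+2%:R) /\
  pd false (bernstein n.+1) x =
  \sum_(k < n.+2) \sum_(l < n.+3) pd false f (nodes n.+2 k l + xi k l *: ax false) *
      ((bern n.+1 k).[sg false x] * (bern n.+2 l).[sg true x]).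
Proof.
have [xi H] := incr_nodes n.+1 false; exists xi; split=> [k l|]; first by have [] := H k l.
rewrite pd_bern exchange_big [RHS]exchange_big /=; apply: eq_bigr => l _.
transitivity (a * (bern n.+2 l).[sg true x] * \sum_(k < n.+3) f (nodes n.+2 k l) * (bern n.+2 k)^`().[sg false x]).
  by rewrite mulr_sumr; apply: eq_bigr => k _; ring.
rewrite (deriv_bern _ (fun k => f (nodes n.+2 k l))) !mulr_sumr; apply: eq_bigr => k _.
have [_ <-] := H k l; ring.
Qed.

Let pd_bern_true n x : exists xi : nat -> nat -> R,
  (forall k l, 0 <= xi k l <= 2 * rho / n.+2%:R) /\
  pd true (bernstein n.+1) x =
  \sum_(k < n.+3) \sum_(l < n.+2) pd true f (nodes n.+2 k l + xi k l *: ax true) *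
      ((bern n.+2 k).[sg false x] * (bern n.+1 l).[sg true x]).
Proof.
have [xi H] := incr_nodes n.+1 true; exists xi; split=> [k l|]; first by have [] := H k l.
rewrite pd_bern; apply: eq_bigr => k _.
transitivity (a * (bern n.+2 k).[sg false x] * \sum_(l < n.+3) f (nodes n.+2 k l) * (bern n.+2 l)^`().[sg true x]).
  by rewrite mulr_sumr; apply: eq_bigr => l _; ring.
rewrite (deriv_bern _ (fun l => f (nodes n.+2 k l))) !mulr_sumr; apply: eq_bigr => l _.
have [_ <-] := H k l; ring.
Qed.

Let node_close i n k x : `|node i n.+1 k - pr i x| = 2 * rho * `|k%:R / n.+1%:R - sg i x|.
Proof. by rewrite node_sg normrM ger0_norm // mulr_ge0 // ltW. Qed.

(** After differentiation the weights have degree [n.+1] while the nodes are still multiples of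
    [1 / n.+2], displaced by an intermediate point. Both errors lie between 0 and one mesh width and
    enter with opposite signs, so together they cost one mesh width. *)
Let shifted_close i n k x (c : R) : (k < n.+2)%N -> 0 <= c <= 2 * rho / n.+2%:R ->
  `|node i n.+2 k + c - pr i x| <= 2 * rho * (`|k%:R / n.+1%:R - sg i x| + n.+2%:R^-1).
Proof.
move=> kn /andP[c0 c1].
have r2 : 0 < 2 * rho by rewrite mulr_gt0.
have n1 : 0 < (n.+1%:R : R) by rewrite ltr0n.
have n2 : 0 < (n.+2%:R : R) by rewrite ltr0n.
have E : n.+2%:R = n.+1%:R + 1 :> R by rewrite natr1.
pose d := k%:R / n.+1%:R - k%:R / n.+2%:R : R.
have kn1 : (k%:R : R) / n.+1%:R <= 1 by rewrite ler_pdivrMr // mul1r ler_nat.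
have dE : d = (k%:R / n.+1%:R) * n.+2%:R^-1.
  by rewrite /d E; move: (n.+1%:R) n1 (k%:R) => N N0 K; field; rewrite !gt_eqF // ltr_wpDr.
have d0 : 0 <= d by rewrite dE mulr_ge0 ?invr_ge0 ?divr_ge0 ?ler0n.
have d1 : d <= n.+2%:R^-1 by rewrite dE ger_pMl ?invr_gt0.
have -> : node i n.+2 k + c - pr i x = 2 * rho * (k%:R / n.+1%:R - sg i x) + (c - 2 * rho * d).
  have := node_sg i x n.+1 k; rewrite (_ : k%:R / n.+2%:R = k%:R / n.+1%:R - d); last by rewrite /d; ring.
  by move: (node _ _ _) => u h; rewrite addrAC h; ring.
apply: le_trans (ler_normD _ _) _; rewrite normrM (ger0_norm (ltW r2)) [leRHS]mulrDr; apply: lerD => //.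
have D1 : 2 * rho * d <= 2 * rho * n.+2%:R^-1 by rewrite ler_pM2l.
have D0 : 0 <= 2 * rho * d by rewrite mulr_ge0 // ltW.
move: (2 * rho * d) (2 * rho / n.+2%:R) D0 D1 c1 => u v hu huv hc.
by rewrite ler_norml; apply/andP; split; lra.
Qed.

Lemma bernstein_C1 (e : R) : 0 < e -> exists n, forall x, box y rho x ->
  `|bernstein n.+1 x - f x| <= e /\ forall i, `|pd i (bernstein n.+1) x - pd i f x| <= e.
Proof.
move=> e0; have [sf _] := tf; have [M M0 [HM HM1 HM2]] := test_pd_bound tf.
have r2 : 0 < 2 * rho by rewrite mulr_gt0.
pose d := e / (M * (2 * rho) * 5).
have d0 : 0 < d by rewrite divr_gt0 // mulr_gt0 // mulr_gt0.
have Ed : M * (2 * rho) * (5 * d) = e by rewrite /d; field; rewrite !gt_eqF.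
pose n := (Num.truncn (d^-1 / d) + Num.truncn (d^-1))%N.
have dn m : (n <= m)%N -> d^-1 <= d * m.+1%:R.
  move=> nm; rewrite mulrC -ler_pdivrMr //; apply: le_trans (ltW (truncnS_gt _)) _.
  by rewrite ler_nat ltnS (leq_trans _ nm) // leq_addr.
have dn' : n.+2%:R^-1 <= d.
  rewrite -[leRHS]invrK lef_pV2 ?posrE ?invr_gt0 ?ltr0n //; apply: le_trans (ltW (truncnS_gt _)) _.
  by rewrite ler_nat ltnS leqW // leq_addl.
have n1 := dn _ (leqnn n); have n2 := dn _ (leqnSn n).
have NC i k x : (k < n.+3)%N -> `|node i n.+2 k - pr i x| <= 2 * rho * `|k%:R / n.+2%:R - sg i x|.
  by rewrite node_close.
have NS i k x c : (k < n.+2)%N -> 0 <= c <= 2 * rho / n.+2%:R ->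
    `|node i n.+2 k + c - pr i x| <= 2 * rho * (`|k%:R / n.+1%:R - sg i x| + d).
  by move=> kn h; apply: le_trans (shifted_close i x kn h) _; rewrite ler_pM2l // lerD2l.
have LF : forall p q, `|f p - f q| <= M * (`|p.1 - q.1| + `|p.2 - q.2|) by exact: pd_bound_lip.
have LP i : forall p q, `|pd i f p - pd i f q| <= M * (`|p.1 - q.1| + `|p.2 - q.2|).
  by apply: pd_bound_lip => //; exact: smooth_pd.
exists n => x bx; rewrite -Ed; split=> [|i].
  apply: (bern2_close (c := fun k l => f (nodes n.+2 k l))) => // [|k l kn ln]; first exact: ltW.
  apply: le_trans (LF _ _) _; rewrite -mulrA; apply: ler_wpM2l; first exact: ltW.
  move: (NC false k x kn) (NC true l x ln) => /=; move: (`|node _ _ _ - _|) (`|node true _ _ - _|) (`|_ - sg _ _|) (`|_ - sg true _|) => u v w z.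
  have := mulr_gt0 r2 d0; nra.
case: i.
  have [xi [xi0 ->]] := pd_bern_true n x.
  apply: (bern2_close (c := fun k l => pd true f (nodes n.+2 k l + xi k l *: ax true))) => // [|k l kn ln]; first exact: ltW.
  apply: le_trans (LP _ _ _) _; rewrite -mulrA scale_ax /= addr0; apply: ler_wpM2l; first exact: ltW.
  move: (NC false k x kn) (NS true l x _ ln (xi0 k l)) => /=; move: (`|node _ _ _ - _|) (`|node true _ _ + _ - _|) (`|_ - sg _ _|) (`|_ - sg true _|) => u v w z.
  nra.
have [xi [xi0 ->]] := pd_bern_false n x.
apply: (bern2_close (c := fun k l => pd false f (nodes n.+2 k l + xi k l *: ax false))) => // [|k l kn ln]; first exact: ltW.
apply: le_trans (LP _ _ _) _; rewrite -mulrA scale_ax /= addr0; apply: ler_wpM2l; first exact: ltW.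
move: (NS false k x _ kn (xi0 k l)) (NC true l x ln) => /=; move: (`|node _ _ _ + _ - _|) (`|node true _ _ - _|) (`|_ - sg _ _|) (`|_ - sg true _|) => u v w z.
nra.
Qed.

End C1Approx.

(** The real and imaginary parts of [z^n], where [z] is [x - y] read as a complex number. *)
Definition zre (y : plane R) : nat -> plane R -> R * R := fun n x =>
  iter n (fun z => ((x.1 - y.1) * z.1 - (x.2 - y.2) * z.2, (x.1 - y.1) * z.2 + (x.2 - y.2) * z.1)) (1, 0).

(** On a circle around [y] these functions are the real trigonometric polynomials. *)
Inductive circ_span (y : plane R) : (plane R -> R) -> Prop :=
| circ_re n : circ_span y (fun x => (zre y n x).1)
| circ_im n : circ_span y (fun x => (zre y n x).2)
| circ_add f g : circ_span y f -> circ_span y g -> circ_span y (fun x => f x + g x)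
| circ_scale t f : circ_span y f -> circ_span y (fun x => t * f x).

(* On the circle [|z| = r] one has [2 Re(z) z^n = z^(n+1) + r^2 z^(n-1)] and
   [2 i Im(z) z^n = z^(n+1) - r^2 z^(n-1)]. *)
Lemma circ_mul (y : plane R) (r : R) i h : circ_span y h ->
  exists2 h', circ_span y h' & forall x, sqd y x = r ^+ 2 -> (pr i x - pr i y) * h x = h' x.
Proof.
have z0 : circ_span y (fun=> 0).
  by have := circ_im y 0; congr circ_span.
elim=> {h} [n|n|f g _ [f' cf Ef] _ [g' cg Eg]|t f _ [f' cf Ef]].
- case: n => [|n].
    by case: i; [exists (fun x => (zre y 1 x).2)|exists (fun x => (zre y 1 x).1)];
      [exact: circ_im| |exact: circ_re|] => x _ /=; ring.
  exists (if i then fun x => 2^-1 * (zre y n.+2 x).2 + (- (r ^+ 2 / 2)) * (zre y n x).2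
          else fun x => 2^-1 * (zre y n.+2 x).1 + (r ^+ 2 / 2) * (zre y n x).1).
    by case: i; apply: circ_add; apply: circ_scale; [exact: circ_im|exact: circ_im|exact: circ_re|exact: circ_re].
  by move=> x; rewrite /sqd => <-; case: i => /=; rewrite -/(zre y n x); case: (zre y n x) => a b /=; field.
- case: n => [|n]; first by exists (fun=> 0) => // x _ /=; rewrite mulr0.
  exists (if i then fun x => (- 2^-1) * (zre y n.+2 x).1 + (r ^+ 2 / 2) * (zre y n x).1
          else fun x => 2^-1 * (zre y n.+2 x).2 + (r ^+ 2 / 2) * (zre y n x).2).
    by case: i; apply: circ_add; apply: circ_scale; [exact: circ_re|exact: circ_re|exact: circ_im|exact: circ_im].
  by move=> x; rewrite /sqd => <-; case: i => /=; rewrite -/(zre y n x); case: (zre y n x) => a b /=; field.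
- exists (fun x => f' x + g' x); first exact: circ_add.
  by move=> x hx; rewrite mulrDr Ef // Eg.
- exists (fun x => t * f' x); first exact: circ_scale.
  by move=> x hx; rewrite -Ef //; ring.
Qed.

(** Closure under both coordinates makes every polynomial, in particular every Bernstein polynomial,
    a trigonometric polynomial on the circle. *)
Lemma circ_poly (y : plane R) (r : R) :
  polyclosed (fun f => exists2 h, circ_span y h & forall x, sqd y x = r ^+ 2 -> f x = h x).
Proof.
have M i f : (exists2 h, circ_span y h & forall x, sqd y x = r ^+ 2 -> f x = h x) ->
    exists2 h, circ_span y h & forall x, sqd y x = r ^+ 2 -> pr i x * f x = h x.
  move=> [h ch Eh]; have [h' ch' Eh'] := circ_mul r i ch.
  exists (fun x => h' x + pr i y * h x); first by apply: circ_add => //; exact: circ_scale.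
  by move=> x hx; rewrite Eh // -Eh' //; ring.
split=> [|f g [f' cf Ef] [g' cg Eg]|t f [f' cf Ef]|f|f].
- by exists (fun x => (zre y 0 x).1) => //; exact: circ_re.
- by exists (fun x => f' x + g' x); [exact: circ_add|move=> x hx; rewrite Ef // Eg].
- by exists (fun x => t * f' x); [exact: circ_scale|move=> x hx; rewrite Ef].
- exact: (M false).
- exact: (M true).
Qed.

Lemma circ_sol (y : plane R) (r : R) (S : (plane R -> R) -> Prop) h : psubspace S ->
  (forall n, (exists2 q, S q & forall x, sqd y x = r ^+ 2 -> q x = (zre y n x).1) /\
     exists2 q, S q & forall x, sqd y x = r ^+ 2 -> q x = (zre y n x).2) ->
  circ_span y h -> exists2 q, S q & forall x, sqd y x = r ^+ 2 -> q x = h x.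
Proof.
move=> [_ SD SZ] H; elim=> {h} [n|n|f g _ [f' cf Ef] _ [g' cg Eg]|t f _ [f' cf Ef]].
- by have [] := H n.
- by have [] := H n.
- by exists (fun x => f' x + g' x); [exact: SD|move=> x hx; rewrite Ef // Eg].
- by exists (fun x => t * f' x); [exact: SZ|move=> x hx; rewrite Ef].
Qed.

Lemma II_dct D (F : nat -> plane R -> R) (M : R) : dom D -> (forall n, continuous (F n)) ->
  (forall n x, D x -> `|F n x| <= M) ->
  (forall x, D x -> exists N, forall n, (N <= n)%N -> F n x = 0) ->
  forall e, 0 < e -> exists N, forall n, (N <= n)%N -> `|II D (F n)| <= e.
Proof.
move=> dD cF FM F0 e e0; have [mD _] := dD.
have [] := @dominated_convergence _ (mplane R) R (@leb2 R) (D : set (mplane R)) mD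
   (fun n => EFin \o F n) (cst 0%E) (cst M%:E).
- by move=> n; apply/measurable_EFinP; exact: measurable_cont_plane_on.
- exact: measurable_cst.
- apply: aeW => x Dx; have [N HN] := F0 x Dx.
  apply: cvg_near_cst; exists N => // n /= Nn; by rewrite HN.
- by apply: (dom_integ (f := cst M)) => //; exact: cst_continuous.
- by apply: aeW => x n Dx; rewrite /= lee_fin; exact: FM.
move=> _ _; rewrite integral0 => /fine_cvgP[_] /cvgrPdist_le /(_ e e0)[N _ HN].
by exists N => n Nn; have := HN n Nn; rewrite /= sub0r normrN IIE.
Qed.

Lemma dom_eball y (a : R) : 0 <= a -> dom (eball y a).
Proof.
move=> a0; split; first by apply: measurable_open_plane; exact: open_eball.
exists (a + `|y.1| + `|y.2|) => x /ltW /(sqd_coord a0)[h1 h2]; rewrite /box /= !subr0.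
move: (ler_normD (x.1 - y.1) y.1) (ler_normD (x.2 - y.2) y.2); rewrite !subrK.
by have := normr_ge0 y.1; have := normr_ge0 y.2; split; lra.
Qed.

Lemma cutoff_ball y (a : R) f : smooth f -> 0 <= a -> exists g, [/\ test_function setT g &
  exists V : set (plane R), [/\ open V, forall x, sqd y x <= a ^+ 2 -> V x & forall x, V x -> g x = f x]].
Proof.
move=> sf a0; have [chi [tc _ [V [oV KV V1]]]] := cutoff (@compact_sqd_le R y (a ^+ 2)) openT (fun _ _ => I).
exists (fun x => chi x * f x); split; first exact: testMr.
by exists V; split=> // x h; rewrite V1 // mul1r.
Qed.

(** A Lipschitz estimate along the radius through [x], up to the point [z] of the circle: the
    distance is [rho - m], at most [(rho^2 - m^2) / rho]. The factor 2 in the constant bounds the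
    sum of the two coordinates of a unit vector. *)
Lemma radial_bound y (rho : R) f : 0 < rho -> smooth f -> (forall x, sqd y x = rho ^+ 2 -> f x = 0) ->
  exists2 C : R, 0 < C & forall x, sqd y x <= rho ^+ 2 -> `|f x| <= C * (rho ^+ 2 - sqd y x).
Proof.
move=> rho0 sf f0; have [g [tg [V [oV KV VE]]]] := cutoff_ball y sf (ltW rho0).
have [M M0 [_ HM _]] := test_pd_bound tg; have [sg _] := tg.
have L := pd_bound_lip sg HM.
exists (2 * M / rho); first by rewrite divr_gt0 // mulr_gt0.
move=> x hx; rewrite -VE; last exact: KV.
pose m := Num.sqrt (sqd y x).
have m0 : 0 <= m by exact: sqrtr_ge0.
have mE : m ^+ 2 = sqd y x by rewrite sqr_sqrtr // sqd_ge0.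
have mr : m <= rho by rewrite -(@ler_pXn2r _ 2) ?nnegrE // ?(ltW rho0) // mE.
have [u1 [u2 [u12 ex ey]]] : exists u1 u2 : R, [/\ u1 ^+ 2 + u2 ^+ 2 = 1, x.1 - y.1 = m * u1 & x.2 - y.2 = m * u2].
  have [mz|mn] := eqVneq m 0.
    have : sqd y x = 0 by rewrite -mE mz expr0n.
    move=> /eqP; rewrite /sqd paddr_eq0 ?sqr_ge0 // !sqrf_eq0 => /andP[/eqP -> /eqP ->].
    by exists 1, 0; rewrite mz !mul0r expr1n expr0n addr0.
  exists ((x.1 - y.1) / m), ((x.2 - y.2) / m); split.
  - by rewrite !expr_div_n -mulrDl -/(sqd y x) -mE divff // expf_neq0.
  - by rewrite mulrCA divff // mulr1.
  - by rewrite mulrCA divff // mulr1.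
pose z : plane R := (y.1 + rho * u1, y.2 + rho * u2).
have zr : sqd y z = rho ^+ 2.
  rewrite /sqd /z /=; transitivity (rho ^+ 2 * (u1 ^+ 2 + u2 ^+ 2)); first by ring.
  by rewrite u12 mulr1.
have gz : g z = 0 by rewrite VE ?f0 //; apply: KV; rewrite zr.
have := L x z; rewrite gz subr0 => /le_trans; apply.
have -> : x.1 - z.1 = (m - rho) * u1 by rewrite /z /= opprD addrA ex; ring.
have -> : x.2 - z.2 = (m - rho) * u2 by rewrite /z /= opprD addrA ey; ring.
rewrite !normrM -mulrDr distrC (ger0_norm (_ : 0 <= rho - m)) ?subr_ge0 //.
have a1 : `|u1| <= 1 by rewrite ler_norml; apply/andP; split; nra.
have a2 : `|u2| <= 1 by rewrite ler_norml; apply/andP; split; nra.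
rewrite -mE (_ : 2 * M / rho * _ = M * (2 * (rho - m) * ((rho + m) / rho))); last by field; rewrite gt_eqF.
apply: ler_wpM2l; first exact: ltW.
have : 1 <= (rho + m) / rho by rewrite ler_pdivlMr // mul1r lerDl.
move: (`|u1|) (`|u2|) a1 a2 ((rho + m) / rho) => p q hp hq w hw; nra.
Qed.

(** The derivative of [step], read off from a function of the plane so that the calculus of [smooth]
    applies to it. *)
Definition dstep (t : R) : R := pd false (fun x => step x.1) (t, 0).

Lemma smooth_stepx : smooth (fun x : plane R => step x.1).
Proof. by apply: smooth_step; exact: smooth_fst. Qed.

Lemma is_derive_step (t : R) : is_derive t (1 : R) (@step R) (dstep t).
Proof.
have := is_derive_axis false (0 : plane R) t smooth_stepx.
have E s : (0 : plane R) + s *: ax false = (s, 0) by rewrite scale_ax add0r.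
by rewrite E; congr is_derive; apply/funext => s; rewrite E.
Qed.

Lemma pd_step f i x : smooth f -> pd i (fun x => step (f x)) x = dstep (f x) * pd i f x.
Proof.
move=> sf; rewrite [LHS](congr1 (@^~ x) (pdE _ _)) [pd i f](pdE i f).
have D := @is_derive_comp _ (@step R) _ f x (ax i) (smooth_der sf) (is_derive_step (f x)).
exact: (@derive_val _ _ _ _ _ _ _ D).
Qed.

Lemma dstep_out (t : R) : t < 0 \/ 1 < t -> dstep t = 0.
Proof.
have cf : continuous (fun x : plane R => x.1) by apply: smooth_cont; exact: smooth_fst.
case=> h; rewrite /dstep.
  have oO : open [set x : plane R | x.1 < 0] by exact: (open_comp (fun x _ => cf x) (@open_lt R 0)).
  rewrite (@pd_loc _ _ (fun=> 0) false _ _ oO) // ?pd_cst // => z z0.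
  by rewrite step_le0 // ltW.
have oO : open [set x : plane R | 1 < x.1] by exact: (open_comp (fun x _ => cf x) (@open_gt R 1)).
rewrite (@pd_loc _ _ (fun=> 1) false _ _ oO) // ?pd_cst // => z z0.
by rewrite step_ge1 // ltW.
Qed.

Lemma dstep_bound : exists2 M : R, 0 < M & forall t, `|dstep t| <= M.
Proof.
have [M HM] := cont_bounded_box (0 : plane R) 2 (smooth_cont (smooth_pd false smooth_stepx)).
exists (`|M| + 1); first by rewrite ltr_wpDl.
move=> t; apply: (@le_trans _ _ (`|M|)); last by rewrite lerDl.
have [h|h] := ltP 2 `|t|.
  rewrite dstep_out ?normr0 //; move: h; rewrite ltr_normr => /orP[] h; [right|left]; lra.
apply: le_trans (ler_norm M); apply: HM; split => /=; rewrite ?subr0 ?subrr ?normr0 //.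
Qed.

Lemma ball_bound y (a : R) f : smooth f -> 0 <= a -> exists2 M : R, 0 < M &
  forall x, sqd y x <= a ^+ 2 -> `|f x| <= M /\ forall i, `|pd i f x| <= M.
Proof.
move=> sf a0; have [g [tg [V [oV KV VE]]]] := cutoff_ball y sf a0.
have [M M0 [H0 H1 _]] := test_pd_bound tg; exists M => // x hx.
rewrite -VE; last exact: KV; split=> [|i]; first exact: H0.
by rewrite -(@pd_loc _ g f i V x) //; exact: KV.
Qed.

(** * Functions vanishing on a circle as limits of test functions of the disc *)

Section ZeroCircle.
Variables (y : plane R) (rho : R) (w : plane R -> R).
Hypothesis rho0 : 0 < rho.
Hypothesis sw : smooth w.
Hypothesis w0 : forall x, sqd y x = rho ^+ 2 -> w x = 0.
(** [chi k] is 1 where [rho^2 - sqd y x >= 2 / (k + 1)] and 0 where it is at most [1 / (k + 1)],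
    hence compactly supported in the disc; [u k] is what it removes from [w]. *)
Let arg k x : R := k.+1%:R * (rho ^+ 2 - sqd y x) - 1.
Let chi k x : R := step (arg k x).
Let u k x : R := (1 - chi k x) * w x.

Let smooth_arg k : smooth (arg k).
Proof.
apply: smoothB; last exact: smooth_cst.
apply: smoothZ; apply: smoothB; [exact: smooth_cst|exact: smooth_sqd].
Qed.

Let smooth_chi k : smooth (chi k).
Proof. by apply: smooth_step; exact: smooth_arg. Qed.

Let smooth_u k : smooth (u k).
Proof. by apply: smoothM => //; apply: smoothB; [exact: smooth_cst|exact: smooth_chi]. Qed.

Let pd_u k i x : pd i (u k) x =
  (1 - chi k x) * pd i w x + w x * (dstep (arg k x) * (k.+1%:R * (2 * (pr i x - pr i y)))).
Proof.
have s1 : smooth (fun x => 1 - chi k x) by apply: smoothB; [exact: smooth_cst|exact: smooth_chi].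
rewrite /u pdMs // pdBs; [|exact: smooth_cst|exact: smooth_chi].
rewrite pd_cst /chi pd_step; last exact: smooth_arg.
have -> : pd i (arg k) x = - (k.+1%:R * (2 * (pr i x - pr i y))).
  rewrite /arg pdBs; [|apply: smoothZ; apply: smoothB; [exact: smooth_cst|exact: smooth_sqd]|exact: smooth_cst].
  rewrite pdZs; last by apply: smoothB; [exact: smooth_cst|exact: smooth_sqd].
  rewrite pdBs; [|exact: smooth_cst|exact: smooth_sqd].
  by rewrite !pd_cst pd_sqd; ring.
ring.
Qed.

(** The gradient of [chi k] is of order [k + 1], but it lives where
    [rho^2 - sqd y x <= 2 / (k + 1)], and there [radial_bound] makes [w] of order [1 / (k + 1)]: the
    product stays bounded. *)
Let u_bound : exists M : R, forall k x, sqd y x < rho ^+ 2 -> `|u k x| <= M /\ forall i, `|pd i (u k) x| <= M.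
Proof.
have [M M0 HM] := ball_bound y sw (ltW rho0); have [C C0 HC] := radial_bound rho0 sw w0.
have [S S0 HS] := dstep_bound.
exists (M + C * 2 * S * (2 * rho)) => k x hx.
have [h1 h2] := HM x (ltW hx); have h3 := HC x (ltW hx).
have c01 : `|1 - chi k x| <= 1.
  have c0 := step_ge0 (arg k x); have c1 := step_le1 (arg k x).
  by rewrite ler_norml; apply/andP; split; rewrite /chi; lra.
have CS : 0 <= C * 2 * S * (2 * rho) by rewrite !mulr_ge0 // ltW.
split=> [|i].
  rewrite normrM; apply: (@le_trans _ _ (1 * M)); last by rewrite mul1r lerDl.
  exact: ler_pM.
rewrite pd_u; apply: le_trans (ler_normD _ _) _; apply: lerD.
  by rewrite normrM -[leRHS]mul1r; apply: ler_pM.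
have [ha|ha] := boolP (0 <= arg k x <= 1); last first.
  rewrite dstep_out ?mul0r ?mulr0 ?normr0 //.
  by move: ha; rewrite negb_and -!ltNge => /orP.
have hp : `|pr i x - pr i y| <= rho.
  by have [a1 a2] := sqd_coord (ltW rho0) (ltW hx); case: (i).
have -> : w x * (dstep (arg k x) * (k.+1%:R * (2 * (pr i x - pr i y)))) =
   (k.+1%:R * w x) * dstep (arg k x) * (2 * (pr i x - pr i y)) by ring.
rewrite 2!normrM; apply: ler_pM => //; last by rewrite normrM ger0_norm // ler_pM2l.
apply: ler_pM => //; rewrite normrM ger0_norm ?ler0n //.
apply: (@le_trans _ _ (k.+1%:R * (C * (rho ^+ 2 - sqd y x)))); first exact: ler_wpM2l.
rewrite mulrCA ler_pM2l //; move: ha; rewrite /arg => /andP[_]; lra.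
Qed.

(** At each point of the open disc [u k] and its gradient eventually vanish, and they are uniformly
    bounded, so their energy tends to 0 by dominated convergence. *)
Lemma zero_circle_approx (e : R) : 0 < e -> exists2 psi, test_function (eball y rho) psi &
  en 1 (eball y rho) (fun x => w x - psi x) (fun x => w x - psi x) <= e.
Proof.
move=> e0; have [M HM] := u_bound.
pose F k x := pd false (u k) x * pd false (u k) x + pd true (u k) x * pd true (u k) x + 1 * (u k x * u k x).
have [N HN] : exists N, forall n, (N <= n)%N -> `|II (eball y rho) (F n)| <= e.
  apply: (@II_dct _ F (M ^+ 2 + M ^+ 2 + M ^+ 2)) => //; first by apply: dom_eball; exact: ltW.
  - by move=> n; apply: smooth_cont; exact: (smooth_density 1 (smooth_u n) (smooth_u n)).
  - move=> n x hx; have [h1 h2] := HM n x hx.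
    rewrite /F mul1r -!expr2 ger0_norm ?addr_ge0 ?sqr_ge0 //.
    have S (a : R) : `|a| <= M -> a ^+ 2 <= M ^+ 2.
      by move=> h; rewrite -real_normK ?num_real // ler_pXn2r // nnegrE // (le_trans _ h).
    by rewrite !lerD // S.
  - move=> x hx; pose d := rho ^+ 2 - sqd y x; have d0 : 0 < d by rewrite subr_gt0.
    exists (Num.truncn (3 / d)) => n nN.
    have h : 3 < n.+1%:R * d.
      by rewrite -ltr_pdivrMr //; apply: lt_le_trans (truncnS_gt _) _; rewrite ler_nat ltnS.
    have c1 : chi n x = 1 by rewrite /chi step_ge1 // /arg -/d; lra.
    have u0 : u n x = 0 by rewrite /u c1 subrr mul0r.
    have p0 i : pd i (u n) x = 0.
      by rewrite pd_u c1 dstep_out; [rewrite subrr !mul0r mulr0 addr0|right; rewrite /arg -/d; lra].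
    by rewrite /F !p0 u0 !mulr0 !addr0.
exists (fun x => chi N x * w x).
  apply: testMr => //; split; first exact: smooth_chi.
  exists [set x | sqd y x <= rho ^+ 2 - N.+1%:R^-1]; split; first exact: compact_sqd_le.
    by move=> x /= h; rewrite /eball /= (le_lt_trans h) // ltrBlDr ltrDl invr_gt0 ltr0n.
  move=> x /= /negP; rewrite -ltNge => h; apply: step_le0; rewrite /arg.
  have n0 : 0 < (N.+1%:R : R) by rewrite ltr0n.
  by rewrite subr_le0 mulrC -ler_pdivlMr // mul1r; move: h; move: (_^-1) => v; lra.
have -> : (fun x => w x - chi N x * w x) = u N by apply/funext => x; rewrite /u; ring.
by apply: le_trans (HN N (leqnn N)); exact: ler_norm.
Qed.

End ZeroCircle.

Lemma form_par (P : (plane R -> R) -> Prop) a u v : psubspace P -> pform P a -> P u -> P v ->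
  a (fun x => u x + v x) (fun x => u x + v x) <= 2 * a u u + 2 * a v v.
Proof.
move=> [_ PD PZ] [aC aD aZ a0] Pu Pv.
have PN : P (fun x => - 1 * v x) by exact: PZ.
have Puv := PD _ _ Pu Pv; have Pum := PD _ _ Pu PN.
have := a0 _ Pum; rewrite !(aD, aC _ (fun x => _ + _), aZ) // (aC u (fun x => -1 * v x)) // (aC v (fun x => -1 * v x)) // !aZ // (aC v u) //.
lra.
Qed.

(** A Bernstein polynomial [P] is close to [phi] in C^1; on the circle it is a trigonometric
    polynomial, hence the trace of some [q] in [S]. Then [P - q] vanishes on the circle and is
    approximated by a test function [psi]. *)
Theorem disc_dense y (rho : R) (S : (plane R -> R) -> Prop) phi (e : R) : 0 < rho -> psubspace S ->
  (forall q, S q -> smooth q) ->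
  (forall n, (exists2 q, S q & forall x, sqd y x = rho ^+ 2 -> q x = (zre y n x).1) /\
     exists2 q, S q & forall x, sqd y x = rho ^+ 2 -> q x = (zre y n x).2) ->
  smooth phi -> 0 < e -> exists psi q, [/\ test_function (eball y rho) psi, S q &
    en 1 (eball y rho) (fun x => phi x - psi x - q x) (fun x => phi x - psi x - q x) <= e].
Proof.
move=> rho0 subS sS HS sphi e0.
have [f [tf [V [oV KV VE]]]] := cutoff_ball y sphi (ltW rho0).
have [sf _] := tf.
have dB := dom_eball y (ltW rho0).
have eF := en_form dB ler01.
pose vol := II (eball y rho) (fun=> 1); have vol0 : 0 <= vol by apply: II_ge0.
(* The three squares in the energy density are at most [d^2 <= d], so the energy of [phi - P] is at
   most [3 d vol <= e / 4]; the parallelogram bound [form_par] doubles each of the two contributions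
   [e / 4]. *)
pose d := Num.min 1 (e / (12 * (vol + 1))).
have d0 : 0 < d by rewrite lt_min ltr01 divr_gt0 // mulr_gt0 // ltr_wpDl.
have [n Hn] := bernstein_C1 y rho0 tf d0.
have [h ch Eh] := bernstein_poly y rho f n.+1 (circ_poly y rho).
have [q Sq Eq] := circ_sol subS HS ch.
pose P := bernstein y rho f n.+1.
have sP : smooth P by exact: smooth_bernstein.
have sq := sS _ Sq.
have sPq : smooth (fun x => P x - q x) by exact: smoothB.
have Pq0 x : sqd y x = rho ^+ 2 -> P x - q x = 0 by move=> hx; rewrite Eq // /P Eh // subrr.
have e4 : 0 < e / 4 by rewrite divr_gt0.
have [psi tpsi Hpsi] := zero_circle_approx rho0 sPq Pq0 e4.
have [spsi _] := tpsi.
exists psi, q; split=> //.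
have sfP : smooth (fun x => phi x - P x) by exact: smoothB.
have swp : smooth (fun x => P x - q x - psi x) by exact: smoothB.
have -> : (fun x => phi x - psi x - q x) = (fun x => (phi x - P x) + (P x - q x - psi x)).
  by apply/funext => x; ring.
apply: le_trans (form_par smooth_sub eF sfP swp) _.
suff H : en 1 (eball y rho) (fun x => phi x - P x) (fun x => phi x - P x) <= e / 4 by lra.
have [mB _] := dB.
apply: (@le_trans _ _ (II (eball y rho) (fun=> 3 * d * 1))); last first.
  have E : II (eball y rho) (fun=> 3 * d * 1) = 3 * d * vol.
    by apply: IIZ => //; apply: dom_integ => // x; exact: cst_continuous.
  rewrite E; have : d * (12 * (vol + 1)) <= e by rewrite -ler_pdivlMr ?ge_min ?lexx ?orbT // mulr_gt0 // ltr_wpDl.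
  nra.
apply: II_le => //.
- by apply: dom_integ => //; apply: smooth_cont; exact: smooth_density.
- by apply: dom_integ => // x; exact: cst_continuous.
move=> x hx; have bx : box y rho x by apply: sqd_box; [exact: ltW|exact: ltW].
have Vx : V x by apply: KV; exact: ltW.
have [h1 h2] := Hn x bx.
have d1 : d <= 1 by rewrite ge_min lexx.
have D i : pd i (fun x => phi x - P x) x = pd i f x - pd i P x.
  by rewrite pdBs // (@pd_loc _ f phi i V x).
have sq_le (a : R) : `|a| <= d -> a * a <= d.
  move=> ha; rewrite -expr2 -real_normK ?num_real // expr2.
  apply: le_trans (ler_pM (normr_ge0 a) (normr_ge0 a) ha ha) _.
  by rewrite -[leRHS]mulr1; apply: ler_wpM2l; [exact: ltW|exact: d1].
rewrite !D mul1r -VE // mulr1 (_ : 3 * d = d + d + d); last by ring.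
by rewrite !lerD //; apply: sq_le; rewrite distrC.
Qed.

End Bernstein.

(** * Representation of functionals *)

Section HahnBanach.
Context {R : realType}.
Implicit Types (f g u v w phi : plane R -> R) (P : (plane R -> R) -> Prop)
  (a : (plane R -> R) -> (plane R -> R) -> R).

Definition tn (j : nat) : R := j.+1%:R^-1.

Lemma tn_gt0 j : 0 < tn j. Proof. by rewrite invr_gt0 ltr0n. Qed.

Lemma tn_le i j : (i <= j)%N -> tn j <= tn i.
Proof. by move=> ij; rewrite lef_pV2 ?posrE ?ltr0n // ler_nat ltnS. Qed.

Lemma tn_le1 j : tn j <= 1.
Proof. by apply: le_trans (tn_le (leq0n j)) _; rewrite /tn invr1. Qed.

Lemma tn_small (K e : R) : 0 < e -> exists N, forall j, (N <= j)%N -> K * tn j <= e.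
Proof.
move=> e0; exists (Num.truncn (`|K| / e)) => j Nj.
have K1 : `|K| <= e * j.+1%:R.
  rewrite mulrC -ler_pdivrMr //; apply: le_trans (ltW (truncnS_gt _)) _.
  by rewrite ler_nat ltnS.
rewrite /tn ler_pdivrMr ?ltr0n //; exact: le_trans (ler_norm K) K1.
Qed.

Lemma tn_squeeze (x K : R) : (forall j, `|x| <= K * tn j) -> x = 0.
Proof.
move=> H; apply/eqP; rewrite -normr_le0; apply/ler_addgt0Pr => e e0; rewrite add0r.
by have [N HN] := tn_small K e0; apply: le_trans (H N) (HN N _).
Qed.

(** The limit is the supremum of the lower bounds [u j - K tn j], which lie below all the upper
    bounds [u i + K tn i]; this keeps the explicit rate. *)
Lemma tn_lim (u : nat -> R) (K : R) : (forall i j, `|u i - u j| <= K * (tn i + tn j)) ->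
  exists l, forall j, `|l - u j| <= K * tn j.
Proof.
move=> H; pose A := [set x | exists j, x = u j - K * tn j].
have ub i : ubound A (u i + K * tn i).
  move=> _ [j ->]; have := H j i; rewrite ler_norml mulrDr => /andP[_]; lra.
have sA : has_sup A by split; [exists (u 0%N - K * tn 0); exists 0%N|exists (u 0%N + K * tn 0); exact: ub].
exists (sup A) => j; rewrite ler_distl; apply/andP; split.
  by apply: ub_le_sup; [case: sA|exists j].
by apply: ge_sup; [case: sA|exact: ub].
Qed.

Definition nm a u := Num.sqrt (a u u).

Lemma nm_ge0 a u : 0 <= nm a u. Proof. exact: sqrtr_ge0. Qed.

Lemma nm_sqr P a u : pform P a -> P u -> nm a u ^+ 2 = a u u.
Proof. by move=> [_ _ _ a0] Pu; rewrite sqr_sqrtr // a0. Qed.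

Lemma form_CSn P a u v : psubspace P -> pform P a -> P u -> P v -> `|a u v| <= nm a u * nm a v.
Proof.
move=> sP fa Pu Pv; rewrite -(@ler_pXn2r _ 2) ?nnegrE ?mulr_ge0 ?nm_ge0 //.
by rewrite exprMn !(nm_sqr fa) // real_normK ?num_real //; exact: (form_CS sP).
Qed.

Lemma sqr_le (x y : R) : 0 <= y -> x ^+ 2 <= y ^+ 2 -> `|x| <= y.
Proof.
by move=> y0 h; rewrite -(@ler_pXn2r _ 2) ?nnegrE // real_normK ?num_real.
Qed.

Lemma psubN P u : psubspace P -> P u -> P (fun x => - u x).
Proof. by move=> [_ _ PZ] Pu; have := PZ (-1) _ Pu; congr P; apply/funext => x; rewrite mulN1r. Qed.

Lemma psubB P u v : psubspace P -> P u -> P v -> P (fun x => u x - v x).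
Proof. by move=> sP Pu Pv; have [_ PD _] := sP; apply: (PD u (fun x => - v x)) => //; exact: psubN. Qed.

Lemma formNl P a u v : psubspace P -> pform P a -> P u -> P v -> a (fun x => - u x) v = - a u v.
Proof.
move=> sP [_ _ aZ _] Pu Pv; rewrite -mulN1r -aZ //; congr (a _ v).
by apply/funext => x; rewrite mulN1r.
Qed.

Lemma formBl P a u v w : psubspace P -> pform P a -> P u -> P v -> P w ->
  a (fun x => u x - v x) w = a u w - a v w.
Proof.
move=> sP fa Pu Pv Pw; have [_ aD _ _] := fa.
by rewrite (aD u (fun x => - v x)) // ?(formNl sP) //; exact: psubN.
Qed.

Lemma formBr P a u v w : psubspace P -> pform P a -> P u -> P v -> P w ->
  a w (fun x => u x - v x) = a w u - a w v.
Proof.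
move=> sP fa Pu Pv Pw; have [aC _ _ _] := fa.
by rewrite aC ?(formBl sP fa) ?(aC _ w) //; exact: psubB.
Qed.

Lemma formDr P a u v w : psubspace P -> pform P a -> P u -> P v -> P w ->
  a w (fun x => u x + v x) = a w u + a w v.
Proof.
move=> sP fa Pu Pv Pw; have [aC aD _ _] := fa; have [_ PD _] := sP.
by rewrite aC ?aD ?(aC _ w) //; exact: PD.
Qed.

Lemma form_triangle P a u v : psubspace P -> pform P a -> P u -> P v ->
  nm a (fun x => u x + v x) <= nm a u + nm a v.
Proof.
move=> sP fa Pu Pv; have [_ PD _] := sP; have [aC aD _ _] := fa.
have Puv := PD _ _ Pu Pv.
apply: le_trans (ler_norm _) _; apply: sqr_le; first by rewrite addr_ge0 ?nm_ge0.
rewrite (nm_sqr fa Puv) sqrrD (nm_sqr fa Pu) (nm_sqr fa Pv).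
rewrite (aD _ _ _ Pu Pv Puv) !(formDr sP fa) // (aC v u) //.
have := le_trans (ler_norm _) (form_CSn sP fa Pu Pv).
lra.
Qed.

Lemma nmN P a u : psubspace P -> pform P a -> P u -> nm a (fun x => - u x) = nm a u.
Proof.
move=> sP fa Pu; have [aC _ _ _] := fa; have Pn := psubN sP Pu.
by rewrite /nm (formNl sP) // aC // (formNl sP) // opprK.
Qed.

Lemma le_of_sqr (x K : R) : 0 <= K -> 0 <= x -> x ^+ 2 <= K * x -> x <= K.
Proof.
move=> K0 x0; have [->//|xn] := eqVneq x 0.
by rewrite expr2 ler_pM2r // lt_neqAle eq_sym xn.
Qed.

(* The functional is the limit of [a (phi - n_k) _] along a sequence [n_k] of [N]
   minimising the distance to [phi]. *)
Theorem hahn_banach_form P N a phi : psubspace P -> pform P a -> psubspace N ->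
  (forall u, N u -> P u) -> P phi ->
  (forall l (C : R), plinear P l -> (forall u, P u -> `|l u| <= C * nm a u) ->
     (forall u, N u -> l u = 0) -> l phi = 0) ->
  forall e : R, 0 < e -> exists2 n, N n & a (fun x => phi x - n x) (fun x => phi x - n x) <= e.
Proof.
move=> sP fa sN NP Pphi H e e0; have [aC aD aZ a0] := fa.
have faN : pform N a.
  split=> [f g /NP ? /NP ?|f g h /NP ? /NP ? /NP ?|t f g /NP ? /NP ?|f /NP ?];
  by [exact: aC|exact: aD|exact: aZ|exact: a0].
have lN : plinear N (a phi).
  split=> [f g /NP Pf /NP Pg|t f /NP Pf]; first exact: (formDr sP).
  by rewrite aC ?aZ ?(aC f) //; have [_ _ PZ] := sP; exact: PZ.
have cN u : N u -> a phi u ^+ 2 <= a phi phi * a u u by move=> /NP Pu; exact: (form_CS sP).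
(* Almost orthogonal projections of [phi] onto [N]: on [N] the form [a (phi - n j)] has norm at most
   [tn j]. *)
have /choice[n Hn] : forall j, exists n, N n /\ forall u, N u -> `|a phi u - a n u| <= tn j * nm a u.
  move=> j; have k0 : 0 < tn j ^+ 2 by rewrite exprn_gt0 // tn_gt0.
  have [n Nn Hn] := riesz_approx sN faN lN cN k0; exists n; split=> // u Nu.
  apply: sqr_le; first by rewrite mulr_ge0 ?nm_ge0 // ltW // tn_gt0.
  by rewrite -sqrrN opprB exprMn (nm_sqr fa) ?Hn //; exact: NP.
have Nn j : N (n j) by case: (Hn j).
have Pn j : P (n j) by exact: NP.
have nd i j : nm a (fun x => n i x - n j x) <= tn i + tn j.
  have Nd : N (fun x => n i x - n j x) by exact: (psubB sN).
  have Pd := NP _ Nd.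
  apply: le_of_sqr; rewrite ?nm_ge0 ?addr_ge0 ?(ltW (tn_gt0 _)) //.
  rewrite (nm_sqr fa) // [leLHS](formBl sP fa) //.
  have [_ /(_ _ Nd)] := Hn i; have [_ /(_ _ Nd)] := Hn j.
  rewrite !ler_norml mulrDl => /andP[_ h1] /andP[h2 _]; lra.
pose r j x := phi x - n j x.
have Pr j : P (r j) by exact: (psubB sP).
have arN j u : N u -> `|a (r j) u| <= tn j * nm a u.
  by move=> Nu; have [_ h] := Hn j; rewrite (formBl sP fa) ?h //; exact: NP.
have rd v i j : P v -> `|a (r i) v - a (r j) v| <= nm a v * (tn i + tn j).
  move=> Pv; rewrite !(formBl sP fa) // (_ : _ - _ = - (a (n i) v - a (n j) v)); last by ring.
  rewrite normrN -(formBl sP fa) // mulrC; apply: le_trans (form_CSn sP fa _ Pv) _; first exact: (psubB sP).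
  by apply: ler_wpM2r; rewrite ?nm_ge0.
have /choice[l Hl] : forall v, exists l, P v -> forall j, `|l - a (r j) v| <= nm a v * tn j.
  move=> v; have [Pv|nP] := pselect (P v); last by exists 0.
  by have [l hl] := tn_lim (fun i j => rd v i j Pv); exists l.
have lin : plinear P l.
  have [_ PD PZ] := sP.
  split=> [f g Pf Pg|t f Pf].
    apply/eqP; rewrite -subr_eq0; apply/eqP.
    apply: (@tn_squeeze _ (nm a (fun x => f x + g x) + nm a f + nm a g)) => j.
    rewrite -(_ : (l (fun x => f x + g x) - a (r j) (fun x => f x + g x)) - (l f - a (r j) f) - (l g - a (r j) g) = l (fun x => f x + g x) - (l f + l g)); last first.
      by rewrite (formDr sP fa) //; ring.
    apply: le_trans (ler_normB _ _) _; rewrite !mulrDl lerD ?Hl //.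
    by apply: le_trans (ler_normB _ _) _; rewrite lerD ?Hl //; exact: PD.
  apply/eqP; rewrite -subr_eq0; apply/eqP.
  apply: (@tn_squeeze _ (nm a (fun x => t * f x) + `|t| * nm a f)) => j.
  rewrite -(_ : (l (fun x => t * f x) - a (r j) (fun x => t * f x)) - t * (l f - a (r j) f) = l (fun x => t * f x) - t * l f); last first.
    by rewrite [a (r j) (fun x => _)]aC ?aZ ?(aC f) //; [ring|exact: PZ].
  apply: le_trans (ler_normB _ _) _; rewrite mulrDl lerD ?Hl //; first exact: PZ.
  by rewrite normrM -mulrA ler_wpM2l // Hl.
have lC u : P u -> `|l u| <= (nm a (r 0) + 1) * nm a u.
  move=> Pu; rewrite -(subrK (a (r 0) u) (l u)); apply: le_trans (ler_normD _ _) _.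
  rewrite addrC mulrDl lerD ?(form_CSn sP fa) // mulrC; apply: le_trans (Hl u Pu 0%N) _.
  by rewrite /tn invr1.
have l0 u : N u -> l u = 0.
  move=> Nu; apply: (@tn_squeeze _ (2 * nm a u)) => j.
  rewrite -(subrK (a (r j) u) (l u)); apply: le_trans (ler_normD _ _) _.
  rewrite (_ : 2 * _ * _ = nm a u * tn j + tn j * nm a u); last by ring.
  by rewrite lerD ?arN // Hl //; exact: NP.
have lphi := H l _ lin lC l0.
pose K := nm a phi + (nm a (n 0) + 2).
have [j Hj] := tn_small K e0; exists (n j) => //.
apply: le_trans (Hj j (leqnn j)).
(* The squared distance is [a (r j) phi - a (r j) (n j)]: the first term is close to [l phi = 0],
   the second is small because [r j] is almost orthogonal to [N]. *)
rewrite -/(r j) [leLHS](formBr sP fa) // -/(r j).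
have h1 : `|a (r j) phi| <= nm a phi * tn j by have := Hl _ Pphi j; rewrite lphi sub0r normrN.
have h2 := arN j _ (Nn j).
have h3 : nm a (n j) <= nm a (n 0) + 2.
  rewrite (_ : n j = fun x => n 0 x + (n j x - n 0 x)); last by apply/funext => x; ring.
  apply: le_trans (form_triangle sP fa _ _) _ => //; first exact: (psubB sP).
  by rewrite lerD2l; apply: le_trans (nd _ _) _; have := tn_le1 j; have := tn_le1 0; lra.
have t0 := tn_gt0 j.
have h4 : tn j * nm a (n j) <= tn j * (nm a (n 0) + 2) by rewrite ler_pM2l.
move: h1 h2; rewrite !ler_norml /K => /andP[_ h1] /andP[h2 _].
rewrite mulrDl [(_ + 2) * _]mulrC; lra.
Qed.

End HahnBanach.

Section Representation.
Context {R : realType}.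
Implicit Types (f g u v w phi : plane R -> R) (x : plane R) (i : bool).
Variables (y : plane R) (rho c : R) (Om : set (plane R)).
Hypothesis rho0 : 0 < rho.
Hypothesis c01 : 0 <= c <= 1.
Notation B := (eball y rho).

Let dB : dom B. Proof. by apply: dom_eball; exact: ltW. Qed.
Let c0 : 0 <= c. Proof. by case/andP: c01. Qed.
Let f1 : pform smooth (en 1 B). Proof. exact: en_form. Qed.
Let fc : pform smooth (en c B). Proof. exact: en_form. Qed.
Let mB : measurable (B : set (mplane R)). Proof. by case: dB. Qed.
Let sS := @smooth_sub R.

Lemma en_parts u q : test_function B u -> smooth q ->
  en c B u q = II B (fun x => u x * (c * q x - lap q x)).
Proof.
move=> tu sq; have [su _] := tu.
have mT : measurable (setT : set (mplane R)) := measurableT.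
have tuT : test_function setT u by apply: test_sub tu.
have sl : smooth (fun x => c * q x - lap q x) by apply: smoothB; [exact: smoothZ|exact: smooth_lap].
have t1 i : test_function B (fun x => pd i u x * pd i q x).
  by apply: testMr; [exact: test_pd|exact: smooth_pd].
have t2 : test_function B (fun x => c * (u x * q x)) by apply: testZ; exact: testMr.
have t3 i : test_function B (fun x => u x * pd i (pd i q) x).
  by apply: testMr => //; apply: smooth_pd; exact: smooth_pd.
have iT f : test_function B f -> integ setT f by exact: integ_test.
rewrite /en (@II_test _ B setT) //; last by apply: testD => //; exact: testD.
rewrite (@II_test _ B setT (fun x => u x * _)) //; last exact: testMr.
rewrite (IID mT (integD mT (iT _ (t1 false)) (iT _ (t1 true))) (iT _ t2)).
rewrite (IID mT (iT _ (t1 false)) (iT _ (t1 true))).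
have E i : II setT (fun x => pd i u x * pd i q x) = - II setT (fun x => u x * pd i (pd i q) x).
  by rewrite (II_parts i tuT (smooth_pd i sq)) opprK.
rewrite !E.
have -> : (fun x => u x * (c * q x - lap q x)) = (fun x => c * (u x * q x) - (u x * pd false (pd false q) x + u x * pd true (pd true q) x)).
  by apply/funext => x; rewrite /lap; ring.
rewrite (IIB mT (iT _ t2) (integD mT (iT _ (t3 false)) (iT _ (t3 true)))).
rewrite (IID mT (iT _ (t3 false)) (iT _ (t3 true))); ring.
Qed.

Lemma nm_mono D (c1 c2 : R) u : dom D -> D `<=` B -> 0 <= c1 -> c1 <= c2 -> smooth u ->
  nm (en c1 D) u <= nm (en c2 B) u.
Proof.
move=> dD DB c10 c12 su; have [mD _] := dD; apply: ler_wsqrtr.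
have sd t := smooth_cont (smooth_density t su su).
apply: (@le_trans _ _ (en c1 B u u)).
  apply: II_mono => //; first exact: dom_integ.
  move=> x _; rewrite -!expr2; apply: addr_ge0; first by apply: addr_ge0; exact: sqr_ge0.
  by apply: mulr_ge0 => //; exact: sqr_ge0.
apply: II_le => //; try exact: dom_integ.
by move=> x _; rewrite lerD2l ler_wpM2r // -expr2 sqr_ge0.
Qed.

(** The Poincare inequality on the support supplies the L^2 part that [en c] contains only with the
    weight [c], possibly 0. *)
Lemma energy_coercive u : test_function B u ->
  nm (en 1 B) u ^+ 2 <= (1 + 4 * rho ^+ 2) * nm (en c B) u ^+ 2.
Proof.
move=> tu; have [su _] := tu.
have mT : measurable (setT : set (mplane R)) := measurableT.
have tuT : test_function setT u by apply: test_sub tu.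
rewrite !(nm_sqr (P := smooth)) //.
have iT f : test_function B f -> integ setT f by exact: integ_test.
have tp i : test_function B (fun x => pd i u x ^+ 2) by apply: testX2; exact: test_pd.
have tuu : test_function B (fun x => u x ^+ 2) by exact: testX2.
have E t : en t B u u = II setT (fun x => pd false u x ^+ 2) + II setT (fun x => pd true u x ^+ 2) + t * II setT (fun x => u x ^+ 2).
  rewrite /en (@II_test _ B setT) //; last first.
    by apply: testD; [apply: testD|apply: testZ]; apply: testMr => //; [exact: test_pd|exact: smooth_pd|exact: test_pd|exact: smooth_pd].
  rewrite -(IIZ t mT (iT _ tuu)) -(IID mT (iT _ (tp false)) (iT _ (tp true))).
  by rewrite -(IID mT (integD mT (iT _ (tp false)) (iT _ (tp true))) (integZ t mT (iT _ tuu))).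
rewrite !E mul1r.
have h : II setT (fun x => u x ^+ 2) <= 4 * rho ^+ 2 * II setT (fun x => pd false u x ^+ 2).
  apply: (poincare (y := y)) => // x nb; apply: test_notin tu _ => /ltW hB; apply: nb; exact: (sqd_box (ltW rho0)).
have p i : 0 <= II setT (fun x => pd i u x ^+ 2) by apply: II_ge0 => x _; exact: sqr_ge0.
have q : 0 <= II setT (fun x => u x ^+ 2) by apply: II_ge0 => x _; exact: sqr_ge0.
have := p false; have := p true; move: h q; move: (II _ _) (II _ _) (II _ (fun x => pd true u x ^+ 2)) => U V W h q w v.
have r2 : 0 <= rho ^+ 2 by exact: sqr_ge0.
have := mulr_ge0 c0 q; move: (rho ^+ 2) r2 h => r r0 h cu; have := mulr_ge0 r0 w; have := mulr_ge0 r0 cu; nra.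
Qed.

Variables (S : (plane R -> R) -> Prop) (l : (plane R -> R) -> R) (C : R).
Hypothesis subS : psubspace S.
Hypothesis smS : forall q, S q -> smooth q.
Hypothesis lapS : forall q, S q -> forall x, lap q x = c * q x.
Hypothesis circS : forall n, (exists2 q, S q & forall x, sqd y x = rho ^+ 2 -> q x = (zre y n x).1) /\
     exists2 q, S q & forall x, sqd y x = rho ^+ 2 -> q x = (zre y n x).2.
Hypothesis mOm : measurable (Om : set (mplane R)).
Hypothesis OmB : Om `<=` B.
Hypothesis linl : plinear smooth l.
Hypothesis bdl : forall u, smooth u -> `|l u| <= C * nm (en 1 Om) u.
Hypothesis lS : forall q, S q -> l q = 0.

Let C0 : 0 <= `|C|. Proof. exact: normr_ge0. Qed.

Let dO : dom Om.
Proof. by split=> //; have [_ [a Ba]] := dB; exists a => x /OmB /Ba. Qed.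

Lemma bdlB u : smooth u -> `|l u| <= `|C| * nm (en 1 B) u.
Proof.
move=> su; apply: le_trans (bdl su) _; apply: (@le_trans _ _ (`|C| * nm (en 1 Om) u)).
  by apply: ler_wpM2r; rewrite ?nm_ge0 ?ler_norm.
by apply: ler_wpM2l => //; exact: nm_mono.
Qed.

Lemma orthoS u q : test_function B u -> S q -> en c B u q = 0.
Proof.
move=> tu Sq; rewrite en_parts //; last exact: smS.
by rewrite -(II0 B); apply: II_eq => x _; rewrite lapS // subrr mulr0.
Qed.

(* Valid for every smooth [phi], even though [psi] comes from the Riesz theorem
   for test functions of [B], because [l] vanishes on [S]. *)
Lemma representation (k : R) : 0 < k -> exists2 psi, test_function B psi &
  forall phi, smooth phi -> `|en c B psi phi - l phi| <= k * nm (en 1 B) phi.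
Proof.
move=> k0; have sT := test_subsp B.
have tS u : test_function B u -> smooth u by case.
have [aC aD aZ a0] := fc.
have fT : pform (test_function B) (en c B).
  split=> [f g /tS ? /tS ?|f g h /tS ? /tS ? /tS ?|t f g /tS ? /tS ?|f /tS ?];
  by [exact: aC|exact: aD|exact: aZ|exact: a0].
have [lD lZ] := linl.
have lT : plinear (test_function B) l.
  by split=> [f g /tS ? /tS ?|t f /tS ?]; [exact: lD|exact: lZ].
pose K := 1 + 4 * rho ^+ 2.
have K0 : 0 <= K by rewrite addr_ge0 // mulr_ge0 // sqr_ge0.
have bT u : test_function B u -> l u ^+ 2 <= (C ^+ 2 * K) * en c B u u.
  move=> tu; have su := tS _ tu; rewrite -(nm_sqr fT) // -mulrA.
  rewrite -(real_normK (num_real (l u))) -(real_normK (num_real C)).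
  apply: (@le_trans _ _ (`|C| ^+ 2 * nm (en 1 B) u ^+ 2)).
    by rewrite -exprMn ler_pXn2r ?nnegrE ?mulr_ge0 ?nm_ge0 //; exact: bdlB.
  by apply: ler_wpM2l; [exact: sqr_ge0|exact: energy_coercive].
have k20 : 0 < k ^+ 2 by rewrite exprn_gt0.
have [psi tpsi Hpsi] := riesz_approx sT fT lT bT k20; exists psi => // phi sphi.
have spsi := tS _ tpsi.
apply/ler_addgt0Pr => e e0.
pose M := k + nm (en c B) psi + `|C|.
have M0 : 0 < M by rewrite ltr_wpDr // ltr_wpDr // nm_ge0.
pose d := e / M.
have d0 : 0 < d by exact: divr_gt0.
have d20 : 0 < d ^+ 2 by rewrite exprn_gt0.
(* Split [phi = u + q + w]. The Riesz estimate handles the test function [u]; both [l] and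
   [en c B psi] vanish on [q]; and [w] is as small as desired. *)
have [u [q [tu Sq Hw]]] := disc_dense rho0 subS smS circS sphi d20.
have su := tS _ tu; have sq := smS Sq.
pose w x := phi x - u x - q x.
have sw : smooth w by apply: smoothB => //; exact: smoothB.
have w1 : nm (en 1 B) w <= d.
  by apply: le_trans (ler_norm _) _; apply: sqr_le; [exact: ltW|rewrite (nm_sqr f1)].
have wc : nm (en c B) w <= d.
  by apply: le_trans w1; apply: nm_mono => //; case/andP: c01.
have Ephi : phi = fun x => (u x + q x) + w x by apply/funext => x; rewrite /w; ring.
have suq : smooth (fun x => u x + q x) by exact: smoothD.
(* By Pythagoras, [u] and [q] being orthogonal for [en c B]. This is what bounds [u] by [phi],
   however large [q] may be. *)
have uq : nm (en c B) u <= nm (en c B) (fun x => u x + q x).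
  apply: ler_wsqrtr; have o := orthoS tu Sq.
  by rewrite aD // !(formDr sS fc) // (aC q u) // o addr0 add0r lerDl a0.
have uphi : nm (en c B) (fun x => u x + q x) <= nm (en 1 B) phi + d.
  have -> : (fun x => u x + q x) = (fun x => phi x + - w x) by apply/funext => x; rewrite /w; ring.
  apply: le_trans (form_triangle sS fc sphi (smoothN sw)) _; rewrite (nmN sS fc) // lerD //.
  by apply: nm_mono => //; case/andP: c01.
have El : l phi = l u + l w by rewrite {1}Ephi (lD _ _ suq sw) (lD _ _ su sq) (lS Sq) addr0.
have Ea : en c B psi phi = en c B psi u + en c B psi w.
  by rewrite {1}Ephi (formDr sS fc suq sw spsi) (formDr sS fc su sq spsi) (orthoS tpsi Sq) addr0.
have E : en c B psi phi - l phi = (en c B psi u - l u) + (en c B psi w - l w).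
  by rewrite El Ea; move: (en _ _ _ _) (en _ _ _ w) => p1 p2; ring.
rewrite E; apply: le_trans (ler_normD _ _) _.
have h1 : `|en c B psi u - l u| <= k * nm (en c B) u.
  apply: sqr_le; first by rewrite mulr_ge0 ?nm_ge0 // ltW.
  by rewrite exprMn (nm_sqr fT) // Hpsi.
have h2 : `|en c B psi w - l w| <= (nm (en c B) psi + `|C|) * d.
  apply: le_trans (ler_normB _ _) _; rewrite mulrDl lerD //.
    apply: le_trans (form_CSn sS fc spsi sw) _; apply: ler_wpM2l => //; exact: nm_ge0.
  by apply: le_trans (bdlB sw) _; apply: ler_wpM2l.
have h3 : k * nm (en c B) u <= k * (nm (en 1 B) phi + d) by rewrite ler_pM2l // (le_trans uq).
have Md : M * d = e by rewrite /d; field; rewrite gt_eqF.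
move: Md; rewrite /M; lra.
Qed.

End Representation.

(** * The weak limit of the representing test functions *)

Section Functional.
Context {R : realType}.
Implicit Types (f g u v w phi : plane R -> R) (x : plane R) (i : bool).
Variables (y : plane R) (rho c : R) (l : (plane R -> R) -> R) (psi : nat -> plane R -> R).
Hypothesis rho0 : 0 < rho.
Hypothesis c01 : 0 <= c <= 1.
Notation B := (eball y rho).
Hypothesis tpsi : forall j, test_function B (psi j).
Hypothesis Hpsi : forall j phi, smooth phi -> `|en c B (psi j) phi - l phi| <= tn j * nm (en 1 B) phi.

Let dB : dom B. Proof. by apply: dom_eball; exact: ltW. Qed.
Let c0 : 0 <= c. Proof. by case/andP: c01. Qed.
Let f1 : pform smooth (en 1 B). Proof. exact: en_form. Qed.
Let fc : pform smooth (en c B). Proof. exact: en_form. Qed.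
Let mB : measurable (B : set (mplane R)). Proof. by case: dB. Qed.
Let sS := @smooth_sub R.
Let spsi j : smooth (psi j). Proof. by case: (tpsi j). Qed.

(** Test the two representations with the difference [psi i - psi j] itself: [l] cancels and its
    energy remains. Coercivity then passes from [en c] to [en 1]. *)
Lemma psi_cauchy (i j : nat) : nm (en 1 B) (fun x => psi i x - psi j x) <= (1 + 4 * rho ^+ 2) * (tn i + tn j).
Proof.
pose d x := psi i x - psi j x.
have td : test_function B d by exact: testB.
have sd : smooth d by case: td.
have K0 : 0 <= 1 + 4 * rho ^+ 2 by rewrite addr_ge0 // mulr_ge0 // sqr_ge0.
apply: le_of_sqr; rewrite ?nm_ge0 //; first by rewrite mulr_ge0 // addr_ge0 // ltW // tn_gt0.
apply: le_trans (energy_coercive rho0 c01 td) _; rewrite -mulrA; apply: ler_wpM2l => //.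
rewrite (nm_sqr fc sd) (formBl sS fc) //.
have := Hpsi i sd; have := Hpsi j sd; rewrite !ler_norml mulrDl => /andP[h1 _] /andP[_ h2].
move: h1 h2; rewrite -/d; lra.
Qed.

Let V := Num.sqrt (II B (fun=> 1)).

Lemma II_bound f g (m : R) : continuous f -> smooth g -> 0 <= m -> (forall x, B x -> `|f x| <= m) ->
  `|II B (fun x => f x * g x)| <= m * V * nm (en 1 B) g.
Proof.
move=> cf sg m0 fm; have cg := smooth_cont sg.
have cM (h k : plane R -> R) : continuous h -> continuous k -> continuous (fun x : plane R => h x * k x : R).
  by move=> ch ck x; apply: continuousM; [exact: ch|exact: ck].
have IfF : integ B (fun x => f x * f x) by apply: dom_integ => //; exact: cM.
have Ifg : integ B (fun x => f x * g x) by apply: dom_integ => //; exact: cM.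
have Igg : integ B (fun x => g x * g x) by apply: dom_integ => //; exact: cM.
have I1 : integ B (fun=> 1) by apply: dom_integ => // x; exact: cst_continuous.
have v0 : 0 <= II B (fun=> 1) by apply: II_ge0.
apply: sqr_le; first by rewrite !mulr_ge0 ?nm_ge0 ?sqrtr_ge0.
apply: le_trans (II_CS mB IfF Ifg Igg) _.
rewrite !exprMn sqr_sqrtr // (nm_sqr f1 sg); apply: ler_pM.
- by apply: II_ge0 => x _; rewrite -expr2 sqr_ge0.
- by apply: II_ge0 => x _; rewrite -expr2 sqr_ge0.
- rewrite -(IIZ (m ^+ 2) mB I1); apply: II_le => //; first exact: integZ.
  move=> x Bx; rewrite mulr1 -expr2 -real_normK ?num_real // ler_pXn2r ?nnegrE //; exact: fm.
- apply: II_le => //; first by apply: dom_integ => //; apply: smooth_cont; exact: smooth_density.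
  by move=> x _; rewrite mul1r lerDr -!expr2 addr_ge0 // sqr_ge0.
Qed.

(** The integrals of [f psi j] form a Cauchy sequence with rate proportional to [tn j] and to the
    supremum of [|f|] on [B], by Cauchy-Schwarz and [psi_cauchy]. *)
Lemma weak_limit : exists U : (plane R -> R) -> R, exists M, 0 <= M /\
  forall f (m : R), continuous f -> 0 <= m -> (forall x, B x -> `|f x| <= m) ->
    forall j, `|U f - II B (fun x => f x * psi j x)| <= M * m * tn j.
Proof.
pose M := V * (1 + 4 * rho ^+ 2).
have M0 : 0 <= M by rewrite mulr_ge0 ?sqrtr_ge0 // addr_ge0 // mulr_ge0 // sqr_ge0.
have cau f (m : R) (i j : nat) : continuous f -> 0 <= m -> (forall x, B x -> `|f x| <= m) ->
    `|II B (fun x => f x * psi i x) - II B (fun x => f x * psi j x)| <= M * m * (tn i + tn j).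
  move=> cf m0 fm.
  have If k : integ B (fun x => f x * psi k x).
    by apply: dom_integ => // x; apply: continuousM; [exact: cf|exact: smooth_cont].
  rewrite -(IIB mB (If i) (If j)).
  have -> : (fun x => f x * psi i x - f x * psi j x) = (fun x => f x * (psi i x - psi j x)).
    by apply/funext => x; ring.
  apply: le_trans (II_bound cf (smoothB (spsi i) (spsi j)) m0 fm) _.
  rewrite /M (_ : _ * _ * m * _ = m * V * ((1 + 4 * rho ^+ 2) * (tn i + tn j))); last by ring.
  by apply: ler_wpM2l; [rewrite mulr_ge0 // sqrtr_ge0|exact: psi_cauchy].
have bd f : continuous f -> exists m : R, 0 <= m /\ forall x, B x -> `|f x| <= m.
  move=> cf; have [m Hm] := cont_bounded_box y rho cf; exists `|m|; split=> // x Bx.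
  apply: le_trans (Hm x _) (ler_norm m); apply: sqd_box; exact: ltW.
have /choice[U HU] : forall f, exists l, continuous f -> exists m : R, forall j,
    `|l - II B (fun x => f x * psi j x)| <= m * tn j.
  move=> f; have [cf|ncf] := pselect (continuous f); last by exists 0.
  have [m [m0 fm]] := bd f cf; have [u Hu] := tn_lim (fun p q => cau f m p q cf m0 fm).
  by exists u => _; exists (M * m).
exists U, M; split=> // f m cf m0 fm j; have [m' Hm'] := HU f cf.
apply/ler_addgt0Pr => e e0; have [i Hi] := tn_small (m' + M * m) e0.
rewrite -(subrKA (II B (fun x => f x * psi i x))); apply: le_trans (ler_normD _ _) _.
have h1 := Hm' i; have h2 := cau f m i j cf m0 fm; have h3 := Hi i (leqnn i).
move: h2 h3; rewrite mulrDr mulrDl; move: h1; lra.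
Qed.

Variables (U : (plane R -> R) -> R) (M : R) (Om : set (plane R)).
Hypothesis M0 : 0 <= M.
Hypothesis HU : forall f (m : R), continuous f -> 0 <= m -> (forall x, B x -> `|f x| <= m) ->
    forall j, `|U f - II B (fun x => f x * psi j x)| <= M * m * tn j.
Hypothesis lOm : forall phi, smooth phi -> (forall x, Om x -> phi x = 0) -> l phi = 0.

Let bd f : continuous f -> exists m : R, 0 <= m /\ forall x, B x -> `|f x| <= m.
Proof.
move=> cf; have [m Hm] := cont_bounded_box y rho cf; exists `|m|; split=> // x Bx.
apply: le_trans (Hm x _) (ler_norm m); apply: sqd_box; exact: ltW.
Qed.

Let UE f (u : nat -> R) K : continuous f -> (forall j, `|II B (fun x => f x * psi j x) - u j| <= K * tn j) ->
  forall (L t : R), (forall j, `|u j - t| <= L * tn j) -> U f = t.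
Proof.
move=> cf Hu L t Ht; have [m [m0 fm]] := bd cf; apply/eqP; rewrite -subr_eq0; apply/eqP.
apply: (@tn_squeeze _ _ (M * m + K + L)) => j.
have h1 := HU cf m0 fm j; have h2 := Hu j; have h3 := Ht j.
rewrite (_ : U f - t = (U f - II B (fun x => f x * psi j x)) + (II B (fun x => f x * psi j x) - u j) + (u j - t)); last by ring.
by rewrite !mulrDl; apply: le_trans (ler_normD _ _) _; apply: lerD => //; apply: le_trans (ler_normD _ _) _; apply: lerD.
Qed.

Let If f k : continuous f -> integ B (fun x => f x * psi k x).
Proof. by move=> cf; apply: dom_integ => // x; apply: continuousM; [exact: cf|exact: smooth_cont]. Qed.

Lemma weak_limitD f g : continuous f -> continuous g -> U (fun x => f x + g x) = U f + U g.
Proof.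
move=> cf cg; have [m [m0 fm]] := bd cf; have [n [n0 gn]] := bd cg.
apply: (@UE _ (fun j => II B (fun x => f x * psi j x) + II B (fun x => g x * psi j x)) 0 _ _ (M * m + M * n)).
- by move=> x; apply: continuousD; [exact: cf|exact: cg].
- move=> j; rewrite -(IID mB (If j cf) (If j cg)) mul0r normr_le0 subr_eq0; apply/eqP.
  by apply: II_eq => x _; ring.
move=> j; have h1 := HU cf m0 fm j; have h2 := HU cg n0 gn j.
rewrite opprD addrACA mulrDl; apply: le_trans (ler_normD _ _) _.
by rewrite distrC [X in _ + X]distrC lerD.
Qed.

Lemma weak_limitZ (a : R) f : continuous f -> U (fun x => a * f x) = a * U f.
Proof.
move=> cf; have [m [m0 fm]] := bd cf.
apply: (@UE _ (fun j => a * II B (fun x => f x * psi j x)) 0 _ _ (`|a| * (M * m))).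
- by move=> x; apply: continuousM; [exact: cst_continuous|exact: cf].
- move=> j; rewrite -(IIZ a mB (If j cf)) mul0r normr_le0 subr_eq0; apply/eqP.
  by apply: II_eq => x _; ring.
by move=> j; rewrite -mulrBr normrM -mulrA distrC; apply: ler_wpM2l => //; exact: HU.
Qed.

Lemma weak_limit_bound : exists2 K, 0 <= K & forall f (m : R), continuous f -> 0 <= m ->
  (forall x, B x -> `|f x| <= m) -> `|U f| <= K * m.
Proof.
exists (M + V * nm (en 1 B) (psi 0)); first by rewrite addr_ge0 // mulr_ge0 ?sqrtr_ge0 ?nm_ge0.
move=> f m cf m0 fm; rewrite -(subrK (II B (fun x => f x * psi 0 x)) (U f)).
apply: le_trans (ler_normD _ _) _; rewrite mulrDl; apply: lerD.
  by have := HU cf m0 fm 0%N; rewrite /tn invr1 mulr1.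
by rewrite mulrC mulrA; exact: II_bound.
Qed.

(** Here [l phi = 0], so the energy products of [psi j] with [phi] tend to 0, and after integration
    by parts these are the integrals of [psi j (c phi - lap phi)]. Since [phi] is free on the circle
    bounding [B], this is the equation for the extension of [U] by zero, across that circle
    included. *)
Lemma weak_limit_lap phi : smooth phi -> (forall x, Om x -> phi x = 0) -> U (lap phi) = c * U phi.
Proof.
move=> sp p0; have cp := smooth_cont sp; have cl := smooth_cont (smooth_lap sp).
have cZ : continuous (fun x => c * phi x) by exact: smooth_cont (smoothZ c sp).
have [m [m0 fm]] := bd cZ.
rewrite -weak_limitZ //.
apply: (@UE _ (fun j => II B (fun x => c * phi x * psi j x)) (nm (en 1 B) phi) _ _ (M * m)) => // j.
  rewrite -(IIB mB (If j cl) (If j cZ)).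
  have -> : II B (fun x => lap phi x * psi j x - c * phi x * psi j x) = - en c B (psi j) phi.
    rewrite (en_parts c (tpsi j) sp) -mulN1r -IIZ //.
      by apply: II_eq => x _; ring.
    apply: dom_integ => //; apply: smooth_cont; apply: smoothM => //.
    by apply: smoothB; [exact: smoothZ|exact: smooth_lap].
  by rewrite normrN mulrC; have := Hpsi j sp; rewrite (lOm sp p0) subr0.
by rewrite distrC; exact: HU.
Qed.

End Functional.

(** * Mollification of the weak limit and its support *)

Section ZeroSet.
Context {R : realType}.
Implicit Types (f g u v w phi eta : plane R -> R) (x z : plane R) (i : bool).

Lemma refl_line eta i x z (t : R) : smooth eta ->
  is_derive t (1 : R) (fun t : R => eta (x - (t *: ax i + z))) (- pd i eta (x - (t *: ax i + z))).
Proof.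
move=> se.
have H2 : is_derive t (1 : R) (-%R : R -> R) (-1 : R) by apply: is_deriveN; exact: is_derive_id.
have E s : x - (s *: ax i + z) = x - z + (- s) *: ax i by rewrite scaleNr opprD addrCA [RHS]addrC.
have := @is_derive1_comp _ (fun s : R => eta (x - z + s *: ax i)) -%R t _ _ (is_derive_axis i (x - z) (- t) se) H2.
by rewrite mulrN1 -E; congr is_derive; apply/funext => s; rewrite /= E.
Qed.

Lemma refl_der eta i x : smooth eta ->
  (forall z, derivable (fun z => eta (x - z)) z (ax i)) /\
  pd i (fun z => eta (x - z)) = fun z => - pd i eta (x - z).
Proof.
move=> se; have D z : derivable (fun z => eta (x - z)) z (ax i).
  by apply/derivable_line; have := refl_line i x z 0 se => -[].
split=> //; apply/funext => z; rewrite [LHS](congr1 (@^~ z) (pdE _ _)).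
have D1 := is_derive_line (D z); have D2 := refl_line i x z 0 se.
rewrite -(@derive_val _ _ _ _ _ _ _ D1) (@derive_val _ _ _ _ _ _ _ D2).
by rewrite scale0r add0r.
Qed.

Lemma smooth_refl eta x : smooth eta -> smooth (fun z => eta (x - z)).
Proof.
move=> se; apply: (@smooth_coind _ (fun g => exists2 eta, smooth eta & g = fun z => eta (x - z))); last by exists eta.
move=> _ [h sh ->]; split.
  move=> z; apply: (@continuous_comp _ _ _ (fun z => x - z) h); last exact: smooth_cont.
  by apply: continuousB; [exact: cst_continuous|exact: cvg_id].
move=> i; have [D E] := refl_der i x sh; split=> //.
exists (fun z => - pd i h z); first by apply: smoothN; exact: smooth_pd.
by rewrite E.
Qed.

Lemma lap_refl eta x z : smooth eta -> lap (fun z => eta (x - z)) z = lap eta (x - z).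
Proof.
move=> se; rewrite /lap.
have E i : pd i (pd i (fun z => eta (x - z))) z = pd i (pd i eta) (x - z).
  have [_ ->] := refl_der i x se.
  rewrite pdNs; last by apply: smooth_refl; exact: smooth_pd.
  by have [_ ->] := refl_der i x (smooth_pd i se); rewrite opprK.
by rewrite !E.
Qed.

Lemma taylor1 eta (M : R) i x (h : R) : smooth eta -> (forall i j x, `|pd i (pd j eta) x| <= M) ->
  `|eta (x + h *: ax i) - eta x - h * pd i eta x| <= M * h ^+ 2.
Proof.
move=> se HM; have L := pd_bound_lip (smooth_pd i se) (fun j x => HM j i x).
have L1 z (t : R) : `|pd i eta (z + t *: ax i) - pd i eta z| <= M * `|t|.
  apply: le_trans (L _ _) _; rewrite scale_ax.
  by case: (i); rewrite /= ?addr0 ?subrr ?normr0 ?addr0 ?add0r [_ + t]addrC addrK.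
have M0 : 0 <= M by apply: le_trans (normr_ge0 _) (HM false false x).
have [h0|h0] := leP 0 h.
  have [t /andP[t0 th] ->] := MVT_ax i x se h0.
  rewrite [_ * h]mulrC -mulrBr normrM (ger0_norm h0) expr2 mulrCA; apply: ler_wpM2l => //.
  by apply: le_trans (L1 _ _) _; apply: ler_wpM2l => //; rewrite ger0_norm.
have h1 : 0 <= - h by rewrite oppr_ge0 ltW.
have [t /andP[t0 th]] := MVT_ax i (x + h *: ax i) se h1.
have -> : x + h *: ax i + (- h) *: ax i = x by rewrite -addrA -scalerDl subrr scale0r addr0.
have -> : x + h *: ax i + t *: ax i = x + (h + t) *: ax i by rewrite -addrA -scalerDl.
move=> E.
have -> : eta (x + h *: ax i) - eta x - h * pd i eta x = h * (pd i eta (x + (h + t) *: ax i) - pd i eta x).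
  by rewrite -(opprB (eta x)) E; ring.
rewrite normrM -[X in _ <= _ * X]real_normK ?num_real // expr2 mulrCA; apply: ler_wpM2l => //.
apply: le_trans (L1 _ _) _; apply: ler_wpM2l => //.
by rewrite (ltr0_norm h0) ler_norml; apply/andP; split; lra.
Qed.

Lemma sqd_triangle (a b : R) x y z : 0 <= a -> 0 <= b -> sqd x y <= a ^+ 2 -> sqd y z <= b ^+ 2 ->
  sqd x z <= (a + b) ^+ 2.
Proof.
move=> a0 b0; rewrite /sqd.
have -> : z.1 - x.1 = (y.1 - x.1) + (z.1 - y.1) by ring.
have -> : z.2 - x.2 = (y.2 - x.2) + (z.2 - y.2) by ring.
move: (y.1 - x.1) (z.1 - y.1) (y.2 - x.2) (z.2 - y.2) => p q p' q' ha hb.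
have : (p * q + p' * q') ^+ 2 <= (a * b) ^+ 2.
  apply: (@le_trans _ _ ((p ^+ 2 + p' ^+ 2) * (q ^+ 2 + q' ^+ 2))).
    rewrite -subr_ge0 (_ : _ - _ = (p * q' - p' * q) ^+ 2); last by ring.
    exact: sqr_ge0.
  by rewrite exprMn; apply: ler_pM => //; rewrite addr_ge0 // sqr_ge0.
move=> /(sqr_le (mulr_ge0 a0 b0)); rewrite ler_norml => /andP[_ h].
move: ha hb h; nra.
Qed.

Lemma sqd_triangle_lt (a b : R) x y z : 0 < a -> 0 <= b -> sqd x y < a ^+ 2 -> sqd y z <= b ^+ 2 ->
  sqd x z < (a + b) ^+ 2.
Proof.
move=> a0 b0 ha hb; pose a' := Num.sqrt (sqd x y).
have a'0 : 0 <= a' by exact: sqrtr_ge0.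
have a'E : a' ^+ 2 = sqd x y by rewrite sqr_sqrtr // sqd_ge0.
have a'a : a' < a by rewrite -(@ltr_pXn2r _ 2) ?nnegrE // ?(ltW a0) // a'E.
have := @sqd_triangle a' b x y z a'0 b0; rewrite a'E => /(_ (lexx _) hb) /le_lt_trans; apply.
by rewrite ltr_pXn2r ?nnegrE ?addr_ge0 // ?(ltW a0) // ltrD2r.
Qed.

Lemma sqdC x z : sqd x z = sqd z x. Proof. by rewrite /sqd; ring. Qed.

(** A bump on [-1, 1] written as a difference of steps, so that the sum of its integer translates
    telescopes to 1. *)
Definition beta (t : R) : R := step (t + 1) - step t.

Lemma beta_ge0 t : 0 <= beta t.
Proof.
rewrite /beta; have [h|h] := leP t 0.
  by rewrite (step_le0 h) subr0 step_ge0.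
by rewrite step_ge1 ?subr_ge0 ?step_le1 //; lra.
Qed.

Lemma beta0 t : 1 <= `|t| -> beta t = 0.
Proof.
rewrite /beta ler_normr => /orP[h|h].
  by rewrite !step_ge1 ?subrr //; lra.
by rewrite !step_le0 ?subrr //; lra.
Qed.

Lemma beta_sum (N : nat) t : `|t| + 1 <= N%:R -> \sum_(i < N + N) beta (i%:R - N%:R - t) = 1.
Proof.
move=> tN; have /andP[t1 t2] : (- N%:R <= t - 1 <= N%:R - 2).
  by have := ler_norm t; have := ler_norm (- t); rewrite normrN; move: tN; move: (`|t|) => u; lra.
have -> : \sum_(i < N + N) beta (i%:R - N%:R - t) = \sum_(0 <= i < N + N) (step (i.+1%:R - N%:R - t) - step (i%:R - N%:R - t)).
  by rewrite big_mkord; apply: eq_bigr => i _; rewrite /beta -natr1; congr (step _ - _); ring.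
rewrite (telescope_sumr (fun i : nat => step (i%:R - N%:R - t))) // natrD addrK mulr0n sub0r.
have := ler_norm (- t); rewrite normrN => h3.
by rewrite step_ge1 ?step_le0 ?subr0 //; move: tN h3; move: (`|t|) => u; lra.
Qed.

Definition bump2 (s : R) : plane R -> R := fun z => beta (z.1 / s) * beta (z.2 / s).

Lemma smooth_beta f : smooth f -> smooth (fun x => beta (f x)).
Proof.
move=> sf; apply: smoothB; last exact: smooth_step.
by apply: smooth_step; apply: smoothD => //; exact: smooth_cst.
Qed.

Lemma smooth_bump2 s : smooth (bump2 s).
Proof.
by apply: smoothM; apply: smooth_beta; apply: smoothM;
  [exact: smooth_fst|exact: smooth_cst|exact: smooth_snd|exact: smooth_cst].
Qed.

Lemma bump2_supp (s : R) z : 0 < s -> s <= `|z.1| \/ s <= `|z.2| -> bump2 s z = 0.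
Proof.
move=> s0 H; have E (t : R) : s <= `|t| -> beta (t / s) = 0.
  by move=> h; apply: beta0; rewrite normrM normfV (gtr0_norm s0) ler_pdivlMr // mul1r.
by rewrite /bump2; case: H => /E ->; rewrite ?mul0r ?mulr0.
Qed.

Lemma bump2_sqd (s : R) x z : 0 < s -> (2 * s) ^+ 2 <= sqd x z -> bump2 s (x - z) = 0.
Proof.
move=> s0 h; apply: bump2_supp => //.
have [h1|h1] := leP s `|(x - z).1|; first by left.
have [h2|h2] := leP s `|(x - z).2|; first by right.
exfalso; move: h; rewrite leNgt => /negP; apply.
have S (t : R) : `|t| < s -> t ^+ 2 < s ^+ 2.
  by move=> ht; rewrite -real_normK ?num_real // ltr_pXn2r // nnegrE // ltW.
have := S _ h1; have := S _ h2; rewrite /sqd /= -[(x.1 - z.1) ^+ 2]sqrrN -[(x.2 - z.2) ^+ 2]sqrrN !opprB.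
rewrite exprMn; nra.
Qed.

Lemma test_bump2 (s : R) : 0 < s -> test_function setT (bump2 s).
Proof.
move=> s0; apply: (@test_of_supp _ _ [set z | sqd 0 z <= (2 * s) ^+ 2]); first exact: smooth_bump2.
  exact: compact_sqd_le.
move=> z /= /negP; rewrite -ltNge => h.
by rewrite -[z]subr0; apply: bump2_sqd => //; rewrite sqdC ltW.
Qed.

Variables (U : (plane R -> R) -> R) (M c rho : R) (y0 : plane R) (Om : set (plane R)).
Hypothesis rho0 : 0 < rho.
Hypothesis M0 : 0 <= M.
Hypothesis c01 : 0 <= c <= 1.
Notation B := (eball y0 rho).
Hypothesis UD : forall f g, continuous f -> continuous g -> U (fun x => f x + g x) = U f + U g.
Hypothesis UZ : forall (a : R) f, continuous f -> U (fun x => a * f x) = a * U f.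
Hypothesis Ub : forall f (m : R), continuous f -> 0 <= m -> (forall x, B x -> `|f x| <= m) -> `|U f| <= M * m.
Hypothesis Ulap : forall phi, smooth phi -> (forall x, Om x -> phi x = 0) -> U (lap phi) = c * U phi.

Let cZ (a : R) f : continuous f -> continuous (fun x => a * f x : R).
Proof. by move=> cf x; apply: (@cvgM R _ (nbhs x) _ (cst a) f); [exact: cvg_cst|exact: cf]. Qed.

Let U0 : U (fun=> 0) = 0.
Proof.
have c0 : continuous (fun _ : plane R => 0 : R) by move=> x; exact: cst_continuous.
have : `|U (fun=> 0)| <= M * 0 by apply: Ub => // x _; rewrite normr0.
by rewrite mulr0 normr_le0 => /eqP.
Qed.

Let UB f g : continuous f -> continuous g -> U (fun x => f x - g x) = U f - U g.
Proof.
move=> cf cg; have cN : continuous (fun x => -1 * g x).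
  exact: cZ.
rewrite -mulN1r -UZ // -UD //; congr U; apply/funext => x; by rewrite mulN1r.
Qed.

Definition conv eta x := U (fun z => eta (x - z)).

Let cr eta x : smooth eta -> continuous (fun z => eta (x - z)).
Proof. by move=> se; apply: smooth_cont; exact: smooth_refl. Qed.

(** The first-order Taylor remainder of [eta] is at most [K h^2] uniformly, and [U] is bounded by
    the supremum over [B]; hence derivatives pass through [U] onto [eta]. *)
Lemma conv_der eta i x : test_function setT eta ->
  is_derive x (ax i) (conv eta) (conv (pd i eta) x).
Proof.
move=> te; have [se _] := te; have [K K0 [_ _ HK]] := test_pd_bound te.
have sp := smooth_pd i se.
have est (h : R) : `|conv eta (x + h *: ax i) - conv eta x - h * conv (pd i eta) x| <= M * (K * h ^+ 2).
  have ch : continuous (fun z => h * pd i eta (x - z)).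
    by apply: cZ; exact: cr.
  have cd : continuous (fun z => eta (x + h *: ax i - z) - eta (x - z)).
    by move=> z; apply: continuousB; exact: cr.
  rewrite /conv -UB; [|exact: cr|exact: cr].
  rewrite -UZ; last exact: cr.
  rewrite -UB //; apply: Ub.
  - by move=> z; apply: (@continuousB R _ _ (fun z => eta (x + h *: ax i - z) - eta (x - z)) (fun z => h * pd i eta (x - z))); [exact: cd|exact: ch].
  - by rewrite mulr_ge0 ?sqr_ge0 // ltW.
  by move=> z _; rewrite (_ : x + h *: ax i - z = x - z + h *: ax i); [exact: taylor1|rewrite addrAC].
have C : (fun h : R => h^-1 *: ((conv eta \o shift x) (h *: ax i) - conv eta x)) @ 0^' --> conv (pd i eta) x.
  apply/cvgrPdist_le => e e0.
  have d0 : 0 < e / (M * K + 1) by rewrite divr_gt0 // ltr_wpDl // mulr_ge0 // ltW.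
  near=> h.
  have hn : h != 0 by near: h; exact: nbhs_dnbhs_neq.
  have hd : `|h| <= e / (M * K + 1) by near: h; exact: dnbhs0_le.
  rewrite distrC /= [h *: _ + x]addrC.
  have -> : h^-1 *: (conv eta (x + h *: ax i) - conv eta x) - conv (pd i eta) x =
     h^-1 * (conv eta (x + h *: ax i) - conv eta x - h * conv (pd i eta) x).
    by rewrite mulrBr mulKf.
  rewrite normrM normfV mulrC ler_pdivrMr ?normr_gt0 //; apply: le_trans (est h) _.
  rewrite -real_normK ?num_real // expr2 !mulrA ler_pM2r ?normr_gt0 //.
  apply: (@le_trans _ _ ((M * K + 1) * `|h|)); first by rewrite mulrDl mul1r lerDl.
  by rewrite mulrC -ler_pdivlMr // ltr_wpDl // mulr_ge0 // ltW.
by split; [apply/cvg_ex; exists (conv (pd i eta) x)|exact: (cvg_lim (@Rhausdorff R) C)].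
Unshelve. all: by end_near. Qed.

Lemma pd_conv eta i : test_function setT eta -> pd i (conv eta) = conv (pd i eta).
Proof.
move=> te; apply/funext => x; rewrite [LHS](congr1 (@^~ x) (pdE _ _)).
exact: (@derive_val _ _ _ _ _ _ _ (conv_der i x te)).
Qed.

Lemma conv_cont eta : test_function setT eta -> continuous (conv eta).
Proof.
move=> te; have [se _] := te; have [K K0 [_ HK _]] := test_pd_bound te.
move=> x; apply/cvgrPdist_le => e e0.
have d0 : 0 < e / (M * K + M * K + 1) by rewrite divr_gt0 // ltr_wpDl // addr_ge0 // mulr_ge0 // ltW.
suff H : nbhs x [set z | `|conv eta x - conv eta z| <= e] by exact: H.
apply/nbhs_eball; exists (e / (M * K + M * K + 1)) => // z /ltW /(sqd_coord (ltW d0))[].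
rewrite distrC [X in _ -> X <= _ -> _]distrC => h1 h2; rewrite /=.
rewrite /conv -UB; [|exact: cr|exact: cr].
apply: (@le_trans _ _ (M * (K * (`|x.1 - z.1| + `|x.2 - z.2|)))).
  apply: Ub => [p| |p _].
  - by apply: continuousB; exact: cr.
  - by rewrite mulr_ge0 ?(ltW K0) // addr_ge0.
  apply: le_trans (pd_bound_lip se HK _ _) _; rewrite /= !opprB.
  by rewrite !addrA !subrK.
apply: (@le_trans _ _ ((M * K + M * K + 1) * (e / (M * K + M * K + 1)))); last first.
  by rewrite mulrC divfK // gt_eqF // ltr_wpDl // addr_ge0 // mulr_ge0 // ltW.
have MK : 0 <= M * K by rewrite mulr_ge0 // ltW.
move: h1 h2 d0; rewrite mulrA; move: (M * K) MK (e / _) (`|_|) (`|x.2 - _|) => m m0 t p q hp hq t0.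
nra.
Qed.

Lemma smooth_conv eta : test_function setT eta -> smooth (conv eta).
Proof.
move=> te; apply: (@smooth_coind _ (fun g => exists2 eta, test_function setT eta & g = conv eta)); last by exists eta.
move=> _ [h th ->]; split; first exact: conv_cont.
move=> i; split=> [x|]; first by have [] := conv_der i x th.
by exists (pd i h); [exact: test_pd|exact: pd_conv].
Qed.

(** The passage from the weak equation to a pointwise one: the reflected kernel [eta (x - z)], as a
    function of [z], vanishes on [Om] and is thus admissible in [Ulap]. *)
Lemma lap_conv eta x : test_function setT eta -> (forall z, Om z -> eta (x - z) = 0) ->
  lap (conv eta) x = c * conv eta x.
Proof.
move=> te e0; have [se _] := te.
have -> : lap (conv eta) x = conv (lap eta) x.
  rewrite /lap !pd_conv //; try exact: test_pd.
  rewrite /conv -UD //; apply: cr; apply: smooth_pd; exact: smooth_pd.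
rewrite /conv -Ulap //; last exact: smooth_refl.
by congr U; apply/funext => z; rewrite lap_refl.
Qed.

Definition Uzero x (a : R) := forall f, test_function (eball x a) f -> U f = 0.

Lemma U_sum (I : Type) (s : seq I) (F : I -> plane R -> R) : (forall j, smooth (F j)) ->
  U (fun x => \sum_(j <- s) F j x) = \sum_(j <- s) U (F j).
Proof.
move=> sF; elim: s => [|j s IH].
  by rewrite big_nil -[RHS]U0; congr U; apply/funext => x; rewrite big_nil.
rewrite big_cons -IH -UD; [|exact: smooth_cont|by apply: smooth_cont; exact: smooth_sum].
by congr U; apply/funext => x; rewrite big_cons.
Qed.

(** Interpolating [f] on a grid of step [s] by the bumps [bump2 s] gives a function close to [f]
    uniformly on [B], and [U] sends it to the sum of the values [f (P i j)] times the convolution at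
    [P i j]. Each product is 0: off the disc [f] vanishes, in it the convolution does. *)
Lemma Uzero_of_conv x (a s0 : R) : 0 < s0 ->
  (forall s, 0 < s -> s <= s0 -> forall z, eball x a z -> conv (bump2 s) z = 0) -> Uzero x a.
Proof.
move=> s00 H f tf; have [sf _] := tf.
have [K K0 [_ HK _]] := test_pd_bound tf; have L := pd_bound_lip sf HK.
apply/eqP; rewrite -normr_le0; apply/ler_addgt0Pr => e e0; rewrite add0r.
pose s := Num.min s0 (e / (M * (2 * K) + 1)).
have MK1 : 0 < M * (2 * K) + 1 by rewrite ltr_wpDl // !mulr_ge0 // ltW.
have ss : 0 < s by rewrite lt_min s00 divr_gt0.
(* Large enough that the grid indices from [-N] to [N - 1] give bumps summing to 1 at every point of
   [B]. *)
pose N := (Num.truncn ((`|y0.1| + `|y0.2| + rho) / s + 1)).+1.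
pose P (i j : nat) : plane R := (s * (i%:R - N%:R), s * (j%:R - N%:R)).
pose F z := \sum_(i < N + N) \sum_(j < N + N) f (P i j) * bump2 s (P i j - z).
have sb p : smooth (fun z => f p * bump2 s (p - z)).
  by apply: smoothZ; apply: smooth_refl; exact: smooth_bump2.
have sF : smooth F by apply: smooth_sum => i; apply: smooth_sum => j.
have UF : U F = 0.
  rewrite /F (@U_sum _ _ (fun (i : 'I_(N + N)) z => \sum_(j < N + N) f (P i j) * bump2 s (P i j - z))); last first.
    by move=> i; apply: smooth_sum => j.
  apply: big1 => i _; rewrite (@U_sum _ _ (fun (j : 'I_(N + N)) z => f (P i j) * bump2 s (P i j - z))) //.
  apply: big1 => j _; rewrite UZ; last by apply: cr; exact: smooth_bump2.
  have [Pa|nP] := pselect (eball x a (P i j)); last by rewrite (test_notin tf nP) mul0r.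
  by have := H s ss; rewrite /conv => -> //; rewrite ?mulr0 // ge_min lexx.
rewrite -(subr0 (U f)) -UF -UB; [|exact: smooth_cont|exact: smooth_cont].
apply: (@le_trans _ _ (M * (K * (s + s)))); last first.
  have : s * (M * (2 * K) + 1) <= e by rewrite -ler_pdivlMr // ge_min lexx orbT.
  rewrite mulrDr mulr1; have := ltW ss.
  rewrite (_ : M * (K * (s + s)) = s * (M * (2 * K))); last by ring.
  move: (M * (2 * K)) => m; lra.
apply: Ub => [z| |z Bz].
- by apply: continuousB; exact: smooth_cont.
- by rewrite mulr_ge0 ?addr_ge0 ?ltW.
have bs (t : R) : `|t| <= `|y0.1| + `|y0.2| + rho -> `|t / s| + 1 <= N%:R.
  move=> ht; rewrite normrM normfV (gtr0_norm ss); apply: le_trans (ltW (truncnS_gt _)).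
  by rewrite lerD2r ler_pM2r ?invr_gt0.
have [z1 z2] := sqd_coord (ltW rho0) (ltW Bz).
have bz1 : `|z.1| <= `|y0.1| + `|y0.2| + rho.
  have := ler_normD (z.1 - y0.1) y0.1; rewrite subrK.
  by have := normr_ge0 y0.2; move: z1; move: (`|_|) (`|z.1|) (`|y0.1|) (`|y0.2|) => *; lra.
have bz2 : `|z.2| <= `|y0.1| + `|y0.2| + rho.
  have := ler_normD (z.2 - y0.2) y0.2; rewrite subrK.
  by have := normr_ge0 y0.1; move: z2; move: (`|_|) (`|z.2|) (`|y0.1|) (`|y0.2|) => *; lra.
pose b1 (i : nat) := beta (i%:R - N%:R - z.1 / s); pose b2 (i : nat) := beta (i%:R - N%:R - z.2 / s).
have S1 : \sum_(i < N + N) b1 i = 1 by apply: beta_sum; exact: bs.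
have S2 : \sum_(i < N + N) b2 i = 1 by apply: beta_sum; exact: bs.
have Eb (i j : nat) : bump2 s (P i j - z) = b1 i * b2 j.
  rewrite /bump2 /b1 /b2 /=; congr (beta _ * beta _); field; by rewrite gt_eqF.
have -> : f z - F z = \sum_(i < N + N) \sum_(j < N + N) (f z - f (P i j)) * (b1 i * b2 j).
  have {1}-> : f z = \sum_(i < N + N) \sum_(j < N + N) f z * (b1 i * b2 j).
    under eq_bigr do rewrite -mulr_sumr -mulr_sumr S2 mulr1.
    by rewrite -mulr_sumr S1 mulr1.
  rewrite /F -sumrB; apply: eq_bigr => i _; rewrite -sumrB; apply: eq_bigr => j _.
  by rewrite Eb; move: (b1 i * b2 j) (f z) (f (P i j)) => *; ring.
have b0 (i j : nat) : 0 <= b1 i * b2 j by rewrite mulr_ge0 // beta_ge0.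
have -> : K * (s + s) = \sum_(i < N + N) \sum_(j < N + N) (K * (s + s)) * (b1 i * b2 j).
  under eq_bigr do rewrite -mulr_sumr -mulr_sumr S2 mulr1.
  by rewrite -mulr_sumr S1 mulr1.
apply: le_trans (ler_norm_sum _ _ _) _; apply: ler_sum => i _.
apply: le_trans (ler_norm_sum _ _ _) _; apply: ler_sum => j _.
rewrite normrM (ger0_norm (b0 i j)).
have [h|h] := boolP ((s <= `|(P i j - z).1|) || (s <= `|(P i j - z).2|)).
  have := Eb i j; rewrite bump2_supp //; last by apply/orP.
  by move=> <-; rewrite !mulr0.
move: h; rewrite negb_or -!ltNge => /andP[/ltW h1 /ltW h2].
apply: ler_wpM2r => //; apply: le_trans (L _ _) _; apply: ler_wpM2l; first exact: ltW.
by apply: lerD; rewrite distrC.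
Qed.

(** Apply [unique_continuation] to the mollified functionals, which are smooth solutions on the disc
    of radius [r] and vanish near [x], then return to [U] by [Uzero_of_conv]. *)
Lemma Uzero_propagate x (r d : R) : 0 < r -> r <= 4^-1 -> 0 < d ->
  (forall z, Om z -> (2 * r) ^+ 2 <= sqd x z) -> Uzero x d -> Uzero x (r / 2).
Proof.
move=> r0 r4 d0 far Ud.
(* The bump has radius at most [2 s]. With [2 s <= r] it does not reach [Om] from the disc of radius
   [r]; with [2 s <= d / 2] it stays in the disc of radius [d] when centered in that of radius
   [d / 2]. *)
pose s0 := Num.min (r / 2) (d / 4).
have s00 : 0 < s0 by rewrite lt_min !divr_gt0.
apply: (Uzero_of_conv s00) => s ss; rewrite le_min => /andP[s1 s2].
have tb := test_bump2 ss.
apply: (unique_continuation c01 (d := d / 2)) => //; first by rewrite divr_gt0.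
- exact: smooth_conv.
- move=> z hz; apply: lap_conv => // p Op; apply: bump2_sqd => //.
  rewrite leNgt; apply/negP => h; have := far p Op; apply/negP; rewrite -ltNge.
  have s20 : 0 <= 2 * s by rewrite mulr_ge0 // ltW.
  have := sqd_triangle_lt r0 s20 hz (ltW h) => /lt_le_trans; apply.
  by rewrite ler_pXn2r ?nnegrE ?addr_ge0 // ?mulr_ge0 // ?(ltW r0) // ?(ltW ss) //; lra.
move=> z hz; apply: Ud; split; first by apply: smooth_refl; exact: smooth_bump2.
exists [set p | sqd z p <= (2 * s) ^+ 2]; split; first exact: compact_sqd_le.
  move=> p /= hp; have d20 : 0 < d / 2 by rewrite divr_gt0.
  have s20 : 0 <= 2 * s by rewrite mulr_ge0 // ltW.
  have := sqd_triangle_lt d20 s20 hz hp => /lt_le_trans; apply.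
  by rewrite ler_pXn2r ?nnegrE ?addr_ge0 // ?(ltW d20) ?(ltW d0) //; lra.
by move=> p /= /negP; rewrite -ltNge => h; apply: bump2_sqd => //; exact: ltW.
Qed.

(** The support of [U] as a distribution. *)
Definition Unonzero : set (plane R) := [set x | ~ exists2 a, 0 < a & Uzero x a].

Let eball_in x z (a b : R) : 0 < a -> 0 <= b -> sqd x z <= b ^+ 2 -> eball z a `<=` eball x (a + b).
Proof.
move=> a0 b0 h p hp; rewrite /eball /= sqdC; rewrite /eball /= sqdC in hp.
by apply: (sqd_triangle_lt a0 b0 hp); rewrite sqdC.
Qed.

Lemma Uzero_open : open (~` Unonzero).
Proof.
rewrite openE => x /contrapT[a a0 Ux]; apply/nbhs_eball; exists (a / 2); first by rewrite divr_gt0.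
have a2 : 0 < a / 2 by rewrite divr_gt0.
move=> z hz H; apply: H; exists (a / 2) => // f tf; apply: Ux; apply: test_sub tf.
by have := eball_in a2 (ltW a2) (ltW hz); rewrite -splitr.
Qed.

(** If a point [z] very close to [x] were off the support, vanishing would propagate from [z] to the
    disc of radius [r / 2] about it, which contains the one of radius [r / 4] about [x]. *)
Lemma Unonzero_open : open (Unonzero `&` ~` closure Om).
Proof.
have oW : open (~` closure Om) by apply: closed_openC; exact: closed_closure.
rewrite openE => x [nx Wx]; have [R0 R00 HR] := open_eballP oW Wx.
pose r := Num.min 4^-1 (R0 / 4); have r0 : 0 < r by rewrite lt_min invr_gt0 ltr0n divr_gt0.
have rR : r <= R0 / 4 by rewrite ge_min lexx orbT.
have r4 : 0 < r / 4 by rewrite divr_gt0.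
apply/nbhs_eball; exists (r / 4) => // z hz; split; last first.
  by apply: HR; apply: eball_sub hz; [exact: ltW|lra].
move=> [d d0 Ud]; apply: nx; exists (r / 4) => // f tf.
apply: (@Uzero_propagate z r d) => //; first by rewrite ge_min lexx.
  move=> p Op; rewrite leNgt; apply/negP => h.
  have r2 : 0 < 2 * r by rewrite mulr_gt0.
  have := @eball_in x z (2 * r) (r / 4) r2 (ltW r4) (ltW hz) p h => hp.
  have /HR : eball x R0 p by apply: eball_sub hp; [rewrite addr_ge0 ?ltW|lra].
  by apply; exact: subset_closure.
apply: test_sub tf; have := @eball_in z x (r / 4) (r / 4) r4 (ltW r4).
rewrite sqdC => /(_ (ltW hz)) /subset_trans; apply; apply: eball_sub; [by rewrite addr_ge0 ?ltW|lra].
Qed.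

Lemma Unonzero_bounded x : Unonzero x -> sqd y0 x <= rho ^+ 2.
Proof.
move=> nx; rewrite leNgt; apply/negP => h; apply: nx.
have oO : open [set z | rho ^+ 2 < sqd y0 z].
  have := @closed_sqd_le R y0 (rho ^+ 2) => /closed_openC; congr open.
  by apply/seteqP; split=> z /=; rewrite ltNge => /negP.
have [a a0 Ha] := open_eballP oO h; exists a => // f tf; have [sf _] := tf.
apply/eqP; rewrite -normr_le0 -(mulr0 M); apply: Ub => //; first exact: smooth_cont.
move=> z Bz; rewrite (test_notin tf) ?normr0 // => /Ha /=.
by move/lt_trans => /(_ _ Bz); rewrite ltxx.
Qed.

End ZeroSet.

(** * Simply connected Lipschitz domains have no holes *)

Section Angles.
Context {R : realType}.
Implicit Types (v w p q x z : plane R) (t s : R).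

Lemma within_comp (T U V : topologicalType) (A : set U) (f : U -> V) (g : T -> U) :
  {within A, continuous f} -> continuous g -> (forall x : T, A (g x)) -> continuous (fun x : T => f (g x)).
Proof.
move=> cf cg Ag x B nB; have H : nbhs_subspace (g x : subspace A) (f @^-1` B) := cf (g x) B nB.
move: H; rewrite -nbhs_subspace_in // => /(cg x) /=.
by apply: (@filterS _ (nbhs x)) => z /(_ (Ag z)).
Qed.

Lemma cont_pair (T : topologicalType) (g1 g2 : T -> R) : continuous g1 -> continuous g2 ->
  continuous (fun t : T => (g1 t, g2 t) : plane R).
Proof. by move=> c1 c2 x; exact: (cvg_pair (c1 x) (c2 x)). Qed.

Lemma cont_eball (f : plane R -> R) x : {for x, continuous f} <->
  forall e : R, 0 < e -> exists2 a : R, 0 < a & forall z, eball x a z -> `|f z - f x| <= e.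
Proof.
split=> [cf e e0|H].
  have /cvgrPdist_le /(_ e e0) : f @ x --> f x by exact: cf.
  by move=> /nbhs_eball[a a0 Ha]; exists a => // z /Ha /=; rewrite distrC.
apply/cvgrPdist_le => e e0; have [a a0 Ha] := H e e0.
suff E : nbhs x [set z | `|f x - f z| <= e] by exact: E.
by apply/nbhs_eball; exists a => // z /Ha; rewrite distrC.
Qed.

(** The Lebesgue number of a cover, phrased for a relation that holds between any two points of a
    small enough disc about each point of [K]. *)
Lemma lebesgue_ball (K : set (plane R)) (P : plane R -> plane R -> Prop) : compact K ->
  (forall p, K p -> exists2 a : R, 0 < a & forall q q', eball p a q -> eball p a q' -> P q q') ->
  exists2 d : R, 0 < d & forall q q', K q -> sqd q q' < d ^+ 2 -> P q q'.
Proof.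
move=> cK HP.
have /choice[a Ha] : forall p, exists a : R, K p -> 0 < a /\ forall q q', eball p a q -> eball p a q' -> P q q'.
  move=> p; have [/HP[a a0 Pa]|nK] := pselect (K p); first by exists a.
  by exists 0.
have [D DK Dc] : finite_subset_cover K (fun p => eball p (a p / 2)) K.
  have : cover_compact K by exact: plane_compact_cover.
  apply; first by move=> p _; exact: open_eball.
  by move=> p Kp; exists p => //; rewrite /eball /= sqdxx exprn_gt0 // divr_gt0 //; case: (Ha p Kp).
have [d d0 Hd] : exists2 d : R, 0 < d & forall p, p \in finmap.enum_fset D -> d <= a p / 2.
  have : forall p, p \in finmap.enum_fset D -> 0 < a p / 2.
    by move=> p /DK; rewrite inE => /Ha[a0 _]; rewrite divr_gt0.
  elim: (finmap.enum_fset D) => [|p s IH] H; first by exists 1.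
  have [d d0 Hd] := IH (fun q qs => H q (mem_behead (s := p :: s) qs)).
  exists (Num.min d (a p / 2)); first by rewrite lt_min d0 H // mem_head.
  move=> q; rewrite inE => /orP[/eqP->|/Hd h]; rewrite ge_min; apply/orP; [by right|by left].
exists d => // q q' Kq qq'; have [p /= pD pq] := Dc q Kq.
have [|a0 HPp] := Ha p; first by have := DK p pD; rewrite inE.
have a2 : 0 < a p / 2 by rewrite divr_gt0.
apply: HPp; first by apply: eball_sub pq; [exact: ltW|lra].
have := sqd_triangle_lt a2 (ltW d0) pq (ltW qq') => /lt_le_trans; apply.
by rewrite ler_pXn2r ?nnegrE ?addr_ge0 ?(ltW a2) ?(ltW d0) ?(ltW a0) //; have := Hd p pD; lra.
Qed.

(** The retraction of the line onto [0, 1], written with absolute values so that its continuity is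
    immediate. It makes paths and homotopies functions on the whole line or plane. *)
Definition clamp t : R := (`|t| - `|t - 1| + 1) / 2.

Lemma clamp_le0 t : t <= 0 -> clamp t = 0.
Proof. by move=> h; rewrite /clamp ler0_norm // ler0_norm ?subr_le0; [lra|apply: le_trans h _]. Qed.

Lemma clamp_ge1 t : 1 <= t -> clamp t = 1.
Proof. by move=> h; rewrite /clamp ger0_norm ?ger0_norm ?subr_ge0 //; [lra|apply: le_trans h]. Qed.

Lemma clamp_id t : 0 <= t <= 1 -> clamp t = t.
Proof. by move=> /andP[h1 h2]; rewrite /clamp ger0_norm // ler0_norm ?subr_le0 //; lra. Qed.

Lemma clamp01 t : 0 <= clamp t <= 1.
Proof.
have [h|h] := leP t 0; first by rewrite clamp_le0 // lexx ler01.
have [h1|h1] := leP 1 t; first by rewrite clamp_ge1 // lexx ler01.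
by rewrite clamp_id !ltW.
Qed.

Lemma cont_clamp : continuous clamp.
Proof.
move=> t; apply: (@continuousM R R (fun t => `|t| - `|t - 1| + 1) (fun=> 2^-1)); last exact: cst_continuous.
apply: (@continuousD R R R (fun t => `|t| - `|t - 1|) (fun=> 1)); last exact: cst_continuous.
apply: (@continuousB R R R (fun t => `|t|) (fun t => `|t - 1|)); first exact: norm_continuous.
apply: (@continuous_comp R R R (fun t => t - 1) (fun t => `|t|)); last exact: norm_continuous.
by apply: (@continuousB R R R id (fun=> 1)); [exact: cvg_id|exact: cst_continuous].
Qed.

(** The difference [f t - f 0] takes values in the multiples of [2 pi], a discrete set, so the
    intermediate value theorem keeps it at 0. *)
Lemma cos1_const (f : R -> R) : continuous f -> (forall t, 0 <= t <= 1 -> cos (f t - f 0) = 1) ->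
  f 1 = f 0.
Proof.
have H (h : R -> R) : continuous h -> h 0 = 0 -> (forall t, 0 <= t <= 1 -> cos (h t) = 1) -> h 1 <= 0.
  move=> ch h0 hc; rewrite leNgt; apply/negP => h1.
  (* An intermediate value in ]0, 1], inside ]0, pi], where [cos] is less than 1. *)
  pose c := Num.min (h 1) 1; have c0 : 0 < c by rewrite lt_min h1 ltr01.
  have [t] : exists2 t, t \in `[0, 1]%R & h t = c.
    apply: IVT; [exact: ler01|exact: continuous_subspaceT|].
    by rewrite h0 (min_idPl (ltW h1)) (max_idPr (ltW h1)) (ltW c0) ge_min lexx.
  rewrite in_itv /= => t01 htc; have := hc t t01; rewrite htc.
  suff : cos c < cos 0 by rewrite cos0 => /[swap] ->; rewrite ltxx.
  have pi2 := @pi_ge2 R; rewrite ltr_cos // in_itv /= ?lexx ?pi_ge0 //.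
  by rewrite (ltW c0) /= (le_trans _ pi2) // (@le_trans _ _ 1) ?ge_min ?lexx ?orbT // ler1n.
move=> cf fc; apply/eqP; rewrite eq_le -subr_le0 -[X in _ && X]subr_le0; apply/andP; split.
  apply: (H (fun t => f t - f 0)) => //; last by rewrite subrr.
  by move=> t; apply: continuousB; [exact: cf|exact: cst_continuous].
apply: (H (fun t => f 0 - f t)); last by move=> t /fc; rewrite -cosN opprB.
- by move=> t; apply: continuousB; [exact: cst_continuous|exact: cf].
- by rewrite subrr.
Qed.

Definition dir v t := exists2 r : R, 0 < r & v = (r * cos t, r * sin t).
Definition dot q p : R := q.1 * p.1 + q.2 * p.2.
Definition crs q p : R := q.1 * p.2 - q.2 * p.1.
(** The signed angle from [q] to [p], correct as long as it is acute, that is, when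
    [dot q p > 0]. *)
Definition ang q p : R := atan (crs q p / dot q p).

Lemma angxx q : ang q q = 0.
Proof. by rewrite /ang /crs [q.2 * q.1]mulrC subrr mul0r atan0. Qed.

Lemma cos2Dsin2' t : cos t * cos t + sin t * sin t = 1.
Proof. by rewrite -!expr2 cos2Dsin2. Qed.

Lemma dir_add q p t : dir q t -> 0 < dot q p -> dir p (t + ang q p).
Proof.
move=> [r r0 qE] d0; set A := ang q p.
have cA : 0 < cos A by apply: cos_gt0_pihalf; rewrite atan_ltpi2 atan_gtNpi2.
have sA : sin A = crs q p / dot q p * cos A.
  by rewrite -[_ / _]atanK -/A /tan divfK // gt_eqF.
exists (dot q p / (r * cos A)); first by rewrite divr_gt0 // mulr_gt0.
rewrite cosD sinD sA; move: d0 cA => d0 cA.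
have E : p = ((dot q p * q.1 - crs q p * q.2) / r ^+ 2, (dot q p * q.2 + crs q p * q.1) / r ^+ 2).
  have h : q.1 ^+ 2 + q.2 ^+ 2 = r ^+ 2.
    by rewrite qE /= !exprMn -mulrDr cos2Dsin2 mulr1.
  have r2 : r ^+ 2 != 0 by rewrite expf_neq0 // gt_eqF.
  rewrite [LHS]surjective_pairing; congr pair; apply: (mulIf r2); rewrite divfK // -h /dot /crs; ring.
rewrite {1}E; move: d0 cA; move: (dot q p) (crs q p) (cos A) => d c a d0 a0.
by rewrite qE /=; congr pair; field; rewrite !gt_eqF.
Qed.

Lemma dir_uniq v s t : dir v s -> dir v t -> cos (t - s) = 1.
Proof.
move=> [r r0 ->] [r' r'0 [h1 h2]].
have E : r = r'.
  apply/eqP; rewrite -(@eqrXn2 _ 2) ?(ltW r0) ?(ltW r'0) //; apply/eqP.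
  transitivity ((r * cos s) ^+ 2 + (r * sin s) ^+ 2); first by rewrite !exprMn -mulrDr cos2Dsin2 mulr1.
  by rewrite h1 h2 !exprMn -mulrDr cos2Dsin2 mulr1.
subst r'; have rn : r != 0 by rewrite gt_eqF.
by rewrite cosB -(mulfI rn h1) -(mulfI rn h2) cos2Dsin2'.
Qed.

Lemma dir_shift v s t : dir v s -> cos t = 1 -> dir v (s + t).
Proof.
move=> [r r0 ->] ct; have st : sin t = 0.
  apply/eqP; rewrite -sqrf_eq0; have := cos2Dsin2 t; rewrite ct expr1n => h.
  by apply/eqP; lra.
by exists r => //; rewrite cosD sinD ct st !mulr1 !mulr0 subr0 addr0.
Qed.

Lemma dir_ex v : 0 < dot v v -> exists t, dir v t.
Proof.
move=> v0.
have D (a : R) w : w = (cos a, sin a) -> 0 < dot w v -> exists t, dir v t.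
  move=> wE h; exists (a + ang w v); apply: dir_add => //.
  by exists 1 => //; rewrite !mul1r.
have [h|h] := ltP 0 v.1; first by apply: (D 0 (1, 0)); rewrite ?cos0 ?sin0 // /dot /= mul1r mul0r addr0.
have [h2|h2] := ltP 0 v.2; first by apply: (D (pi / 2) (0, 1)); rewrite ?cos_pihalf ?sin_pihalf // /dot /= mul1r mul0r add0r.
have [h3|h3] := ltP v.1 0.
  by apply: (D pi (-1, 0)); rewrite ?cospi ?sinpi // /dot /= mul0r addr0 mulN1r oppr_gt0.
apply: (D (- (pi / 2)) (0, -1)); rewrite ?cosN ?sinN ?cos_pihalf ?sin_pihalf // /dot /= mul0r add0r mulN1r oppr_gt0.
have v1 : v.1 = 0 by apply/eqP; rewrite eq_le h h3.
rewrite lt_neqAle h2 andbT; apply: contraTneq v0 => v2.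
by rewrite /dot v1 v2 !mul0r addr0 ltxx.
Qed.

Lemma cont_ang (T : topologicalType) (q1 q2 p1 p2 : T -> R) (x : T) :
  {for x, continuous q1} -> {for x, continuous q2} -> {for x, continuous p1} -> {for x, continuous p2} ->
  0 < dot (q1 x, q2 x) (p1 x, p2 x) ->
  {for x, continuous (fun t : T => ang (q1 t, q2 t) (p1 t, p2 t))}.
Proof.
move=> c1 c2 c3 c4 d0.
apply: (@continuous_comp T R R (fun t : T => crs (q1 t, q2 t) (p1 t, p2 t) / dot (q1 t, q2 t) (p1 t, p2 t)) atan); last exact: continuous_atan.
apply: (@continuousM R T (fun t : T => q1 t * p2 t - q2 t * p1 t) (fun t : T => (q1 t * p1 t + q2 t * p2 t)^-1)).
  by apply: (@continuousB R R T (fun t : T => q1 t * p2 t) (fun t : T => q2 t * p1 t)); apply: continuousM.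
apply: (@continuousV R T (fun t : T => q1 t * p1 t + q2 t * p2 t)); first by rewrite gt_eqF.
by apply: (@continuousD R R T (fun t : T => q1 t * p1 t) (fun t : T => q2 t * p2 t)); apply: continuousM.
Qed.

(** Homotopy invariance of the winding number, with the first coordinate as homotopy parameter. Cut
    it into steps so short that successive rows make acute angles everywhere; adding these angles
    carries the argument [L] from the first row to the last, which is constant, so the transported
    argument closes up. The angles added at the two ends coincide because the ends of each row
    do. *)
Lemma loop_closes (K1 K2 : plane R -> R) (L : R -> R) : continuous K1 -> continuous K2 -> continuous L ->
  (forall p, 0 < dot (K1 p, K2 p) (K1 p, K2 p)) ->
  (forall s, K1 (s, 0) = K1 (s, 1) /\ K2 (s, 0) = K2 (s, 1)) ->
  (forall t, 0 <= t <= 1 -> K1 (1, t) = K1 (1, 0) /\ K2 (1, t) = K2 (1, 0)) ->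
  (forall t, 0 <= t <= 1 -> dir (K1 (0, t), K2 (0, t)) (L t)) -> L 1 = L 0.
Proof.
move=> c1 c2 cL K0 K01 Kc HL; pose K p : plane R := (K1 p, K2 p).
have [d d0 Hd] : exists2 d : R, 0 < d & forall q q', [set x : plane R | `|x.1 - 2^-1| <= 2^-1 /\ `|x.2 - 2^-1| <= 2^-1] q ->
    sqd q q' < d ^+ 2 -> 0 < dot (K q) (K q').
  apply: lebesgue_ball; first exact: (@compact_box R (2^-1, 2^-1) 2^-1).
  (* Here [|K p| = 4 e]. If both vectors are within [e] of [K p] in each coordinate, their dot
     product is at least [12 e^2 - 10 e^2]. *)
  move=> p _; pose e := Num.sqrt (dot (K p) (K p)) / 4.
  have e0 : 0 < e by rewrite divr_gt0 // sqrtr_gt0; exact: K0.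
  have eE : 16 * e ^+ 2 = dot (K p) (K p).
    by rewrite /e expr_div_n sqr_sqrtr ?(ltW (K0 p)) //; field.
  have [a1 a10 H1] := (cont_eball K1 p).1 (c1 p) e e0.
  have [a2 a20 H2] := (cont_eball K2 p).1 (c2 p) e e0.
  exists (Num.min a1 a2); first by rewrite lt_min a10 a20.
  have m0 : 0 <= Num.min a1 a2 by rewrite le_min !ltW.
  have I1 : eball p (Num.min a1 a2) `<=` eball p a1 by apply: eball_sub; rewrite // ge_min lexx.
  have I2 : eball p (Num.min a1 a2) `<=` eball p a2 by apply: eball_sub; rewrite // ge_min lexx orbT.
  move=> q q' hq hq'.
  have B (a u u' : R) : `|u - a| <= e -> `|u' - a| <= e -> 3 / 4 * a ^+ 2 - 5 * e ^+ 2 <= u * u'.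
    rewrite !ler_norml => /andP[l1 l2] /andP[l3 l4].
    have := sqr_ge0 (a / 2 + (u - a + (u' - a))); nra.
  have := B _ _ _ (H1 q (I1 _ hq)) (H1 q' (I1 _ hq')); have := B _ _ _ (H2 q (I2 _ hq)) (H2 q' (I2 _ hq')).
  have e2 : 0 < e ^+ 2 by rewrite exprn_gt0.
  move: eE; rewrite /dot /= -!expr2; lra.
pose N := (Num.truncn d^-1).+1.
have N0 : 0 < (N%:R : R) by rewrite ltr0n.
have Nd : N%:R^-1 < d by rewrite -[ltRHS]invrK ltf_pV2 ?posrE ?invr_gt0 // truncnS_gt.
pose P k t : plane R := (k%:R / N%:R, clamp t).
have dP k t : (k < N)%N -> 0 < dot (K (P k t)) (K (P k.+1 t)).
  move=> kN; apply: Hd.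
    have /andP[u0 u1] := clamp01 t; have v0 : 0 <= (k%:R : R) / N%:R by rewrite divr_ge0 ?ler0n.
    have v1 : (k%:R : R) / N%:R <= 1 by rewrite ler_pdivrMr // mul1r ler_nat ltnW.
    by rewrite /P /= !ler_norml; split; apply/andP; split; lra.
  rewrite /sqd /P /= subrr expr0n addr0 -mulrBl -natr1 addrAC subrr add0r mul1r.
  by rewrite ltr_pXn2r ?nnegrE ?invr_ge0 ?(ltW N0) // ltW.
(* A continuous argument along row [j] of the homotopy. *)
pose M j t := L (clamp t) + \sum_(k < j) ang (K (P k t)) (K (P k.+1 t)).
have cP (f : plane R -> R) k : continuous f -> continuous (fun t => f (P k t)).
  move=> cf t; apply: (@continuous_comp R _ R (fun t => P k t) f); last exact: cf.
  by apply: (@cont_pair _ (fun=> _) clamp); [exact: cst_continuous|exact: cont_clamp].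
have cM j : (j <= N)%N -> continuous (M j).
  elim: j => [|j IH] jN t.
    rewrite (_ : M 0%N = L \o clamp); first by apply: continuous_comp; [exact: cont_clamp|exact: cL].
    by apply/funext => u; rewrite /M big_ord0 addr0.
  rewrite (_ : M j.+1 = fun t => M j t + ang (K (P j t)) (K (P j.+1 t))); last first.
    by apply/funext => u; rewrite /M big_ord_recr addrA.
  apply: (@continuousD R R R (M j)); first exact: IH (ltnW jN) t.
  by apply: cont_ang; [exact: cP|exact: cP|exact: cP|exact: cP|exact: dP].
have dM j t : (j <= N)%N -> dir (K (P j t)) (M j t).
  elim: j => [|j IH] jN.
    by rewrite /M /P big_ord0 mul0r addr0; apply: HL; exact: clamp01.
  by rewrite /M big_ord_recr /= addrA; apply: dir_add; [exact: IH (ltnW jN)|exact: dP].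
have c0 : clamp 0 = 0 by rewrite clamp_le0.
have c1' : clamp 1 = 1 by rewrite clamp_ge1.
have EM : M N 1 = M N 0.
  apply: cos1_const; first exact: cM.
  move=> t t01; have := dM N t (leqnn N); have := dM N 0 (leqnn N).
  rewrite /P divff ?gt_eqF // /K c0 clamp_id //; have [-> ->] := Kc t t01; exact: dir_uniq.
move: EM; rewrite /M c0 c1' => /(congr1 (fun u => u - \sum_(k < N) ang (K (P k 0)) (K (P k.+1 0)))).
rewrite addrK (_ : \sum_(k < N) ang (K (P k 1)) (K (P k.+1 1)) = \sum_(k < N) ang (K (P k 0)) (K (P k.+1 0))) ?addrK //.
apply: eq_bigr => k _; rewrite /P c0 c1' /K.
by have [-> ->] := K01 (k%:R / N%:R); have [-> ->] := K01 (k.+1%:R / N%:R).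
Qed.

End Angles.

(** * A continuous argument of [x - y] on the domain and up to its boundary *)

Section Branch.
Context {R : realType}.
Implicit Types (x z : plane R) (t s c : R).
Variables (Om : set (plane R)) (y p0 : plane R).
Hypothesis oOm : open Om.
Hypothesis scOm : simply_connected Om.
Hypothesis Op0 : Om p0.
Hypothesis nOy : ~ Om y.

Let vat x : plane R := (x.1 - y.1, x.2 - y.2).
Let seg x z c : plane R := (x.1 + c * (z.1 - x.1), x.2 + c * (z.2 - x.2)).

Lemma vat_gt0 x : x <> y -> 0 < dot (vat x) (vat x).
Proof.
move=> xy; rewrite /dot /= -!expr2 lt_neqAle addr_ge0 ?sqr_ge0 // andbT eq_sym paddr_eq0 ?sqr_ge0 //.
rewrite !sqrf_eq0 !subr_eq0; apply/negP => /andP[/eqP h1 /eqP h2]; apply: xy.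
by rewrite [LHS]surjective_pairing [RHS]surjective_pairing h1 h2.
Qed.

(** Seen from [y], a point closer to [x] than [y] is lies within a right angle of [x]; otherwise
    Cauchy-Schwarz would force its distance to [x] to be at least that of [y]. *)
Lemma dot_pos x z : sqd x z < sqd y x -> 0 < dot (vat x) (vat z).
Proof.
rewrite /sqd /dot /vat /= => h.
have -> : z.1 - y.1 = (x.1 - y.1) + (z.1 - x.1) by ring.
have -> : z.2 - y.2 = (x.2 - y.2) + (z.2 - x.2) by ring.
move: (x.1 - y.1) (x.2 - y.2) (z.1 - x.1) (z.2 - x.2) h => a b u v h.
rewrite ltNge; apply/negP => k.
have cs : (a * u + b * v) ^+ 2 <= (a ^+ 2 + b ^+ 2) * (u ^+ 2 + v ^+ 2).
  rewrite -subr_ge0 (_ : _ - _ = (a * v - b * u) ^+ 2); last by ring.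
  exact: sqr_ge0.
have uv : 0 <= u ^+ 2 + v ^+ 2 by rewrite addr_ge0 // sqr_ge0.
have k1 : a ^+ 2 + b ^+ 2 <= - (a * u + b * v) by lra.
move: cs uv h k1; move: (a * u + b * v) (a ^+ 2 + b ^+ 2) (u ^+ 2 + v ^+ 2) => d e w cs w0 h k1.
nra.
Qed.

Variables (t0 : R).
Hypothesis dt0 : dir (vat p0) t0.

(** Continuation of the argument of [x - y] along a path in [Om] from [p0], where it is [t0], to
    [x], where it is [t]. Path and argument live on the whole line, so that continuity is never
    relative to an interval. *)
Definition reach x t := exists (g1 g2 L : R -> R),
  [/\ [/\ continuous g1, continuous g2 & continuous L],
      forall s, Om (g1 s, g2 s) /\ dir (vat (g1 s, g2 s)) (L s),
      (g1 0, g2 0) = p0 /\ L 0 = t0 & (g1 1, g2 1) = x /\ L 1 = t].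

Lemma reach_in x t : reach x t -> Om x /\ dir (vat x) t.
Proof. by move=> [g1 [g2 [L [_ /(_ 1) H _ [gx Lt]]]]]; move: H; rewrite gx Lt. Qed.

Lemma cont_affine_clamp (a b c d : R) : continuous (fun s : R => a + clamp (b * s + c) * d).
Proof.
move=> s; apply: (@continuousD R R R (fun=> a) (fun s => clamp (b * s + c) * d)); first exact: cst_continuous.
apply: (@continuousM R R (fun s => clamp (b * s + c)) (fun=> d)); last exact: cst_continuous.
apply: (@continuous_comp R R R (fun s => b * s + c) (@clamp R)); last exact: cont_clamp.
apply: (@continuousD R R R (fun s => b * s) (fun=> c)); last exact: cst_continuous.
by apply: (@continuousM R R (fun=> b) id); [exact: cst_continuous|exact: cvg_id].
Qed.

Lemma cont_reclamp (g : R -> R) (b c : R) : continuous g -> continuous (fun s : R => g (clamp (b * s + c))).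
Proof.
move=> cg s; apply: (@continuous_comp R R R (fun s => clamp (b * s + c)) g); last exact: cg.
have E : (fun s : R => clamp (b * s + c)) = fun s => 0 + clamp (b * s + c) * 1.
  by apply/funext => u; rewrite mulr1 add0r.
by rewrite E; exact: cont_affine_clamp.
Qed.

Lemma reach_ext x t z : reach x t -> (forall c, 0 <= c <= 1 -> Om (seg x z c)) ->
  sqd x z < sqd y x -> reach z (t + ang (vat x) (vat z)).
Proof.
move=> rx sO xz; have [Ox dx] := reach_in rx.
have [g1 [g2 [L [[c1 c2 cL] Hg [g0 L0] [g1x L1]]]]] := rx.
(* [u] runs during the first half and [v] during the second. As one of them is always at rest,
   concatenation of paths is just the sum of displacements. *)
pose u s := clamp (2 * s + 0); pose v s := clamp (2 * s + -1).
pose w1 s := x.1 + v s * (z.1 - x.1); pose w2 s := x.2 + v s * (z.2 - x.2).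
have cw1 : continuous w1 by exact: cont_affine_clamp.
have cw2 : continuous w2 by exact: cont_affine_clamp.
have xs c : 0 <= c <= 1 -> sqd x (seg x z c) < sqd y x.
  move=> /andP[c0 c1']; apply: le_lt_trans xz; rewrite /sqd /seg /= ![_ + c * _ - _]addrAC !subrr !add0r.
  by rewrite !exprMn -mulrDr ler_piMl ?expr_le1 // addr_ge0 // sqr_ge0.
have wO s : Om (w1 s, w2 s) by apply: (sO (v s)); exact: clamp01.
have wd s : 0 < dot (vat x) (vat (w1 s, w2 s)) by apply: dot_pos; apply: (xs (v s)); exact: clamp01.
have cu (g : R -> R) : continuous g -> continuous (fun s => g (u s)) by exact: cont_reclamp.
exists (fun s => g1 (u s) + v s * (z.1 - x.1)), (fun s => g2 (u s) + v s * (z.2 - x.2)),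
  (fun s => L (u s) + ang (vat x) (vat (w1 s, w2 s))).
have E0 s : v s = 0 -> (w1 s, w2 s) = x.
  by move=> h; rewrite /w1 /w2 h !mul0r !addr0 -surjective_pairing.
have half s : v s = 0 \/ u s = 1.
  have [h|h] := leP s 2^-1; first by left; apply: clamp_le0; lra.
  by right; apply: clamp_ge1; lra.
have u0 : u 0 = 0 by rewrite /u mulr0 addr0 clamp_le0.
have v0 : v 0 = 0 by rewrite /v mulr0 add0r clamp_le0.
have u1 : u 1 = 1 by rewrite /u; apply: clamp_ge1; lra.
have v1 : v 1 = 1 by rewrite /v; apply: clamp_ge1; lra.
split.
- have cw (e : R) : continuous (fun s => v s * e).
    have E : (fun s => v s * e) = fun s => 0 + clamp (2 * s + -1) * e by apply/funext => s; rewrite add0r.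
    by rewrite E; exact: cont_affine_clamp.
  split=> s.
  + apply: (@continuousD R R R (fun s => g1 (u s)) (fun s => v s * (z.1 - x.1))); [exact: cu|exact: cw].
  + apply: (@continuousD R R R (fun s => g2 (u s)) (fun s => v s * (z.2 - x.2))); [exact: cu|exact: cw].
  + apply: (@continuousD R R R (fun s => L (u s))); first exact: cu.
    apply: cont_ang; [exact: cst_continuous|exact: cst_continuous| | |exact: wd].
      by apply: (@continuousB R R R w1 (fun=> y.1)); [exact: cw1|exact: cst_continuous].
    by apply: (@continuousB R R R w2 (fun=> y.2)); [exact: cw2|exact: cst_continuous].
- move=> s; case: (half s) => h.
    by rewrite h !mul0r !addr0 E0 // angxx addr0; exact: Hg.
  have E : (g1 (u s) + v s * (z.1 - x.1), g2 (u s) + v s * (z.2 - x.2)) = (w1 s, w2 s).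
    by rewrite h /w1 /w2 -g1x.
  rewrite E h L1; split; first exact: wO.
  exact: dir_add.
- by rewrite u0 v0 !mul0r !addr0 E0 // angxx addr0.
- rewrite u1 L1 v1 !mul1r; have [-> ->] : g1 1 = x.1 /\ g2 1 = x.2 by rewrite -g1x.
  have -> : (w1 1, w2 1) = z by rewrite /w1 /w2 v1 !mul1r !subrKC -surjective_pairing.
  by rewrite !subrKC -surjective_pairing.
Qed.

(** One path followed by the reverse of the other is a loop in [Om]. It contracts inside [Om], which
    avoids [y], so the argument along it returns to its initial value; the net change is
    [t - t']. *)
Lemma reach_uniq x t t' : reach x t -> reach x t' -> t = t'.
Proof.
move=> r r'; have [Ox dx] := reach_in r; have [_ dx'] := reach_in r'.
have cd : cos (t - t') = 1 by exact: dir_uniq dx' dx.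
have [g1 [g2 [L [[c1 c2 cL] Hg [g0 L0] [gx L1]]]]] := r.
have [h1 [h2 [L' [[c1' c2' cL'] Hh [h0 L'0] [hx L'1]]]]] := r'.
(* [v] runs backwards in the second half. The argument on the return path is shifted by [t - t'], a
   multiple of [2 pi], to match at [x]. *)
pose u s := clamp (2 * s + 0); pose v s := clamp (-2 * s + 2).
have cu (g : R -> R) : continuous g -> continuous (fun s => g (u s)) by exact: cont_reclamp.
have cv (g : R -> R) : continuous g -> continuous (fun s => g (v s)) by exact: cont_reclamp.
pose k1 s := g1 (u s) + h1 (v s) - x.1; pose k2 s := g2 (u s) + h2 (v s) - x.2.
pose M s := L (u s) + (L' (v s) - t').
have ck1 : continuous k1.
  move=> s; apply: (@continuousB R R R (fun s => g1 (u s) + h1 (v s)) (fun=> x.1)); last exact: cst_continuous.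
  by apply: (@continuousD R R R (fun s => g1 (u s)) (fun s => h1 (v s))); [exact: cu|exact: cv].
have ck2 : continuous k2.
  move=> s; apply: (@continuousB R R R (fun s => g2 (u s) + h2 (v s)) (fun=> x.2)); last exact: cst_continuous.
  by apply: (@continuousD R R R (fun s => g2 (u s)) (fun s => h2 (v s))); [exact: cu|exact: cv].
have cM : continuous M.
  move=> s; apply: (@continuousD R R R (fun s => L (u s)) (fun s => L' (v s) - t')); first exact: cu.
  by apply: (@continuousB R R R (fun s => L' (v s)) (fun=> t')); [exact: cv|exact: cst_continuous].
have half s : v s = 1 \/ u s = 1.
  have [h|h] := leP s 2^-1; first by left; apply: clamp_ge1; lra.
  by right; apply: clamp_ge1; lra.
have [gx1 gx2] : g1 1 = x.1 /\ g2 1 = x.2 by rewrite -gx.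
have [hx1 hx2] : h1 1 = x.1 /\ h2 1 = x.2 by rewrite -hx.
have Hk s : Om (k1 s, k2 s) /\ dir (vat (k1 s, k2 s)) (M s).
  case: (half s) => e.
    rewrite /k1 /k2 /M e hx1 hx2 L'1 subrr addr0 !addrK; exact: Hg.
  rewrite /k1 /k2 /M e gx1 gx2 L1 ![_ + _ - x.1]addrAC ![_ + _ - x.2]addrAC !subrr !add0r.
  have [Oh dh] := Hh (v s); split=> //.
  by rewrite addrC addrAC -addrA; exact: dir_shift.
have u0 : u 0 = 0 by rewrite /u mulr0 addr0 clamp_le0.
have v0 : v 0 = 1 by rewrite /v mulr0 add0r; apply: clamp_ge1; lra.
have u1 : u 1 = 1 by rewrite /u; apply: clamp_ge1; lra.
have v1 : v 1 = 0 by rewrite /v; apply: clamp_le0; lra.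
have [g10 g20] : g1 0 = p0.1 /\ g2 0 = p0.2 by rewrite -g0.
have [h10 h20] : h1 0 = p0.1 /\ h2 0 = p0.2 by rewrite -h0.
have k10 : k1 0 = p0.1 by rewrite /k1 u0 v0 g10 hx1 addrK.
have k20 : k2 0 = p0.2 by rewrite /k2 u0 v0 g20 hx2 addrK.
have k11 : k1 1 = p0.1 by rewrite /k1 u1 v1 gx1 h10 addrC addKr.
have k21 : k2 1 = p0.2 by rewrite /k2 u1 v1 gx2 h20 addrC addKr.
have [_ /(_ (fun s => (k1 s, k2 s)))] := scOm.
case.
- by apply: continuous_subspaceT; exact: cont_pair.
- by move=> s _; have [] := Hk s.
- by rewrite k10 k20 k11 k21.
move=> H [cH HO Ht Hs].
pose cl (p : plane R) : plane R := (clamp p.1, clamp p.2).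
have ccl : continuous cl.
  apply: cont_pair => p; apply: continuous_comp; [exact: cvg_fst|exact: cont_clamp|exact: cvg_snd|exact: cont_clamp].
have cHc : continuous (fun p => H (cl p)).
  apply: (within_comp cH ccl) => p; split; rewrite /= in_itv; exact: clamp01.
pose K1 p := (H (cl p)).1 - y.1; pose K2 p := (H (cl p)).2 - y.2.
have cK1 : continuous K1.
  move=> p; apply: (@continuousB R R _ (fun p => (H (cl p)).1) (fun=> y.1)); last exact: cst_continuous.
  by apply: (@continuous_comp _ _ _ (fun p => H (cl p)) fst); [exact: cHc|exact: cvg_fst].
have cK2 : continuous K2.
  move=> p; apply: (@continuousB R R _ (fun p => (H (cl p)).2) (fun=> y.2)); last exact: cst_continuous.
  by apply: (@continuous_comp _ _ _ (fun p => H (cl p)) snd); [exact: cHc|exact: cvg_snd].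
have cl0 : clamp 0 = 0 :> R by rewrite clamp_le0.
have cl1 : clamp 1 = 1 :> R by rewrite clamp_ge1.
have i0 : 0 <= (0 : R) <= 1 by rewrite lexx ler01.
have ML : M 1 = M 0.
  apply: (loop_closes cK1 cK2 cM).
  - move=> p; have Ok : Om (H (cl p)) by apply: HO; exact: clamp01.
    by apply: (@vat_gt0 (H (cl p))) => E; apply: nOy; rewrite -E.
  - by move=> s; rewrite /K1 /K2 /cl /= cl0 cl1; have [-> ->] := Hs (clamp s) (clamp01 s).
  - move=> s s01; rewrite /K1 /K2 /cl /= cl0 cl1 clamp_id //.
    by have [_ ->] := Ht s s01; have [_ ->] := Ht 0 i0.
  - move=> s s01; rewrite /K1 /K2 /cl /= cl0 clamp_id //.
    by have [-> _] := Ht s s01; have [] := Hk s.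
move: ML; rewrite /M u1 v1 u0 v0 L1 L0 L'0 L'1; lra.
Qed.

Lemma eball_far x z (a : R) : 0 < a -> eball x a `<=` Om -> eball x a z -> sqd x z < sqd y x.
Proof.
move=> a0 aO xz; apply: (lt_le_trans xz); rewrite leNgt; apply/negP => h; apply: nOy; apply: aO.
by rewrite /eball /= sqdC.
Qed.

Lemma eball_seg x z (a c : R) : eball x a z -> 0 <= c <= 1 -> eball x a (seg x z c).
Proof.
move=> xz /andP[c0 c1]; apply: le_lt_trans xz.
rewrite /sqd /seg /= ![_ + c * _ - _]addrAC !subrr !add0r.
by rewrite !exprMn -mulrDr ler_piMl ?expr_le1 // addr_ge0 // sqr_ge0.
Qed.

Lemma reach_ball x z t (a : R) : 0 < a -> eball x a `<=` Om -> eball x a z -> reach x t ->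
  reach z (t + ang (vat x) (vat z)).
Proof.
move=> a0 aO xz rx; apply: reach_ext rx _ _; last exact: eball_far aO xz.
by move=> c c01; apply: aO; exact: eball_seg.
Qed.

(** The set of reachable points is open, and so is its complement in [Om], since continuation works
    within any disc in [Om]; connectedness concludes. *)
Lemma reach_all x : Om x -> exists t, reach x t.
Proof.
have conn : connected Om by case: scOm.
pose B := [set x | Om x /\ exists t, reach x t].
have B0 : B p0.
  split=> //; exists t0; exists (fun=> p0.1), (fun=> p0.2), (fun=> t0); split=> //.
  - by split=> s; exact: cst_continuous.
  - by move=> s; rewrite -surjective_pairing.
  - by rewrite -surjective_pairing.
  - by rewrite -surjective_pairing.
have oB : open B.
  rewrite openE => z [Oz [t rz]]; have [a a0 aO] := open_eballP oOm Oz.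
  apply/nbhs_eball; exists a => // w zw; split; first exact: aO.
  by exists (t + ang (vat z) (vat w)); exact: (reach_ball a0 aO zw rz).
have oN : open (Om `\` B).
  rewrite openE => z [Oz nz]; have [a a0 aO] := open_eballP oOm Oz.
  have a2 : 0 < a / 2 by rewrite divr_gt0.
  apply/nbhs_eball; exists (a / 2) => // w zw; split; first by apply: aO; apply: eball_sub zw; [exact: ltW|lra].
  move=> [_ [t rw]]; apply: nz; split=> //; exists (t + ang (vat w) (vat z)).
  apply: (@reach_ball w z t (a / 2)) => //; last by rewrite /eball /= sqdC.
  move=> q wq; apply: aO; have := sqd_triangle_lt a2 (ltW a2) zw (ltW wq).
  by rewrite /eball /= -splitr.
have BE : B = Om.
  apply: (conn B (ex_intro _ p0 B0)); first by exists B => //; rewrite setIidr // => z [].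
  exists (~` (Om `\` B)); first exact: open_closedC.
  apply/seteqP; split=> z; first by move=> Bz; split; [case: Bz|move=> [_ /(_ Bz)]].
  by move=> [Oz /not_andP[/(_ Oz)//|/contrapT]].
by rewrite -BE => -[].
Qed.

Variable th : plane R -> R.
Hypothesis Hth : forall x, Om x -> reach x (th x).

Lemma th_dir x : Om x -> dir (vat x) (th x).
Proof. by move=> /Hth /reach_in[]. Qed.

Lemma th_ball x z (a : R) : 0 < a -> eball x a `<=` Om -> eball x a z ->
  th z = th x + ang (vat x) (vat z).
Proof.
move=> a0 aO xz; have Ox : Om x by apply: aO; rewrite /eball /= sqdxx exprn_gt0.
apply: (reach_uniq (x := z)); first by apply: Hth; exact: aO.
by apply: (reach_ball a0 aO xz); exact: Hth.
Qed.

Lemma cont_ang_at x z : 0 < dot (vat x) (vat z) -> {for z, continuous (fun z => ang (vat x) (vat z))}.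
Proof.
move=> d; apply: cont_ang => //; [exact: cst_continuous|exact: cst_continuous| | ].
  by apply: (@continuousB R R _ (fun z => z.1) (fun=> y.1)); [exact: cvg_fst|exact: cst_continuous].
by apply: (@continuousB R R _ (fun z => z.2) (fun=> y.2)); [exact: cvg_snd|exact: cst_continuous].
Qed.

Lemma cont_th x : Om x -> {for x, continuous th}.
Proof.
move=> Ox; apply/cont_eball => e e0; have [a a0 aO] := open_eballP oOm Ox.
have xy : x <> y by move=> E; apply: nOy; rewrite -E.
have [b b0 Hb] := (cont_eball _ x).1 (cont_ang_at (vat_gt0 xy)) e e0.
have m0 : 0 < Num.min a b by rewrite lt_min a0.
exists (Num.min a b) => // z xz.
have za : eball x a z by apply: eball_sub xz; [exact: ltW|rewrite ge_min lexx].
have zb : eball x b z by apply: eball_sub xz; [exact: ltW|rewrite ge_min lexx orbT].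
by have := Hb z zb; rewrite angxx subr0 (th_ball a0 aO za) addrC addKr.
Qed.

Definition th_lim x l := forall e, 0 < e -> exists2 a : R, 0 < a &
  forall z, eball x a z -> Om z -> `|th z - l| <= e.

(** In the chart, compare [th] with the explicit branch [tau + ang], which is continuous near [x].
    Their difference is a multiple of [2 pi] on the part [Q] of a rectangle above the graph; [Q]
    being connected, it is constant there, and [th] has the limit of the explicit branch. *)
Lemma lim_boundary x : lipschitz_boundary Om -> boundary Om x -> x <> y ->
  exists l, th_lim x l /\ dir (vat x) l.
Proof.
move=> lip bx xy; have [a [b [psi [L [rho [h [ab rho0 h0 Lpsi HOm]]]]]]] := lip x bx.
have [clx nix] := bx.
have nOx : ~ Om x by move=> Ox; apply: nix; apply: open_nbhs_nbhs; split.
pose Phi (s t : R) : plane R := (x.1 + s * a - t * b, x.2 + s * b + t * a).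
have sqPhi s t : sqd x (Phi s t) = s ^+ 2 + t ^+ 2.
  rewrite /sqd /Phi /=; transitivity ((s ^+ 2 + t ^+ 2) * (a ^+ 2 + b ^+ 2)); first by ring.
  by rewrite ab mulr1.
pose cs z := a * (z.1 - x.1) + b * (z.2 - x.2); pose ct z := a * (z.2 - x.2) - b * (z.1 - x.1).
have PhiK z : Phi (cs z) (ct z) = z.
  rewrite /Phi /cs /ct [RHS]surjective_pairing; congr pair.
    transitivity (x.1 + (z.1 - x.1) * (a ^+ 2 + b ^+ 2)); first by ring.
    by rewrite ab mulr1 subrKC.
  transitivity (x.2 + (z.2 - x.2) * (a ^+ 2 + b ^+ 2)); first by ring.
  by rewrite ab mulr1 subrKC.
have cst z : sqd x z = cs z ^+ 2 + ct z ^+ 2 by rewrite -sqPhi PhiK.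
have small z (d : R) : 0 < d -> eball x d z -> `|cs z| < d /\ `|ct z| < d.
  move=> d0; rewrite /eball /= cst => hd.
  by split; rewrite -(@ltr_pXn2r _ 2) ?nnegrE ?(ltW d0) // real_normK ?num_real //;
    apply: le_lt_trans hd; rewrite ?lerDl ?lerDr sqr_ge0.
have L0 : 0 <= `|L| by [].
have Lp s t : `|psi s - psi t| <= `|L| * `|s - t|.
  by apply: le_trans (Lpsi s t) _; apply: ler_wpM2r => //; exact: ler_norm.
(* The graph passes through [x]: above it [x] would be interior to [Om], and below it there would be
   no point of [Om] near [x]. *)
have p00 : psi 0 = 0.
  apply/eqP; rewrite eq_le; apply/andP; split; last first.
    rewrite leNgt; apply/negP => p0'; apply: nOx.
    have /= := (HOm 0 0); rewrite !normr0 => /(_ rho0 h0)[_ /(_ p0')].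
    by rewrite !mul0r !addr0 subr0 -surjective_pairing.
  rewrite leNgt; apply/negP => pp.
  pose d := Num.min (Num.min rho h) (psi 0 / (2 * (`|L| + 1))).
  have d0 : 0 < d by rewrite !lt_min rho0 h0 divr_gt0 // mulr_gt0 // ltr_wpDl.
  have [z [Oz xz]] : exists z, (Om `&` eball x d) z.
    by apply: clx; apply/nbhs_eball; exists d.
  have [s1 t1] := small z d d0 xz.
  have := HOm (cs z) (ct z); rewrite -/(Phi _ _) PhiK.
  have dr : d <= rho by rewrite !ge_min lexx.
  have dh : d <= h by rewrite !ge_min lexx orbT.
  move=> /(_ (lt_le_trans s1 dr) (lt_le_trans t1 dh))[/(_ Oz) pt _].
  have dL : d * (2 * (`|L| + 1)) <= psi 0.
    by rewrite -ler_pdivlMr ?ge_min ?lexx ?orbT // mulr_gt0 // ltr_wpDl.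
  have := Lp (cs z) 0; rewrite subr0 ler_norml => /andP[q _].
  have q2 : `|L| * `|cs z| <= `|L| * d by apply: ler_wpM2l => //; exact: ltW.
  have q3 := ler_norm (ct z).
  have aux (l u p q' t t' : R) : 0 < d -> 0 <= l * d -> d * (2 * (l + 1)) <= p -> - (l * u) <= q' - p -> l * u <= l * d -> t <= t' -> t' < d -> q' < t -> False.
    by clear; rewrite mulrCA mulrDr mulr1 [d * l]mulrC; move: (l * d) (l * u) => m m'; lra.
  exact: (aux _ _ _ _ _ _ d0 (mulr_ge0 L0 (ltW d0)) dL q q2 q3 t1 pt).
have psiL s : psi s <= `|L| * `|s|.
  have := Lp s 0; rewrite p00 !subr0; exact: le_trans (ler_norm _).
pose D := sqd y x.
have D0 : 0 < D.
  by have := vat_gt0 xy; rewrite /D /sqd /dot /= -!expr2.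
(* The rectangle fits in the chart, stays nearer to [x] than [y] is, so that [ang] is valid on it,
   and its top edge, at height [T > |L| sg], lies above the graph. *)
pose T := Num.min (h / 2) (Num.sqrt D / 2).
have T0 : 0 < T by rewrite lt_min !divr_gt0 // sqrtr_gt0.
pose sg := Num.min (Num.min (rho / 2) (Num.sqrt D / 2)) (T / (2 * (`|L| + 1))).
have sg0 : 0 < sg by rewrite !lt_min !divr_gt0 // ?sqrtr_gt0 // mulr_gt0 // ltr_wpDl.
have hT : T < h by rewrite /T gt_min; apply/orP; left; lra.
have sr : sg < rho by rewrite /sg !gt_min; apply/orP; left; apply/orP; left; lra.
have D4 : (Num.sqrt D / 2) ^+ 2 = D / 4 by rewrite expr_div_n sqr_sqrtr ?(ltW D0) //; field.
have sD0 : 0 <= Num.sqrt D / 2 by rewrite divr_ge0 // sqrtr_ge0.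
have TD : T ^+ 2 <= D / 4 by rewrite -D4 ler_pXn2r ?nnegrE ?(ltW T0) // ge_min lexx orbT.
have sD : sg ^+ 2 <= D / 4 by rewrite -D4 ler_pXn2r ?nnegrE ?(ltW sg0) // !ge_min lexx orbT.
have LT : `|L| * sg < T.
  have : sg * (2 * (`|L| + 1)) <= T by rewrite -ler_pdivlMr ?ge_min ?lexx ?orbT // mulr_gt0 // ltr_wpDl.
  rewrite mulrCA mulrDr mulr1 [sg * `|L|]mulrC.
  have := mulr_ge0 L0 (ltW sg0); move: (`|L| * sg) sg0 T0 => *; lra.
have [tau dtau] := dir_ex (vat_gt0 xy).
pose Q s t := [/\ `|s| <= sg, `|t| <= T & psi s < t].
have QO s t : Q s t -> Om (Phi s t).
  by move=> [h1 h2 h3]; apply/(HOm s t (le_lt_trans h1 sr) (le_lt_trans h2 hT)).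
have sq_le' (u v : R) : `|u| <= v -> u ^+ 2 <= v ^+ 2.
  by move=> uv; rewrite -(real_normK (num_real u)) ler_pXn2r ?nnegrE //; exact: le_trans uv.
have Qd s t : Q s t -> 0 < dot (vat x) (vat (Phi s t)).
  move=> [h1 h2 _]; apply: dot_pos; rewrite sqPhi -/D.
  have := sq_le' _ _ h1; have := sq_le' _ _ h2; lra.
pose m s t := th (Phi s t) - tau - ang (vat x) (vat (Phi s t)).
have mcos s t : Q s t -> cos (m s t) = 1.
  move=> q; rewrite /m -addrA -opprD; apply: dir_uniq; last exact: th_dir (QO s t q).
  by apply: dir_add => //; exact: Qd.
have mseg s1 t1 s2 t2 : (forall c, 0 <= c <= 1 -> Q (s1 + c * (s2 - s1)) (t1 + c * (t2 - t1))) ->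
    m s2 t2 = m s1 t1.
  move=> HQ; pose u c := s1 + clamp (1 * c + 0) * (s2 - s1); pose v c := t1 + clamp (1 * c + 0) * (t2 - t1).
  have Quv c : Q (u c) (v c) by apply: HQ; exact: clamp01.
  have cu : continuous u by exact: cont_affine_clamp.
  have cv : continuous v by exact: cont_affine_clamp.
  pose f c := m (u c) (v c).
  have -> : m s2 t2 = f 1.
    by rewrite /f /u /v mul1r addr0 clamp_ge1 // !mul1r !subrKC.
  have -> : m s1 t1 = f 0.
    by rewrite /f /u /v mul1r addr0 clamp_le0 // !mul0r !addr0.
  apply: cos1_const => [c|c _]; last first.
    have q1 := mcos _ _ (Quv c); have q0 := mcos _ _ (Quv 0).
    have s0 r : cos r = 1 -> sin r = 0 :> R.
      move=> cr; apply/eqP; rewrite -sqrf_eq0; have := cos2Dsin2 r; rewrite cr expr1n => hh.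
      by apply/eqP; lra.
    by rewrite /f cosB q1 q0 (s0 _ q1) mul0r addr0 mul1r.
  have cPhi : continuous (fun c => Phi (u c) (v c)).
    apply: cont_pair => r.
      apply: (@continuousB R R R (fun c => x.1 + u c * a) (fun c => v c * b)).
        apply: (@continuousD R R R (fun=> x.1) (fun c => u c * a)); first exact: cst_continuous.
        by apply: (@continuousM R R u (fun=> a)); [exact: cu|exact: cst_continuous].
      by apply: (@continuousM R R v (fun=> b)); [exact: cv|exact: cst_continuous].
    apply: (@continuousD R R R (fun c => x.2 + u c * b) (fun c => v c * a)).
      apply: (@continuousD R R R (fun=> x.2) (fun c => u c * b)); first exact: cst_continuous.
      by apply: (@continuousM R R u (fun=> b)); [exact: cu|exact: cst_continuous].
    by apply: (@continuousM R R v (fun=> a)); [exact: cv|exact: cst_continuous].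
  apply: (@continuousB R R R (fun c => th (Phi (u c) (v c)) - tau) (fun c => ang (vat x) (vat (Phi (u c) (v c))))).
    apply: (@continuousB R R R (fun c => th (Phi (u c) (v c))) (fun=> tau)); last exact: cst_continuous.
    by apply: (@continuous_comp _ _ _ (fun c => Phi (u c) (v c)) th); [exact: cPhi|exact: cont_th (QO _ _ (Quv c))].
  apply: (@continuous_comp _ _ _ (fun c => Phi (u c) (v c)) (fun z => ang (vat x) (vat z))); first exact: cPhi.
  exact: cont_ang_at (Qd _ _ (Quv c)).
have psiT s : `|s| <= sg -> psi s < T.
  move=> hs; apply: le_lt_trans (psiL s) _; apply: le_lt_trans LT; exact: ler_wpM2l.
(* Two segments inside [Q]: up to the height [T], then along the top edge to the axis. *)
have mconst s t : Q s t -> m s t = m 0 T.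
  move=> [hs ht hst]; have pT := psiT s hs.
  have e1 : m s T = m s t.
    apply: mseg => c /andP[c0 c1]; rewrite subrr mulr0 addr0; move: ht; rewrite ler_norml => /andP[l1 l2].
    split=> //; last by apply: lt_le_trans hst _; rewrite lerDl mulr_ge0 // subr_ge0.
    rewrite ler_norml; apply/andP; split; last by rewrite -lerBrDl ler_piMl // subr_ge0.
    by apply: le_trans l1 _; rewrite lerDl mulr_ge0 // subr_ge0.
  rewrite -e1; symmetry; apply: mseg => c /andP[c0 c1]; rewrite subrr mulr0 addr0.
  have hs' : `|s + c * (0 - s)| <= sg.
    rewrite sub0r mulrN -[X in X - _]mul1r -mulrBl normrM ger0_norm ?subr_ge0 //.
    by apply: le_trans hs; rewrite ler_piMl // gerBl.
  by split=> //; [rewrite ger0_norm // ltW|exact: psiT].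
have Q0 : Q 0 T by split; [rewrite normr0 ltW|rewrite ger0_norm // ltW|rewrite p00].
exists (tau + m 0 T); split; last by apply: dir_shift => //; exact: mcos.
move=> e e0; have [d d0 Hd] := (cont_eball _ x).1 (cont_ang_at (vat_gt0 xy)) e e0.
pose d' := Num.min d (Num.min sg T).
have d'0 : 0 < d' by rewrite lt_min d0 lt_min sg0.
exists d' => // z xz Oz.
have [s1 t1] := small z d' d'0 xz.
have d's : d' <= sg by rewrite ge_min; apply/orP; right; rewrite ge_min lexx.
have d't : d' <= T by rewrite ge_min; apply/orP; right; rewrite ge_min lexx orbT.
have q : Q (cs z) (ct z).
  split; [exact: ltW (lt_le_trans s1 d's)|exact: ltW (lt_le_trans t1 d't)|].
  have [+ _] := HOm (cs z) (ct z) (lt_trans (lt_le_trans s1 d's) sr) (lt_trans (lt_le_trans t1 d't) hT).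
  by rewrite -/(Phi _ _) PhiK; exact.
have := mconst _ _ q; rewrite /m PhiK => <-.
have zd : eball x d z by apply: eball_sub xz; [exact: ltW|rewrite ge_min lexx].
have := Hd z zd; rewrite angxx subr0.
by rewrite (_ : th z - _ = ang (vat x) (vat z)) //; move: (th z) (ang _ _) => p q'; ring.
Qed.

End Branch.

(* For [y] in [C], a continuous argument of [x - y] on [Om] extends to the closure
   of [Om], then to [C] by the Tietze theorem; the resulting nowhere zero vector
   field on a disc is radial on the bounding circle, which is impossible. *)
Lemma no_holes {R : realType} (Om C : set (plane R)) (y0 : plane R) (rho : R) : open Om -> simply_connected Om ->
  lipschitz_boundary Om -> Om !=set0 -> open C -> (forall x, C x -> ~ closure Om x) ->
  open (~` (C `|` closure Om)) ->
  0 < rho -> (forall x, Om x -> sqd y0 x <= rho ^+ 2) -> (forall x, C x -> sqd y0 x <= rho ^+ 2) ->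
  C = set0.
Proof.
move=> oOm scOm lip [p0 Op0] oC CW oN rho0 bOm bC; apply/seteqP; split=> // y Cy.
have ncy := CW y Cy.
have nOy : ~ Om y by move=> /subset_closure.
have py : p0 <> y by move=> E; apply: nOy; rewrite -E.
pose vat (x : plane R) : plane R := (x.1 - y.1, x.2 - y.2).
have [t0 dt0] := dir_ex (vat_gt0 py).
have /choice[th Hth'] : forall x, exists t, Om x -> reach Om y p0 t0 x t.
  move=> x; have [Ox|nO] := pselect (Om x); last by exists 0.
  by have [t Ht] := reach_all oOm scOm Op0 nOy dt0 Ox; exists t.
have Hth x : Om x -> reach Om y p0 t0 x (th x) by exact: Hth'.
have clxy x : closure Om x -> x <> y by move=> cx E; apply: ncy; rewrite -E.
have /choice[tb Htb'] : forall x, exists l, closure Om x -> th_lim Om th x l /\ dir (vat x) l.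
  move=> x; have [cx|ncx] := pselect (closure Om x); last by exists 0.
  have [Ox|nOx] := pselect (Om x).
    exists (th x) => _; split; last exact: (proj2 (reach_in (Hth x Ox))).
    move=> e e0; have [a a0 Ha] := (cont_eball th x).1 (cont_th oOm scOm nOy Hth Ox) e e0.
    by exists a => // z xz _; exact: Ha.
  have bx : boundary Om x by split=> // /interior_subset.
  by have [l Hl] := lim_boundary oOm scOm nOy Hth lip bx (clxy x cx); exists l.
have Htb x : closure Om x -> th_lim Om th x (tb x) /\ dir (vat x) (tb x) by exact: Htb'.
(* A point [z] of the closure is a limit of points of [Om] where [th] is near both [tb x] and
   [tb z]. *)
have tbc x : closure Om x -> forall e, 0 < e -> exists2 a : R, 0 < a &
    forall z, eball x a z -> closure Om z -> `|tb z - tb x| <= e.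
  move=> cx e e0; have [a a0 Ha] := (Htb x cx).1 e e0; exists a => // z xz cz.
  apply/ler_addgt0Pr => e' e'0; have [b b0 Hb] := (Htb z cz).1 e' e'0.
  have [w [Ow [xw zw]]] : exists w, (Om `&` (eball x a `&` eball z b)) w.
    apply: cz; apply: open_nbhs_nbhs; split; first by apply: openI; exact: open_eball.
    by split=> //; rewrite /eball /= sqdxx exprn_gt0.
  rewrite -(subrKA (th w)) addrC; apply: le_trans (ler_normD _ _) _.
  by rewrite lerD ?Ha // distrC Hb.
have cOm : compact (closure Om).
  apply: (subclosed_compact (B := [set x | sqd y0 x <= rho ^+ 2])); first exact: closed_closure.
    exact: compact_sqd_le.
  have cl := @closed_sqd_le R y0 (rho ^+ 2).
  by move=> z cz; apply: cl => B nB; have [w [Ow Bw]] := cz B nB; exists w; split=> //; exact: bOm.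
have ctb : {within closure Om, continuous tb}.
  move=> x; have [cx|ncx] := pselect (closure Om x).
    apply/cvgrPdist_le => e e0; have [a a0 Ha] := tbc x cx e e0.
    have E : nbhs_subspace (x : subspace (closure Om)) [set z | `|tb x - tb z| <= e].
      rewrite -nbhs_subspace_in //; apply/nbhs_eball; exists a => // z xz cz.
      by rewrite /= distrC; exact: Ha.
    exact: E.
  move=> B nB; have E : nbhs_subspace (x : subspace (closure Om)) (tb @^-1` B).
    by rewrite -nbhs_subspace_out // => _ ->; exact: nbhs_singleton nB.
  exact: E.
have [M M0 HM] : exists2 M : R, 0 < M & forall x, closure Om x -> `|tb x| <= M.
  have /compact_bounded[M [_ HM]] := continuous_compact ctb cOm.
  exists (`|M| + 1); first by rewrite ltr_wpDl.
  move=> x cx; apply: (HM (`|M| + 1)); last by exists x.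
  by rewrite (le_lt_trans (ler_norm M)) // ltrDl.
have [g [gE cg _]] := @continuous_bounded_extension (plane R) R (@pseudometric_normal R (plane R)) _ (@closed_closure _ Om) tb M M0 ctb HM.
have gtb x : closure Om x -> g x = tb x by move=> cx; rewrite gE // inE.
pose nv (x : plane R) := Num.sqrt (dot (vat x) (vat x)).
have nv0 x : x <> y -> 0 < nv x by move=> xy; rewrite sqrtr_gt0; exact: vat_gt0.
have nvE x (r t : R) : 0 < r -> vat x = (r * cos t, r * sin t) -> nv x = r.
  move=> r0 E; rewrite /nv E /dot /= (_ : _ + _ = r ^+ 2 * (cos t * cos t + sin t * sin t)); last by ring.
  by rewrite cos2Dsin2' mulr1 sqrtr_sqr ger0_norm // ltW.
(* Two unit fields: [F1] is made from the Tietze extension [g] of the argument and is continuous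
   everywhere, [F2] is the radial field about [y]. They agree on the closure of [Om]. *)
pose F1 (i : bool) (x : plane R) : R := if i then sin (g x) else cos (g x).
pose F2 (i : bool) (x : plane R) : R := (if i then (vat x).2 else (vat x).1) / nv x.
have F12 i x : closure Om x -> F1 i x = F2 i x.
  move=> cx; have [r r0 E] := (Htb x cx).2.
  rewrite /F1 /F2 (nvE x r (tb x)) // E gtb //; case: (i) => /=; by rewrite mulrAC divff ?mul1r // gt_eqF.
have cF1 i : continuous (F1 i).
  move=> x; case: i; rewrite /F1.
    by apply: (@continuous_comp _ _ _ g sin); [exact: cg|exact: continuous_sin].
  by apply: (@continuous_comp _ _ _ g cos); [exact: cg|exact: continuous_cos].
have cv1 : continuous (fun x : plane R => (vat x).1).
  by move=> x; apply: (@continuousB R R _ (fun z : plane R => z.1) (fun=> y.1)); [exact: cvg_fst|exact: cst_continuous].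
have cv2 : continuous (fun x : plane R => (vat x).2).
  by move=> x; apply: (@continuousB R R _ (fun z : plane R => z.2) (fun=> y.2)); [exact: cvg_snd|exact: cst_continuous].
have cF2 i x : x <> y -> {for x, continuous (F2 i)}.
  move=> xy; apply: (@continuousM R _ (fun x => if i then (vat x).2 else (vat x).1) (fun x => (nv x)^-1)).
    by case: (i); [exact: cv2|exact: cv1].
  apply: (@continuousV R _ nv); first by rewrite gt_eqF // nv0.
  apply: (@continuous_comp _ _ _ (fun x => dot (vat x) (vat x)) Num.sqrt); last exact: sqrt_continuous.
  apply: (@continuousD R R _ (fun x => (vat x).1 * (vat x).1) (fun x => (vat x).2 * (vat x).2)).
    by apply: (@continuousM R _ (fun x => (vat x).1) (fun x => (vat x).1)); exact: cv1.
  by apply: (@continuousM R _ (fun x => (vat x).2) (fun x => (vat x).2)); exact: cv2.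
(* Replacing the radial field inside [C] removes its singularity at [y]. The result is continuous
   because [C] and the rest of the exterior are open and the two fields match on the closure of [Om]
   in between. *)
pose r i x := if `[< C x >] then F1 i x else F2 i x.
have rC i x : C x -> r i x = F1 i x by rewrite /r => Cx; rewrite asboolT.
have rN i x : ~ C x -> r i x = F2 i x by rewrite /r => Cx; rewrite asboolF.
have cr i : continuous (r i).
  move=> x; apply/cont_eball => e e0.
  have [Cx|nCx] := pselect (C x).
    have [a a0 Ha] := (cont_eball _ x).1 (cF1 i x) e e0; have [b b0 Hb] := open_eballP oC Cx.
    exists (Num.min a b) => [|z xz]; first by rewrite lt_min a0.
    have za : eball x a z by apply: eball_sub xz; [rewrite le_min !ltW|rewrite ge_min lexx].
    have zb : eball x b z by apply: eball_sub xz; [rewrite le_min !ltW|rewrite ge_min lexx orbT].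
    by rewrite !rC //; [exact: Ha|exact: Hb].
  have xy : x <> y by move=> E; apply: nCx; rewrite E.
  have [a a0 Ha] := (cont_eball _ x).1 (cF2 i x xy) e e0.
  have [cx|ncx] := pselect (closure Om x).
    have [b b0 Hb] := (cont_eball _ x).1 (cF1 i x) e e0.
    exists (Num.min a b) => [|z xz]; first by rewrite lt_min a0.
    have za : eball x a z by apply: eball_sub xz; [rewrite le_min !ltW|rewrite ge_min lexx].
    have zb : eball x b z by apply: eball_sub xz; [rewrite le_min !ltW|rewrite ge_min lexx orbT].
    rewrite (rN i x nCx); have [Cz|nCz] := pselect (C z).
      by rewrite rC // -F12 //; exact: Hb.
    by rewrite rN //; exact: Ha.
  have Nx : (~` (C `|` closure Om)) x by move=> [].
  have [b b0 Hb] := open_eballP oN Nx.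
  exists (Num.min a b) => [|z xz]; first by rewrite lt_min a0.
  have za : eball x a z by apply: eball_sub xz; [rewrite le_min !ltW|rewrite ge_min lexx].
  have zb : eball x b z by apply: eball_sub xz; [rewrite le_min !ltW|rewrite ge_min lexx orbT].
  by rewrite !rN //; [exact: Ha|move=> Cz; apply: (Hb z zb); left].
have r1 x : 0 < dot (r false x, r true x) (r false x, r true x).
  have [Cx|nCx] := pselect (C x).
    rewrite !rC // /F1 /dot /=; by rewrite [X in _ < X](_ : _ = 1) ?ltr01 // cos2Dsin2'.
  have xy : x <> y by move=> E; apply: nCx; rewrite E.
  rewrite !rN // /F2 /dot /=; have n0 := nv0 x xy.
  rewrite [X in _ < X](_ : _ = dot (vat x) (vat x) / (nv x) ^+ 2); first by rewrite divr_gt0 ?exprn_gt0 // vat_gt0.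
  rewrite /dot /vat /=; move: (nv x) n0 => n n0; by field; rewrite gt_eqF.
(* Polar coordinates about [y], shrinking a circle of radius [3 rho] to its center. Points of [C]
   are within [2 rho] of [y], so on that circle the field is radial with argument [2 pi t], and
   [loop_closes] would give [2 pi = 0]. *)
pose P (p : plane R) : plane R := (y.1 + (1 - p.1) * (3 * rho) * cos (2 * pi * p.2), y.2 + (1 - p.1) * (3 * rho) * sin (2 * pi * p.2)).
have cP : continuous P.
  have c2 (f : R -> R) : continuous f -> continuous (fun p : plane R => f (2 * pi * p.2)).
    move=> cf p; apply: (@continuous_comp _ _ _ (fun p : plane R => 2 * pi * p.2) f); last exact: cf.
    by apply: (@continuousM R _ (fun=> 2 * pi) (fun p : plane R => p.2)); [exact: cst_continuous|exact: cvg_snd].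
  have c1 : continuous (fun p : plane R => (1 - p.1) * (3 * rho)).
    move=> p; apply: (@continuousM R _ (fun p : plane R => 1 - p.1) (fun=> 3 * rho)); last exact: cst_continuous.
    by apply: (@continuousB R R _ (fun=> 1) (fun p : plane R => p.1)); [exact: cst_continuous|exact: cvg_fst].
  apply: cont_pair => p.
    apply: (@continuousD R R _ (fun=> y.1) (fun p : plane R => (1 - p.1) * (3 * rho) * cos (2 * pi * p.2))); first exact: cst_continuous.
    by apply: (@continuousM R _ (fun p : plane R => (1 - p.1) * (3 * rho)) (fun p : plane R => cos (2 * pi * p.2))); [exact: c1|exact: (c2 cos (@continuous_cos R))].
  apply: (@continuousD R R _ (fun=> y.2) (fun p : plane R => (1 - p.1) * (3 * rho) * sin (2 * pi * p.2))); first exact: cst_continuous.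
  by apply: (@continuousM R _ (fun p : plane R => (1 - p.1) * (3 * rho)) (fun p : plane R => sin (2 * pi * p.2))); [exact: c1|exact: (c2 sin (@continuous_sin R))].
have rho3 : 0 < 3 * rho by rewrite mulr_gt0.
have far t : ~ C (P (0, t)).
  move=> /bC h1; have h2 := bC y Cy.
  have h3 : sqd y y0 <= rho ^+ 2 by rewrite sqdC.
  have := sqd_triangle (ltW rho0) (ltW rho0) h3 h1.
  have -> : sqd y (P (0, t)) = (3 * rho) ^+ 2.
    rewrite /sqd /P /= subr0 mul1r ![_ + _ - _]addrAC !subrr !add0r !exprMn -mulrDr.
    by rewrite !expr2 cos2Dsin2' mulr1.
  rewrite ler_pXn2r ?nnegrE ?addr_ge0 ?(ltW rho0) ?(ltW rho3) //; lra.
have vP t : vat (P (0, t)) = (3 * rho * cos (2 * pi * t), 3 * rho * sin (2 * pi * t)).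
  by rewrite /vat /P /= subr0 mul1r ![_ + _ - _]addrAC !subrr !add0r.
have cL : continuous (fun t : R => 2 * pi * t).
  by move=> t; apply: (@continuousM R R (fun=> 2 * pi) id); [exact: cst_continuous|exact: cvg_id].
have cK i : continuous (fun p => r i (P p)).
  by move=> p; apply: (@continuous_comp _ _ _ P (r i)); [exact: cP|exact: cr].
have p2 : 2 * pi = pi *+ 2 :> R by rewrite mulr_natl.
have := loop_closes (cK false) (cK true) cL (fun p => r1 (P p)) _ _ _.
rewrite mulr1 mulr0 => H; have : 2 * pi = 0 :> R.
  apply: H => [s|t _|t _].
  - by rewrite /P /= mulr0 mulr1 p2 cos0 sin0 cos2pi sin2pi.
  - by rewrite /P /= subrr !mul0r.
  - exists 1 => //; rewrite !rN // /F2 (nvE _ _ _ rho3 (vP t)) vP /=.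
    by congr pair; rewrite mul1r mulrAC divff ?mul1r // gt_eqF.
by apply/eqP; rewrite mulf_neq0 // gt_eqF // pi_gt0.
Qed.

(** * Vanishing of the functional *)

Section NullSequences.
Context {R : realType}.

Lemma chart_radii (r d : R) : 0 < r / 2 -> d <= r / 2 ->
  [/\ r < 3 * r, 2 * r <= 3 * r, r + d < 3 * r & 2 * r + d <= 3 * r].
Proof. by move=> *; split; lra. Qed.

Lemma chart_gap (g d : R) : 0 < d -> (- (d / 2) <= g -> 0 < g + d) /\ (g <= - (d / 2) -> g < 0).
Proof. by move=> *; split; lra. Qed.

Lemma four_terms (e a b p q s t : R) : a <= p + q -> b <= s + t ->
  p <= e / 3 / 2 -> q <= e / 3 -> s <= e / 3 / 2 -> t <= e / 3 -> a + b <= e.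
Proof. lra. Qed.

Definition to0 (u : nat -> R) := forall e, 0 < e -> exists N, forall n, (N <= n)%N -> `|u n| <= e.

Lemma to0D (u v : nat -> R) : to0 u -> to0 v -> to0 (fun n => u n + v n).
Proof.
move=> Hu Hv e e0; have e2 : 0 < e / 2 by rewrite divr_gt0.
have [N HN] := Hu _ e2; have [N' HN'] := Hv _ e2.
exists (maxn N N') => n; rewrite geq_max => /andP[h h'].
by apply: le_trans (ler_normD _ _) _; rewrite [leRHS]splitr lerD ?HN ?HN'.
Qed.

Lemma to0_le (u v : nat -> R) (K : R) : to0 u -> (forall n, `|v n| <= K * `|u n|) -> to0 v.
Proof.
move=> Hu Huv e e0; have K1 : 0 < `|K| + 1 by rewrite ltr_wpDl.
have [N HN] := Hu (e / (`|K| + 1)) (divr_gt0 e0 K1); exists N => n Nn.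
apply: le_trans (Huv n) _; apply: (@le_trans _ _ ((`|K| + 1) * `|u n|)).
  by apply: ler_wpM2r => //; rewrite (le_trans (ler_norm K)) // lerDl.
by rewrite mulrC -ler_pdivlMr // HN.
Qed.

Lemma to0_sqr (u : nat -> R) : (forall n, 0 <= u n) -> to0 (fun n => u n ^+ 2) -> to0 u.
Proof.
move=> u0 H e e0; have [N HN] := H (e ^+ 2) (exprn_gt0 2 e0); exists N => n /HN.
by rewrite ger0_norm ?sqr_ge0 // ger0_norm // ler_pXn2r ?nnegrE // ltW.
Qed.

Lemma to0_tn (K : R) : to0 (fun n => K * tn n).
Proof.
move=> e e0; have [N HN] := tn_small `|K| e0; exists N => n /HN.
by rewrite normrM (ger0_norm (ltW (tn_gt0 n))).
Qed.

End NullSequences.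

Section Vanishing.
Context {R : realType}.
Implicit Types (f g u v w phi theta : plane R -> R) (x y z : plane R).
Variables (x0 : plane R) (rho c : R) (l : (plane R -> R) -> R) (psi : nat -> plane R -> R).
Hypothesis rho0 : 0 < rho.
Hypothesis c01 : 0 <= c <= 1.
Notation B := (eball x0 rho).
Hypothesis tpsi : forall j, test_function B (psi j).
Hypothesis Hpsi : forall j phi, smooth phi -> `|en c B (psi j) phi - l phi| <= tn j * nm (en 1 B) phi.

Let dB : dom B. Proof. by apply: dom_eball; exact: ltW. Qed.
Let c0 : 0 <= c. Proof. by case/andP: c01. Qed.
Let f1 : pform smooth (en 1 B). Proof. exact: en_form. Qed.
Let fc : pform smooth (en c B). Proof. exact: en_form. Qed.
Let mB : measurable (B : set (mplane R)). Proof. by case: dB. Qed.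
Let sS := @smooth_sub R.
Let spsi j : smooth (psi j). Proof. by case: (tpsi j). Qed.
Notation nm1 := (nm (en 1 B)).

Let dens u v x : R := pd false u x * pd false v x + pd true u x * pd true v x + 1 * (u x * v x).

Lemma nm_mul g : smooth g -> exists2 K : R, 0 <= K & forall u, smooth u -> nm1 (fun x => g x * u x) <= K * nm1 u.
Proof.
move=> sg; have [M M0 HM] := ball_bound x0 sg (ltW rho0); exists (3 * M).
  by rewrite mulr_ge0 // ltW.
move=> u su; have sgu : smooth (fun x => g x * u x) by exact: smoothM.
apply: le_trans (ler_norm _) _; apply: sqr_le; first by rewrite !mulr_ge0 ?nm_ge0 // ltW.
rewrite exprMn !(nm_sqr f1) // /en -IIZ //; last by apply: dom_integ => //; apply: smooth_cont; exact: smooth_density.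
apply: II_le => //.
- by apply: dom_integ => //; apply: smooth_cont; exact: smooth_density.
- by apply: integZ => //; apply: dom_integ => //; apply: smooth_cont; exact: smooth_density.
move=> x Bx; have [g0 g1] := HM x (ltW Bx); rewrite !pdMs // !mul1r.
have S (p : R) : `|p| <= M -> p ^+ 2 <= M ^+ 2.
  by move=> h; rewrite -real_normK ?num_real // ler_pXn2r ?nnegrE // ltW.
have h0 := S _ g0; have h1 := S _ (g1 false); have h2 := S _ (g1 true).
have D (p q : R) : (p + q) * (p + q) <= 2 * p ^+ 2 + 2 * q ^+ 2 by have := sqr_ge0 (p - q); nra.
have G (i : bool) : pd i g x ^+ 2 <= M ^+ 2 -> (g x * pd i u x + u x * pd i g x) * (g x * pd i u x + u x * pd i g x) <=
   2 * M ^+ 2 * pd i u x ^+ 2 + 2 * M ^+ 2 * u x ^+ 2.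
  move=> hi; have d := D (g x * pd i u x) (u x * pd i g x).
  have e1 := ler_wpM2r (sqr_ge0 (pd i u x)) h0; have e2 := ler_wpM2r (sqr_ge0 (u x)) hi.
  apply: le_trans d _; rewrite !exprMn.
  move: e1 e2; move: (g x ^+ 2) (M ^+ 2) (pd i u x ^+ 2) (u x ^+ 2) (pd i g x ^+ 2) => *; lra.
have := G false h1; have := G true h2.
have : g x * u x * (g x * u x) <= M ^+ 2 * u x ^+ 2.
  by rewrite mulrACA -!expr2 ler_wpM2r // sqr_ge0.
have u2 := mulr_ge0 (sqr_ge0 M) (sqr_ge0 (u x)).
have p2 := mulr_ge0 (sqr_ge0 M) (sqr_ge0 (pd false u x)); have q2 := mulr_ge0 (sqr_ge0 M) (sqr_ge0 (pd true u x)).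
move=> e1 e2 e3; apply: le_trans (lerD (lerD e3 e2) e1) _.
rewrite exprMn (_ : 3 ^+ 2 = 9); last by ring.
rewrite -!expr2; move: u2 p2 q2; move: (M ^+ 2) (u x ^+ 2) (pd false u x ^+ 2) (pd true u x ^+ 2) => m w p q; lra.
Qed.

Lemma psi_bound : exists2 P : R, 0 <= P & forall n, nm1 (psi n) <= P.
Proof.
have K0 : 0 <= 1 + 4 * rho ^+ 2 by rewrite addr_ge0 // mulr_ge0 // sqr_ge0.
exists (nm1 (psi 0) + (1 + 4 * rho ^+ 2) * 2) => [|n]; first by rewrite addr_ge0 ?nm_ge0 // mulr_ge0.
have -> : psi n = fun x => psi 0 x + (psi n x - psi 0 x) by apply/funext => x; ring.
apply: le_trans (form_triangle sS f1 (spsi 0) (smoothB (spsi n) (spsi 0))) _.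
rewrite lerD2l; apply: le_trans (psi_cauchy rho0 c01 tpsi Hpsi n 0) _; apply: ler_wpM2l => //.
by have := tn_le1 (R := R) n; have := tn_le1 (R := R) 0; lra.
Qed.

Lemma II_bound3 g (G : R) u v : continuous g -> smooth u -> smooth v -> 0 <= G ->
  (forall x, B x -> `|g x| <= G) -> `|II B (fun x => g x * u x * v x)| <= G * nm1 u * nm1 v.
Proof.
move=> cg su sv G0 HG; have cu := smooth_cont su; have cv := smooth_cont sv.
have cM (h k : plane R -> R) : continuous h -> continuous k -> continuous (fun x => h x * k x : R).
  by move=> ch ck x; apply: continuousM; [exact: ch|exact: ck].
have cgu := cM _ _ cg cu.
have I1 : integ B (fun x => g x * u x * (g x * u x)) by apply: dom_integ => //; exact: cM.
have I2 : integ B (fun x => g x * u x * v x) by apply: dom_integ => //; exact: cM.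
have I3 : integ B (fun x => v x * v x) by apply: dom_integ => //; exact: cM.
have Id w : smooth w -> integ B (dens w w) by move=> sw; apply: dom_integ => //; apply: smooth_cont; exact: smooth_density.
apply: sqr_le; first by rewrite !mulr_ge0 ?nm_ge0.
apply: le_trans (II_CS mB I1 I2 I3) _; rewrite !exprMn !(nm_sqr f1) //; apply: ler_pM.
- by apply: II_ge0 => x _; rewrite -expr2 sqr_ge0.
- by apply: II_ge0 => x _; rewrite -expr2 sqr_ge0.
- rewrite /en -(IIZ (G ^+ 2) mB (Id u su)); apply: II_le => //; first exact: (integZ _ mB (Id u su)).
  move=> x Bx; rewrite /dens mulrACA -!expr2 mul1r; apply: ler_pM; rewrite ?sqr_ge0 //.
    by rewrite -real_normK ?num_real // ler_pXn2r ?nnegrE // HG.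
  by rewrite lerDr addr_ge0 // sqr_ge0.
- apply: II_le => //; first exact: Id.
  by move=> x _; rewrite mul1r lerDr -!expr2 addr_ge0 // sqr_ge0.
Qed.

Variables (U : (plane R -> R) -> R) (M : R) (Om : set (plane R)).
Hypothesis M0 : 0 <= M.
Hypothesis HU : forall f (m : R), continuous f -> 0 <= m -> (forall x, B x -> `|f x| <= m) ->
    forall j, `|U f - II B (fun x => f x * psi j x)| <= M * m * tn j.
Hypothesis lOm : forall phi, smooth phi -> (forall x, Om x -> phi x = 0) -> l phi = 0.
Hypothesis UW : forall y, ~ closure Om y -> exists2 a, 0 < a & Uzero U y a.

Section Local.
Variables (y : plane R) (a : R).
Hypothesis Uy : Uzero U y a.
Hypothesis yOm : forall x, eball y a x -> ~ Om x.

(** From weak to strong vanishing: split one factor as [psi n = psi m + (psi n - psi m)]. The second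
    part is small by the Cauchy estimate once [m] is fixed large; then the first tends to
    [U (g psi m) = 0] as [n] grows. *)
Lemma local_L2 g : test_function (eball y a) g -> to0 (fun n => II B (fun x => g x * psi n x * psi n x)).
Proof.
move=> tg e e0; have [sg _] := tg; have [G G0 HG] := ball_bound x0 sg (ltW rho0).
have [P P0 HP] := psi_bound.
pose K := G * P * ((1 + 4 * rho ^+ 2) * 2).
have e2 : 0 < e / 2 by rewrite divr_gt0.
have [m Hm] := tn_small K e2.
have tgm : test_function (eball y a) (fun x => g x * psi m x) by exact: testMr.
have [sgm _] := tgm; have [Q Q0 HQ] := ball_bound x0 sgm (ltW rho0).
have [N HN] := tn_small (M * Q) e2.
exists (maxn m N) => n; rewrite geq_max => /andP[mn Nn].
have cgm := smooth_cont sgm.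
have I1 : integ B (fun x => g x * psi m x * psi n x).
  by apply: dom_integ => //; apply: smooth_cont; exact: smoothM.
have sd : smooth (fun x => psi n x - psi m x) by exact: smoothB.
have I2 : integ B (fun x => g x * psi n x * (psi n x - psi m x)).
  by apply: dom_integ => //; apply: smooth_cont; apply: smoothM => //; exact: smoothM.
have -> : (fun x => g x * psi n x * psi n x) = (fun x => g x * psi m x * psi n x + g x * psi n x * (psi n x - psi m x)).
  by apply/funext => x; ring.
rewrite (IID mB I1 I2); apply: le_trans (ler_normD _ _) _; rewrite [leRHS]splitr; apply: lerD.
  have := HU cgm (ltW Q0) (fun x Bx => (HQ x (ltW Bx)).1) n; rewrite (Uy tgm) sub0r normrN => /le_trans; apply.
  exact: HN.
apply: le_trans (II_bound3 (smooth_cont sg) (spsi n) sd (ltW G0) (fun x Bx => (HG x (ltW Bx)).1)) _.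
apply: le_trans (Hm m (leqnn m)); rewrite /K -!mulrA; apply: ler_wpM2l; first exact: ltW.
apply: ler_pM; rewrite ?nm_ge0 //.
apply: le_trans (psi_cauchy rho0 c01 tpsi Hpsi n m) _; apply: ler_wpM2l.
  by rewrite addr_ge0 // mulr_ge0 // sqr_ge0.
by have := tn_le (R := R) mn; lra.
Qed.

(** The Caccioppoli inequality: testing with [theta^2 psi n], on which [l] vanishes because [theta]
    vanishes on [Om], bounds the gradient by the L^2 norm already known to tend to 0. *)
Lemma caccioppoli theta : test_function (eball y a) theta -> to0 (fun n => nm1 (fun x => theta x * psi n x)).
Proof.
move=> tt; have [st _] := tt; have [P P0 HP] := psi_bound.
(* Exactly the difference between the H^1 density of [theta psi n] and the [c]-energy density of the
   pair [psi n], [theta^2 psi n]. *)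
pose g x := (1 - c) * theta x ^+ 2 + (pd false theta x ^+ 2 + pd true theta x ^+ 2).
have tg : test_function (eball y a) g.
  apply: testD; first by apply: testZ; exact: testX2.
  by apply: testD; apply: testX2; exact: test_pd.
have [sg _] := tg.
have stt : smooth (fun x => theta x * theta x) by exact: smoothM.
have [K K0 HK] := nm_mul stt.
pose phi n x := theta x * theta x * psi n x.
have sphi n : smooth (phi n) by exact: smoothM.
have h1 : to0 (fun n => en c B (psi n) (phi n)).
  apply: (@to0_le _ (fun n => (K * P) * tn n) _ 1); first exact: to0_tn.
  move=> n; rewrite mul1r normrM (ger0_norm (ltW (tn_gt0 n))) ger0_norm ?mulr_ge0 //.
  have := Hpsi n (sphi n); rewrite (lOm (sphi n)) ?subr0 => [|x Ox].
    move=> /le_trans; apply; rewrite mulrC; apply: ler_wpM2r; first by rewrite ltW // tn_gt0.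
    by apply: le_trans (HK _ (spsi n)) _; apply: ler_wpM2l.
  by rewrite /phi (test_notin tt) ?mulr0 ?mul0r // => /yOm.
apply: to0_sqr => [n|]; first exact: nm_ge0.
have h2 := local_L2 tg.
have E n : nm1 (fun x => theta x * psi n x) ^+ 2 = en c B (psi n) (phi n) + II B (fun x => g x * psi n x * psi n x).
  rewrite (nm_sqr f1); last exact: smoothM.
  rewrite /en -IID //.
  - apply: II_eq => x _; rewrite /phi !pdMs //; rewrite /g; move: (pd false theta x) (pd true theta x) (pd false (psi n) x) (pd true (psi n) x) => p q p' q'; ring.
  - by apply: dom_integ => //; apply: smooth_cont; exact: smooth_density.
  - by apply: dom_integ => //; apply: smooth_cont; apply: smoothM => //; exact: smoothM.
have := to0D h1 h2; congr to0; apply/funext => n; by rewrite E.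
Qed.

End Local.

(** [caccioppoli] gives this for small radial cutoffs; the class of such [f] is closed under sums
    and smooth factors, so [cutoff_principle] reaches the whole compact support of [g]. *)
Lemma exterior_to0 g : test_function (~` closure Om) g -> to0 (fun n => nm1 (fun x => g x * psi n x)).
Proof.
move=> [sg [K [cK KW gK]]].
pose A f := smooth f /\ to0 (fun n => nm1 (fun x => f x * psi n x)).
have AM f h : A f -> smooth h -> A (fun x => h x * f x).
  move=> [sf Hf] sh; split; first exact: smoothM.
  have [k k0 Hk] := nm_mul sh; apply: (to0_le (K := k) Hf) => n.
  rewrite !ger0_norm ?nm_ge0 // (_ : (fun x => h x * f x * psi n x) = fun x => h x * (f x * psi n x)).
    by apply: Hk; exact: smoothM.
  by apply/funext => x; rewrite mulrA.
have [|||||chi [[schi Achi] _ _ [V [oV KV V1]]]] := @cutoff_principle R A K.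
- split; first exact: smooth_cst.
  move=> e e0; exists 0%N => n _.
  have -> : (fun x => 0 * psi n x) = (fun x => 0 * (0 * psi n x)) by apply/funext => x; rewrite !mul0r.
  have [_ _ aZ _] := f1; have s0 : smooth (fun x => 0 * psi n x) by exact: smoothZ.
  have [aC _ _ _] := f1; have s00 : smooth (fun x => 0 * (0 * psi n x)) by exact: smoothZ.
  by rewrite /nm (aZ 0 _ _ s0 s00) mul0r sqrtr0 normr0 ltW.
- move=> f h [sf Hf] [sh Hh]; split; first exact: smoothD.
  apply: (to0_le (K := 1) (to0D Hf Hh)) => n; rewrite mul1r !ger0_norm ?addr_ge0 ?nm_ge0 //.
  rewrite (_ : (fun x => (f x + h x) * psi n x) = fun x => f x * psi n x + h x * psi n x).
    by apply: form_triangle sS f1 _ _; exact: smoothM.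
  by apply/funext => x; rewrite mulrDl.
- exact: AM.
- exact: cK.
- move=> y Ky; have ny := KW y Ky; have [a a0 Ua] := UW ny.
  have oW : open (~` closure Om) by apply: closed_openC; exact: closed_closure.
  have [b b0 Hb] := open_eballP oW ny.
  pose d := Num.min a b; have d0 : 0 < d by rewrite lt_min a0.
  have d4 : 0 < d / 4 by rewrite divr_gt0.
  have da : d <= a by rewrite ge_min lexx.
  have db : d <= b by rewrite ge_min lexx orbT.
  exists (d / 4) => //; split; first exact: smooth_rcut.
  apply: (@caccioppoli y d).
  + by move=> f tf; apply: Ua; apply: test_sub tf; apply: eball_sub; [exact: ltW|].
  + move=> x xd Ox; have : (~` closure Om) x by apply: Hb; apply: eball_sub xd; [exact: ltW|].
    by apply; exact: subset_closure.
  + by apply: (test_rcut (c := d)) => //; [exact: ltW|lra|lra].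
have [_ +] := AM _ _ (conj schi Achi) sg; congr to0; apply/funext => n; congr nm.
apply/funext => x; have [Kx|nK] := pselect (K x); first by rewrite V1 ?mulr1 //; exact: KV.
by rewrite gK // !mul0r.
Qed.

Hypothesis oOm : open Om.
Hypothesis OmB : closure Om `<=` B.
Hypothesis lipOm : lipschitz_boundary Om.
Hypothesis lT : forall phi, test_function Om phi -> l phi = 0.

Lemma en_shift (e : R) (a : plane R) f : test_function B f -> test_function B (shiftf a f) ->
  en e B (shiftf a f) (shiftf a f) = en e B f f.
Proof.
move=> tf ts; have [sf _] := tf.
have td g : test_function B g -> test_function B (fun x => pd false g x * pd false g x + pd true g x * pd true g x + e * (g x * g x)).
  move=> tg; have [sg _] := tg.
  by apply: testD; [apply: testD|apply: testZ]; apply: testMr => //; try exact: test_pd; exact: smooth_pd.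
rewrite /en (@II_test _ B setT) //; last exact: td.
rewrite (@II_test _ B setT (fun x => pd false f x * _ + _ + _)) //; last exact: td.
rewrite -(II_shift a (test_sub (O' := setT) (fun x _ => I) (td f tf))).
by congr II; apply/funext => x; rewrite !pd_shift.
Qed.

(** The class fed to [cutoff_principle] on the whole disc: localized by [f], the [psi n] are
    eventually close to test functions of [Om]. *)
Definition approximable f := smooth f /\ forall e, 0 < e -> exists N, forall n, (N <= n)%N ->
  exists2 om, test_function Om om & nm1 (fun x => f x * psi n x - om x) <= e.

Lemma approximable_mul f h : approximable f -> smooth h -> approximable (fun x => h x * f x).
Proof.
move=> [sf Hf] sh; split; first exact: smoothM.
have [k k0 Hk] := nm_mul sh => e e0; have k1 : 0 < k + 1 by rewrite ltr_wpDl.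
have [N HN] := Hf (e / (k + 1)) (divr_gt0 e0 k1); exists N => n Nn.
have [om tom Hom] := HN n Nn; have [som _] := tom.
exists (fun x => h x * om x); first exact: testM.
have -> : (fun x => h x * f x * psi n x - h x * om x) = fun x => h x * (f x * psi n x - om x).
  by apply/funext => x; ring.
have sd : smooth (fun x => f x * psi n x - om x) by apply: smoothB => //; exact: smoothM.
apply: le_trans (Hk _ sd) _; apply: (@le_trans _ _ ((k + 1) * (e / (k + 1)))).
  by apply: ler_pM; rewrite ?nm_ge0 // lerDl.
by rewrite mulrC divfK // gt_eqF.
Qed.

Lemma approximable_add f h : approximable f -> approximable h -> approximable (fun x => f x + h x).
Proof.
move=> [sf Hf] [sh Hh]; split; first exact: smoothD.
move=> e e0; have e2 : 0 < e / 2 by rewrite divr_gt0.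
have [N HN] := Hf _ e2; have [N' HN'] := Hh _ e2.
exists (maxn N N') => n; rewrite geq_max => /andP[Nn Nn'].
have [om tom Hom] := HN n Nn; have [om' tom' Hom'] := HN' n Nn'.
have [som _] := tom; have [som' _] := tom'.
exists (fun x => om x + om' x); first exact: testD.
have -> : (fun x => (f x + h x) * psi n x - (om x + om' x)) = fun x => (f x * psi n x - om x) + (h x * psi n x - om' x).
  by apply/funext => x; ring.
apply: le_trans (form_triangle sS f1 _ _) _; try by apply: smoothB => //; exact: smoothM.
by rewrite [leRHS]splitr lerD.
Qed.

Lemma nm0 : nm1 (fun=> 0) = 0.
Proof.
rewrite /nm (_ : en 1 B (fun=> 0) (fun=> 0) = 0) ?sqrtr0 // /en -[RHS](II0 B); apply: II_eq => x _.
by rewrite !pd_cst !mul0r mulr0 !addr0.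
Qed.

Lemma approximable_in y : Om y -> exists2 a : R, 0 < a & approximable (rcut y a (2 * a)).
Proof.
move=> Oy; have [a a0 aO] := open_eballP oOm Oy; have a4 : 0 < a / 4 by rewrite divr_gt0.
exists (a / 4) => //; split; first exact: smooth_rcut.
move=> e e0; exists 0%N => n _; exists (fun x => rcut y (a / 4) (2 * (a / 4)) x * psi n x).
  by apply: testMr => //; apply: (test_rcut (c := a)) => //; [exact: ltW|lra|lra].
rewrite (_ : (fun x => _ - _) = fun=> 0) ?nm0 ?ltW //.
by apply/funext => x; rewrite subrr.
Qed.

Lemma approximable_out y : ~ closure Om y -> exists2 a : R, 0 < a & approximable (rcut y a (2 * a)).
Proof.
move=> ny; have oW : open (~` closure Om) by apply: closed_openC; exact: closed_closure.
have [a a0 aO] := open_eballP oW ny; have a4 : 0 < a / 4 by rewrite divr_gt0.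
exists (a / 4) => //; split; first exact: smooth_rcut.
have tt : test_function (~` closure Om) (rcut y (a / 4) (2 * (a / 4))).
  by apply: (test_rcut (c := a)) => //; [exact: ltW|lra|lra].
move=> e e0; have [N HN] := exterior_to0 tt e0; exists N => n Nn.
exists (fun=> 0); first exact: test0.
rewrite (_ : (fun x => _ - _) = fun x => rcut y (a / 4) (2 * (a / 4)) x * psi n x).
  by apply: le_trans (HN n Nn); exact: ler_norm.
by apply/funext => x; rewrite subr0.
Qed.

Lemma shift_small f (a : plane R) : test_function setT f -> exists2 C : R, 0 < C &
  forall d, `|d| <= 1 -> nm1 (fun x => f x - shiftf (d *: a) f x) <= C * `|d|.
Proof.
move=> tf; have [sf _] := tf; have [L L0 [_ HL1 HL2]] := test_pd_bound tf.
pose vol := II B (fun=> 1); have vol0 : 0 <= vol by apply: II_ge0.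
pose A := L * (`|a.1| + `|a.2|); have A0 : 0 <= A by rewrite mulr_ge0 ?addr_ge0 // ltW.
exists (A * Num.sqrt (3 * vol) + 1); first by rewrite ltr_wpDl // mulr_ge0 // sqrtr_ge0.
move=> d d1; have ss := smooth_shift (d *: a) sf.
have H g : smooth g -> (forall i x, `|pd i g x| <= L) -> forall x, `|g x - shiftf (d *: a) g x| <= A * `|d|.
  move=> sg Hg x; apply: le_trans (pd_bound_lip sg Hg _ _) _.
  rewrite /= !opprD !addrA !subrr !add0r !normrN !normrM -mulrDr /A le_eqVlt; apply/orP; left; apply/eqP; ring.
have h0 := H f sf HL1; have h1 i := H (pd i f) (smooth_pd i sf) (fun j => HL2 j i).
have sd : smooth (fun x => f x - shiftf (d *: a) f x) by exact: smoothB.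
apply: (@le_trans _ _ (A * `|d| * Num.sqrt (3 * vol))); last first.
  by rewrite mulrAC ler_wpM2r // lerDl.
apply: le_trans (ler_norm _) _; apply: sqr_le; first by apply: mulr_ge0; [apply: mulr_ge0|exact: sqrtr_ge0].
rewrite (nm_sqr f1) // exprMn sqr_sqrtr ?mulr_ge0 // mulrA mulrAC.
have E : II B (fun=> (A * `|d|) ^+ 2 * 3 * 1) = (A * `|d|) ^+ 2 * 3 * vol.
  by apply: IIZ => //; apply: dom_integ => // x; exact: cst_continuous.
rewrite [leRHS](_ : _ = (A * `|d|) ^+ 2 * 3 * vol); last by ring.
rewrite -E; apply: II_le => //.
- by apply: dom_integ => //; apply: smooth_cont; exact: smooth_density.
- by apply: dom_integ => // x; exact: cst_continuous.
move=> x _; rewrite !pdBs // !pd_shift mulr1 mul1r.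
have S (p : R) : `|p| <= A * `|d| -> p * p <= (A * `|d|) ^+ 2.
  by move=> h; rewrite -expr2 -real_normK ?num_real // ler_pXn2r ?nnegrE // mulr_ge0.
have := S _ (h0 x); have := S _ (h1 false x); have := S _ (h1 true x); rewrite /shiftf; lra.
Qed.

(** Translating the localized [psi n] by [d] into [Om] along the chart axis leaves outside of [Om]
    only what came from points at depth at least [d / 2] below the graph; that part is negligible by
    [exterior_to0], and a cutoff [kap] removes it. *)
Lemma approximable_boundary y : closure Om y -> ~ Om y -> exists2 a : R, 0 < a & approximable (rcut y a (2 * a)).
Proof.
move=> cly nOy.
have by_ : boundary Om y by split=> // /interior_subset.
have [a [b [gr [L [r0 [h [ab r00 h0 Lgr HOm]]]]]]] := lipOm by_.
pose Phi (s t : R) : plane R := (y.1 + s * a - t * b, y.2 + s * b + t * a).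
pose cs z := a * (z.1 - y.1) + b * (z.2 - y.2); pose ct z := a * (z.2 - y.2) - b * (z.1 - y.1).
have PhiK z : Phi (cs z) (ct z) = z.
  rewrite /Phi /cs /ct [RHS]surjective_pairing; congr pair.
    transitivity (y.1 + (z.1 - y.1) * (a ^+ 2 + b ^+ 2)); first by ring.
    by rewrite ab mulr1 subrKC.
  transitivity (y.2 + (z.2 - y.2) * (a ^+ 2 + b ^+ 2)); first by ring.
  by rewrite ab mulr1 subrKC.
have cst z : sqd y z = cs z ^+ 2 + ct z ^+ 2.
  rewrite /sqd /cs /ct; transitivity (((z.1 - y.1) ^+ 2 + (z.2 - y.2) ^+ 2) * (a ^+ 2 + b ^+ 2)); last by ring.
  by rewrite ab mulr1.
have small z (d : R) : 0 < d -> eball y d z -> `|cs z| < d /\ `|ct z| < d.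
  move=> d0; rewrite /eball /= cst => hd.
  by split; rewrite -(@ltr_pXn2r _ 2) ?nnegrE ?(ltW d0) // real_normK ?num_real //;
    apply: le_lt_trans hd; rewrite ?lerDl ?lerDr sqr_ge0.
have scs : smooth cs by apply: smoothD; apply: smoothZ; apply: smoothB; [exact: smooth_fst|exact: smooth_cst|exact: smooth_snd|exact: smooth_cst].
have sct : smooth ct by apply: smoothB; apply: smoothZ; apply: smoothB; [exact: smooth_snd|exact: smooth_cst|exact: smooth_fst|exact: smooth_cst].
have cgr : continuous gr.
  move=> s; apply/cvgrPdist_le => e e0; have L1 : 0 < `|L| + 1 by rewrite ltr_wpDl.
  have d0 : 0 < e / (`|L| + 1) by rewrite divr_gt0.
  near=> t.
  have ht : `|s - t| <= e / (`|L| + 1) by near: t; exact: cvgr_dist_le.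
  apply: le_trans (Lgr s t) _; apply: (@le_trans _ _ ((`|L| + 1) * `|s - t|)).
    by apply: ler_wpM2r => //; rewrite (le_trans (ler_norm L)) // lerDl.
  by rewrite mulrC -ler_pdivlMr.
pose gap z := ct z - gr (cs z).
have cgap : continuous gap.
  move=> z; apply: (@continuousB R R _ ct (fun z => gr (cs z))); first exact: smooth_cont.
  by apply: (@continuous_comp _ _ _ cs gr); [exact: smooth_cont|exact: cgr].
have oB := @open_eball R x0 rho.
have [q q0 qB] := open_eballP oB (OmB cly).
pose r := Num.min (Num.min r0 h) q / 3.
have m0 : 0 < Num.min (Num.min r0 h) q by rewrite !lt_min r00 h0.
have rr : 0 < r by rewrite divr_gt0.
have E3 : 3 * r = Num.min (Num.min r0 h) q by rewrite /r; field.
have r3 : 3 * r <= r0 by rewrite E3 !ge_min lexx.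
have rh : 3 * r <= h by rewrite E3 !ge_min lexx orbT.
have rq : 3 * r <= q by rewrite E3 ge_min lexx orbT.
have r30 : 0 < 3 * r by rewrite mulr_gt0.
have boxOm z : eball y (3 * r) z -> Om z <-> 0 < gap z.
  move=> /(small z _ r30)[hs ht]; rewrite subr_gt0.
  by have := HOm (cs z) (ct z) (lt_le_trans hs r3) (lt_le_trans ht rh); rewrite -/(Phi _ _) PhiK.
have r2 : 0 < r / 2 by rewrite divr_gt0.
have rE : 2 * (r / 2) = r by field.
exists (r / 2) => //; rewrite rE; pose theta := rcut y (r / 2) r.
have st : smooth theta by exact: smooth_rcut.
have rr2 : r / 2 < r by lra.
have th0 z : r ^+ 2 <= sqd y z -> theta z = 0 by apply: rcut0 => //; exact: ltW.
split=> // e e0; have e3 : 0 < e / 3 by rewrite divr_gt0.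
have tt : test_function (eball y (2 * r)) theta.
  by apply: (test_rcut (c := 2 * r)) => //; [exact: ltW|lra].
have I3B : eball y (3 * r) `<=` B by move=> z hz; apply: qB; apply: eball_sub hz; [exact: ltW|].
have I23 : eball y (2 * r) `<=` eball y (3 * r) by apply: eball_sub; [rewrite mulr_ge0 // ltW|case: (chart_radii r2 (lexx _))].
pose v n z := theta z * psi n z.
have tv n : test_function (eball y (2 * r)) (v n) by exact: testMr.
have sv n : smooth (v n) by case: (tv n).
have [k k0 Hk] := nm_mul st.
pose K := 1 + 4 * rho ^+ 2; have K0 : 0 <= K by rewrite addr_ge0 // mulr_ge0 // sqr_ge0.
(* The distance [d] of translation must not depend on [n]. It is chosen for the single function
   [v m], to which all later [v n] are close. *)
have [m Hm] := tn_small (k * (K * 2)) (divr_gt0 e3 (ltr0n R 2)).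
have vm n : (m <= n)%N -> nm1 (fun z => v n z - v m z) <= e / 3 / 2.
  move=> mn; apply: le_trans (Hm m (leqnn m)).
  rewrite (_ : (fun z => _) = fun z => theta z * (psi n z - psi m z)); last by apply/funext => z; rewrite /v; ring.
  apply: le_trans (Hk _ (smoothB (spsi n) (spsi m))) _; rewrite -!mulrA; apply: ler_wpM2l => //.
  apply: le_trans (psi_cauchy rho0 c01 tpsi Hpsi n m) _; rewrite -/K; apply: ler_wpM2l => //.
  by have := tn_le (R := R) mn; lra.
have [C C0 HC] := shift_small (b, - a) (test_sub (O' := setT) (fun x _ => I) (tv m)).
pose d := Num.min (r / 2) (Num.min 1 (e / 3 / C)).
have d0 : 0 < d by rewrite !lt_min r2 ltr01 divr_gt0.
have dr : d <= r / 2 by rewrite ge_min lexx.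
have d1 : `|d| <= 1 by rewrite ger0_norm ?(ltW d0) // ge_min; apply/orP; right; rewrite ge_min lexx.
have dC : C * `|d| <= e / 3.
  rewrite ger0_norm ?(ltW d0) // mulrC -ler_pdivlMr // ge_min; apply/orP; right; rewrite ge_min lexx orbT //.
have wm := le_trans (HC d d1) dC.
(* [shiftf nu f] moves the graph of [f] by [- nu], which in the chart is the upward direction: [ct]
   grows by [d]. *)
pose nu : plane R := d *: (b, - a).
have nuE' z : z - nu = (z.1 - d * b, z.2 + d * a) by rewrite /nu; congr pair; rewrite /= /GRing.scale /= ?mulrN ?opprK.
have csn z : cs (z - nu) = cs z by rewrite nuE' /cs /=; ring.
have ctn z : ct (z - nu) = ct z + d.
  rewrite nuE' /ct /=; transitivity (a * (z.2 - y.2) - b * (z.1 - y.1) + d * (a ^+ 2 + b ^+ 2)); first by ring.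
  by rewrite ab mulr1.
have gapn z : gap (z - nu) = gap z + d by rewrite /gap csn ctn addrAC.
have nud z : sqd z (z - nu) = d ^+ 2.
  rewrite nuE' /sqd /=; transitivity (d ^+ 2 * (a ^+ 2 + b ^+ 2)); first by ring.
  by rewrite ab mulr1.
(* The points at depth at most [d / 2]; moved up by [d] they form a compact subset [K1] of [Om]. *)
pose Z := [set z | sqd y z <= r ^+ 2] `&` [set z | - (d / 2) <= gap z].
have cZ : compact Z.
  apply: (subclosed_compact (B := [set z | sqd y z <= r ^+ 2])); [|exact: compact_sqd_le|by move=> z []].
  apply: closedI; first exact: closed_sqd_le.
  exact: (closed_comp (fun x _ => cgap x) (@closed_ge R _)).
pose K1 := (fun z => z - nu) @` Z.
have cK1 : compact K1.
  apply: continuous_compact => //; apply: continuous_subspaceT => z.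
  by apply: (@continuousB R _ _ id (fun=> nu)); [exact: cvg_id|exact: cst_continuous].
have K1Om : K1 `<=` Om.
  move=> _ [z [/= hz gz] <-]; apply/boxOm.
    have := sqd_triangle (ltW rr) (ltW d0) hz (_ : sqd z (z - nu) <= d ^+ 2).
    rewrite nud lexx => /(_ isT) /le_lt_trans; apply.
    by rewrite ltr_pXn2r ?nnegrE ?addr_ge0 // ?(ltW rr) ?(ltW d0) ?(ltW r30) //; case: (chart_radii r2 dr).
  by rewrite gapn; apply: (chart_gap _ d0).1.
have [kap [tk _ [V [oV KV V1]]]] := cutoff cK1 oOm K1Om; have [sk _] := tk.
(* What the cutoff loses, pulled back before the translation. It is supported at depth at least
   [d / 2], outside of the closure of [Om]. *)
pose g z := (1 - kap (z - nu)) * theta z.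
have sg : smooth g.
  apply: smoothM => //; apply: smoothB; first exact: smooth_cst.
  exact: (smooth_shift (- nu) sk).
have tg : test_function (~` closure Om) g.
  split=> //; exists ([set z | sqd y z <= r ^+ 2] `&` [set z | gap z <= - (d / 2)]); split.
  - apply: (subclosed_compact (B := [set z | sqd y z <= r ^+ 2])); [|exact: compact_sqd_le|by move=> z []].
    apply: closedI; first exact: closed_sqd_le.
    exact: (closed_comp (fun x _ => cgap x) (@closed_le R _)).
  - move=> z [/= hz gz] cz.
    have oN : open (eball y (3 * r) `&` [set z | gap z < 0]).
      by apply: openI; [exact: open_eball|exact: (open_comp (fun x _ => cgap x) (@open_lt R 0))].
    have [w [Ow [w3 gw]]] : exists w : plane R, (Om `&` (eball y (3 * r) `&` [set z | gap z < 0])) w.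
      apply: cz; apply: open_nbhs_nbhs; split=> //; split; last exact: (chart_gap _ d0).2.
      rewrite /eball /=; apply: le_lt_trans hz _; by rewrite ltr_pXn2r ?nnegrE ?(ltW rr) ?(ltW r30) //; case: (chart_radii r2 dr).
    by have := (boxOm w w3).1 Ow; rewrite ltNge (ltW gw).
  - move=> z nz; rewrite /g; have [hz|hz] := leP (r ^+ 2) (sqd y z); first by rewrite th0 // mulr0.
    have gz : - (d / 2) <= gap z.
      rewrite leNgt; apply/negP => hg; apply: nz; split; exact: ltW.
    rewrite V1 ?subrr ?mul0r //; apply: KV; exists z => //; split=> //; exact: ltW.
have [N HN] := exterior_to0 tg e3.
exists (maxn m N) => n; rewrite geq_max => /andP[mn Nn].
exists (fun z => kap z * shiftf nu (v n) z); first by apply: testMr => //; exact: smooth_shift.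
have tin f : test_function (eball y (2 * r)) f -> test_function B f /\ test_function B (shiftf nu f).
  move=> tf; split; first by apply: test_sub tf => z /I23 /I3B.
  apply: (test_shift (O := eball y (2 * r))) => // z hz; apply: I3B.
  have h1 : sqd (z + nu) z <= d ^+ 2 by have := nud (z + nu); rewrite addrK => ->.
  have r20 : 0 < 2 * r by rewrite mulr_gt0.
  have := sqd_triangle_lt r20 (ltW d0) hz h1 => /lt_le_trans; apply.
  by rewrite ler_pXn2r ?nnegrE ?addr_ge0 // ?(ltW d0) ?(ltW r30) ?(ltW r20) //; case: (chart_radii r2 dr).
have nms f : test_function (eball y (2 * r)) f -> nm1 (shiftf nu f) = nm1 f.
  by move=> /tin[t1 t2]; rewrite /nm en_shift.
have tgp : test_function (eball y (2 * r)) (fun z => g z * psi n z).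
  have -> : (fun z => g z * psi n z) = fun z => (1 - kap (z - nu)) * v n z by apply/funext => z; rewrite /g /v; ring.
  apply: testM => //; apply: smoothB; first exact: smooth_cst.
  exact: (smooth_shift (- nu) sk).
have -> : (fun z => theta z * psi n z - kap z * shiftf nu (v n) z) =
   fun z => ((v n z - v m z) + (v m z - shiftf nu (v m) z)) + (shiftf nu (fun z => v m z - v n z) z + shiftf nu (fun z => g z * psi n z) z).
  by apply/funext => z; rewrite /shiftf /g /v addrK; ring.
have s1 : smooth (fun z => v n z - v m z) by exact: smoothB.
have s2 : smooth (fun z => v m z - shiftf nu (v m) z) by apply: smoothB => //; exact: smooth_shift.
have s3 : smooth (shiftf nu (fun z => v m z - v n z)) by apply: smooth_shift; exact: smoothB.
have s4 : smooth (shiftf nu (fun z => g z * psi n z)) by apply: smooth_shift; exact: smoothM.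
apply: le_trans (form_triangle sS f1 (smoothD s1 s2) (smoothD s3 s4)) _.
have t1 := form_triangle sS f1 s1 s2; have t2 := form_triangle sS f1 s3 s4.
rewrite (nms _ tgp) nms in t2; last exact: testB.
have n1 := vm n mn.
have n2 : nm1 (fun z => v m z - v n z) <= e / 3 / 2.
  rewrite (_ : (fun z => _) = fun z => - (v n z - v m z)); last by apply/funext => z; rewrite opprB.
  by rewrite (nmN sS f1).
have n3 := le_trans (ler_norm _) (HN n Nn).
exact: (four_terms t1 t2 n1 wm n2 n3).
Unshelve. all: by end_near. Qed.

(** With test functions [om] of [Om] close to [psi n], the energy of [psi n] is its product with
    [psi n - om], which is small, plus its product with [om], which is close to [l om = 0]. So the
    energy tends to 0, and with it the products with [phi], whose limit is [l phi]. *)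
Theorem functional_zero phi : smooth phi -> l phi = 0.
Proof.
move=> sphi.
have [|||||chi [[schi Achi] _ _ [V [oV KV V1]]]] := @cutoff_principle R approximable [set x | sqd x0 x <= rho ^+ 2].
- split; first exact: smooth_cst.
  move=> e e0; exists 0%N => n _; exists (fun=> 0); first exact: test0.
  rewrite (_ : (fun x => _ - _) = fun=> 0) ?nm0 ?ltW //.
  by apply/funext => x; rewrite mul0r subr0.
- exact: approximable_add.
- by move=> f g Af sg; exact: approximable_mul.
- exact: compact_sqd_le.
- move=> y _; have [Oy|nOy] := pselect (Om y); first exact: approximable_in.
  by have [cy|ncy] := pselect (closure Om y); [exact: approximable_boundary|exact: approximable_out].
have chipsi n : (fun x => chi x * psi n x) = psi n.
  apply/funext => x; have [h|h] := leP (sqd x0 x) (rho ^+ 2); first by rewrite V1 ?mul1r //; exact: KV.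
  by rewrite (test_notin (tpsi n)) ?mulr0 // /eball /= => /lt_trans /(_ h); rewrite ltxx.
have [P P0 HP] := psi_bound.
have nmc f : smooth f -> nm (en c B) f <= nm1 f by move=> sf; apply: nm_mono => //; case/andP: c01.
have to0c : to0 (fun n => nm (en c B) (psi n)).
  apply: to0_sqr => [n|e e0]; first exact: nm_ge0.
  have Q0 : 0 < P + P + 2 by rewrite ltr_wpDl // addr_ge0.
  pose d := Num.min 1 (e / (P + P + 2)).
  have d0 : 0 < d by rewrite lt_min ltr01 divr_gt0.
  have d1 : d <= 1 by rewrite ge_min lexx.
  have dQ : d * (P + P + 2) <= e by rewrite -ler_pdivlMr // ge_min lexx orbT.
  have [N HN] := Achi d d0; have [N' HN'] := tn_small 1 d0.
  exists (maxn N N') => n; rewrite geq_max => /andP[Nn Nn'].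
  have [om tom] := HN n Nn; rewrite (congr1 (fun f => nm1 (fun x => f x - om x)) (chipsi n)) => Hom.
  have [som _] := tom; have sd : smooth (fun x => psi n x - om x) by exact: smoothB.
  rewrite ger0_norm ?sqr_ge0 // (nm_sqr fc) //.
  have E : en c B (psi n) (psi n) = en c B (psi n) (fun x => psi n x - om x) + en c B (psi n) om.
    by rewrite (formBr sS fc) // subrK.
  have h1 : `|en c B (psi n) (fun x => psi n x - om x)| <= P * d.
    apply: le_trans (form_CSn sS fc (spsi n) sd) _; apply: ler_pM; rewrite ?nm_ge0 //.
      exact: le_trans (nmc _ (spsi n)) (HP n).
    exact: le_trans (nmc _ sd) Hom.
  have h2 : `|en c B (psi n) om| <= tn n * nm1 om by have := Hpsi n som; rewrite (lT tom) subr0.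
  have h3 : nm1 om <= P + 1.
    rewrite (_ : om = fun x => psi n x + - (psi n x - om x)); last by apply/funext => x; ring.
    apply: le_trans (form_triangle sS f1 (spsi n) (smoothN sd)) _; rewrite (nmN sS f1) //.
    by apply: lerD => //; exact: le_trans Hom d1.
  have h4 : tn n <= d by have := HN' n Nn'; rewrite mul1r.
  have h5 : tn n * nm1 om <= d * (P + 1) by apply: ler_pM; rewrite ?nm_ge0 // ltW // tn_gt0.
  have h6 := le_trans (ler_norm _) h1; have h7 := le_trans (ler_norm _) h2.
  rewrite E; move: h5 h6 h7 dQ d0; lra.
apply/eqP; rewrite -normr_le0; apply/ler_addgt0Pr => e e0; rewrite add0r.
have K0 : 0 < nm1 phi + 1 by rewrite ltr_wpDl // nm_ge0.
have d0 : 0 < e / 2 / (nm1 phi + 1) by rewrite !divr_gt0.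
have [N HN] := to0c _ d0; have [N' HN'] := tn_small 1 d0.
pose n := maxn N N'; have h1 := HN n (leq_maxl _ _); have h2 := HN' n (leq_maxr _ _).
rewrite mul1r in h2; rewrite ger0_norm ?nm_ge0 // in h1.
rewrite -[l phi](subKr (en c B (psi n) phi)); apply: le_trans (ler_normB _ _) _.
have h3 := Hpsi n sphi; have h4 := form_CSn sS fc (spsi n) sphi.
have h5 : nm (en c B) (psi n) * nm (en c B) phi <= e / 2 / (nm1 phi + 1) * (nm1 phi + 1).
  by apply: ler_pM; rewrite ?nm_ge0 // (le_trans (nmc _ sphi)) // lerDl.
have h6 : tn n * nm1 phi <= e / 2 / (nm1 phi + 1) * (nm1 phi + 1).
  by apply: ler_pM; rewrite ?nm_ge0 ?(ltW (tn_gt0 n)) // lerDl.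
have E : e / 2 / (nm1 phi + 1) * (nm1 phi + 1) = e / 2 by rewrite divfK // gt_eqF.
rewrite [leRHS]splitr; move: h5 h6; rewrite E => h5 h6.
by apply: lerD; [exact: le_trans h4 h5|exact: le_trans h3 h6].
Qed.

End Vanishing.

(** * Solutions plus test functions are dense in the energy norm *)

Section Density.
Context {R : realType}.
Implicit Types (f g u v phi q om : plane R -> R) (x y : plane R).

Theorem harmonic_dense (Om : set (plane R)) x0 (c rho : R) (S : (plane R -> R) -> Prop) phi (e : R) :
  open Om -> simply_connected Om -> lipschitz_boundary Om -> Om !=set0 ->
  0 < rho -> (forall x, Om x -> sqd x0 x <= rho ^+ 2) -> 0 <= c <= 1 ->
  psubspace S -> (forall q, S q -> smooth q) -> (forall q, S q -> forall x, lap q x = c * q x) ->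
  (forall (r : R) n, 0 < r -> (exists2 q, S q & forall x, sqd x0 x = r ^+ 2 -> q x = (zre x0 n x).1) /\
     exists2 q, S q & forall x, sqd x0 x = r ^+ 2 -> q x = (zre x0 n x).2) ->
  smooth phi -> 0 < e -> exists q om, [/\ S q, test_function Om om &
    en 1 Om (fun x => phi x - (q x + om x)) (fun x => phi x - (q x + om x)) <= e].
Proof.
move=> oOm scOm lipOm Om0 rho0 bOm c01 sS smS lapS circS sphi e0.
(* The disc is doubled so that the closure of [Om] lies in its interior. *)
pose r := 2 * rho; have r0 : 0 < r by rewrite mulr_gt0.
have rr : rho ^+ 2 < r ^+ 2 by rewrite ltr_pXn2r ?nnegrE ?ltW // /r; lra.
have clb : forall x, closure Om x -> sqd x0 x <= rho ^+ 2.
  move=> x cx; apply: (@closed_sqd_le R x0 (rho ^+ 2)) => B nB.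
  by have [w [Ow Bw]] := cx B nB; exists w; split=> //; exact: bOm.
have clB : closure Om `<=` eball x0 r by move=> x /clb h; exact: le_lt_trans rr.
have OmB : Om `<=` eball x0 r by move=> x /subset_closure /clB.
have mOm : measurable (Om : set (mplane R)) by exact: measurable_open_plane.
have dOm : dom Om.
  by have [_ [b Bb]] := dom_eball x0 (ltW r0); split=> //; exists b => x /OmB /Bb.
have fO : pform smooth (en 1 Om) by exact: en_form.
pose N u := exists q om, [/\ S q, test_function Om om & u = fun x => q x + om x].
have [S0 SD SZ] := sS.
have sN : psubspace N.
  split.
  - by exists (fun=> 0), (fun=> 0); split=> //; [exact: test0|apply/funext => x; rewrite addr0].
  - move=> _ _ [q [om [Sq to ->]]] [q' [om' [Sq' to' ->]]].
    exists (fun x => q x + q' x), (fun x => om x + om' x); split; [exact: SD|exact: testD|].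
    by apply/funext => x; ring.
  - move=> t _ [q [om [Sq to ->]]].
    exists (fun x => t * q x), (fun x => t * om x); split; [exact: SZ|exact: testZ|].
    by apply/funext => x; ring.
have Nsm u : N u -> smooth u.
  by move=> [q [om [Sq [so _] ->]]]; apply: smoothD => //; exact: smS.
have [|_ [q [om [Sq to ->]]] H] := hahn_banach_form (@smooth_sub R) fO sN Nsm sphi _ e0; last by exists q, om.
move=> l C linl bdl lN.
have lS q : S q -> l q = 0.
  by move=> Sq; apply: lN; exists q, (fun=> 0); split=> //; [exact: test0|apply/funext => x; rewrite addr0].
have lT om : test_function Om om -> l om = 0.
  by move=> to; apply: lN; exists (fun=> 0), om; split=> //; apply/funext => x; rewrite add0r.
have lOm f : smooth f -> (forall x, Om x -> f x = 0) -> l f = 0.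
  move=> sf f0; apply/eqP; rewrite -normr_le0; apply: le_trans (bdl f sf) _.
  rewrite /nm (_ : en 1 Om f f = 0) ?sqrtr0 ?mulr0 // /en -[RHS](II0 Om); apply: II_eq => x Ox.
  have P0 i : pd i f x = 0.
    by rewrite (@pd_loc _ f (fun=> 0) i Om x) // pd_cst.
  by rewrite !P0 f0 // !mul0r mulr0 !addr0.
have /choice[psi Hpsi] : forall j, exists psi, test_function (eball x0 r) psi /\
    forall f, smooth f -> `|en c (eball x0 r) psi f - l f| <= tn j * nm (en 1 (eball x0 r)) f.
  move=> j; have [psi tpsi Hp] := representation r0 c01 sS smS lapS (fun n => circS r n r0) mOm OmB linl bdl lS (tn_gt0 (R := R) j).
  by exists psi.
have tpsi j : test_function (eball x0 r) (psi j) by case: (Hpsi j).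
have Hp j f : smooth f -> `|en c (eball x0 r) (psi j) f - l f| <= tn j * nm (en 1 (eball x0 r)) f.
  by case: (Hpsi j) => _; apply.
have [U [M [M0 HU]]] := weak_limit r0 c01 tpsi Hp.
have UD := weak_limitD r0 tpsi HU.
have UZ := weak_limitZ r0 tpsi HU.
have [K K0 Ub] := weak_limit_bound r0 tpsi M0 HU.
have Ulap := weak_limit_lap r0 tpsi Hp HU lOm.
(* The support of [U] outside the closure of [Om] is taken as the hole [C]: it is open by unique
   continuation, and the rest of the exterior is open as the complement of a support. *)
have hole : Unonzero U `&` ~` closure Om = set0.
  apply: (@no_holes _ Om _ x0 r) => //.
  - exact: (Unonzero_open r0 K0 c01 UD UZ Ub Ulap).
  - by move=> x [].
  - have -> : ~` (Unonzero U `&` ~` closure Om `|` closure Om) = ~` Unonzero U `&` ~` closure Om.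
      apply/seteqP; split=> x.
        by move=> H; split=> h; apply: H; [have [cx|ncx] := pselect (closure Om x); [right|left]|right].
      by move=> [h1 h2] [[]|].
    apply: openI; first exact: Uzero_open.
    by apply: closed_openC; exact: closed_closure.
  - by move=> x /bOm /le_trans; apply; exact: ltW.
  - by move=> x [Ux _]; exact: (Unonzero_bounded Ub).
apply: (functional_zero r0 c01 tpsi Hp HU lOm _ oOm clB lipOm lT sphi) => y ncy.
have [[a a0 Ua]|n] := pselect (exists2 a, 0 < a & Uzero U y a); first by exists a.
by have : (Unonzero U `&` ~` closure Om) y by []; rewrite hole.
Qed.

End Density.

(** * Hausdorff measure on a Lipschitz boundary *)

Section Hausdorff.
Context {R : realType}.
Implicit Types (A B F : set (plane R)) (x y z : plane R).
Local Open Scope ereal_scope.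

Lemma ediam_ge0 A : 0 <= ediam A.
Proof. by apply: ereal_sup_ubound; left. Qed.

Lemma ediam_le A (d : R) : (0 <= d)%R -> (forall x y, A x -> A y -> (enorm (x - y) <= d)%R) ->
  ediam A <= d%:E.
Proof.
move=> d0 H; apply: ge_ereal_sup => _ [->|[[x y] [/= Ax Ay] <-]]; first by rewrite lee_fin.
by rewrite lee_fin; exact: H.
Qed.

Lemma ediam_ge A x y : A x -> A y -> (enorm (x - y))%:E <= ediam A.
Proof. by move=> Ax Ay; apply: ereal_sup_ubound; right; exists (x, y). Qed.

Lemma ediam0 : ediam (set0 : set (plane R)) = 0.
Proof. by apply/eqP; rewrite eq_le ediam_ge0 andbT; exact: ediam_le. Qed.

(** Sets of diameter above [d] cost [+oo], which turns the constraint on covers into part of the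
    gauge and makes [hausdorff1_delta d] an outer measure induced by a set function on all
    subsets. *)
Let dmu (d : R) : set (g_sigma_algebraType [set: set (plane R)]) -> \bar R :=
  fun F => if ediam F <= d%:E then ediam F else +oo.

Let dmu_ge0 d F : 0 <= dmu d F.
Proof. by rewrite /dmu; case: ifP => // _; exact: ediam_ge0. Qed.

Let dmu0 (d : R) : (0 < d)%R -> dmu d set0 = 0.
Proof. by move=> d0; rewrite /dmu ediam0 lee_fin ltW. Qed.

Lemma hausdorff1_deltaE (d : R) A : hausdorff1_delta d A = mu_ext (dmu d) A.
Proof.
apply/eqP; rewrite eq_le; apply/andP; split.
  apply: le_ereal_inf_tmp => _ [F [_ AF] <-].
  have [HF|/existsNP[k Hk]] := pselect (forall k, ediam (F k) <= d%:E).
    apply: ereal_inf_lbound; exists F => //; apply: eq_eseriesr => k _.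
    by rewrite /dmu HF.
  rewrite (@eseries_pinfty _ (fun k => dmu d (F k)) _ k) ?leey //.
    by move=> n _; rewrite -ltNye (lt_le_trans _ (dmu_ge0 _ _)).
  by rewrite /dmu; case: ifP.
apply: le_ereal_inf_tmp => _ [F [AF HF] <-]; apply: ereal_inf_lbound; exists F.
  by split=> // i; exact: sub_sigma_algebra.
by apply: eq_eseriesr => k _; rewrite /dmu HF.
Qed.

Lemma hausdorff1_delta_ge0 (d : R) A : 0 <= hausdorff1_delta d A.
Proof. by rewrite hausdorff1_deltaE; apply: mu_ext_ge0. Qed.

Lemma hausdorff1_delta_le (d : R) A : (0 < d)%R -> hausdorff1_delta d A <= hausdorff1 A.
Proof. by move=> d0; apply: ereal_sup_ubound; exists d. Qed.

Lemma hausdorff1_delta_anti (d d' : R) A : (d <= d')%R -> hausdorff1_delta d' A <= hausdorff1_delta d A.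
Proof.
move=> dd; apply: le_ereal_inf_tmp => _ [F [AF HF] <-]; apply: ereal_inf_lbound; exists F => //.
by split=> // k; apply: le_trans (HF k) _; rewrite lee_fin.
Qed.

Let hausdorff1_0 : hausdorff1 (set0 : set (plane R)) = 0.
Proof.
apply/eqP; rewrite eq_le; apply/andP; split.
  by apply: ge_ereal_sup => _ [d d0 <-]; rewrite hausdorff1_deltaE mu_ext0 // dmu0.
by apply: le_trans (hausdorff1_delta_le _ (@ltr01 R)); exact: hausdorff1_delta_ge0.
Qed.

Let hausdorff1_ge0 A : 0 <= hausdorff1 A.
Proof. by apply: le_trans (hausdorff1_delta_le _ (@ltr01 R)); exact: hausdorff1_delta_ge0. Qed.

Let hausdorff1_mono : {homo (@hausdorff1 R) : A B / A `<=` B >-> A <= B}.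
Proof.
move=> A B AB; apply: ge_ereal_sup => _ [d d0 <-]; apply: le_trans (hausdorff1_delta_le _ d0).
by rewrite !hausdorff1_deltaE; exact: le_mu_ext.
Qed.

Let hausdorff1_subadd : sigma_subadditive (@hausdorff1 R).
Proof.
move=> F; apply: ge_ereal_sup => _ [d d0 <-].
apply: (@le_trans _ _ (\sum_(0 <= i <oo) hausdorff1_delta d (F i))).
  rewrite hausdorff1_deltaE (eq_eseriesr (fun k _ => hausdorff1_deltaE d (F k))).
  exact: (@mu_ext_sigma_subadditive _ (g_sigma_algebraType [set: set (plane R)]) R (dmu d) (dmu_ge0 d) F).
apply: lee_nneseries => [k _ _|k _]; first exact: hausdorff1_delta_ge0.
exact: hausdorff1_delta_le.
Qed.

HB.instance Definition _ := isOuterMeasure.Build R (plane R) (@hausdorff1 R)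
  hausdorff1_0 hausdorff1_ge0 hausdorff1_mono hausdorff1_subadd.

Lemma enorm_pr i x : (`|pr i x| <= enorm x)%R.
Proof.
rewrite /enorm -sqrtr_sqr; apply: ler_wsqrtr.
by case: i; rewrite /= ?lerDl ?lerDr sqr_ge0.
Qed.

(* A set of diameter less than [t - s] cannot meet both half-planes. *)
Lemma hausdorff1_separated i (s t : R) A B : (s < t)%R -> (forall x, A x -> (pr i x <= s)%R) ->
  (forall x, B x -> (t <= pr i x)%R) -> hausdorff1 A + hausdorff1 B <= hausdorff1 (A `|` B).
Proof.
move=> st HA HB; have [->|fin] := eqVneq (hausdorff1 (A `|` B)) +oo; first by rewrite leey.
have H (d : R) : (0 < d)%R -> (d < t - s)%R -> hausdorff1_delta d A + hausdorff1_delta d B <= hausdorff1_delta d (A `|` B).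
  move=> d0 dst; apply: le_ereal_inf_tmp => _ [F [ABF HF] <-].
  (* Pieces meeting [A] are kept for [A]; by their small diameter they miss [B], so the others cover
     [B]. *)
  pose m k := `[< F k `&` A !=set0 >].
  pose F1 k := if m k then F k else set0; pose F2 k := if m k then set0 else F k.
  have -> : \sum_(0 <= k <oo) ediam (F k) = \sum_(0 <= k <oo) (ediam (F1 k) + ediam (F2 k)).
    by apply: eq_eseriesr => k _; rewrite /F1 /F2; case: ifP => _; rewrite ediam0 ?adde0 ?add0e.
  rewrite nneseriesD; [|by move=> *; exact: ediam_ge0|by move=> *; exact: ediam_ge0].
  apply: leeD; apply: ereal_inf_lbound.
    exists F1 => //; split=> [x Ax|k]; last by rewrite /F1; case: ifP => _ //; rewrite ediam0 lee_fin ltW.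
    have [k _ Fx] := ABF x (or_introl Ax); exists k => //; rewrite /F1 /m asboolT //.
    by exists x.
  exists F2 => //; split=> [x Bx|k]; last by rewrite /F2; case: ifP => _ //; rewrite ediam0 lee_fin ltW.
  have [k _ Fx] := ABF x (or_intror Bx); exists k => //; rewrite /F2 /m asboolF // => -[z [Fz Az]].
  have := le_trans (ediam_ge Fx Fz) (HF k); rewrite lee_fin leNgt => /negP; apply.
  apply: lt_le_trans dst _; apply: le_trans (le_trans (ler_norm _) (enorm_pr i _)).
  have -> : pr i (x - z)%R = (pr i x - pr i z)%R by case: (i).
  by apply: lerB; [exact: HB|exact: HA].
have H2 (d1 d2 : R) : (0 < d1)%R -> (0 < d2)%R -> hausdorff1_delta d1 A + hausdorff1_delta d2 B <= hausdorff1 (A `|` B).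
  move=> d10 d20; pose d := Num.min (Num.min d1 d2) ((t - s) / 2)%R.
  have ts : (0 < t - s)%R by rewrite subr_gt0.
  have d0 : (0 < d)%R by rewrite !lt_min d10 d20 divr_gt0.
  have dl : (d < t - s)%R by rewrite /d gt_min; apply/orP; right; rewrite ltr_pdivrMr // ltr_pMr // ltr1n.
  apply: le_trans (hausdorff1_delta_le _ d0); apply: le_trans (H d d0 dl).
  by apply: leeD; apply: hausdorff1_delta_anti; rewrite !ge_min lexx ?orbT.
have fC : hausdorff1 (A `|` B) \is a fin_num.
  by rewrite ge0_fin_numE ?ltey //; exact: hausdorff1_ge0.
have fd (d : R) : (0 < d)%R -> hausdorff1_delta d B \is a fin_num.
  move=> d0; rewrite ge0_fin_numE; last exact: hausdorff1_delta_ge0.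
  apply: le_lt_trans (_ : hausdorff1 (A `|` B) < +oo); last by rewrite ltey.
  by apply: le_trans (hausdorff1_delta_le _ d0) _; apply: hausdorff1_mono => x; right.
have fA : hausdorff1 A \is a fin_num.
  rewrite ge0_fin_numE; last exact: hausdorff1_ge0.
  apply: le_lt_trans (_ : hausdorff1 (A `|` B) < +oo); last by rewrite ltey.
  by apply: hausdorff1_mono => x; left.
rewrite addeC -leeBrDr //; apply: ge_ereal_sup => _ [d2 d20 <-].
rewrite leeBrDr // addeC -leeBrDr ?fd //; apply: ge_ereal_sup => _ [d1 d10 <-].
by rewrite leeBrDr ?fd //; exact: H2.
Qed.

(** Caratheodory's criterion for metric outer measures. The part of [X] in the half-plane is
    exhausted by the sets [A n], each separated from the complement; the point is that [A n] already
    carries almost all of its measure, since the remaining slices [B k] have summable measures. *)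
Lemma caratheodory_halfplane i (t : R) : (@hausdorff1 R).-caratheodory [set x | (pr i x < t)%R].
Proof.
apply: le_caratheodory_measurable => X; set E := [set x | _].
suff : hausdorff1 (X `&` E) + hausdorff1 (X `&` ~` E) <= hausdorff1 X by [].
have [->|fin] := eqVneq (hausdorff1 X) +oo; first by rewrite leey.
have sub A : A `<=` X -> hausdorff1 A \is a fin_num.
  move=> AX; rewrite ge0_fin_numE; last exact: hausdorff1_ge0.
  by apply: le_lt_trans (hausdorff1_mono AX) _; rewrite ltey.
pose c n : R := (t - tn n)%R.
pose A n := X `&` [set x | (pr i x <= c n)%R].
pose B n := X `&` [set x | (c n < pr i x <= c n.+1)%R].
pose a n := fine (hausdorff1 (A n)); pose b n := fine (hausdorff1 (B n)).
have aE n : hausdorff1 (A n) = (a n)%:E by rewrite fineK // sub // => x [].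
have bE n : hausdorff1 (B n) = (b n)%:E by rewrite fineK // sub // => x [].
have cS n : (c n < c n.+1)%R.
  by rewrite ltrD2l ltrN2 /tn ltf_pV2 ?posrE ?ltr0n // ltr_nat.
have cle m n : (m <= n)%N -> (c m <= c n)%R by move=> mn; rewrite lerD2l lerN2 tn_le.
have ct n : (c n < t)%R by rewrite ltrBlDr ltrDl tn_gt0.
(* [A n] and [B n.+1] are separated by a strip, the place of the skipped slice [B n]; this is why
   indices advance by two. *)
have ab n : (a n + b n.+1 <= a n.+2)%R.
  rewrite -lee_fin EFinD -aE -bE -aE; apply: (@le_trans _ _ (hausdorff1 (A n `|` B n.+1))).
    apply: (@hausdorff1_separated i (c n) (c n.+1)) => //; first by move=> x [].
    by move=> x [_ /andP[/ltW]].
  apply: hausdorff1_mono => x [[Xx h]|[Xx /andP[_ h]]]; split=> //.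
  by apply: le_trans h _; apply: cle; exact: leqW.
have ea n : (a n)%:E + hausdorff1 (X `&` ~` E) <= hausdorff1 X.
  rewrite -aE; apply: (@le_trans _ _ (hausdorff1 (A n `|` X `&` ~` E))).
    apply: (@hausdorff1_separated i (c n) t) => //; first by move=> x [].
    by move=> x [_ /negP]; rewrite -leNgt.
  by apply: hausdorff1_mono => x [[]|[]].
have aub n : (a n <= fine (hausdorff1 X))%R.
  by rewrite -lee_fin -aE fineK ?sub //; apply: hausdorff1_mono => x [].
pose S := [set r | exists n, r = a n].
have hS : has_sup S by split; [exists (a 0%N); exists 0%N|exists (fine (hausdorff1 X)) => _ [n ->]].
pose L := sup S.
have aL n : (a n <= L)%R by apply: ub_le_sup; [case: hS|exists n].
have amono n : (a n <= a n.+1)%R.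
  rewrite -lee_fin -!aE; apply: hausdorff1_mono => x [Xx h]; split=> //.
  by apply: le_trans h _; exact: cle.
(* The sum of [a k.+2 - a k] telescopes and leaves two terms at each end. *)
have part (n N : nat) : (\sum_(k < N) b (k + n.+1)%N <= a (n + N)%N + a (n + N).+1 - a n - a n.+1)%R.
  elim: N => [|N IH]; first by rewrite big_ord0 addn0; lra.
  rewrite big_ord_recr /= !addnS [(N + n)%N]addnC; have := ab (n + N)%N.
  move: IH; lra.
have tail (n : nat) : \sum_(0 <= k <oo) hausdorff1 (B (k + n.+1)%N) <= (2 * (L - a n))%:E.
  apply: lime_le; first by apply: is_cvg_nneseries => *; exact: hausdorff1_ge0.
  near=> N; rewrite big_mkord; under eq_bigr do rewrite bE.
  rewrite sumEFin lee_fin; apply: le_trans (part n N) _.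
  have := aL (n + N)%N; have := aL (n + N).+1; have := amono n; lra.
have EL : hausdorff1 (X `&` E) <= L%:E.
  apply/lee_addgt0Pr => e e0; have e3 : (0 < e / 3)%R by rewrite divr_gt0.
  have [_ [n ->] Ln] := sup_adherent e3 hS.
  apply: (@le_trans _ _ (hausdorff1 (A n.+1) + \sum_(0 <= k <oo) hausdorff1 (B (k + n.+1)%N))).
    apply: (@le_trans _ _ (hausdorff1 (A n.+1 `|` \bigcup_k B (k + n.+1)%N))); last first.
      apply: le_trans (outer_measureU2 (hausdorff1 : outer_measure R (plane R)) _ _) _.
      by apply: leeD2l; exact: (outer_measure_sigma_subadditive (hausdorff1 : outer_measure R (plane R))).
    apply: hausdorff1_mono => x [Xx Ex].
    have [h|h] := leP (pr i x) (c n.+1); first by left.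
    right; have [N HN] : exists N, (pr i x <= c N)%R.
      have d0 : (0 < t - pr i x)%R by rewrite subr_gt0.
      have [N HN] := tn_small 1 d0; exists N; have := HN N (leqnn N); rewrite mul1r /c; lra.
    have /ex_minnP[m Hm mmin] : exists N, (pr i x <= c N)%R by exists N.
    have nm : (n.+1 < m)%N by rewrite ltnNge; apply/negP => /cle /(le_trans Hm); rewrite leNgt h.
    exists (m.-1 - n.+1)%N => //; rewrite subnK; last by rewrite -ltnS prednK // (ltn_trans _ nm).
    have m1 : m = m.-1.+1 by rewrite prednK // (ltn_trans _ nm).
    split=> //=; rewrite -m1 Hm andbT ltNge; apply/negP => /mmin; by rewrite {1}m1 ltnn.
  rewrite aE; apply: le_trans (leeD2l _ (tail n)) _; rewrite -EFinD lee_fin.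
  have := aL n.+1; move: Ln; rewrite -/L; lra.
have fe : hausdorff1 (X `&` ~` E) \is a fin_num by apply: sub => x [].
apply: le_trans (leeD2r _ EL) _; rewrite -leeBrDr //.
rewrite -(fineK fe) -(fineK (sub X (fun x => id))) -EFinB lee_fin.
apply: ge_sup; first by case: hS.
move=> _ [n ->]; have := ea n; rewrite -(fineK fe) -(fineK (sub X (fun x => id))) -EFinD lee_fin; lra.
Unshelve. all: by end_near. Qed.

(** Half-planes suffice: they make both coordinates measurable from the Caratheodory sigma-algebra,
    and the product sigma-algebra is generated by the coordinates. *)
Lemma caratheodory_borel (A : set (mplane R)) : measurable A -> (@hausdorff1 R).-caratheodory A.
Proof.
pose h : outer_measure R (plane R) := hausdorff1.
move=> mA; pose idf (x : caratheodory_type h) : mplane R := x.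
have mp i : measurable_fun [set: caratheodory_type h] (fun x : caratheodory_type h => pr i x : measurableTypeR R).
  apply: (@measurability _ _ _ _ _ _ (@RGenInftyO.G R)); first exact: RGenInftyO.measurableE.
  move=> _ [_ [a ->] <-]; rewrite setTI.
  have H (B : set (caratheodory_type h)) : B = [set x : plane R | (pr i x < a)%R] -> measurable B.
    by move=> ->; exact: caratheodory_halfplane.
  by apply: H; apply/funext => x; rewrite /preimage /= in_itv.
have mid : measurable_fun setT idf.
  by apply/measurable_fun_pairP; split; [exact: (mp false)|exact: (mp true)].
have := mid measurableT A mA; rewrite setTI; exact.
Qed.

Lemma hausdorff1_sigma_additive : semi_sigma_additive (@hausdorff1 R).
Proof.
move=> F mF tF mU; pose h : outer_measure R (plane R) := hausdorff1.
by apply: (@caratheodory_measure_sigma_additive R _ h F) => // [i|]; exact: caratheodory_borel.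
Qed.

HB.instance Definition _ := isMeasure.Build _ (mplane R) R (@hausdorff1 R)
  hausdorff1_0 hausdorff1_ge0 hausdorff1_sigma_additive.

(** * Boundary pieces in a chart have finite and positive length *)

Section LipschitzBoundary.
Variables (Om : set (plane R)) (y : plane R).
Hypothesis oOm : open Om.
Hypothesis by_ : boundary Om y.
Variables (a b : R) (gr : R -> R) (L r0 h : R).
Hypothesis ab : (a ^+ 2 + b ^+ 2 = 1)%R.
Hypothesis r00 : (0 < r0)%R.
Hypothesis h0 : (0 < h)%R.
Hypothesis Lgr : forall s t : R, (`|gr s - gr t| <= L * `|s - t|)%R.
Hypothesis HOm : forall s t : R, (`|s| < r0)%R -> (`|t| < h)%R ->
  (Om (y.1 + s * a - t * b, y.2 + s * b + t * a)%R <-> (gr s < t)%R).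

Let Phi (s t : R) : plane R := (y.1 + s * a - t * b, y.2 + s * b + t * a)%R.
Let cs z : R := (a * (z.1 - y.1) + b * (z.2 - y.2))%R.
Let ct z : R := (a * (z.2 - y.2) - b * (z.1 - y.1))%R.

Let PhiK z : Phi (cs z) (ct z) = z.
Proof.
rewrite /Phi /cs /ct [RHS]surjective_pairing; congr pair.
  transitivity (y.1 + (z.1 - y.1) * (a ^+ 2 + b ^+ 2))%R; first by ring.
  by rewrite ab mulr1 subrKC.
transitivity (y.2 + (z.2 - y.2) * (a ^+ 2 + b ^+ 2))%R; first by ring.
by rewrite ab mulr1 subrKC.
Qed.

Let csPhi s t : cs (Phi s t) = s.
Proof.
rewrite /cs /Phi /=; transitivity (s * (a ^+ 2 + b ^+ 2))%R; first by ring.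
by rewrite ab mulr1.
Qed.

Let ctPhi s t : ct (Phi s t) = t.
Proof.
rewrite /ct /Phi /=; transitivity (t * (a ^+ 2 + b ^+ 2))%R; first by ring.
by rewrite ab mulr1.
Qed.

Let dPhi s t s' t' : sqd (Phi s t) (Phi s' t') = ((s' - s) ^+ 2 + (t' - t) ^+ 2)%R.
Proof.
rewrite /sqd /Phi /=; transitivity (((s' - s) ^+ 2 + (t' - t) ^+ 2) * (a ^+ 2 + b ^+ 2))%R; first by ring.
by rewrite ab mulr1.
Qed.

Let ycs z : sqd y z = (cs z ^+ 2 + ct z ^+ 2)%R.
Proof.
rewrite /sqd /cs /ct; transitivity (((z.1 - y.1) ^+ 2 + (z.2 - y.2) ^+ 2) * (a ^+ 2 + b ^+ 2))%R; last by ring.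
by rewrite ab mulr1.
Qed.

Let small z (d : R) : (0 < d)%R -> eball y d z -> (`|cs z| < d)%R /\ (`|ct z| < d)%R.
Proof.
move=> d0; rewrite /eball /= ycs => hd.
by split; rewrite -(@ltr_pXn2r _ 2) ?nnegrE ?(ltW d0) // real_normK ?num_real //;
  apply: le_lt_trans hd; rewrite ?lerDl ?lerDr sqr_ge0.
Qed.

Let Lp s t : (`|gr s - gr t| <= `|L| * `|s - t|)%R.
Proof. by apply: le_trans (Lgr s t) _; apply: ler_wpM2r => //; exact: ler_norm. Qed.

Let graph_boundary s : (`|s| < r0)%R -> (`|gr s| < h)%R -> boundary Om (Phi s (gr s)).
Proof.
move=> hs hg; split; last by move=> /interior_subset /(HOm hs hg); rewrite ltxx.
move=> B /nbhs_eball[d d0 Hd]; pose e := Num.min (d / 2)%R ((h - `|gr s|) / 2)%R.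
have hg0 : (0 < h - `|gr s|)%R by rewrite subr_gt0.
have e0 : (0 < e)%R by rewrite lt_min !divr_gt0.
have ed : (e <= d / 2)%R by rewrite ge_min lexx.
have eh : (e <= (h - `|gr s|) / 2)%R by rewrite ge_min lexx orbT.
exists (Phi s (gr s + e)); split.
  apply/HOm => //; last by rewrite ltrDl.
  apply: le_lt_trans (ler_normD _ _) _; rewrite (gtr0_norm e0); lra.
apply: Hd; rewrite /eball /= dPhi subrr expr0n /= add0r addrAC subrr add0r.
rewrite ltr_pXn2r ?nnegrE ?(ltW e0) ?(ltW d0) //; lra.
Qed.

Let boundary_graph z : boundary Om z -> (`|cs z| < r0)%R -> (`|ct z| < h)%R -> ct z = gr (cs z).
Proof.
move=> [cz nz] hs ht; apply/eqP; rewrite eq_le; apply/andP; split.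
  rewrite leNgt; apply/negP => g; apply: nz; apply: open_nbhs_nbhs; split=> //.
  by rewrite -(PhiK z); apply/HOm.
rewrite leNgt; apply/negP => g.
pose m := Num.min (Num.min (r0 - `|cs z|)%R (h - `|ct z|)%R) ((gr (cs z) - ct z) / (`|L| + 2))%R.
have L2 : (0 < `|L| + 2)%R by rewrite ltr_wpDl.
have m0 : (0 < m)%R by rewrite !lt_min !subr_gt0 hs ht divr_gt0 // subr_gt0.
have [w [Ow zw]] : exists w, (Om `&` eball z m) w by apply: cz; apply/nbhs_eball; exists m.
have mr : (m <= r0 - `|cs z|)%R by rewrite !ge_min lexx.
have mh : (m <= h - `|ct z|)%R by rewrite !ge_min lexx orbT.
have mL : (m * (`|L| + 2) <= gr (cs z) - ct z)%R by rewrite -ler_pdivlMr // ge_min lexx orbT.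
have [d1 d2] : (`|cs w - cs z| < m)%R /\ (`|ct w - ct z| < m)%R.
  move: zw; rewrite /eball /= -{1}(PhiK z) -{1}(PhiK w) dPhi => hd.
  by split; rewrite -(@ltr_pXn2r _ 2) ?nnegrE ?(ltW m0) // real_normK ?num_real //;
    apply: le_lt_trans hd; rewrite ?lerDl ?lerDr sqr_ge0.
have hs' : (`|cs w| < r0)%R.
  by have := ler_normD (cs w - cs z)%R (cs z); rewrite subrK => /le_lt_trans; apply; lra.
have ht' : (`|ct w| < h)%R.
  by have := ler_normD (ct w - ct z)%R (ct z); rewrite subrK => /le_lt_trans; apply; lra.
have := (HOm hs' ht').1; rewrite -/(Phi _ _) PhiK => /(_ Ow) gw.
have := Lp (cs z) (cs w); rewrite distrC => h1.
have h2 : (`|L| * `|cs z - cs w| <= `|L| * m)%R by apply: ler_wpM2l => //; rewrite distrC ltW.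
have := ler_norm (gr (cs z) - gr (cs w))%R; rewrite distrC => h3.
have := ler_norm (ct w - ct z)%R => h4.
move: mL; rewrite mulrDr [(m * `|L|)%R]mulrC; move: h1 h2 h3 h4 d2 gw m0; lra.
Qed.

Let gr0 : gr 0 = 0%R.
Proof.
have y0 : Phi 0 0 = y by rewrite /Phi !mul0r subr0 !addr0 -surjective_pairing.
have c0 : cs y = 0%R by rewrite /cs !subrr !mulr0 addr0.
have t0 : ct y = 0%R by rewrite /ct !subrr !mulr0 subrr.
by have := boundary_graph by_; rewrite c0 t0 !normr0 => /(_ r00 h0).
Qed.

(** A half-width over which the Lipschitz graph, which passes through 0, stays within the height [h]
    of the chart. *)
Let q := (Num.min r0 (h / (`|L| + 1)) / 2)%R.
Let L1 : (0 < `|L| + 1)%R. Proof. by rewrite ltr_wpDl. Qed.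
Let q0 : (0 < q)%R. Proof. by rewrite divr_gt0 // lt_min r00 divr_gt0. Qed.
Let qr : (q < r0)%R.
Proof.
by rewrite ltr_pdivrMr // (@le_lt_trans _ _ r0) ?ge_min ?lexx // ltr_pMr // ltr1n.
Qed.
Let qh : (`|L| * q < h)%R.
Proof.
have : (2 * q <= h / (`|L| + 1))%R by rewrite mulrC divfK ?gt_eqF // ge_min lexx orbT.
rewrite ler_pdivlMr // => H; have := mulr_ge0 (normr_ge0 L) (ltW q0).
move: H q0; rewrite mulrDr -mulrA [(q * _)%R]mulrC; lra.
Qed.

Let grs s : (`|s| <= q)%R -> (`|gr s| < h)%R.
Proof.
move=> hs; apply: le_lt_trans qh; have := Lp s 0; rewrite gr0 !subr0 => /le_trans; apply.
exact: ler_wpM2l.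
Qed.

(** Cut the base of the graph into [N] cells. Over each the graph has diameter at most [(1 + |L|)]
    times the cell, so the sum is at most [(1 + |L|) 2 q] however fine the cover has to be. *)
Lemma boundary_piece_finite : exists2 d : R, (0 < d)%R & hausdorff1 (boundary Om `&` eball y d) < +oo.
Proof.
pose d := Num.min q h; have d0 : (0 < d)%R by rewrite lt_min q0.
exists d => //; pose P := boundary Om `&` eball y d.
apply: (@le_lt_trans _ _ ((1 + `|L|) * (2 * q))%:E); last by rewrite ltey.
apply: ge_ereal_sup => _ [e /= e0 <-].
have K0 : (0 < (1 + `|L|) * (2 * q))%R by apply: mulr_gt0; [rewrite ltr_wpDr //|exact: mulr_gt0].
pose N := (Num.truncn ((1 + `|L|) * (2 * q) / e)).+1.
have N0 : (0 < N%:R :> R)%R by rewrite ltr0n.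
have Ne : ((1 + `|L|) * (2 * q / N%:R) <= e)%R.
  by rewrite mulrA ler_pdivrMr // [leRHS]mulrC -ler_pdivrMr // ltW // /N truncnS_gt.
pose nd k : R := (- q + 2 * q / N%:R * k%:R)%R.
pose F k : set (plane R) := if (k < N)%N then P `&` [set z | (nd k <= cs z <= nd k.+1)%R] else set0.
have ndS k : (nd k.+1 = nd k + 2 * q / N%:R)%R by rewrite /nd -natr1; ring.
have cell0 : (0 <= 2 * q / N%:R)%R by rewrite divr_ge0 ?ler0n // mulr_ge0 // ltW.
have dF k : ediam (F k) <= (if (k < N)%N then (1 + `|L|) * (2 * q / N%:R) else 0)%R%:E.
  rewrite /F; case: ifPn => _; last by rewrite ediam0.
  apply: ediam_le; first by rewrite mulr_ge0 // addr_ge0.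
  move=> u v [[bu uy] /andP[u1 u2]] [[bv vy] /andP[v1 v2]].
  have dq : (d <= q)%R by rewrite ge_min lexx.
  have dh : (d <= h)%R by rewrite ge_min lexx orbT.
  have [us ut] := small d0 uy; have [vs vt] := small d0 vy.
  have ur : (`|cs u| < r0)%R := lt_trans us (le_lt_trans dq qr).
  have vr : (`|cs v| < r0)%R := lt_trans vs (le_lt_trans dq qr).
  have uh : (`|ct u| < h)%R := lt_le_trans ut dh.
  have vh : (`|ct v| < h)%R := lt_le_trans vt dh.
  have gu := boundary_graph bu ur uh; have gv := boundary_graph bv vr vh.
  have D : (`|cs u - cs v| <= 2 * q / N%:R)%R.
    by rewrite ler_norml; move: u2 v2; rewrite !ndS => u2 v2; apply/andP; split; lra.
  have D2 : (`|ct u - ct v| <= `|L| * (2 * q / N%:R))%R.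
    by rewrite gu gv; apply: le_trans (Lp _ _) _; exact: ler_wpM2l.
  have -> : enorm (u - v)%R = Num.sqrt ((cs u - cs v) ^+ 2 + (ct u - ct v) ^+ 2)%R.
    have := dPhi (cs v) (ct v) (cs u) (ct u); rewrite !PhiK => <-.
    by rewrite /enorm /sqd.
  have W0 : (0 <= (1 + `|L|) * (2 * q / N%:R))%R by rewrite mulr_ge0 // addr_ge0.
  rewrite -(ger0_norm W0) -(sqrtr_sqr ((1 + `|L|) * (2 * q / N%:R))%R); apply: ler_wsqrtr.
  move: D D2; rewrite -(real_normK (num_real (cs u - cs v))) -(real_normK (num_real (ct u - ct v))).
  move: (`|L|)%R (normr_ge0 L) (2 * q / N%:R)%R cell0 (`|cs u - cs v|)%R (normr_ge0 (cs u - cs v)%R) (`|ct u - ct v|)%R (normr_ge0 (ct u - ct v)%R) => l l0 w w0 p p0 m m0 pw mw.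
  have A1 : (p ^+ 2 <= w ^+ 2)%R by rewrite ler_pXn2r.
  have A2 : (m ^+ 2 <= (l * w) ^+ 2)%R by rewrite ler_pXn2r ?nnegrE ?mulr_ge0.
  by have := mulr_ge0 l0 (sqr_ge0 w); move: A1 A2; rewrite !exprMn; nra.
apply: (@le_trans _ _ (\sum_(0 <= k <oo) ediam (F k))).
  apply: ereal_inf_lbound; exists F => //; split=> [z [bz zy]|k]; last first.
    by apply: le_trans (dF k) _; rewrite lee_fin; case: ifP => // _; exact: ltW.
  have [zs zt] := small d0 zy.
  have zq : (`|cs z| < q)%R by apply: lt_le_trans zs _; rewrite ge_min lexx.
  move: (zq); rewrite ltr_norml => /andP[z1 z2].
  pose k := Num.truncn ((cs z + q) / (2 * q / N%:R)).
  have c0 : (0 < 2 * q / N%:R)%R by rewrite divr_gt0 // mulr_gt0.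
  have k0 : (0 <= (cs z + q) / (2 * q / N%:R))%R by rewrite divr_ge0 // ?(ltW c0) //; lra.
  have /andP[k1 k2] := truncn_itv k0.
  rewrite -/k in k1 k2; rewrite ler_pdivlMr // in k1; rewrite ltr_pdivrMr // in k2.
  have kN : (k < N)%N.
    rewrite -(ltr_nat R); apply: le_lt_trans (_ : (cs z + q) / (2 * q / N%:R) < N%:R)%R.
      by rewrite ler_pdivlMr.
    rewrite ltr_pdivrMr // [(N%:R * _)%R]mulrC divfK ?gt_eqF //; lra.
  exists k => //; rewrite /F kN; split=> //=; rewrite /nd.
  by apply/andP; split; [move: k1|move: k2]; rewrite [(_%:R * _)%R]mulrC; lra.
apply: lime_le; first by apply: is_cvg_nneseries => *; exact: ediam_ge0.
near=> M; apply: (@le_trans _ _ (\sum_(0 <= k < M) (if (k < N)%N then (1 + `|L|) * (2 * q / N%:R) else 0)%R%:E)).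
  by apply: lee_sum => k _; exact: dF.
rewrite sumEFin lee_fin.
apply: (@le_trans _ _ (\sum_(0 <= k < N) ((1 + `|L|) * (2 * q / N%:R)))%R).
  rewrite -big_mkcond /=; have [MN|NM] := leqP M N.
    rewrite (big_nat_widen _ _ _ _ _ MN) /= [leLHS]big_mkcond /=; apply: ler_sum => k _.
    by case: ifP => // _; rewrite mulr_ge0 // addr_ge0.
  by rewrite -(big_nat_widen 0 N M xpredT) // ltnW.
rewrite sumr_const_nat subn0 -[leLHS]mulr_natr -mulrA.
by rewrite (_ : 2 * q / N%:R * N%:R = 2 * q)%R // divfK // gt_eqF.
Unshelve. all: by end_near. Qed.

(** Projection onto the chart axis does not increase distances: a cover of the piece yields
    intervals of half-length [e k], the diameters, covering one of half-length [s0]. Subadditivity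
    of the Lebesgue measure gives at least [s0] for the sum. *)
Lemma boundary_piece_pos (d : R) : (0 < d)%R -> 0 < hausdorff1 (boundary Om `&` eball y d).
Proof.
move=> d0; have L2 : (0 < `|L| + 2)%R by rewrite ltr_wpDl.
pose s0 := Num.min q (d / (`|L| + 2))%R; have s00 : (0 < s0)%R by rewrite lt_min q0 divr_gt0.
have sq : (s0 <= q)%R by rewrite ge_min lexx.
have sd : (s0 * (`|L| + 2) <= d)%R by rewrite -ler_pdivlMr // ge_min lexx orbT.
apply: lt_le_trans (hausdorff1_delta_le _ (@ltr01 R)).
apply: (@lt_le_trans _ _ s0%:E); first by rewrite lte_fin.
apply: le_ereal_inf_tmp => _ [F [PF HF] <-].
have Fin k : exists e : R, (0 <= e)%R /\ ediam (F k) = e%:E.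
  have : ediam (F k) \is a fin_num by rewrite ge0_fin_numE ?ediam_ge0 // (le_lt_trans (HF k)) // ltey.
  move=> /fineK E; exists (fine (ediam (F k))); rewrite E; split=> //.
  by rewrite -lee_fin E ediam_ge0.
have /choice[e He] := Fin.
have /choice[c Hc] : forall k, exists c : R, forall z, F k z -> (`|cs z - c| <= e k)%R.
  move=> k; have [[w Fw]|nF] := pselect (F k !=set0); last by exists 0%R => z Fz; exfalso; apply: nF; exists z.
  exists (cs w) => z Fz; have := ediam_ge Fz Fw; rewrite (He k).2 lee_fin; apply: le_trans.
  rewrite -sqrtr_sqr; apply: ler_wsqrtr.
  have := dPhi (cs w) (ct w) (cs z) (ct z); rewrite !PhiK /sqd => E.
  by rewrite /= E lerDl sqr_ge0.
have cov : (`[(- s0)%R, s0] : set R) `<=` \bigcup_k `[(c k - e k)%R, (c k + e k)%R]%classic.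
  move=> s; rewrite /= in_itv /= => /andP[s1 s2].
  have hs : (`|s| <= s0)%R by rewrite ler_norml s1.
  have hq : (`|s| <= q)%R by exact: le_trans hs sq.
  have [|k _ Fk] := PF (Phi s (gr s)).
    split; first by apply: graph_boundary; [exact: le_lt_trans qr|exact: grs].
    rewrite /eball /= ycs csPhi ctPhi.
    have g1 : (`|gr s| <= `|L| * s0)%R.
      have := Lp s 0; rewrite gr0 !subr0 => /le_trans; apply; exact: ler_wpM2l.
    rewrite -(real_normK (num_real s)) -(real_normK (num_real (gr s))).
    have l0 := normr_ge0 L.
    have A1 : (`|s| ^+ 2 <= s0 ^+ 2)%R by rewrite ler_pXn2r ?nnegrE // ltW.
    have A2 : (`|gr s| ^+ 2 <= (`|L| * s0) ^+ 2)%R by rewrite ler_pXn2r ?nnegrE ?mulr_ge0 // ltW.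
    have A3 : ((s0 * (`|L| + 2)) ^+ 2 <= d ^+ 2)%R by rewrite ler_pXn2r ?nnegrE ?mulr_ge0 ?(ltW s00) ?(ltW d0) ?(ltW L2).
    have A4 : (0 < s0 ^+ 2)%R by rewrite exprn_gt0.
    have := mulr_ge0 l0 (ltW A4); move: A1 A2 A3; rewrite !exprMn; move: (s0 ^+ 2)%R A4 (`|L|)%R l0 => S S0 l l0; nra.
  exists k => //=; rewrite in_itv /=; have := Hc k _ Fk; rewrite csPhi ler_norml => /andP[u v].
  by apply/andP; split; lra.
have : lebesgue_measure (`[(- s0)%R, s0] : set (measurableTypeR R)) <= \sum_(0 <= k <oo) lebesgue_measure (`[(c k - e k)%R, (c k + e k)%R]%classic : set (measurableTypeR R)).
  by apply: measure_sigma_subadditive => //; exact: measurable_itv.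
have LI (u v : R) : (u <= v)%R -> lebesgue_measure (`[u, v]%classic : set (measurableTypeR R)) = (v - u)%:E.
  move=> uv; rewrite lebesgue_measure_itv /= lte_fin; case: ltgtP uv => // -> _; by rewrite subrr.
rewrite LI; last by lra.
have -> : \sum_(0 <= k <oo) lebesgue_measure (`[(c k - e k)%R, (c k + e k)%R]%classic : set (measurableTypeR R)) =
   \sum_(0 <= k <oo) (2%:E * ediam (F k)).
  apply: eq_eseriesr => k _; have [ek Ek] := He k; rewrite LI; last by lra.
  by rewrite Ek -EFinM; congr EFin; ring.
rewrite nneseriesZl; last by move=> *; exact: ediam_ge0.
have -> : ((s0 - - s0)%:E = 2%:E * s0%:E)%E by rewrite -EFinM; congr EFin; ring.
by rewrite lee_pmul2l.
Qed.

End LipschitzBoundary.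

Lemma closed_boundary A : closed (boundary A).
Proof.
by rewrite /boundary setDE; apply: closedI; [exact: closed_closure|apply: open_closedC; exact: open_interior].
Qed.

Lemma boundary_finite (Om : set (plane R)) y0 (rho : R) : open Om -> lipschitz_boundary Om ->
  (forall x, Om x -> (sqd y0 x <= rho ^+ 2)%R) -> hausdorff1 (boundary Om) < +oo.
Proof.
move=> oOm lip bOm.
have cb : compact (boundary Om).
  apply: (subclosed_compact (B := [set x | (sqd y0 x <= rho ^+ 2)%R])); first exact: closed_boundary.
    exact: compact_sqd_le.
  move=> x [cx _]; apply: (@closed_sqd_le R y0 (rho ^+ 2)%R) => B nB.
  by have [w [Ow Bw]] := cx B nB; exists w; split=> //; exact: bOm.
have /choice[d Hd] : forall y, exists d : R, boundary Om y -> (0 < d)%R /\ hausdorff1 (boundary Om `&` eball y d) < +oo.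
  move=> y; have [by_|nb] := pselect (boundary Om y); last by exists 0%R.
  have [a [b [gr [L [r0 [h [ab r00 h0 Lgr HOm]]]]]]] := lip y by_.
  have [d d0 Hd] := boundary_piece_finite oOm ab r00 h0 Lgr HOm.
  by exists d.
have [D DK Dc] : finite_subset_cover (boundary Om) (fun y => eball y (d y)) (boundary Om).
  have : cover_compact (boundary Om) by exact: plane_compact_cover.
  apply; first by move=> y _; exact: open_eball.
  by move=> y Ky; exists y => //; rewrite /eball /= sqdxx exprn_gt0 //; case: (Hd y Ky).
pose E : seq (plane R) := finmap.enum_fset D.
have EK z : z \in E -> boundary Om z by move=> /DK; rewrite inE.
suff H : forall s : seq (plane R), (forall z, z \in s -> boundary Om z) ->
    hausdorff1 (\bigcup_(z in [set` s]) (boundary Om `&` eball z (d z))) < +oo.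
  apply: le_lt_trans (H E EK); apply: hausdorff1_mono => z bz.
  by have [p pD pz] := Dc z bz; exists p.
elim=> [|z s IH] Hs.
  rewrite (_ : \bigcup_(_ in _) _ = set0) ?hausdorff1_0 ?ltey //.
  by apply/seteqP; split=> // w [p].
apply: (@le_lt_trans _ _ (hausdorff1 ((boundary Om `&` eball z (d z)) `|` \bigcup_(z in [set` s]) (boundary Om `&` eball z (d z))))).
  apply: hausdorff1_mono => w [p /=]; rewrite inE => /orP[/eqP->|ps] hw; [by left|by right; exists p].
apply: le_lt_trans (outer_measureU2 (hausdorff1 : outer_measure R (plane R)) _ _) _.
apply: lte_add_pinfty; first by have [] := Hd z (Hs z (mem_head _ _)).
by apply: IH => w ws; apply: Hs; rewrite inE ws orbT.
Qed.

Lemma boundary_pos (Om : set (plane R)) y (d : R) : open Om -> lipschitz_boundary Om -> boundary Om y ->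
  (0 < d)%R -> 0 < hausdorff1 (boundary Om `&` eball y d).
Proof.
move=> oOm lip by_ d0; have [a [b [gr [L [r0 [h [ab r00 h0 Lgr HOm]]]]]]] := lip y by_.
exact: (boundary_piece_pos oOm by_ ab r00 h0 Lgr HOm d0).
Qed.

End Hausdorff.

(** * Bessel series and modes *)

Section Bessel.
Context {R : realType}.
Implicit Types (n k : nat) (t : R).

(** [I_n(r)] is [(r / 2)^n] times the power series with these coefficients in [t = r^2]. Working
    with this series shows that the radial factor is smooth at the pole. *)
Definition bessel_coef n k : R := (4 ^+ k * k`!%:R * (k + n)`!%:R)^-1.

Definition bessel_series n t : R := limn (pseries (bessel_coef n) t).

Let fact_neq0 n : n`!%:R != 0 :> R.
Proof. by rewrite pnatr_eq0 -lt0n fact_gt0. Qed.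

Lemma bessel_coef_gt0 n k : 0 < bessel_coef n k.
Proof. by rewrite invr_gt0 !mulr_gt0 ?exprn_gt0 // ltr0n fact_gt0. Qed.

Lemma bessel_coef_diffs n : pseries_diffs (bessel_coef n) = 4^-1 *: bessel_coef n.+1.
Proof.
apply/funext => k; rewrite /pseries_diffs /bessel_coef /= fctE /GRing.scale /= exprS factS addSn -addnS natrM.
have h1 := fact_neq0 k; have h2 := fact_neq0 (k + n.+1); have h3 : (4 : R) ^+ k != 0 by rewrite expf_neq0.
have h4 : k.+1%:R != 0 :> R by rewrite pnatr_eq0.
move: (k`!%:R) ((k + n.+1)`!%:R) (4 ^+ k) (k.+1%:R) h1 h2 h3 h4 => a b c d h1 h2 h3 h4.
by field; rewrite h1 h2 h3 h4.
Qed.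

Lemma bessel_coef_rec n k :
  bessel_coef n k.+1 = bessel_coef n.+2 k / 4 + n.+1%:R * bessel_coef n.+1 k.+1.
Proof.
rewrite /bessel_coef exprS !addnS !addSn !factS !natrM.
have h1 := fact_neq0 k; have h2 := fact_neq0 (k + n); have h3 : (4 : R) ^+ k != 0 by rewrite expf_neq0.
have e1 : (k + n).+1%:R = k%:R + n%:R + 1 :> R by rewrite -natr1 natrD.
have e2 : (k + n).+2%:R = k%:R + n%:R + 2 :> R by rewrite -[(k + n).+2%:R]natr1 e1; ring.
rewrite e1 e2 -[k.+1%:R]natr1 -[n.+1%:R]natr1.
move: (k`!%:R) ((k + n)`!%:R) (4 ^+ k) h1 h2 h3 => a b c h1 h2 h3.
have k0 := ler0n R k; have n0 := ler0n R n; move: (k%:R) (n%:R) k0 n0 => x y x0 y0.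
have p1 : x + 1 != 0 by rewrite gt_eqF //; lra.
have p2 : x + y + 1 != 0 by rewrite gt_eqF //; lra.
have p3 : x + y + 2 != 0 by rewrite gt_eqF //; lra.
by field; rewrite h1 h2 h3 p1 p2 p3.
Qed.

Lemma bessel_cvg n t : pseries (bessel_coef n) t @ \oo --> bessel_series n t.
Proof.
apply: (@normed_cvg _ _ (fun k => bessel_coef n k * t ^+ k)).
apply: (@series_le_cvg _ _ (exp_coeff `|t|)) => [k|k|k|]; last exact: is_cvg_series_exp_coeff.
- exact: normr_ge0.
- by rewrite exp_coeffE mulr_ge0 ?invr_ge0 ?ler0n // exprn_ge0.
- rewrite exp_coeffE /= normrM normrX (gtr0_norm (bessel_coef_gt0 _ _)) ler_wpM2r ?exprn_ge0 //.
  rewrite lef_pV2 ?posrE ?mulr_gt0 ?exprn_gt0 ?ltr0n ?fact_gt0 //.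
  rewrite mulrAC ler_peMl ?ler0n // mulr_ege1 ?exprn_ege1 ?ler1n ?fact_gt0 //.
Qed.

Let is_cvgZ n (a t : R) : cvgn (pseries (a *: bessel_coef n) t) /\
  limn (pseries (a *: bessel_coef n) t) = a * bessel_series n t.
Proof.
have -> : pseries (a *: bessel_coef n) t = a *: pseries (bessel_coef n) t.
  apply/funext => N; rewrite /pseries /series [RHS]/(_ *: _) /= /GRing.scale /= mulr_sumr; apply: eq_bigr => k _.
  by rewrite mulrA.
have C := bessel_cvg (n := n) (t := t).
have CZ : a *: pseries (bessel_coef n) t @ \oo --> a *: bessel_series n t by apply: cvgZr.
by split; [apply: cvgP CZ|exact: cvg_lim CZ].
Qed.

Lemma is_derive_bessel n t : is_derive t (1 : R) (bessel_series n) (4^-1 * bessel_series n.+1 t).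
Proof.
have D := bessel_coef_diffs n.
have [c1 l1] := is_cvgZ n.+1 4^-1 t.
rewrite -l1 -D; apply: (@pseries_snd_diffs _ _ (`|t| + 1)).
- exact: cvgP (bessel_cvg (n := n) (t := _)).
- by rewrite D; case: (is_cvgZ n.+1 4^-1 (`|t| + 1)).
- rewrite D (_ : pseries_diffs _ = (4^-1 * 4^-1) *: bessel_coef n.+2); last first.
    rewrite -scalerA -(bessel_coef_diffs n.+1); apply/funext => k.
    exact: mulrCA.
  by case: (is_cvgZ n.+2 (4^-1 * 4^-1) (`|t| + 1)).
- by rewrite [ltRHS]ger0_norm ?addr_ge0 // ltrDl.
Qed.

(** The Bessel equation in disguise: each derivative raises the index and brings a factor 1/4, so
    this recurrence reads [t S'' + (n + 1) S' = S / 4]. *)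
Lemma bessel_series_rec n t :
  t / 4 * bessel_series n.+2 t + n.+1%:R * bessel_series n.+1 t = bessel_series n t.
Proof.
have P N : pseries (bessel_coef n) t N.+1 =
    t / 4 * pseries (bessel_coef n.+2) t N + n.+1%:R * pseries (bessel_coef n.+1) t N.+1.
  elim: N => [|N IH].
    rewrite /pseries /series /= !big_nat1 big_geq // mulr0 add0r expr0 !mulr1 /bessel_coef expr0 !fact0 !mul1r !add0n.
    by rewrite factS natrM invfM mulrA divff ?mul1r // pnatr_eq0.
  rewrite /pseries [LHS]seriesSr -/(pseries _ _) IH /pseries !seriesSr /= -/(pseries _ _) bessel_coef_rec exprS.
  by ring.
have H : (fun N => pseries (bessel_coef n) t N.+1) @ \oo --> bessel_series n t.
  by rewrite cvg_shiftS; exact: bessel_cvg.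
rewrite -(cvg_lim _ H) //; apply/esym/cvg_lim => //.
rewrite (_ : (fun N : nat => _) = fun N => t / 4 * pseries (bessel_coef n.+2) t N + n.+1%:R * pseries (bessel_coef n.+1) t N.+1); last exact/funext.
apply: cvgD; apply: cvgMr => //; first exact: bessel_cvg.
by rewrite cvg_shiftS; exact: bessel_cvg.
Qed.

Lemma bessel_series_gt0 n t : 0 <= t -> 0 < bessel_series n t.
Proof.
move=> t0; apply: (@lt_le_trans _ _ (pseries (bessel_coef n) t 1%N)).
  by rewrite /pseries /series /= big_nat1 expr0 mulr1 bessel_coef_gt0.
apply: nondecreasing_cvgn_le; last exact: cvgP (bessel_cvg (n := n) (t := t)).
apply: nondecreasing_series => k _ _; by rewrite mulr_ge0 ?exprn_ge0 // ltW // bessel_coef_gt0.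
Qed.

Lemma besselIE n (r : R) : besselI n r = (r / 2) ^+ n * bessel_series n (r ^+ 2).
Proof.
rewrite /besselI; apply: cvg_lim => //.
rewrite (_ : series _ = fun N => (r / 2) ^+ n * pseries (bessel_coef n) (r ^+ 2) N).
  by apply: cvgMr => //; exact: bessel_cvg.
apply/funext => N; rewrite /pseries /series /= mulr_sumr; apply: eq_bigr => k _.
rewrite exprD exprM mulrAC [LHS]mulrC; congr (_ * _); rewrite /bessel_coef natrM !exprMn exprVn.
have -> : (4 : R) ^+ k = 2 ^+ k * 2 ^+ k by rewrite -exprMn; congr (_ ^+ k); ring.
have h1 := fact_neq0 k; have h2 := fact_neq0 (k + n); have h3 : (2 : R) ^+ k != 0 by rewrite expf_neq0.
move: (k`!%:R) ((k + n)`!%:R) (2 ^+ k) h1 h2 h3 => a b c h1 h2 h3.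
by field; rewrite h1 h2 h3.
Qed.

End Bessel.

Section Profiles.
Context {R : realType}.
Implicit Types (A : nat -> R -> R) (n : nat) (t : R) (x y : plane R).

(* [A n (r ^ 2) * r ^ n * exp (i n theta)] solves [lap u = c u] when
   [t A'' + (n + 1) A' = c / 4 A]. *)
Definition profile (c : R) A :=
  [/\ forall n, smooth1 (A n), forall n t, 0 <= t -> 0 < A n t &
   forall n, exists B C : R -> R, [/\ smooth1 B, forall t, is_derive t (1 : R) (A n) (B t),
     forall t, is_derive t (1 : R) B (C t) & forall t, t * C t + n.+1%:R * B t = c / 4 * A n t]].

Lemma smooth1_cst (a : R) : smooth1 (fun=> a).
Proof.
exists (fun k => if k is 0 then fun=> a else fun=> 0); split=> // -[|k] t; exact: is_derive_cst.
Qed.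

Lemma smooth1_bessel (a : R) n : smooth1 (fun t => a * bessel_series n t).
Proof.
exists (fun k t => a * (4^-1) ^+ k * bessel_series (n + k)%N t); split.
  by apply/funext => t; rewrite expr0 mulr1 addn0.
move=> k t; rewrite addnS exprSr.
have D := is_derive_bessel (n + k) t.
have := @is_deriveZ _ _ _ (bessel_series (n + k)%N) (a * 4^-1 ^+ k) t 1 _ D.
by move/is_derive_eq; apply; rewrite /GRing.scale /= !mulrA.
Qed.

Lemma profile_power : profile 0 (fun _ _ => 1 : R).
Proof.
split=> [n|n t _|n]; [exact: smooth1_cst|exact: ltr01|].
exists (fun=> 0), (fun=> 0); split=> [|t|t|t]; [exact: smooth1_cst|exact: is_derive_cst|exact: is_derive_cst|].
by rewrite !mulr0 mul0r addr0 mul0r.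
Qed.

Lemma profile_bessel : profile 1 (fun n t => 2^-1 ^+ n * bessel_series n t).
Proof.
split=> [n|n t t0|n]; first exact: smooth1_bessel.
  by rewrite mulr_gt0 ?bessel_series_gt0 // exprn_gt0 // invr_gt0.
have D (a : R) m t : is_derive t (1 : R) (fun t => a * bessel_series m t) (a * 4^-1 * bessel_series m.+1 t).
  have := @is_deriveZ _ _ _ (bessel_series m) a t 1 _ (is_derive_bessel m t).
  by move/is_derive_eq; apply; rewrite /GRing.scale /= !mulrA.
exists (fun t => 2^-1 ^+ n * 4^-1 * bessel_series n.+1 t), (fun t => 2^-1 ^+ n * 4^-1 * 4^-1 * bessel_series n.+2 t).
split=> [|t|t|t]; [exact: smooth1_bessel|exact: D|exact: D|].
by rewrite -[in RHS]bessel_series_rec; ring.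
Qed.

Definition zco (s : bool) n y x : R := if s then (zre y n x).2 else (zre y n x).1.

Lemma zco0 s y x : zco s 0 y x = if s then 0 else 1.
Proof. by case: s. Qed.

Lemma zcoS s n y x : zco s n.+1 y x =
  if s then (x.1 - y.1) * zco true n y x + (x.2 - y.2) * zco false n y x
  else (x.1 - y.1) * zco false n y x - (x.2 - y.2) * zco true n y x.
Proof. by case: s. Qed.

Let smooth_X y : smooth (fun x => x.1 - y.1).
Proof. by apply: smoothB; [exact: smooth_fst|exact: smooth_cst]. Qed.

Let smooth_Y y : smooth (fun x => x.2 - y.2).
Proof. by apply: smoothB; [exact: smooth_snd|exact: smooth_cst]. Qed.

Lemma smooth_zco s n y : smooth (zco s n y).
Proof.
elim: n s => [|n IH] s.
  by rewrite (_ : zco s 0 y = fun=> zco s 0 y y); [exact: smooth_cst|apply/funext => x; rewrite !zco0].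
rewrite (_ : zco s n.+1 y = fun x => if s then (x.1 - y.1) * zco true n y x + (x.2 - y.2) * zco false n y x
  else (x.1 - y.1) * zco false n y x - (x.2 - y.2) * zco true n y x); last by apply/funext => x; rewrite zcoS.
by case: s; [apply: smoothD|apply: smoothB]; apply: smoothM.
Qed.

Let pd_X y i x : pd i (fun x : plane R => x.1 - y.1) x = (~~ i)%:R.
Proof.
rewrite pdBs; [|exact: smooth_fst|exact: smooth_cst].
by rewrite (pd_pr false i) pd_cst subr0; case: i.
Qed.

Let pd_Y y i x : pd i (fun x : plane R => x.2 - y.2) x = i%:R.
Proof.
rewrite pdBs; [|exact: smooth_snd|exact: smooth_cst].
by rewrite (pd_pr true i) pd_cst subr0; case: i.
Qed.

Lemma pd_zco s n y i x : pd i (zco s n.+1 y) x =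
  n.+1%:R * (if i then (if s then zco false n y x else - zco true n y x) else zco s n y x).
Proof.
elim: n s i x => [|n IH] s i x.
  have E z : zco s 1 y z = if s then z.2 - y.2 else z.1 - y.1.
    by rewrite zcoS !zco0; case: s; rewrite ?mulr0 ?mulr1 ?add0r ?subr0.
  rewrite (_ : zco s 1 y = if s then fun z => z.2 - y.2 else fun z => z.1 - y.1); last first.
    by apply/funext => z; rewrite E; case: s {E}.
  by case: s {E}; [rewrite pd_Y|rewrite pd_X]; case: i; rewrite !zco0 ?oppr0 ?mulr1 ?mulr0.
have Z b := smooth_zco b n.+1 y.
rewrite (_ : zco s n.+2 y = if s then fun x => (x.1 - y.1) * zco true n.+1 y x + (x.2 - y.2) * zco false n.+1 y x
  else fun x => (x.1 - y.1) * zco false n.+1 y x - (x.2 - y.2) * zco true n.+1 y x); last first.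
  by apply/funext => z; rewrite zcoS; case: s.
have M b : smooth (fun x => (x.1 - y.1) * zco b n.+1 y x) /\ smooth (fun x => (x.2 - y.2) * zco b n.+1 y x).
  by split; apply: smoothM.
have N1 : n.+2%:R = n.+1%:R + 1 :> R by rewrite -natr1.
case: s; [rewrite pdDs; [|by case: (M true)|by case: (M false)]|
  rewrite pdBs; [|by case: (M false)|by case: (M true)]];
  rewrite !pdMs // !IH pd_X pd_Y N1; case: i; rewrite !zcoS; move: (zco true n y x) (zco false n y x) => a b /=; ring.
Qed.

Let pd_zco_fun s n y i : pd i (zco s n y) = fun x =>
  n%:R * (if i then (if s then zco false n.-1 y x else - zco true n.-1 y x) else zco s n.-1 y x).
Proof.
apply/funext => x; case: n => [|n]; last exact: pd_zco.
rewrite (_ : zco s 0 y = fun=> zco s 0 y y); last by apply/funext => z; rewrite !zco0.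
by rewrite pd_cst mul0r.
Qed.

Lemma lap_zco s n y x : lap (zco s n y) x = 0.
Proof.
rewrite /lap !pd_zco_fun; case: n => [|n].
  rewrite (_ : (fun _ => _) = fun=> 0); last by apply/funext => z; rewrite mul0r.
  rewrite (_ : (fun z => _) = fun=> 0); last by apply/funext => z; rewrite mul0r.
  by rewrite !pd_cst addr0.
rewrite [n.+1.-1]/= pdZs; last exact: smooth_zco.
case: s.
  by rewrite pdZs ?pd_zco_fun; [ring|exact: smooth_zco].
rewrite pdZs; last by apply: smoothN; exact: smooth_zco.
by rewrite pdNs ?pd_zco_fun; [ring|exact: smooth_zco].
Qed.

Lemma euler_zco s n y x :
  (x.1 - y.1) * pd false (zco s n y) x + (x.2 - y.2) * pd true (zco s n y) x = n%:R * zco s n y x.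
Proof.
rewrite !pd_zco_fun; case: n => [|n]; first by rewrite !mul0r !mulr0 addr0.
by rewrite zcoS /=; case: s; ring.
Qed.

Lemma pd_comp_sqd (F G : R -> R) y i x : (forall t, is_derive t (1 : R) F (G t)) ->
  pd i (fun z => F (sqd y z)) x = G (sqd y x) * (2 * (pr i x - pr i y)).
Proof.
move=> FG; rewrite -pd_sqd pdE [in RHS]pdE.
have := is_derive_comp (@smooth_der R (sqd y) i x (@smooth_sqd R y)) (FG (sqd y x)).
exact: (@derive_val _ _ _ _ _ _ _).
Qed.

Lemma smooth_radial (F : R -> R) y : smooth1 F -> smooth (fun x => F (sqd y x)).
Proof. by move=> sF; apply: (smooth_comp sF); exact: smooth_sqd. Qed.

(** With [t = |x - y|^2] and [h] harmonic and homogeneous of degree [n], Euler's relation gives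
    [lap (A(t) h) = 4 h (t A'' + (n + 1) A')]. *)
Lemma lap_profile c A s n y x : profile c A ->
  lap (fun x => A n (sqd y x) * zco s n y x) x = c * (A n (sqd y x) * zco s n y x).
Proof.
move=> [sA _ /(_ n)[B [C [sB AB BC ode]]]].
have sh := smooth_zco s n y; have sF := smooth_radial y (sA n); have sG := smooth_radial y sB.
have sp i : smooth (fun x => 2 * (pr i x - pr i y)).
  by apply: smoothZ; apply: smoothB; [exact: smooth_pr|exact: smooth_cst].
have P1 i : pd i (fun x => A n (sqd y x) * zco s n y x) =
    fun x => A n (sqd y x) * pd i (zco s n y) x + zco s n y x * (B (sqd y x) * (2 * (pr i x - pr i y))).
  by rewrite pdMs //; apply/funext => z; rewrite (pd_comp_sqd y i z AB).
have P2 i : pd i (fun x => 2 * (pr i x - pr i y)) x = 2.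
  rewrite pdZs; last by apply: smoothB; [exact: smooth_pr|exact: smooth_cst].
  by rewrite pdBs; [rewrite pd_pr pd_cst eqxx subr0 mulr1|exact: smooth_pr|exact: smooth_cst].
have P3 i : pd i (pd i (fun x => A n (sqd y x) * zco s n y x)) x =
    A n (sqd y x) * pd i (pd i (zco s n y)) x + pd i (zco s n y) x * (B (sqd y x) * (2 * (pr i x - pr i y)))
    + zco s n y x * (B (sqd y x) * 2 + 2 * (pr i x - pr i y) * (C (sqd y x) * (2 * (pr i x - pr i y))))
    + B (sqd y x) * (2 * (pr i x - pr i y)) * pd i (zco s n y) x.
  rewrite P1 pdDs; [|by apply: smoothM => //; exact: smooth_pd|by apply: smoothM => //; exact: smoothM].
  rewrite pdMs //; last exact: smooth_pd.
  rewrite pdMs //; last exact: smoothM.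
  by rewrite pdMs // P2 (pd_comp_sqd y i x AB) (pd_comp_sqd y i x BC) !addrA.
have L := lap_zco s n y x; have E := euler_zco s n y x; have O := ode (sqd y x).
rewrite /lap !P3 /=; rewrite /lap in L.
have -> : c * (A n (sqd y x) * zco s n y x) = 4 * zco s n y x * (c / 4 * A n (sqd y x)) by field.
rewrite -O.
transitivity (A n (sqd y x) * (pd false (pd false (zco s n y)) x + pd true (pd true (zco s n y)) x)
  + 4 * B (sqd y x) * ((x.1 - y.1) * pd false (zco s n y) x + (x.2 - y.2) * pd true (zco s n y) x)
  + 4 * zco s n y x * (B (sqd y x) + C (sqd y x) * ((x.1 - y.1) ^+ 2 + (x.2 - y.2) ^+ 2))); first by ring.
rewrite L E -/(sqd y x) mulr0 add0r -natr1; ring.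
Qed.

End Profiles.

Section ComplexParts.
Context {R : realType}.
Implicit Types (a b z : R[i]).

Lemma complex_ext a b : complex.Re a = complex.Re b -> complex.Im a = complex.Im b -> a = b.
Proof. by case: a => a1 a2; case: b => b1 b2 /= -> ->. Qed.

Lemma complex_ReD a b : complex.Re (a + b) = complex.Re a + complex.Re b.
Proof. by case: a; case: b. Qed.

Lemma complex_ImD a b : complex.Im (a + b) = complex.Im a + complex.Im b.
Proof. by case: a; case: b. Qed.

Lemma complex_ReB a b : complex.Re (a - b) = complex.Re a - complex.Re b.
Proof. by case: a; case: b. Qed.

Lemma complex_ImB a b : complex.Im (a - b) = complex.Im a - complex.Im b.
Proof. by case: a; case: b. Qed.

Lemma complex_ReM a b : complex.Re (a * b) = complex.Re a * complex.Re b - complex.Im a * complex.Im b.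
Proof. by case: a; case: b. Qed.

Lemma complex_ImM a b : complex.Im (a * b) = complex.Re a * complex.Im b + complex.Im a * complex.Re b.
Proof. by case: a; case: b. Qed.

Lemma normc_sqr z : ComplexField.Normc.normc z ^+ 2 = complex.Re z ^+ 2 + complex.Im z ^+ 2.
Proof. by case: z => x y /=; rewrite sqr_sqrtr // addr_ge0 ?sqr_ge0. Qed.

End ComplexParts.

(** * Polar coordinates and the Cartesian form of the families *)

Section Polar.
Context {R : realType}.
Implicit Types (x y p : plane R).

Lemma enorm_sqr p : enorm p ^+ 2 = p.1 ^+ 2 + p.2 ^+ 2.
Proof. by rewrite sqr_sqrtr // addr_ge0 ?sqr_ge0. Qed.

(** At the pole all terms are 0, so the value chosen for the angle there is harmless. *)
Lemma polar_coord p : enorm p * cos (angle p) = p.1 /\ enorm p * sin (angle p) = p.2.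
Proof.
have e0 : 0 <= enorm p by exact: sqrtr_ge0.
have [h|/eqP h] := eqVneq (enorm p) 0.
  have p1 := enorm_pr false p; have p2 := enorm_pr true p; rewrite h !normr_le0 /= in p1 p2.
  by rewrite h !mul0r (eqP p1) (eqP p2).
have ep : 0 < enorm p by rewrite lt_neqAle e0 andbT eq_sym; exact/eqP.
have c1 : -1 <= p.1 / enorm p <= 1.
  have := enorm_pr false p; rewrite /= ler_norml => /andP[h1 h2].
  by rewrite ler_pdivlMr // ler_pdivrMr // mulN1r mul1r h1.
have C : cos (angle p) = p.1 / enorm p.
  by rewrite /angle; case: ifP => _; rewrite ?cosN acosK.
have S : enorm p * Num.sqrt (1 - (p.1 / enorm p) ^+ 2) = `|p.2|.
  rewrite -{1}(ger0_norm e0) -sqrtr_sqr -sqrtrM ?sqr_ge0 // -sqrtr_sqr; congr Num.sqrt.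
  by rewrite mulrBr mulr1 -exprMn [_ * (_ / _)]mulrC divfK ?gt_eqF // enorm_sqr addrAC subrr add0r.
split; first by rewrite C mulrC divfK ?gt_eqF.
rewrite /angle; case: ifPn => [p2|]; first by rewrite sin_acos // S ger0_norm.
by rewrite -ltNge => p2; rewrite sinN sin_acos // mulrN S ltr0_norm // opprK.
Qed.

Lemma de_moivre y x n s : zco s n y x =
  enorm (x - y) ^+ n * (if s then sin else cos) (n%:R * angle (x - y)).
Proof.
have [h1 h2] := polar_coord (x - y); rewrite /= in h1 h2.
elim: n s => [|n IH] s; first by rewrite zco0 mul0r expr0 mul1r; case: s; rewrite ?sin0 ?cos0.
rewrite zcoS !IH -[n.+1%:R]natr1 [(n%:R + 1) * _]mulrDl mul1r exprS -h1 -h2.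
move: (enorm _) (angle _) (n%:R) => r t m.
by case: s; rewrite ?sinD ?cosD; ring.
Qed.

Lemma sqd_enorm y x : sqd y x = enorm (x - y) ^+ 2.
Proof. by rewrite enorm_sqr. Qed.

End Polar.

Section Family.
Context {R : realType}.
Implicit Types (A : nat -> R -> R) (x y : plane R) (f : int -> plane R -> R[i]).

Definition int_sign (j : int) : R := if j is Posz _ then 1 else -1.

(** The common Cartesian form of [P_] and [Q_], in which smoothness at the pole is visible; [zco]
    supplies [r^n cos (n theta)] and [r^n sin (n theta)]. *)
Definition modes A y (j : int) x : R[i] := Complex
  (A `|j|%N (sqd y x) * zco false `|j|%N y x)
  (int_sign j * (A `|j|%N (sqd y x) * zco true `|j|%N y x)).

Lemma expi_int (j : int) (t : R) : expi (j%:~R * t) = Complex (cos (`|j|%N%:R * t)) (int_sign j * sin (`|j|%N%:R * t)).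
Proof.
case: j => n; first by rewrite /= mul1r.
by rewrite NegzE mulrNz mulNr /expi cosN sinN /= mulN1r.
Qed.

Lemma in_polar_P y j : in_polar y (P_ j) = modes (fun _ _ => 1) y j.
Proof.
apply/funext => x; rewrite /in_polar /P_ /modes !de_moivre expi_int.
by apply: complex_ext; rewrite ?complex_ReM ?complex_ImM /=; ring.
Qed.

Lemma in_polar_Q y j : in_polar y (Q_ j) = modes (fun n t => 2^-1 ^+ n * bessel_series n t) y j.
Proof.
apply/funext => x; rewrite /in_polar /Q_ /modes !de_moivre expi_int besselIE -sqd_enorm exprMn.
by apply: complex_ext; rewrite ?complex_ReM ?complex_ImM /=; ring.
Qed.

Definition helmholtz (c : R) (u : plane R -> R[i]) := csmooth u /\
  forall x, lap (fun x => complex.Re (u x)) x = c * complex.Re (u x) /\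
            lap (fun x => complex.Im (u x)) x = c * complex.Im (u x).

Lemma lapD (f g : plane R -> R) x : smooth f -> smooth g -> lap (fun x => f x + g x) x = lap f x + lap g x.
Proof.
by move=> sf sg; rewrite /lap !pdDs //; try exact: smooth_pd; rewrite addrACA.
Qed.

Lemma lapZ (t : R) (f : plane R -> R) x : smooth f -> lap (fun x => t * f x) x = t * lap f x.
Proof.
by move=> sf; rewrite /lap !pdZs //; try exact: smooth_pd; rewrite mulrDr.
Qed.

Lemma helmholtz_modes c A y j : profile c A -> helmholtz c (modes A y j).
Proof.
move=> PA; have [sA _ _] := PA.
have S s n : smooth (fun x => A n (sqd y x) * zco s n y x).
  by apply: smoothM; [exact: smooth_radial|exact: smooth_zco].
split; first by split; [exact: S|exact: smoothZ].
move=> x; split; first exact: lap_profile.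
by rewrite [LHS]lapZ // (lap_profile _ _ _ _ PA) [RHS]mulrCA.
Qed.

Lemma csmoothD (u v : plane R -> R[i]) : csmooth u -> csmooth v -> csmooth (fun x => u x + v x).
Proof.
move=> [u1 u2] [v1 v2]; split.
  by rewrite (_ : (fun x => _) = fun x => complex.Re (u x) + complex.Re (v x)); [exact: smoothD|apply/funext => x; exact: complex_ReD].
by rewrite (_ : (fun x => _) = fun x => complex.Im (u x) + complex.Im (v x)); [exact: smoothD|apply/funext => x; exact: complex_ImD].
Qed.

Lemma csmoothB (u v : plane R -> R[i]) : csmooth u -> csmooth v -> csmooth (fun x => u x - v x).
Proof.
move=> [u1 u2] [v1 v2]; split.
  by rewrite (_ : (fun x => _) = fun x => complex.Re (u x) - complex.Re (v x)); [exact: smoothB|apply/funext => x; exact: complex_ReB].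
by rewrite (_ : (fun x => _) = fun x => complex.Im (u x) - complex.Im (v x)); [exact: smoothB|apply/funext => x; exact: complex_ImB].
Qed.

Lemma helmholtzD c u v : helmholtz c u -> helmholtz c v -> helmholtz c (fun x => u x + v x).
Proof.
move=> [su Lu] [sv Lv]; split; first exact: csmoothD.
have [u1 u2] := su; have [v1 v2] := sv.
move=> x; have [h1 h2] := Lu x; have [h3 h4] := Lv x; split.
  rewrite (_ : (fun x => _) = fun x => complex.Re (u x) + complex.Re (v x)); last by apply/funext => z; exact: complex_ReD.
  by rewrite lapD // h1 h3 complex_ReD mulrDr.
rewrite (_ : (fun x => _) = fun x => complex.Im (u x) + complex.Im (v x)); last by apply/funext => z; exact: complex_ImD.
by rewrite lapD // h2 h4 complex_ImD mulrDr.
Qed.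

Lemma helmholtzZ c (a : R[i]) u : helmholtz c u -> helmholtz c (fun x => a * u x).
Proof.
move=> [[u1 u2] Lu].
have E1 : (fun x => complex.Re (a * u x)) = fun x => complex.Re a * complex.Re (u x) + (- complex.Im a) * complex.Im (u x).
  by apply/funext => x; rewrite complex_ReM mulNr.
have E2 : (fun x => complex.Im (a * u x)) = fun x => complex.Re a * complex.Im (u x) + complex.Im a * complex.Re (u x).
  by apply/funext => x; rewrite complex_ImM.
have Z (t : R) (f : plane R -> R) : smooth f -> smooth (fun x => t * f x) by exact: smoothZ.
split; first by rewrite /csmooth E1 E2; split; apply: smoothD; exact: Z.
move=> x; have [h1 h2] := Lu x; rewrite E1 E2 !lapD; try exact: Z.
by rewrite !lapZ // h1 h2 complex_ReM complex_ImM; split; ring.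
Qed.

Lemma helmholtz0 c : helmholtz c (fun=> 0).
Proof.
split; first by split; exact: smooth_cst.
by move=> x; rewrite /= !mulr0 /lap !pd_cst addr0.
Qed.

Lemma helmholtz_lincomb c f s (a : int -> R[i]) : (forall j, helmholtz c (f j)) -> helmholtz c (lincomb f s a).
Proof.
move=> Hf; elim: s => [|j s IH].
  by rewrite (_ : lincomb f [::] a = fun=> 0); [exact: helmholtz0|apply/funext => x; rewrite /lincomb big_nil].
rewrite (_ : lincomb f (j :: s) a = fun x => a j * f j x + lincomb f s a x).
  by apply: helmholtzD => //; exact: helmholtzZ.
by apply/funext => x; rewrite /lincomb big_cons.
Qed.

End Family.

(** * The maximum principle for [lap u = c u] *)

Section MaximumPrinciple.
Context {R : realType}.
Implicit Types (u f : plane R -> R) (x y z : plane R) (Om : set (plane R)).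

Lemma sqd_ax x i (t : R) : sqd x (x + t *: ax i) = t ^+ 2.
Proof. by rewrite scale_ax /sqd; case: i => /=; ring. Qed.

(** Were the second derivative positive, the first would increase strictly along the axis near [x].
    Looking to the left of the maximum it is nonnegative at [x], hence positive to the right, where
    [f] would exceed [f x]. *)
Lemma second_derivative_max f i x (d : R) : smooth f -> 0 < d ->
  (forall z, eball x d z -> f z <= f x) -> pd i (pd i f) x <= 0.
Proof.
move=> sf d0 fmax; rewrite leNgt; apply/negP => D0.
have sD : smooth (pd i f) by exact: smooth_pd.
have [r [r0 rd rD]] : exists r : R, [/\ 0 < r, r < d & forall t : R, `|t| <= r -> 0 < pd i (pd i f) (x + t *: ax i)].
  have cD : continuous (pd i (pd i f)) by apply: smooth_cont; exact: smooth_pd.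
  have : nbhs x (pd i (pd i f) @^-1` [set t | 0 < t]).
    by apply: cD; apply: open_nbhs_nbhs; split; [exact: open_gt|].
  move=> /nbhs_eball[b b0 Hb]; exists (Num.min b d / 2).
  have m0 : 0 < Num.min b d by rewrite lt_min b0.
  have mb : Num.min b d <= b by rewrite ge_min lexx.
  have md : Num.min b d <= d by rewrite ge_min lexx orbT.
  split; [by rewrite divr_gt0|by move: (Num.min b d) m0 md => m m0 md; lra|].
  move=> t ht; apply: Hb; rewrite /eball /= sqd_ax -(real_normK (num_real t)) ltr_pXn2r ?nnegrE ?(ltW b0) //.
  by apply: le_lt_trans ht _; move: (Num.min b d) m0 mb => m m0 mb; lra.
pose g (t : R) := x + t *: ax i.
have gD (a h : R) : g a + h *: ax i = g (a + h) by rewrite /g scalerDl addrA.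
have inb (t : R) : `|t| <= r -> eball x d (g t).
  move=> ht; rewrite /eball /= sqd_ax -(real_normK (num_real t)) ltr_pXn2r ?nnegrE ?(ltW d0) //.
  exact: le_lt_trans rd.
have inc (a b : R) : - r <= a -> a < b -> b <= r -> pd i f (g a) < pd i f (g b).
  move=> ra ab br; have [|c /andP[c0 cb] E] := MVT_ax i (g a) (h := b - a) sD; first by rewrite subr_ge0 ltW.
  move: E; rewrite !gD [a + (b - a)]addrC subrK => E; rewrite -subr_gt0 E mulr_gt0 ?subr_gt0 //.
  by apply: rD; rewrite ler_norml; apply/andP; split; lra.
have g0 : g 0 = x by rewrite /g scale0r addr0.
have p0 : 0 <= pd i f x.
  have [|c /andP[c0 cr] E] := MVT_ax i (g (- r)) (h := r) sf; first exact: ltW.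
  move: E; rewrite !gD [- r + r]addrC subrr g0 => E.
  have H : 0 <= pd i f (g (- r + c)).
    rewrite -(pmulr_lge0 _ r0) -E subr_ge0; apply: fmax; apply: inb.
    by rewrite normrN ger0_norm // ltW.
  apply: le_trans H _; have [->|cr'] := eqVneq c r; first by rewrite addrC subrr g0.
  have lt : c < r by rewrite lt_neqAle cr' cr.
  by rewrite -[in leRHS]g0; apply/ltW/inc; lra.
have [|c /andP[c0 cr] E] := MVT_ax i x (h := r / 2) sf; first by rewrite divr_ge0 // ltW.
have [|c' /andP[c'0 c'r] E'] := MVT_ax i (g (r / 2)) (h := r / 2) sf; first by rewrite divr_ge0 // ltW.
move: E'; rewrite !gD => E'; rewrite -!/(g _) in E.
have H1 : 0 <= pd i f (g c).
  apply: le_trans p0 _; rewrite -{1}g0; have [->//|cn] := eqVneq c 0.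
  by apply/ltW/inc; [lra|rewrite lt_neqAle eq_sym cn|lra].
have H2 : 0 < pd i f (g (r / 2 + c')).
  by apply: le_lt_trans p0 _; rewrite -g0; apply: inc; lra.
have r2 : 0 < r / 2 by rewrite divr_gt0.
have H3 := mulr_ge0 H1 (ltW r2); rewrite -E in H3.
have H4 := mulr_gt0 H2 r2; rewrite -E' in H4.
have : f (g r) <= f x by apply: fmax; apply: inb; rewrite ger0_norm // ltW.
have -> : g r = g (r / 2 + r / 2) by congr g; lra.
by move: H3 H4; lra.
Qed.

Lemma lap_sqd y x : lap (sqd y) x = 4.
Proof.
have P i : pd i (pd i (sqd y)) x = 2.
  rewrite (_ : pd i (sqd y) = fun x => 2 * (pr i x - pr i y)); last by apply/funext => z; exact: pd_sqd.
  rewrite pdZs; last by apply: smoothB; [exact: smooth_pr|exact: smooth_cst].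
  by rewrite pdBs; [rewrite pd_pr pd_cst eqxx subr0 mulr1|exact: smooth_pr|exact: smooth_cst].
by rewrite /lap !P; ring.
Qed.

Lemma closed_disc_closure Om y (rho : R) : (forall x, Om x -> sqd y x <= rho) -> forall x, closure Om x -> sqd y x <= rho.
Proof.
move=> bOm x cx; apply: (@closed_sqd_le R y rho) => B nB.
by have [w [Ow Bw]] := cx B nB; exists w; split=> //; exact: bOm.
Qed.

(** Adding [e sqd] makes the Laplacian at an interior maximum with [u > 0] at least [4 e > 0], which
    the second derivative test forbids. So [u <= 0] at the maximum of [v], on the boundary or
    inside. *)
Lemma max_principle Om y (rho c : R) u : open Om -> (forall x, Om x -> sqd y x <= rho ^+ 2) -> 0 <= c ->
  smooth u -> (forall x, lap u x = c * u x) -> (forall x, boundary Om x -> u x <= 0) ->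
  forall x, Om x -> u x <= 0.
Proof.
move=> oOm bOm c0 su Lu u0 x Ox; rewrite leNgt; apply/negP => ux.
have r1 : 0 < rho ^+ 2 + 1 by rewrite ltr_wpDl // sqr_ge0.
(* Small enough that [e rho^2 < u x]: the perturbation alone cannot account for the value of [v] at
   [x]. *)
pose e := u x / (2 * (rho ^+ 2 + 1)); have e0 : 0 < e by rewrite divr_gt0 // mulr_gt0.
have eu : e * (2 * (rho ^+ 2 + 1)) = u x by rewrite divfK // gt_eqF // mulr_gt0.
pose v z := u z + e * sqd y z.
have sv : smooth v by apply: smoothD => //; apply: smoothZ; exact: smooth_sqd.
have clb := closed_disc_closure bOm.
have [z /[!inE] cz vmax] : exists2 z, z \in closure Om & forall w, w \in closure Om -> v w <= v z.
  apply: compact_EVT_max; first by exists x; exact: subset_closure.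
    apply: (subclosed_compact (B := [set x | sqd y x <= rho ^+ 2])) => //; first exact: closed_closure.
    exact: (@compact_sqd_le R y).
  by apply: continuous_subspaceT; exact: smooth_cont.
have vx : v x <= v z by apply: vmax; rewrite inE; exact: subset_closure.
have sz := clb z cz; have sx := sqd_ge0 y x.
have uz : u z <= 0.
  have [Oz|nOz] := pselect (Om z); last by apply: u0; split=> // /interior_subset.
  have [d d0 Hd] := open_eballP oOm Oz.
  have D i : pd i (pd i v) z <= 0.
    apply: (second_derivative_max i sv d0) => w /Hd Ow.
    by apply: vmax; rewrite inE; exact: subset_closure.
  have : lap v z <= 0 by rewrite /lap; have := D true; have := D false; lra.
  rewrite lapD ?lapZ ?lap_sqd //; [|exact: smooth_sqd|by apply: smoothZ; exact: smooth_sqd].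
  rewrite Lu => H; rewrite leNgt; apply/negP => uz.
  by have := mulr_ge0 c0 (ltW uz); lra.
have h1 : e * sqd y z <= e * rho ^+ 2 by rewrite ler_pM2l.
have h2 := mulr_ge0 (ltW e0) sx.
by move: vx eu ux; rewrite /v; lra.
Qed.

Lemma helmholtz_unique Om y (rho c : R) (q : plane R -> R[i]) : open Om ->
  (forall x, Om x -> sqd y x <= rho ^+ 2) -> 0 <= c -> helmholtz c q ->
  (forall x, boundary Om x -> q x = 0) -> forall x, Om x -> q x = 0.
Proof.
move=> oOm bOm c0 [[s1 s2] Lq] q0.
have U (u : plane R -> R) : smooth u -> (forall x, lap u x = c * u x) -> (forall x, boundary Om x -> u x = 0) ->
    forall x, Om x -> u x = 0.
  move=> su Lu u0 x Ox; apply/eqP; rewrite eq_le; apply/andP; split.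
    by apply: (max_principle oOm bOm c0 su Lu) => // z /u0 ->.
  rewrite -oppr_le0; apply: (max_principle oOm bOm c0 (smoothN su)) => // [z|z /u0 ->]; last by rewrite oppr0.
  rewrite (_ : (fun z => _) = fun z => -1 * u z); last by apply/funext => w; rewrite mulN1r.
  by rewrite lapZ // Lu; ring.
move=> x Ox; apply: complex_ext.
  by apply: (U (fun x => complex.Re (q x))) => // [z|z /q0 ->] //; case: (Lq z).
by apply: (U (fun x => complex.Im (q x))) => // [z|z /q0 ->] //; case: (Lq z).
Qed.

End MaximumPrinciple.

(** * Linear independence on the boundary *)

Section Independence.
Context {R : realType}.
Implicit Types (A : nat -> R -> R) (x y : plane R) (Om : set (plane R)).

Let Z y x : R[i] := Complex (x.1 - y.1) (x.2 - y.2).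
Let Zc y x : R[i] := Complex (x.1 - y.1) (- (x.2 - y.2)).

Let ZX y x n : Z y x ^+ n = Complex (zco false n y x) (zco true n y x).
Proof.
elim: n => [|n IH]; first by rewrite expr0 !zco0.
by rewrite exprS IH !zcoS; apply: complex_ext; rewrite ?complex_ReM ?complex_ImM.
Qed.

Let ZcX y x n : Zc y x ^+ n = Complex (zco false n y x) (- zco true n y x).
Proof.
elim: n => [|n IH]; first by rewrite expr0 !zco0 oppr0.
by rewrite exprS IH !zcoS; apply: complex_ext; rewrite ?complex_ReM ?complex_ImM /=; ring.
Qed.

Let ZZc y x : Z y x * Zc y x = real_complex R (sqd y x).
Proof. by apply: complex_ext; rewrite ?complex_ReM ?complex_ImM /sqd /=; ring. Qed.

Let modesE A y j x : modes A y j x = real_complex R (A `|j|%N (sqd y x)) *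
  (if j is Posz n then Z y x ^+ n else Zc y x ^+ `|j|%N).
Proof.
case: j => n; rewrite ?ZX ?ZcX; apply: complex_ext;
  rewrite ?complex_ReM ?complex_ImM /modes /=; ring.
Qed.

(* On a circle around [y] a combination of the modes is, up to a factor [z ^ N],
   a polynomial in [z], and the circle is infinite. *)
Lemma modes_independent A y (d : R) s (c : int -> R[i]) : (forall n t, 0 <= t -> 0 < A n t) ->
  0 < d -> uniq s -> (forall x, eball y d x -> lincomb (modes A y) s c x = 0) ->
  forall j, j \in s -> c j = 0.
Proof.
move=> A0 d0 us H j js.
pose N := (\sum_(j <- s) `|j|)%N.
have jN i : i \in s -> (`|i| <= N)%N.
  by move=> ins; rewrite /N (big_rem i ins) /= leq_addr.
pose r := d / 2; have r0 : 0 < r by rewrite divr_gt0.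
(* The exponent [i + N], nonnegative for all indices in [s]. *)
pose ex (i : int) : nat := if i is Posz n then (n + N)%N else (N - `|i|)%N.
have exI : {in s &, injective ex}.
  move=> [m|m] [n|n] /jN hm /jN hn; rewrite /ex /= in hm hn *.
  - by move=> /addIn ->.
  - by move=> E; have := leq_addl m N; rewrite E leqNgt ltn_subrL /= (leq_trans _ hn).
  - by move=> E; have := leq_addl n N; rewrite -E leqNgt ltn_subrL /= (leq_trans _ hm).
  - by move=> E; congr Negz; apply: succn_inj; rewrite -(subKn hm) E subKn.
(* On the circle the conjugate of [z] is [r^2 / z], so a negative mode is a negative power of [z] up
   to this nonzero factor. *)
pose w (i : int) : R[i] := real_complex R (A `|i|%N (r ^+ 2) * (if i is Posz _ then 1 else (r ^+ 2) ^+ `|i|)).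
have w0 i : w i != 0.
  apply/eqP => /(congr1 (@complex.Re R)) /= /eqP; rewrite gt_eqF // mulr_gt0 ?A0 ?sqr_ge0 //.
  by case: i => n //; rewrite !exprn_gt0.
pose p := \sum_(i <- s) (c i * w i) *: 'X^(ex i) : {poly R[i]}.
have pZ x : sqd y x = r ^+ 2 -> p.[Z y x] = Z y x ^+ N * lincomb (modes A y) s c x.
  move=> hx; rewrite /p /lincomb horner_sum mulr_sumr; apply: eq_big_seq => i ins.
  rewrite hornerZ hornerXn modesE hx -mulrA [RHS]mulrCA; congr (_ * _).
  rewrite /w rmorphM -mulrA [RHS]mulrCA; congr (_ * _).
  case: i ins (jN _ ins) => n _ hn /=; first by rewrite mul1r exprD mulrC.
  have -> : real_complex R ((r ^+ 2) ^+ n.+1) = (Z y x * Zc y x) ^+ n.+1 by rewrite ZZc hx rmorphXn.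
  rewrite exprMn mulrAC -exprD.
  by congr (_ ^+ _ * _); rewrite subnKC.
(* The rational parametrization of the circle; the first coordinate determines [k^2], so these
   points are distinct roots. *)
pose pt (k : nat) : plane R := (y.1 + r * ((1 - k%:R ^+ 2) / (1 + k%:R ^+ 2)), y.2 + r * (2 * k%:R / (1 + k%:R ^+ 2))).
have q0 (k : nat) : 0 < 1 + k%:R ^+ 2 :> R by rewrite ltr_pwDl // sqr_ge0.
have ptr k : sqd y (pt k) = r ^+ 2.
  by rewrite /sqd /pt /=; have := q0 k; move: (k%:R) => t /lt0r_neq0 h; field.
have ptI : injective (Z y \o pt).
  move=> k l /(congr1 (@complex.Re R)) /=; rewrite [y.1 + _]addrC [y.1 + r * (_ / (1 + l%:R ^+ 2))]addrC !addrK.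
  move=> /(mulfI (lt0r_neq0 r0)) /eqP; rewrite eqr_div; [|exact: lt0r_neq0|exact: lt0r_neq0] => /eqP E.
  have : (k%:R ^+ 2 == l%:R ^+ 2 :> R) by apply/eqP; move: E; lra.
  by rewrite eqrXn2 ?ler0n // eqr_nat => /eqP.
have p0 : p = 0.
  apply: (@roots_geq_poly_eq0 _ _ [seq Z y (pt k) | k <- iota 0 (size p)]).
  - apply/allP => _ /mapP[k _ ->]; rewrite /root pZ // H ?mulr0 //.
    by rewrite /eball /= ptr ltr_pXn2r ?nnegrE ?(ltW r0) ?(ltW d0) // /r; lra.
  - by rewrite (map_inj_uniq ptI) iota_uniq.
  - by rewrite size_map size_iota.
have := congr1 (fun q : {poly R[i]} => q`_(ex j)) p0; rewrite /p coef0 coef_sum (bigD1_seq j) //= coefZ coefXn eqxx mulr1.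
rewrite big_seq_cond big1 ?addr0 => [/eqP|i /andP[ins ij]].
  by rewrite mulf_eq0 (negPf (w0 j)) orbF => /eqP.
rewrite coefZ coefXn; case: eqP => [/esym /exI E|]; last by rewrite mulr0.
by rewrite E ?eqxx in ij.
Qed.

Lemma boundary_not_negligible Om y (d : R) (N : set (mplane R)) : open Om -> lipschitz_boundary Om ->
  boundary Om y -> 0 < d -> boundary Om `&` eball y d `<=` N -> ~ hausdorff1.-negligible N.
Proof.
move=> oOm lip by_ d0 sN [B [_ B0 NB]].
have := boundary_pos oOm lip by_ d0; rewrite ltNge => /negP; apply.
rewrite -B0; apply: (le_outer_measure (hausdorff1 : {outer_measure set (plane R) -> \bar R})).
exact: subset_trans sN NB.
Qed.

(** By continuity a nonzero value at a boundary point persists on a boundary arc, which has positive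
    length and so is not negligible. *)
Lemma trace_zero Om (q : plane R -> R[i]) : open Om -> lipschitz_boundary Om -> csmooth q ->
  trace_eq Om q (fun=> 0) -> forall x, boundary Om x -> q x = 0.
Proof.
move=> oOm lip [s1 s2] tq y by_; apply: contrapT => qy.
have [d d0 Hd] : exists2 d : R, 0 < d & forall x, eball y d x -> q x <> 0.
  have E (P : R[i] -> R) : continuous (fun x => P (q x)) -> P 0 = 0 -> P (q y) != 0 ->
      exists2 d : R, 0 < d & forall x, eball y d x -> q x <> 0.
    move=> cP P0 Py; have : nbhs y ((fun x => P (q x)) @^-1` [set t | t != 0]).
      apply: cP; apply: open_nbhs_nbhs; split=> //; exact: open_neq.
    by move=> /nbhs_eball[d d0 Hd]; exists d => // x /Hd /= h qx; rewrite qx P0 eqxx in h.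
  have [h|h] := eqVneq (complex.Re (q y)) 0; last by apply: (E (@complex.Re R)) => //; exact: smooth_cont.
  apply: (E (@complex.Im R)) => //; first exact: smooth_cont.
  by apply/eqP => h2; apply: qy; apply: complex_ext.
by apply: (boundary_not_negligible oOm lip by_ d0 _ tq) => x [bx /Hd].
Qed.

Lemma independence Om A y (rho c : R) : open Om -> lipschitz_boundary Om -> Om y ->
  (forall x, Om x -> sqd y x <= rho ^+ 2) -> 0 <= c -> profile c A -> H12_independent Om (modes A y).
Proof.
move=> oOm lip Oy bOm c0 PA s a us tr.
have Hq : helmholtz c (lincomb (modes A y) s a) by apply: helmholtz_lincomb => j; exact: helmholtz_modes.
have q0 := trace_zero oOm lip Hq.1 tr.
have q1 := helmholtz_unique oOm bOm c0 Hq q0.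
have [d d0 Hd] := open_eballP oOm Oy.
have [_ A0 _] := PA.
by apply: (modes_independent A0 d0 us) => x /Hd; exact: q1.
Qed.

End Independence.

(** * Square integrable functions and Sobolev spaces *)

Section SquareIntegrable.
Context {R : realType}.
Variables (mu : {measure set (mplane R) -> \bar R}) (D : set (plane R)).
Hypothesis mD : measurable (D : set (mplane R)).
Implicit Types (u v : plane R -> R[i]).
Local Open Scope ereal_scope.

Lemma measurable_normc_sqr u : cmeasurable D u ->
  measurable_fun (D : set (mplane R)) (fun x => (ComplexField.Normc.normc (u x) ^+ 2)%:E).
Proof.
move=> [m1 m2]; apply/measurable_EFinP.
rewrite (_ : (fun x => _) = fun x => (complex.Re (u x) ^+ 2 + complex.Im (u x) ^+ 2)%R); last first.
  by apply/funext => x; exact: normc_sqr.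
by apply: measurable_funD; exact: measurable_funX.
Qed.

Lemma cmeasurableB u v : cmeasurable D u -> cmeasurable D v -> cmeasurable D (u \- v)%R.
Proof.
move=> [u1 u2] [v1 v2]; split.
  rewrite (_ : (fun x => _) = fun x => (complex.Re (u x) - complex.Re (v x))%R); first exact: measurable_funB.
  by apply/funext => x; exact: complex_ReB.
rewrite (_ : (fun x => _) = fun x => (complex.Im (u x) - complex.Im (v x))%R); first exact: measurable_funB.
by apply/funext => x; exact: complex_ImB.
Qed.

Lemma sqL2_ge0 u : 0 <= sqL2 mu D u.
Proof. by apply: integral_ge0 => x _; rewrite lee_fin sqr_ge0. Qed.

Lemma sqL2B u v : cmeasurable D u -> cmeasurable D v ->
  sqL2 mu D (u \- v)%R <= 2%:E * sqL2 mu D u + 2%:E * sqL2 mu D v.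
Proof.
move=> mu_ mv; have := measurable_normc_sqr mu_; have := measurable_normc_sqr mv => Mv Mu.
have P w (x : plane R) : 0 <= (ComplexField.Normc.normc (w x : R[i]) ^+ 2)%:E by rewrite lee_fin sqr_ge0.
have MZ w : cmeasurable D w -> measurable_fun (D : set (mplane R)) (fun x => 2%:E * (ComplexField.Normc.normc (w x) ^+ 2)%:E).
  by move=> mw; apply: measurable_funeM; exact: measurable_normc_sqr.
rewrite /sqL2 -!ge0_integralZl //; try by move=> x _; exact: P.
rewrite -ge0_integralD //; try exact: MZ; try by move=> x _; rewrite mule_ge0 ?lee_fin ?sqr_ge0.
apply: ge0_le_integral => //.
- by apply: measurable_normc_sqr; exact: cmeasurableB.
- by apply: emeasurable_funD; exact: MZ.
- move=> x _; rewrite -!EFinM -EFinD lee_fin !normc_sqr /= complex_ReB complex_ImB.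
  move: (complex.Re _) (complex.Re _) (complex.Im _) (complex.Im _) => a b c d.
  by have := sqr_ge0 (a + b)%R; have := sqr_ge0 (c + d)%R; nra.
Qed.

Lemma inL2B u v : inL2 mu D u -> inL2 mu D v -> inL2 mu D (u \- v)%R.
Proof.
move=> [mu_ fu] [mv fv]; split; first exact: cmeasurableB.
apply: le_lt_trans (sqL2B mu_ mv) _; apply: lte_add_pinfty; apply: lte_mul_pinfty => //; by rewrite lee_fin.
Qed.

Lemma cmeasurable_cont u : continuous (fun x => complex.Re (u x)) -> continuous (fun x => complex.Im (u x)) ->
  cmeasurable D u.
Proof. by move=> c1 c2; split; exact: measurable_cont_plane_on. Qed.

Lemma inL2_cont u (a : R) : mu D < +oo -> D `<=` box 0%R a ->
  continuous (fun x => complex.Re (u x)) -> continuous (fun x => complex.Im (u x)) -> inL2 mu D u.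
Proof.
move=> fD Da c1 c2; have mu_ := cmeasurable_cont c1 c2; split=> //.
have [M1 H1] := cont_bounded_box 0%R a c1; have [M2 H2] := cont_bounded_box 0%R a c2.
apply: (@le_lt_trans _ _ (\int[mu]_(x in D) cst (M1 ^+ 2 + M2 ^+ 2)%:E x)).
  apply: ge0_le_integral => //.
  - by move=> x _; rewrite lee_fin sqr_ge0.
  - exact: measurable_normc_sqr.
  - move=> x Dx; rewrite lee_fin normc_sqr; have h1 := H1 x (Da x Dx); have h2 := H2 x (Da x Dx).
    rewrite -(real_normK (num_real (complex.Re _))) -(real_normK (num_real (complex.Im _))).
    by apply: lerD; rewrite ler_pXn2r ?nnegrE // (le_trans _ h1, le_trans _ h2).
rewrite integral_cst // lte_mul_pinfty // lee_fin; by rewrite addr_ge0 ?sqr_ge0.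
Qed.

Lemma sqL2_0 u v : (forall x, D x -> u x = v x) -> sqL2 mu D (u \- v)%R = 0.
Proof.
move=> uv; rewrite /sqL2 (eq_integral (cst 0)) ?integral0 // => x; rewrite inE => Dx /=.
by rewrite uv // subrr /= expr0n /= addr0 sqrtr0 expr0n.
Qed.

Lemma eq_sqL2 u v : (forall x, D x -> u x = v x) -> sqL2 mu D u = sqL2 mu D v.
Proof. by move=> uv; apply: eq_integral => x; rewrite inE => Dx; rewrite uv. Qed.

End SquareIntegrable.

(** * Smooth functions and differences as elements of H^1 *)

Section SobolevSpace.
Context {R : realType}.
Variable Om : set (plane R).
Hypothesis dOm : dom Om.
Implicit Types (u v g : plane R -> R[i]) (phi : plane R -> R) (i : bool).

Let mOm : measurable (Om : set (mplane R)). Proof. by case: dOm. Qed.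

Let leb2_fin : ((leb2 : measure (mplane R) R) Om < +oo)%E.
Proof.
have [_ [a Da]] := dOm; apply: (@le_lt_trans _ _ ((leb2 : measure (mplane R) R) (box 0 (`|a|)))).
  apply: le_measure; rewrite ?inE //; first exact: measurable_box.
  by move=> x /Da [h1 h2]; split; [apply: le_trans h1 _|apply: le_trans h2 _]; exact: ler_norm.
by rewrite leb2_box // ltry.
Qed.

Lemma csmooth_inL2 u : csmooth u -> inL2 leb2 Om u.
Proof.
move=> [s1 s2]; have [_ [a Da]] := dOm.
by apply: (@inL2_cont _ (leb2 : measure (mplane R) R) Om mOm u a) => //; exact: smooth_cont.
Qed.

Let integ_sqr u : inL2 leb2 Om u -> integ Om (fun x => ComplexField.Normc.normc (u x) ^+ 2).
Proof.
move=> [mu_ fu]; apply/integrableP; split; first exact: measurable_normc_sqr.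
by under eq_integral => x _ do rewrite /= ger0_norm ?sqr_ge0 //.
Qed.

(** On a domain of finite measure [|t| <= t^2 + 1] makes square integrable functions integrable
    against bounded ones. Weak derivatives can then be subtracted under the integral. *)
Lemma integ_L2_bounded u phi : inL2 leb2 Om u -> continuous phi -> (exists M, forall x, `|phi x| <= M) ->
  integ Om (fun x => complex.Re (u x) * phi x) /\ integ Om (fun x => complex.Im (u x) * phi x).
Proof.
move=> Lu cphi [M HM]; have M0 : 0 <= M := le_trans (normr_ge0 _) (HM 0).
have I : integ Om (fun x => M * (ComplexField.Normc.normc (u x) ^+ 2 + 1)).
  apply: integZ => //; apply: integD => //; first exact: integ_sqr.
  by apply: dom_integ => //; exact: cst_continuous.
have K (f : plane R -> R) : measurable_fun (Om : set (mplane R)) f ->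
    (forall x, f x ^+ 2 <= ComplexField.Normc.normc (u x) ^+ 2) -> integ Om (fun x => f x * phi x).
  move=> mf Hf; apply: le_integrable I => //.
    apply/measurable_EFinP; apply: measurable_funM => //; exact: measurable_cont_plane_on.
  move=> x _; rewrite lee_fin normrM [leRHS]ger0_norm; last by rewrite mulr_ge0 // addr_ge0 ?sqr_ge0.
  rewrite mulrC; apply: ler_pM => //; apply: (@le_trans _ _ (f x ^+ 2 + 1)); last by rewrite lerD2r.
  rewrite -(real_normK (num_real (f x))); move: (`|f x|) => t.
  by have := sqr_ge0 (t - 2^-1); nra.
have [[m1 m2] _] := Lu; split; apply: K => // x; rewrite normc_sqr ?lerDl ?lerDr sqr_ge0 //.
Qed.

Lemma weak_derivativeE i u g : weak_derivative Om (ax i) u g <-> forall phi, test_function Om phi ->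
  II Om (fun x => complex.Re (u x) * pd i phi x) = - II Om (fun x => complex.Re (g x) * phi x) /\
  II Om (fun x => complex.Im (u x) * pd i phi x) = - II Om (fun x => complex.Im (g x) * phi x).
Proof. by split=> H phi /H; rewrite !IIE pdE. Qed.

Lemma weak_derivativeB i u v gu gv : inL2 leb2 Om u -> inL2 leb2 Om v -> inL2 leb2 Om gu -> inL2 leb2 Om gv ->
  weak_derivative Om (ax i) u gu -> weak_derivative Om (ax i) v gv ->
  weak_derivative Om (ax i) (u \- v) (gu \- gv).
Proof.
move=> Lu Lv Lgu Lgv /weak_derivativeE Wu /weak_derivativeE Wv; apply/weak_derivativeE => phi tphi.
have [u1 u2] := Wu phi tphi; have [v1 v2] := Wv phi tphi.
have I w j : inL2 leb2 Om w -> integ Om (fun x => complex.Re (w x) * (if j then pd i phi x else phi x)) /\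
    integ Om (fun x => complex.Im (w x) * (if j then pd i phi x else phi x)).
  move=> Lw; apply: integ_L2_bounded => //; case: j.
  - by apply: smooth_cont; apply: smooth_pd; case: tphi.
  - by apply: smooth_cont; case: tphi.
  - by have [M _ HM] := test_bounded (test_pd i tphi); exists M.
  - by have [M _ HM] := test_bounded tphi; exists M.
have [a1 a2] := I u true Lu; have [b1 b2] := I v true Lv.
have [c1 c2] := I gu false Lgu; have [d1 d2] := I gv false Lgv.
split.
  transitivity (II Om (fun x => complex.Re (u x) * pd i phi x - complex.Re (v x) * pd i phi x)).
    by apply: II_eq => x _; rewrite /= complex_ReB mulrBl.
  rewrite (IIB mOm a1 b1) u1 v1 -opprD -[X in - X](IIB mOm c1 d1) //; congr (- _).
  by apply: II_eq => x _; rewrite /= complex_ReB mulrBl.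
transitivity (II Om (fun x => complex.Im (u x) * pd i phi x - complex.Im (v x) * pd i phi x)).
  by apply: II_eq => x _; rewrite /= complex_ImB mulrBl.
rewrite (IIB mOm a2 b2) u2 v2 -opprD -[X in - X](IIB mOm c2 d2) //; congr (- _).
by apply: II_eq => x _; rewrite /= complex_ImB mulrBl.
Qed.

Definition cpd i u : plane R -> R[i] := fun x =>
  Complex (pd i (fun x => complex.Re (u x)) x) (pd i (fun x => complex.Im (u x)) x).

Lemma csmooth_cpd i u : csmooth u -> csmooth (cpd i u).
Proof. by move=> [s1 s2]; split; exact: smooth_pd. Qed.

Lemma weak_derivative_smooth i u : csmooth u -> weak_derivative Om (ax i) u (cpd i u).
Proof.
move=> [s1 s2]; apply/weak_derivativeE => phi tphi.
have K (f : plane R -> R) : smooth f -> II Om (fun x => f x * pd i phi x) = - II Om (fun x => pd i f x * phi x).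
  move=> sf; rewrite (II_test (@subsetT _ Om) (testM (test_pd i tphi) sf)).
  rewrite (II_test (@subsetT _ Om) (testM tphi (smooth_pd i sf))).
  have tT : test_function setT phi by exact: test_sub tphi.
  rewrite (_ : II setT (fun x => pd i f x * phi x) = II setT (fun x => phi x * pd i f x)).
    by rewrite (II_parts i tT sf) opprK; apply: II_eq => x _; rewrite mulrC.
  by apply: II_eq => x _; rewrite mulrC.
by split; exact: K.
Qed.

Definition H1smooth u (su : csmooth u) : H1 Om :=
  MkH1 (csmooth_inL2 su) (csmooth_inL2 (csmooth_cpd false su)) (csmooth_inL2 (csmooth_cpd true su))
    (weak_derivative_smooth false su) (weak_derivative_smooth true su).

Let L2B u v : inL2 leb2 Om u -> inL2 leb2 Om v -> inL2 leb2 Om (u \- v).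
Proof. exact: (inL2B (mu := (leb2 : measure (mplane R) R)) mOm). Qed.

Definition H1sub (v w : H1 Om) : H1 Om :=
  MkH1 (L2B (H1val_L2 v) (H1val_L2 w)) (L2B (H1dx_L2 v) (H1dx_L2 w)) (L2B (H1dy_L2 v) (H1dy_L2 w))
    (weak_derivativeB (i := false) (H1val_L2 v) (H1val_L2 w) (H1dx_L2 v) (H1dx_L2 w) (H1dxP v) (H1dxP w))
    (weak_derivativeB (i := true) (H1val_L2 v) (H1val_L2 w) (H1dy_L2 v) (H1dy_L2 w) (H1dyP v) (H1dyP w)).

Let sqL2_smooth u : csmooth u ->
  sqL2 leb2 Om u = (II Om (fun x => complex.Re (u x) * complex.Re (u x) + complex.Im (u x) * complex.Im (u x)))%:E.
Proof.
move=> [s1 s2]; have I : integ Om (fun x => complex.Re (u x) * complex.Re (u x) + complex.Im (u x) * complex.Im (u x)).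
  by apply: dom_integ => //; apply: smooth_cont; apply: smoothD; exact: smoothM.
rewrite IIE /Rintegral fineK; last exact: integrable_fin_num I.
by apply: eq_integral => x _; rewrite normc_sqr !expr2.
Qed.

Lemma energy_smooth u (su : csmooth u) :
  (sqL2 leb2 Om u + sqL2 leb2 Om (H1dx (H1smooth su)) + sqL2 leb2 Om (H1dy (H1smooth su)))%E =
  (en 1 Om (fun x => complex.Re (u x)) (fun x => complex.Re (u x)) +
   en 1 Om (fun x => complex.Im (u x)) (fun x => complex.Im (u x)))%:E.
Proof.
have [s1 s2] := su.
have I f : smooth f -> integ Om f by move=> sf; apply: dom_integ => //; exact: smooth_cont.
rewrite /= !sqL2_smooth //; try exact: csmooth_cpd.
rewrite -!EFinD; congr EFin.
have S (w : plane R -> R[i]) : csmooth w -> smooth (fun x => complex.Re (w x) * complex.Re (w x) + complex.Im (w x) * complex.Im (w x)).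
  by move=> [h1 h2]; apply: smoothD; exact: smoothM.
have S0 := S _ su; have S1 := S _ (csmooth_cpd false su); have S2 := S _ (csmooth_cpd true su).
have i0 := I _ S0; have i1 := I _ S1; have i2 := I _ S2; have i01 := I _ (smoothD S0 S1).
rewrite -(IID mOm i0 i1) -(IID mOm i01 i2).
have E1 := I _ (smooth_density 1 s1 s1); have E2 := I _ (smooth_density 1 s2 s2).
rewrite /en -(IID mOm E1 E2); apply: II_eq => x _ /=; ring.
Qed.

End SobolevSpace.

Section ExtendedRoot.
Context {R : realType}.
Local Open Scope ereal_scope.

Lemma sqrte_lt (S : \bar R) (d : R) : 0 <= S -> (0 < d)%R -> (sqrte S < d%:E) = (S < (d ^+ 2)%:E).
Proof.
move=> S0 d0; rewrite !ltNge; congr (~~ _).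
by rewrite -{1}(ger0_norm (ltW d0)) -sqrtr_sqr -[(Num.sqrt _)%:E]/(sqrte (d ^+ 2)%:E) lee_sqrt.
Qed.

End ExtendedRoot.

(** * Density of the modes in the trace space *)

Section Density.
Context {R : realType}.
Implicit Types (Om : set (plane R)) (x y : plane R) (F : int -> plane R -> R[i]).

Definition span F (h : plane R -> R[i]) := exists s c, uniq s /\ h = lincomb F s c.

Lemma span0 F : span F (fun=> 0).
Proof. by exists [::], (fun=> 0); split=> //; apply/funext => x; rewrite /lincomb big_nil. Qed.

Lemma spanD1 F h (a : R[i]) j : span F h -> span F (fun x => h x + a * F j x).
Proof.
move=> [s [c [us ->]]]; have [js|njs] := boolP (j \in s).
  exists s, (fun i => c i + (i == j)%:R * a); split=> //; apply/funext => x; rewrite /lincomb.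
  under [RHS]eq_bigr do rewrite mulrDl.
  rewrite big_split /=; congr (_ + _); rewrite (bigD1_seq j) //= eqxx mul1r big1 ?addr0 // => i /negPf ->.
  by rewrite !mul0r.
exists (j :: s), (fun i => if i == j then a else c i); split; first by rewrite /= njs.
apply/funext => x; rewrite /lincomb big_cons eqxx addrC; congr (_ + _).
by apply: eq_big_seq => i si; case: eqP => // E; rewrite -E si in njs.
Qed.

Lemma spanD F h1 h2 : span F h1 -> span F h2 -> span F (fun x => h1 x + h2 x).
Proof.
move=> H1 [s [c [_ ->]]]; elim: s => [|j s IH].
  by rewrite (_ : (fun x => _) = h1) //; apply/funext => x; rewrite /lincomb big_nil addr0.
rewrite (_ : (fun x => _) = fun x => (h1 x + lincomb F s c x) + c j * F j x); first exact: spanD1.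
by apply/funext => x; rewrite /lincomb big_cons addrA addrAC.
Qed.

Lemma spanZ F (a : R[i]) h : span F h -> span F (fun x => a * h x).
Proof.
move=> [s [c [us ->]]]; exists s, (fun j => a * c j); split=> //.
by apply/funext => x; rewrite /lincomb mulr_sumr; apply: eq_bigr => j _; rewrite mulrA.
Qed.

Lemma span_gen F j : span F (F j).
Proof.
by have := spanD1 1 j (span0 F); congr span; apply/funext => x; rewrite add0r mul1r.
Qed.

(** The real functions of the complex span. They form the real space of solutions to which
    [harmonic_dense] is applied. *)
Definition real_span F (q : plane R -> R) := span F (fun x => real_complex R (q x)).

Lemma psubspace_real_span F : psubspace (real_span F).
Proof.
split; first exact: span0.
  move=> f g Hf Hg; have := spanD Hf Hg; congr span.
  by apply/funext => x; rewrite -rmorphD.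
move=> t f Hf; have := spanZ (real_complex R t) Hf; congr span.
by apply/funext => x; rewrite -rmorphM.
Qed.

Lemma modes_opp A y n x : modes A y (- n%:Z) x =
  Complex (A n (sqd y x) * zco false n y x) (- (A n (sqd y x) * zco true n y x)) :> R[i].
Proof.
case: n => [|n]; first by rewrite oppr0 /modes !zco0 !mulr0 oppr0.
by rewrite -NegzE /modes /= mulN1r.
Qed.

(** Half sums and half differences of the modes [n] and [-n] give the cosine and sine; dividing by
    [A n (r^2)], positive, normalizes them on the circle. *)
Lemma modes_circle c A y (r : R) n s : profile c A ->
  exists2 q, real_span (modes A y) q & forall x, sqd y x = r ^+ 2 -> q x = zco s n y x.
Proof.
move=> [_ A0 _]; exists (fun x => (A n (r ^+ 2))^-1 * (A n (sqd y x) * zco s n y x)).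
  have [_ _ SZ] := psubspace_real_span (modes A y); apply: SZ.
  pose a : R[i] := if s then Complex 0 (- 2^-1) else Complex 2^-1 0.
  pose b : R[i] := if s then Complex 0 2^-1 else Complex 2^-1 0.
  have := spanD (spanZ a (span_gen (modes A y) n)) (spanZ b (span_gen (modes A y) (- n%:Z))).
  congr span; apply/funext => x; rewrite modes_opp /a /b.
  by apply: complex_ext; rewrite ?complex_ReD ?complex_ImD ?complex_ReM ?complex_ImM; case: (s) => /=; field.
by move=> x ->; rewrite mulrA mulVf ?mul1r // gt_eqF // A0 // sqr_ge0.
Qed.

Lemma en_swap Om (f g : plane R -> R) : smooth f -> smooth g ->
  en 1 Om (fun x => f x - g x) (fun x => f x - g x) = en 1 Om (fun x => g x - f x) (fun x => g x - f x).
Proof. by move=> sf sg; rewrite /en; apply: II_eq => x _; rewrite !pdBs //; ring. Qed.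

Lemma boundary_notin Om x : open Om -> boundary Om x -> ~ Om x.
Proof. by move=> oOm [_ nx] Ox; apply: nx; apply: open_nbhs_nbhs. Qed.

Section Approximation.
Variables (Om : set (plane R)) (y : plane R) (c rho a : R) (A : nat -> R -> R).
Hypotheses (oOm : open Om) (scOm : simply_connected Om) (lip : lipschitz_boundary Om).
Hypotheses (Oy : Om y) (rho0 : 0 < rho) (bOm : forall x, Om x -> sqd y x <= rho ^+ 2).
Hypotheses (c01 : 0 <= c <= 1) (PA : profile c A).

Let F := modes A y.

Let dOm : dom Om.
Proof.
split; first exact: measurable_open_plane.
have [_ [b Bb]] := dom_eball y (ltW (mulr_gt0 (ltr0Sn R 1) rho0)); exists b => x Ox; apply: Bb.
by apply: le_lt_trans (bOm Ox) _; rewrite ltr_pXn2r ?nnegrE ?mulr_ge0 ?(ltW rho0) // ltr_pMl // ltr1n.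
Qed.

Let mB : measurable (boundary Om : set (mplane R)).
Proof. by apply: measurable_closed_plane; exact: closed_boundary. Qed.

Let boundary_inL2 u : csmooth u -> inL2 hausdorff1 (boundary Om) u.
Proof.
move=> [s1 s2]; have [_ [b Bb]] := dom_eball y (ltW (mulr_gt0 (ltr0Sn R 1) rho0)).
apply: (@inL2_cont R (hausdorff1 : {measure set (mplane R) -> \bar R}) _ mB u b); try exact: smooth_cont.
  exact: boundary_finite oOm lip bOm.
move=> x [cx _]; apply: Bb; apply: le_lt_trans (closed_disc_closure bOm cx) _.
by rewrite ltr_pXn2r ?nnegrE ?mulr_ge0 ?(ltW rho0) // ltr_pMl // ltr1n.
Qed.

Lemma smooth_inH12 u : csmooth u -> inH12 Om u.
Proof.
move=> su; exists (H1smooth dOm su); split; first exact: boundary_inL2.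
exists (fun=> H1smooth dOm su); split=> //.
  rewrite /H1dist !(sqL2_0 (leb2 : {measure set (mplane R) -> \bar R})) // !adde0 sqrte0; exact: cvg_cst.
by rewrite (sqL2_0 (hausdorff1 : {measure set (mplane R) -> \bar R})) //; exact: cvg_cst.
Qed.

Let helm j : helmholtz c (F j). Proof. exact: helmholtz_modes. Qed.

Let span_helmholtz h : span F h -> helmholtz c h.
Proof. by move=> [s [d [_ ->]]]; exact: helmholtz_lincomb. Qed.

Let real_approx phi (e : R) : smooth phi -> 0 < e -> exists q om,
  [/\ real_span F q, test_function Om om & en 1 Om (fun x => (q x + om x) - phi x) (fun x => (q x + om x) - phi x) <= e].
Proof.
move=> sphi e0.
have sm q : real_span F q -> smooth q by move=> /span_helmholtz[[]].
have [|q Sq x|r n r0|q [om [Sq to H]]] := @harmonic_dense R Om y c rho (real_span F) phi e oOm scOm lip _ rho0 bOm c01 (psubspace_real_span F) sm _ _ sphi e0.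
- by exists y.
- by have [_ /(_ x) []] := span_helmholtz Sq.
- by split; [exact: (modes_circle y r n false PA)|exact: (modes_circle y r n true PA)].
exists q, om; split=> //; rewrite en_swap //; by apply: smoothD; [exact: sm|case: to].
Qed.

(** The approximant [q] differs from the combination [h] by test functions of [Om] only, so both
    have the same boundary values: [q] is close to [u] in H^1 while [h] is what its trace sees. *)
Lemma complex_approx u (e : R) (su : csmooth u) : 0 < e -> exists h q,
  [/\ span F h, csmooth q, forall x, ~ Om x -> q x = h x &
   en 1 Om (fun x => complex.Re (q x - u x)) (fun x => complex.Re (q x - u x)) +
   en 1 Om (fun x => complex.Im (q x - u x)) (fun x => complex.Im (q x - u x)) <= e].
Proof.
move=> e0; have e2 : 0 < e / 2 by rewrite divr_gt0.
have [q1 [m1 [S1 t1 H1]]] := real_approx su.1 e2; have [q2 [m2 [S2 t2 H2]]] := real_approx su.2 e2.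
have sm q : real_span F q -> smooth q by move=> /span_helmholtz[[]].
exists (fun x => real_complex R (q1 x) + Complex 0 1 * real_complex R (q2 x)), (fun x => Complex (q1 x + m1 x) (q2 x + m2 x)).
split.
- by apply: spanD => //; exact: spanZ.
- by split; apply: smoothD; [exact: sm|case: t1|exact: sm|case: t2].
- move=> x nx; rewrite (test_notin t1 nx) (test_notin t2 nx).
  by apply: complex_ext; rewrite ?complex_ReD ?complex_ImD ?complex_ReM ?complex_ImM /=; ring.
- apply: le_trans (_ : e / 2 + e / 2 <= e); last by lra.
  apply: lerD.
    rewrite (_ : (fun x => complex.Re _) = fun x => (q1 x + m1 x) - complex.Re (u x)) //.
    by apply/funext => x; exact: complex_ReB.
  rewrite (_ : (fun x => complex.Im _) = fun x => (q2 x + m2 x) - complex.Im (u x)) //.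
  by apply/funext => x; exact: complex_ImB.
Qed.

Local Notation L2 := (sqL2 leb2 Om).

Let L2_ge0 u : (0 <= L2 u)%E.
Proof. exact: (sqL2_ge0 (leb2 : {measure set (mplane R) -> \bar R})). Qed.

Let dist_small (v : H1 Om) (phi : nat -> H1 Om) (d : R) : 0 < d -> H1dist (phi n) v @[n --> \oo] --> 0%E ->
  exists n, (L2 (v \- phi n)%R + L2 (H1dx v \- H1dx (phi n))%R + L2 (H1dy v \- H1dy (phi n))%R < (d ^+ 2)%:E)%E.
Proof.
move=> d0 cv; have [n Hn] : exists n, (H1dist (phi n) v < d%:E)%E.
  have /fine_cvgP[fn /cvgrPdist_lt /(_ d d0) cf] := cv.
  have : \forall n \near \oo, (H1dist (phi n) v < d%:E)%E.
    near=> n; have fin : H1dist (phi n) v \is a fin_num by near: n.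
    rewrite -(fineK fin) lte_fin; apply: le_lt_trans (ler_norm _) _.
    by rewrite -normrN -sub0r; near: n.
  by move=> [N _ /(_ N (leqnn N))]; exists N.
exists n; move: Hn; rewrite /H1dist sqrte_lt //; last by apply: adde_ge0; [apply: adde_ge0|]; exact: L2_ge0.
have sw (u w : plane R -> R[i]) : L2 (u \- w) = L2 (w \- u).
  apply: eq_integral => x _; rewrite !normc_sqr /= !complex_ReB !complex_ImB; congr EFin; ring.
by rewrite (sw (phi n)) (sw (H1dx _)) (sw (H1dy _)).
Unshelve. all: by end_near. Qed.

(** Any element of H^1 with trace [g - h] bounds the quotient norm. Morally it is [v - q], with [q]
    close to a smooth approximant [phi n] of [v] and equal to [h] on the boundary. *)
Lemma modes_dense : H12_span_dense Om F.
Proof.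
split; first by move=> j; apply: smooth_inH12; case: (helm j).
move=> g [v [Lg [phi [sphi cphi bphi]]]] eps eps0.
have d0 : 0 < eps / 4 by rewrite divr_gt0.
have [n Hn] := dist_small d0 cphi.
have [h [q [Sh sq qh Eq]]] := complex_approx (sphi n) (exprn_gt0 2 d0).
have sh : csmooth h by case: (span_helmholtz Sh).
have sd : csmooth (fun x => q x - phi n x) by exact: csmoothB.
have [s [b [_ hE]]] := Sh; exists s, b; rewrite -hE.
(* Written [(w - phi n) - (q - phi n)]: the weak derivatives bundled with [phi n] are only
   representatives, and this form never compares them with the classical ones. *)
pose W (w : H1 Om) : H1 Om := H1sub dOm (H1sub dOm w (phi n)) (H1smooth dOm sd).
have tr : is_trace (W v) (g \- h).
  split.
    by apply: (inL2B (mu := (hausdorff1 : {measure set (mplane R) -> \bar R})) mB) => //; exact: boundary_inL2.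
  exists (fun m => W (phi m)); split.
  - by move=> m; apply: csmoothB => //; exact: csmoothB.
  (* Both corrections cancel in [W (phi m) - W v], so the convergence of [phi m] to [v] is
     inherited. *)
  - have E (p r k l : plane R -> R[i]) : (p \- k \- l) \- (r \- k \- l) = p \- r.
      by apply/funext => x /=; rewrite opprB addrA subrK opprB addrA subrK.
    by under eq_fun => m do rewrite /H1dist /= !E.
  - rewrite (_ : (fun m => _) = fun m => sqL2 hausdorff1 (boundary Om) (phi m \- g)) //; apply/funext => m.
    apply: (eq_sqL2 (hausdorff1 : {measure set (mplane R) -> \bar R})) => x bx /=.
    have -> : q x = h x by apply: qh; exact: boundary_notin bx.
    by rewrite opprB addrA subrK opprB addrA subrK.
apply: le_lt_trans (_ : (H1norm (W v) < eps%:E)%E).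
  by apply: ereal_inf_lbound; exists (W v).
rewrite /H1norm sqrte_lt //; last by apply: adde_ge0; [apply: adde_ge0|]; exact: L2_ge0.
have cm (w : plane R -> R[i]) : inL2 leb2 Om w -> cmeasurable Om w by case.
have [mOm _] := dOm.
pose w1 := H1sub dOm v (phi n); pose w2 := H1smooth dOm sd.
have B (u w : plane R -> R[i]) : inL2 leb2 Om u -> inL2 leb2 Om w -> (L2 (u \- w)%R <= 2%:E * L2 u + 2%:E * L2 w)%E.
  by move=> Lu Lw; apply: (sqL2B (leb2 : {measure set (mplane R) -> \bar R}) mOm); exact: cm.
have B0 := B _ _ (H1val_L2 w1) (H1val_L2 w2).
have B1 := B _ _ (H1dx_L2 w1) (H1dx_L2 w2).
have B2 := B _ _ (H1dy_L2 w1) (H1dy_L2 w2).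
have E2 := energy_smooth dOm sd.
apply: le_lt_trans (leeD (leeD B0 B1) B2) _.
have fin (u : plane R -> R[i]) : inL2 leb2 Om u -> exists2 t : R, 0 <= t & L2 u = t%:E.
  move=> [_ fu]; have f0 : (0 <= L2 u)%E by exact: L2_ge0.
  have ff : L2 u \is a fin_num by rewrite ge0_fin_numE.
  by exists (fine (L2 u)); rewrite ?fineK // -lee_fin fineK.
have [t0 t00 T0] := fin _ (H1val_L2 w1); have [t1 t10 T1] := fin _ (H1dx_L2 w1); have [t2 t20 T2] := fin _ (H1dy_L2 w1).
have [r0 r00 R0] := fin _ (H1val_L2 w2); have [r1 r10 R1] := fin _ (H1dx_L2 w2); have [r2 r20 R2] := fin _ (H1dy_L2 w2).
rewrite T0 T1 T2 R0 R1 R2 -!EFinM -!EFinD lte_fin.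
have h1 : t0 + t1 + t2 < (eps / 4) ^+ 2 by rewrite -lte_fin !EFinD -T0 -T1 -T2.
have h2 : r0 + r1 + r2 <= (eps / 4) ^+ 2.
  by rewrite -lee_fin !EFinD -R0 -R1 -R2 E2 lee_fin.
have h3 : (eps / 4) ^+ 2 = eps ^+ 2 / 16 by field.
have h4 : 0 < eps ^+ 2 by rewrite exprn_gt0.
(* Two parts of squared norm at most [eps^2 / 16], each doubled, give less than [eps^2]. *)
by move: h1 h2 h4; rewrite h3; lra.
Qed.

End Approximation.

End Density.

Theorem theorem3p7 (R : realType) (Om : set (plane R)) (x0 : plane R) :
  open Om -> bounded_set Om -> simply_connected Om -> lipschitz_boundary Om ->
  Om x0 ->
  (H12_independent Om (fun j => in_polar x0 (P_ j)) /\
   H12_span_dense Om (fun j => in_polar x0 (P_ j))) /\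
  (H12_independent Om (fun j => in_polar x0 (Q_ j)) /\
   H12_span_dense Om (fun j => in_polar x0 (Q_ j))).
Proof.
move=> oOm [M [_ HM]] scOm lip Ox0.
(* Boundedness refers to the sup norm and to the origin; here it becomes a Euclidean disc about
   [x0]. *)
have [a [a0 bOm]] : exists a : R, 0 < a /\ forall x, Om x -> sqd x0 x <= a ^+ 2.
  pose m := `|M| + 1; pose b := m + `|x0.1| + `|x0.2|.
  have m0 : 0 < m by rewrite ltr_wpDl.
  have b0 : 0 < b by rewrite ltr_wpDr // ltr_wpDr.
  exists (2 * b); split; first by rewrite mulr_gt0.
  move=> x Ox; have := HM m; rewrite (le_lt_trans (ler_norm M)) ?ltrDl // => /(_ erefl x Ox).
  rewrite /= prod_normE ge_max => /andP[h1 h2].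
  have k1 : `|x.1 - x0.1| <= b.
    by apply: le_trans (ler_normB _ _) _; apply: le_trans (lerD h1 (lexx _)) _; rewrite /b lerDl.
  have k2 : `|x.2 - x0.2| <= b.
    by apply: le_trans (ler_normB _ _) _; apply: le_trans (lerD h2 (lexx _)) _; rewrite /b [leRHS]addrAC lerDl.
  have sq t : `|t| <= b -> t ^+ 2 <= b ^+ 2.
    by move=> tb; rewrite -(real_normK (num_real t)) ler_pXn2r ?nnegrE // ltW.
  have := sq _ k1; have := sq _ k2; rewrite /sqd exprMn; have := sqr_ge0 b; lra.
(* Both parts of the theorem at once: [c = 0] with the constant profile for the powers, [c = 1] with
   the Bessel profile. *)
have main c A : 0 <= c <= 1 -> profile c A ->
    H12_independent Om (modes A x0) /\ H12_span_dense Om (modes A x0).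
  move=> c01 PA; split; last exact: (modes_dense oOm scOm lip Ox0 a0 bOm c01 PA).
  by case/andP: c01 => c0 _; exact: (independence oOm lip Ox0 bOm c0 PA).
have -> : (fun j => in_polar x0 (P_ j)) = modes (fun _ _ => 1) x0.
  by apply/funext => j; exact: in_polar_P.
have -> : (fun j => in_polar x0 (Q_ j)) = modes (fun n t => 2^-1 ^+ n * bessel_series n t) x0.
  by apply/funext => j; exact: in_polar_Q.
split.
  by apply: (main 0); [rewrite lexx ler01|exact: profile_power].
by apply: (main 1); [rewrite ler01 lexx|exact: profile_bessel].
Qed.
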